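(* Let $\ell\ge0$, $\beta\in\mathbb{R}$, $\gamma>\max\{0,-\frac{\beta}{4\pi^2}\}$ and $\theta>0$. There exists $\delta'>0$ such that, for every $f$ that is $\theta$-periodic in time with $\langle f(t)\rangle=0$ for $t\in[0,\theta)$ and $$\sup_{t\ge0}\|f(t)\|_{H^{\ell-2}_{per,0}}\le\delta',$$ the equation $$u_t+u_x-u_{xxt}+uu_x+\beta u-\gamma u_{xx}=f(x,t)\ \text{ on }\mathbb{T}\times[0,\infty)$$ has a time-periodic (with period $\theta$) solution that is globally stable in $H^\ell_{per,0}$.
   Context: $\mathbb{T}=\mathbb{R}/\mathbb{Z}$ and $\Delta=\partial_x^2$. For $\ell\in\mathbb{R}$, $H^\ell_{per}$ is the space of 1-periodic distributions $g$ with $\|g\|_{H^\ell_{per}}=\big(\sum_{k\in\mathbb{Z}}(1+(2\pi k)^2)^\ell|\widehat g(k)|^2\big)^{1/2}<\infty$, where $\widehat g(k)=\int_0^1 e^{-2\pi i kx}g(x)\,dx$. We write $\langle g\rangle=\int_{\mathbb{T}}g\,dx=\widehat g(0)$; $H^\ell_{per,0}$ is the subspace of $g\in H^\ell_{per}$ with $\langle g\rangle=0$, with the same norm. Let $Av=(I-\Delta)^{-1}(-v_x-\beta v+\gamma v_{xx})$, which generates a $C_0$-semigroup $e^{At}$ on $H^\ell_{per,0}$. Solutions are mild solutions: $u(t)\in H^\ell_{per,0}$ and $$u(t)=e^{At}u(0)+\int_0^t e^{A(t-s)}(I-\Delta)^{-1}\big[f(s)-u(s)u_x(s)\big]ds,\qquad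 t\ge0,$$ where $uu_x$ means $\tfrac12\partial_x(u^2)$. A solution $\tilde u$ is $\theta$-periodic if $\tilde u(t+\theta)=\tilde u(t)$ for all $t\ge0$. A solution $\tilde u$ is globally stable in a space $X$ if every solution $u$ with arbitrary initial datum $u(0)\in X$ satisfies $\|u(t)-\tilde u(t)\|_X\to0$ as $t\to\infty$, regardless of the distance between $u(0)$ and $\tilde u(0)$. *)

(* Defs.v *)
From HB Require Import structures.
From mathcomp Require Import all_boot all_order all_algebra.
From mathcomp Require Import complex.
From mathcomp Require Import all_classical all_reals all_analysis.
Import Order.TTheory GRing.Theory Num.Theory.
Import numFieldNormedType.Exports.

Set Implicit Arguments.
Unset Strict Implicit.
Unset Printing Implicit Defensive.

Local Open Scope classical_set_scope.
Local Open Scope ring_scope.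

(* Real-valued 1-periodic distributions are continuous linear functionals on
   the space [test R] of real-valued smooth 1-periodic functions. *)

Section TestFunctions.
Context {R : realType}.
Implicit Types f g : R -> R.

Definition smooth f := forall (n : nat) (x : R), derivable (derive1n n f) x 1.
Definition periodic1 f := forall x, f (x + 1) = f x.
Definition smooth_periodic : {pred R -> R} :=
  fun f => `[< smooth f /\ periodic1 f >].

Lemma smooth_periodicP f :
  reflect (smooth f /\ periodic1 f) (f \in smooth_periodic).
Proof. exact: asboolP. Qed.

Lemma derive1n_linear f g (a : R) n : smooth f -> smooth g ->
  derive1n n (a *: f + g) = a *: derive1n n f + derive1n n g.
Proof.
move=> sf sg; elim: n => [//|n IHn].
rewrite !derive1nS IHn; apply/funext => x.
have df := sf n x; have dg := sg n x.
rewrite derive1E deriveD//; last exact: derivableZ.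
by rewrite deriveZ// -!derive1E.
Qed.

Lemma smooth_linear f g (a : R) : smooth f -> smooth g -> smooth (a *: f + g).
Proof.
move=> sf sg n x; rewrite derive1n_linear//.
by apply: derivableD => //; exact: derivableZ.
Qed.

Lemma smooth_derive f : smooth f -> smooth (derive1 f).
Proof. by move=> sf n x; rewrite -derive1Sn; exact: sf. Qed.

Lemma smooth0 : smooth (0 : R -> R).
Proof.
have d0 n : derive1n n (0 : R -> R) = 0.
  elim: n => [//|n IHn]; rewrite derive1nS IHn; apply/funext => x.
  by rewrite derive1E derive_cst.
by move=> n x; rewrite d0; exact: (@derivable_cst _ _ _ (0 : R)).

Qed.

Lemma smooth_periodic_submod : submod_closed smooth_periodic.
Proof.
split=> [|a f g /smooth_periodicP[sf pf] /smooth_periodicP[sg pg]]; apply/smooth_periodicP; split.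
- exact: smooth0.
- by [].
- exact: smooth_linear.
- by move=> x; rewrite !fctE pf pg.
Qed.

HB.instance Definition _ :=
  GRing.isSubmodClosed.Build R (R -> R^o) smooth_periodic
    smooth_periodic_submod.

Lemma smooth_periodic_derive f :
  f \in smooth_periodic -> derive1 f \in smooth_periodic.
Proof.
move=> /smooth_periodicP[sf pf]; apply/smooth_periodicP; split.
  exact: smooth_derive.
move=> x; rewrite /derive1.
by under [in LHS]eq_fun do rewrite addrA !pf.
Qed.

Lemma smooth_periodic_cos_sin (k : int) (a b : R) :
  (fun x => a * cos (2 * pi * k%:~R * x) + b * sin (2 * pi * k%:~R * x))
    \in smooth_periodic.
Proof.
apply/smooth_periodicP; split.
  set w := 2 * pi * k%:~R.
  pose F (c d : R) : R -> R := fun x => c * cos (w * x) + d * sin (w * x).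
  have dF (c d x : R) : is_derive x 1 (F c d) (F (d * w) (- (c * w)) x).
    have dw : is_derive x 1 (fun y : R => w * y) w.
      by apply: is_derive_eq; rewrite /GRing.scale/= mulr1.
    have dc : is_derive x 1 (fun y : R => cos (w * y)) (- sin (w * x) * w).
      exact: (@is_derive1_comp R cos (fun y => w * y)).
    have ds : is_derive x 1 (fun y : R => sin (w * y)) (cos (w * x) * w).
      exact: (@is_derive1_comp R sin (fun y => w * y)).
    rewrite /F; apply: is_derive_eq.
    rewrite /GRing.scale/= !(mulrN, mulNr) addrC; congr (_ - _).
      by rewrite mulrA mulrAC.
    by rewrite mulrA mulrAC.
  have dnF n c d : exists c' d', derive1n n (F c d) = F c' d'.
    elim: n => [|n [c' [d' IHn]]]; first by exists c, d.
    exists (d' * w), (- (c' * w)); rewrite derive1nS IHn.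
    by apply/funext => x; rewrite derive1E; apply: derive_val.
  move=> n x; have [c [d ->]] := dnF n a b.
  by apply: ex_derive; exact: dF.
move=> x; rewrite mulrDr mulr1.
have -> : 2 * pi * k%:~R = pi *+ 2 *~ k :> R.
  by rewrite mulrzr mulr_natl.
have cosn (n : nat) (y : R) : cos (y + pi *+ 2 *+ n) = cos y.
  elim: n => [|n IHn]; first by rewrite mulr0n addr0.
  by rewrite mulrSr addrA cosD2pi IHn.
have sinn (n : nat) (y : R) : sin (y + pi *+ 2 *+ n) = sin y.
  elim: n => [|n IHn]; first by rewrite mulr0n addr0.
  by rewrite mulrSr addrA sinD2pi IHn.
case: k => n; rewrite ?NegzE ?mulrNz -!pmulrn; first by rewrite cosn sinn.
move: (_ * x) => z.
by rewrite -(cosn n.+1 (z - _)) -(sinn n.+1 (z - _)) subrK.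
Qed.

End TestFunctions.

Definition test (R : realType) := {f : R -> R^o | f \in smooth_periodic}.

HB.instance Definition _ (R : realType) := Choice.on (test R).
HB.instance Definition _ (R : realType) := SubType.on (test R).
HB.instance Definition _ (R : realType) :=
  [SubChoice_isSubLmodule of test R by <:].

Definition dist (R : realType) := test R -> R^o.

Section Distributions.
Context {R : realType}.
Implicit Types (u v w : dist R) (phi : test R) (k : int) (l : R).

Definition is_distribution u :=
  scalar u /\
  exists (N : nat) (C : R), forall phi (B : R),
    (forall (j : nat) (x : R), (j <= N)%N -> `| derive1n j (val phi) x | <= B) ->
    `| u phi | <= C * B.

Definition test_derive phi : test R :=
  exist (fun f => f \in smooth_periodic) _ (smooth_periodic_derive (valP phi)).

Definition dx u : dist R := fun phi => - u (test_derive phi).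

Definition trig k (a b : R) : test R :=
  exist (fun f => f \in smooth_periodic) _ (smooth_periodic_cos_sin k a b).

(* The pairing of [u] with exp(-2 pi i k x) = cos(2 pi k x) - i sin(2 pi k x). *)
Definition fourier u k : R[i] := Complex (u (trig k 1 0)) (- u (trig k 0 1)).

Definition mean_zero u := fourier u 0 = 0.

Definition sobolev_norm l u : \bar R :=
  ((\esum_(k in [set: int])
     ((1 + (2 * pi * k%:~R) ^+ 2) `^ l
       * ComplexField.Normc.normc (fourier u k) ^+ 2)%:E) `^ 2^-1)%E.

Definition Hper l : set (dist R) :=
  [set u | is_distribution u /\ (sobolev_norm l u < +oo)%E].

Definition Hper0 l : set (dist R) := [set u | Hper l u /\ mean_zero u].

Local Notation mu := (@lebesgue_measure R).

(* [u] is the distribution given by the square-integrable function [h]. *)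
Definition is_L2_density u (h : R -> R) :=
  [/\ measurable_fun (`[0, 1] : set R) h,
      mu.-integrable `[0, 1] (EFin \o (fun x => h x ^+ 2)) &
      forall phi, u phi = \int[mu]_(x in `[0, 1]) (h x * val phi x)].

(* The distribution u^2, for [u] in L^2 (junk value 0 otherwise). *)
Definition dist_sqr u : dist R :=
  xget 0 [set w | exists h, is_L2_density u h /\
    forall phi, w phi = \int[mu]_(x in `[0, 1]) (h x ^+ 2 * val phi x)].

Definition u_ux u : dist R := 2^-1 *: dx (dist_sqr u).

(* (I - Delta)^-1 on periodic distributions. *)
Definition resolvent w : dist R :=
  xget 0 [set v | is_distribution v /\ v - dx (dx v) = w].

Definition opA (beta gamma : R) v : dist R :=
  resolvent (- dx v - beta *: v + gamma *: dx (dx v)).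

(* [S] is a C_0-semigroup on H^l_{per,0} whose generator is the (everywhere
   defined) operator [A]. *)
Definition C0_semigroup_generated_by l (A : dist R -> dist R)
    (S : R -> dist R -> dist R) :=
  [/\ (forall t, 0 <= t ->
        [/\ (forall v, Hper0 l v -> Hper0 l (S t v)),
            (forall (a : R) v w, Hper0 l v -> Hper0 l w ->
               S t (a *: v + w) = a *: S t v + S t w) &
            exists M : R, forall v, Hper0 l v ->
              (sobolev_norm l (S t v) <= M%:E * sobolev_norm l v)%E]),
      (forall v, Hper0 l v -> S 0 v = v),
      (forall s t v, 0 <= s -> 0 <= t -> Hper0 l v ->
         S (s + t) v = S s (S t v)),
      (forall v, Hper0 l v ->
         sobolev_norm l (S t v - v) @[t --> 0^'+] --> 0%E) &
      (forall v, Hper0 l v ->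
         sobolev_norm l (t^-1 *: (S t v - v) - A v) @[t --> 0^'+] --> 0%E)].

(* A simple function, encoded as the list of the pairs (A_i, g_i) in
   sum_i 1_{A_i} g_i. *)
Definition simple_fun := seq (set R * dist R).

Definition is_simple l (s : simple_fun) :=
  forall p, p \in s -> measurable p.1 /\ Hper l p.2.

Definition simple_val (s : simple_fun) (x : R) : dist R :=
  \sum_(p <- s) (\1_(p.1) x : R) *: p.2.

Definition simple_integral (D : set R) (s : simple_fun) : dist R :=
  \sum_(p <- s) fine (mu (p.1 `&` D)) *: p.2.

Definition simple_approx l (D : set R) (F : R -> dist R)
    (s : nat -> simple_fun) :=
  (forall n, is_simple l (s n)) /\
  {ae mu, forall x, D x ->
    sobolev_norm l (F x - simple_val (s n) x) @[n --> \oo] --> 0%E}.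

Definition strongly_measurable l (D : set R) (F : R -> dist R) :=
  exists s, simple_approx l D F s.

(* [I] is the Bochner integral of [F : D -> H^l_per]; [D] is measurable and of
   finite measure. *)
Definition is_bochner_integral l (D : set R) (F : R -> dist R) (I : dist R) :=
  [/\ (forall x, D x -> Hper l (F x)), Hper l I &
      exists s, [/\ simple_approx l D F s,
        (\int[mu]_(x in D) sobolev_norm l (F x - simple_val (s n) x)%R)%E
          @[n --> \oo] --> 0%E &
        sobolev_norm l (I - simple_integral D (s n)) @[n --> \oo] --> 0%E]].

(* Mild solutions of u_t + u_x - u_xxt + u u_x + beta u - gamma u_xx = f, when
   [S t] is e^{At} with [A = opA beta gamma]. *)
Definition mild_solution l (S : R -> dist R -> dist R) (f u : R -> dist R) :=
  forall t, 0 <= t ->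
    Hper0 l (u t) /\
    exists2 I,
      is_bochner_integral l `[0, t]
        (fun s => S (t - s) (resolvent (f s - u_ux (u s)))) I &
      u t = S t (u 0) + I.

Definition time_periodic (theta : R) (g : R -> dist R) :=
  forall t, 0 <= t -> g (t + theta) = g t.

Definition globally_stable l (S : R -> dist R -> dist R) (f ut : R -> dist R) :=
  forall u : R -> dist R, mild_solution l S f u ->
    sobolev_norm l (u t - ut t) @[t --> +oo] --> 0%E.

End Distributions.

(* Main.v *)
(* The whole argument takes place on the Fourier side. On mean-zero functions A
   is a bounded multiplier with symbols lambda_k, Re lambda_k <= -c < 0, and
   N(a, b) = - (I - Delta)^-1 d/dx (a b) / 2 is bounded and bilinear on H^l. Any
   semigroup generated by A is exp (lambda_k t) on the k-th mode: a functional
   v |-> (S t v)^_k intertwines A with lambda_k, and lambda_k, lambda_{-k} are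
   separated from all the other symbols.

   For small f the periodic solution is the fixed point of the contraction that
   solves the linear problem with periodic right-hand side f + N(u, u).

   The difference w of two solutions satisfies w_t = A w + N(w, w) + 2 N(ut, w).
   Since w(0) lies only in L^2, the H^1 energy is replaced by
   E = sum_k (1 + kappa^2) / (1 + e^4 kappa^2) |w_k|^2 with kappa = 2 pi k. After
   symmetrization over p + q + r = 0 the cubic term is at most e^3 E^(3/2), while
   E(0) <= e^-4 |w(0)|^2; hence, if e is small compared with 1 / |w(0)|, E decays
   exponentially. The L^2 norm then decays, the nonlinearity becomes small in
   H^l, and the H^l norm decays as well. *)

Require Import Defs.
From mathcomp Require Import all_boot all_order all_algebra.
From mathcomp Require Import complex ring lra zify.
From mathcomp Require Import all_classical all_reals all_analysis measurable_realfun.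
Import Order.TTheory GRing.Theory Num.Theory.
Import numFieldNormedType.Exports.
Import ComplexField.Normc.
Set Implicit Arguments.
Unset Strict Implicit.
Unset Printing Implicit Defensive.
Local Open Scope classical_set_scope.
Local Open Scope ring_scope.

(** * Modulus and convergence of complex numbers *)

Section ComplexNorm.
Context {R : realType}.
Implicit Types z w : R[i].

Local Notation nc := (@normc R).
Local Notation Rc := (Rcomplex R).

(** With the plain H^1 weight the multiplier of the cubic term is [kappa_p + kappa_q + kappa_r],
    which vanishes on [p + q + r = 0]. The weight used here keeps this cancellation up to a factor
    [e^4], and an l^1 sum over frequencies costs [1/e]. As the energy norm starts below
    [e^-2 |w(0)|], the bound [e^3 E^(1/2)] becomes [e |w(0)|]: large data only force a small [e],
    and the rate of decay does not depend on them. Mild solutions with measurable forcing need not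
    be differentiable in time, so no energy is differentiated. The forcing cancels in the difference
    of two solutions, what remains is Lipschitz in time, and explicit Euler steps are consistent to
    second order. Bochner integrals are turned into integrals of single modes. The coefficients of
    an integrand agree with measurable functions only almost everywhere; hence the versions [G] that
    accompany a solution, and the comparison of integrals whose integrands are not known to be
    measurable. Norm bounds are uniform bounds on finite sums of squares ([norm_le]). *)

Lemma nc_ge0 z : 0 <= nc z. Proof. exact: (normr_ge0 (z : Rc)). Qed.
Lemma nc0 : nc 0 = 0. Proof. exact: (normr0 Rc). Qed.
Lemma ncN z : nc (- z) = nc z. Proof. exact: (normrN (z : Rc)). Qed.
Lemma ncD z w : nc (z + w) <= nc z + nc w.
Proof. exact: (ler_normD (z : Rc) (w : Rc)). Qed.
Lemma ncB z w : nc (z - w) <= nc z + nc w.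
Proof. exact: (ler_normB (z : Rc) (w : Rc)). Qed.
Lemma ncBC z w : nc (z - w) = nc (w - z).
Proof. exact: (distrC (z : Rc) (w : Rc)). Qed.
Lemma nc_sum I (s : seq I) (F : I -> R[i]) :
  nc (\sum_(i <- s) F i) <= \sum_(i <- s) nc (F i).
Proof.
elim: s => [|a s IHs]; first by rewrite !big_nil nc0.
by rewrite !big_cons (le_trans (ncD _ _)) // lerD2l.
Qed.
Lemma nc_sqr z : nc z ^+ 2 = complex.Re z ^+ 2 + complex.Im z ^+ 2.
Proof. by case: z => a b /=; rewrite sqr_sqrtr // addr_ge0 ?sqr_ge0. Qed.
Lemma nc_Re z : `|complex.Re z| <= nc z.
Proof.
rewrite -(ler_pXn2r (n := 2)) ?nnegrE ?nc_ge0 ?normr_ge0 //.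
by rewrite nc_sqr real_normK ?num_real // lerDl sqr_ge0.
Qed.
Lemma nc_Im z : `|complex.Im z| <= nc z.
Proof.
rewrite -(ler_pXn2r (n := 2)) ?nnegrE ?nc_ge0 ?normr_ge0 //.
by rewrite nc_sqr real_normK ?num_real // lerDr sqr_ge0.
Qed.
Lemma nc_le z : nc z <= `|complex.Re z| + `|complex.Im z|.
Proof.
rewrite -(ler_pXn2r (n := 2)) ?nnegrE ?nc_ge0 ?addr_ge0 //.
rewrite nc_sqr sqrrD !real_normK ?num_real // -addrA lerD2l lerDr.
by rewrite mulrn_wge0 // mulr_ge0.
Qed.
Lemma nc_conj z : nc (conjc z) = nc z.
Proof. by case: z => a b /=; rewrite sqrrN. Qed.
Lemma nc_real (x : R) : nc (real_complex R x) = `|x|.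
Proof. by rewrite /= expr0n /= addr0 sqrtr_sqr. Qed.

Lemma ReB z w : complex.Re (z - w) = complex.Re z - complex.Re w.
Proof. by case: z w => [? ?] [? ?]. Qed.
Lemma ImB z w : complex.Im (z - w) = complex.Im z - complex.Im w.
Proof. by case: z w => [? ?] [? ?]. Qed.

(** [normc] takes its values in [R], unlike the norm of [R[i]], so complex convergence becomes that
    of a real sequence. *)
Definition ccvg (s : nat -> R[i]) (l : R[i]) :=
  (fun m => nc (s m - l)) @ \oo --> (0 : R).

Lemma ccvgP s l : ccvg s l <->
  forall e, 0 < e -> exists m0, forall m, (m0 <= m)%N -> nc (s m - l) <= e.
Proof.
split=> [/cvgr0Pnorm_le h e e0|h].
  have [m0 _ hm] := h e e0; exists m0 => m lm.
  by have := hm m lm; rewrite /= ger0_norm ?nc_ge0.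
apply/cvgr0Pnorm_le => e e0; have [m0 hm] := h e e0.
by exists m0 => //= m lm; rewrite ger0_norm ?nc_ge0 ?hm.
Qed.

Lemma ccvg_ReIm s l :
  (fun m => complex.Re (s m)) @ \oo --> complex.Re l ->
  (fun m => complex.Im (s m)) @ \oo --> complex.Im l -> ccvg s l.
Proof.
move=> hR hI; apply: (@squeeze_cvgr _ _ _ _ (cst 0)
  (fun m => `|complex.Re (s m) - complex.Re l|
          + `|complex.Im (s m) - complex.Im l|)).
- near=> m; rewrite nc_ge0 /=; apply: (le_trans (nc_le _)).
  by rewrite ReB ImB.
- exact: cvg_cst.
- rewrite -[X in _ --> X](addr0 0); apply: cvgD.
    by rewrite -(normr0 R) -(subrr (complex.Re l)); apply: cvg_norm; apply: cvgB => //; exact: cvg_cst.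
  by rewrite -(normr0 R) -(subrr (complex.Im l)); apply: cvg_norm; apply: cvgB => //; exact: cvg_cst.
Unshelve. all: by end_near. Qed.

Lemma cvg_dist (s : nat -> R) l (b : nat -> R) :
  b @ \oo --> (0 : R) -> (forall m, `|s m - l| <= b m) -> s @ \oo --> l.
Proof.
move=> b0 h; apply/cvgrPdist_le => e e0; move/cvgr0Pnorm_le: b0 => /(_ e e0) hb.
near=> m; rewrite distrC (le_trans (h m)) // (le_trans (ler_norm _)) //.
by near: m.
Unshelve. all: by end_near. Qed.

Lemma ccvg_Re s l : ccvg s l ->
  (fun m => complex.Re (s m)) @ \oo --> complex.Re l.
Proof.
move=> h; apply: (cvg_dist h) => m.
by rewrite -ReB nc_Re.
Qed.

Lemma ccvg_Im s l : ccvg s l ->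
  (fun m => complex.Im (s m)) @ \oo --> complex.Im l.
Proof.
move=> h; apply: (cvg_dist h) => m.
by rewrite -ImB nc_Im.
Qed.

Lemma ccvg_uniq s l l' : ccvg s l -> ccvg s l' -> l = l'.
Proof.
move=> h h'.
have eqR := cvg_unique (@Rhausdorff R) (ccvg_Re h) (ccvg_Re h').
have eqI := cvg_unique (@Rhausdorff R) (ccvg_Im h) (ccvg_Im h').
by case: l l' eqR eqI {h h'} => [? ?] [? ?] /= -> ->.
Qed.

Lemma ccvgD s l s' l' : ccvg s l -> ccvg s' l' ->
  ccvg (fun m => s m + s' m) (l + l').
Proof.
move=> h h'; apply: (@squeeze_cvgr _ _ _ _ (cst 0)
  (fun m => nc (s m - l) + nc (s' m - l'))).
- near=> m; rewrite nc_ge0 /= (_ : _ - _ = (s m - l) + (s' m - l')); last by ring.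
  exact: ncD.
- exact: cvg_cst.
- by rewrite -[X in _ --> X](addr0 0); exact: cvgD.
Unshelve. all: by end_near. Qed.

Lemma ccvg_cst c : ccvg (fun=> c) c.
Proof. by rewrite /ccvg subrr nc0; exact: cvg_cst. Qed.

Lemma ccvg_nc s l : ccvg s l -> (fun m => nc (s m)) @ \oo --> nc l.
Proof.
move=> h; apply: (cvg_dist h) => m.
exact: (ler_dist_dist (s m : Rc) (l : Rc)).
Qed.

Lemma ccvg_shift s l n : ccvg s l -> ccvg (fun m => s (m + n)%N) l.
Proof.
move=> /ccvgP h; apply/ccvgP => e /h[m0 hm]; exists m0 => m lm.
by apply: hm; rewrite (leq_trans lm) ?leq_addr.
Qed.

Lemma ccvg_le s l (B : R) : ccvg s l -> (forall m, nc (s m) <= B) -> nc l <= B.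
Proof.
move=> /ccvg_nc h hB; rewrite -(cvg_lim (@Rhausdorff R) h).
by apply: limr_le; [apply/cvg_ex; exists (nc l) | exact: nearW].
Qed.

End ComplexNorm.

(** * Sums over the integers and convolutions *)

Section IntSums.
Context {R : realType}.

Definition zr (n : nat) : seq int := [seq i%:Z - n%:Z | i <- iota 0 (n + n).+1].

Lemma mem_zr n k : (k \in zr n) = (`|k| <= n)%N.
Proof.
apply/mapP/idP => [ [j]|kn].
  by rewrite mem_iota => /andP[_ hj] ->; lia.
exists (absz (k + n%:Z)); last by lia.
by rewrite mem_iota; lia.
Qed.

Lemma zr_uniq n : uniq (zr n).
Proof. by rewrite map_inj_uniq ?iota_uniq // => i j; lia. Qed.

Lemma sum_zrN n (V : nmodType) (F : int -> V) :
  \sum_(k <- zr n) F (- k) = \sum_(k <- zr n) F k.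
Proof.
rewrite -(big_map (@GRing.opp int) predT F); apply: perm_big.
apply: uniq_perm; rewrite ?zr_uniq //.
  by rewrite map_inj_uniq ?zr_uniq //; exact: oppr_inj.
move=> k; rewrite mem_zr; apply/mapP/idP => [ [j]|kn].
  by rewrite mem_zr => ? ->; lia.
by exists (- k); rewrite ?mem_zr; lia.
Qed.

Lemma zr0 : zr 0 = [:: 0]. Proof. by []. Qed.

Lemma sum_uniq_sub (s t : seq int) (F : int -> R) : uniq s -> uniq t ->
  {subset s <= t} -> (forall k, 0 <= F k) ->
  \sum_(k <- s) F k <= \sum_(k <- t) F k.
Proof.
move=> us ut st F0; rewrite [leRHS](bigID (mem s)) /=.
rewrite [X in _ <= X + _](_ : _ = \sum_(k <- s) F k).
  by rewrite lerDl sumr_ge0.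
rewrite -big_filter; apply: perm_big; apply: uniq_perm => //.
  exact: filter_uniq.
by move=> k; rewrite mem_filter andb_idr // => /st.
Qed.

Lemma uniq_sub_zr (s : seq int) : exists n, {subset s <= zr n}.
Proof.
elim: s => [|k s [n hn]]; first by exists 0%N.
exists (maxn n `|k|%N) => j; rewrite inE => /orP[/eqP->|/hn]; rewrite !mem_zr; lia.
Qed.

(** For nonnegative families this replaces summability: a bound on all duplicate-free finite sums is
    stable under injective reindexing, domination and coefficientwise limits, and mentions no
    infinite sum. *)
Definition sums_le (F : int -> R) (B : R) :=
  forall s, uniq s -> \sum_(k <- s) F k <= B.

Lemma sums_le_zr F B : (forall k, 0 <= F k) ->
  (forall n, \sum_(k <- zr n) F k <= B) -> sums_le F B.
Proof.
move=> F0 h s us; have [n sn] := uniq_sub_zr s.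
exact: (le_trans (sum_uniq_sub us (zr_uniq n) sn F0) (h n)).
Qed.

Lemma sums_le_coef F B k : sums_le F B -> F k <= B.
Proof. by move=> /(_ [:: k] isT); rewrite big_seq1. Qed.

Lemma sums_le_le F G B : sums_le G B -> (forall k, F k <= G k) -> sums_le F B.
Proof. by move=> h FG s us; apply: (le_trans _ (h s us)); apply: ler_sum. Qed.

Lemma sums_le_inj F B (g : int -> int) : injective g -> sums_le F B -> sums_le (F \o g) B.
Proof.
move=> ig h s us; rewrite -(big_map g predT F); apply: h.
by rewrite map_inj_uniq.
Qed.

Lemma sums_leZ F B c : 0 <= c -> sums_le F B -> sums_le (fun k => c * F k) (c * B).
Proof. by move=> c0 h s us; rewrite -mulr_sumr ler_wpM2l ?h. Qed.

Lemma sums_leD F B G C : sums_le F B -> sums_le G C -> sums_le (fun k => F k + G k) (B + C).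
Proof. by move=> h g s us; rewrite big_split lerD ?h ?g. Qed.

Lemma sums_leW F B C : sums_le F B -> B <= C -> sums_le F C.
Proof. by move=> h BC s us; rewrite (le_trans _ BC) ?h. Qed.

(** Induction on the list: by the induction hypothesis the square of the new cross term is at most
    [4 a^2 b^2 X Y], and AM-GM bounds it by [a^2 Y + b^2 X]. *)
Lemma CS_sqr I (s : seq I) (x y : I -> R) :
  (\sum_(i <- s) x i * y i) ^+ 2
    <= (\sum_(i <- s) x i ^+ 2) * (\sum_(i <- s) y i ^+ 2).
Proof.
elim: s => [|i s IH]; first by rewrite !big_nil expr0n /= mulr0.
rewrite !big_cons; move: IH.
have X0 : 0 <= \sum_(i <- s) x i ^+ 2 by apply: sumr_ge0 => ? _; exact: sqr_ge0.
have Y0 : 0 <= \sum_(i <- s) y i ^+ 2 by apply: sumr_ge0 => ? _; exact: sqr_ge0.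
move: X0 Y0; set X := \sum_(i <- s) x i ^+ 2; set Y := \sum_(i <- s) y i ^+ 2.
set T := \sum_(i <- s) x i * y i => X0 Y0 IH.
move: (x i) (y i) => a b.
have ab : 2 * (a * b * T) <= a ^+ 2 * Y + b ^+ 2 * X.
  apply: (le_trans (ler_norm _)); rewrite -(ler_pXn2r (n := 2)) ?nnegrE //; last first.
    by rewrite addr_ge0 // mulr_ge0 ?sqr_ge0.
  rewrite real_normK ?num_real // (_ : (2 * (a * b * T)) ^+ 2 = 4 * (a ^+ 2 * b ^+ 2) * T ^+ 2); last by ring.
  apply: (@le_trans _ _ (4 * (a ^+ 2 * b ^+ 2) * (X * Y))).
    by rewrite ler_wpM2l // mulr_ge0 // mulr_ge0 ?sqr_ge0.
  rewrite -subr_ge0 (_ : _ - _ = (a ^+ 2 * Y - b ^+ 2 * X) ^+ 2) ?sqr_ge0 //; by ring.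
rewrite -subr_ge0 (_ : _ - _ = (X * Y - T ^+ 2) + (a ^+ 2 * Y + b ^+ 2 * X - 2 * (a * b * T))); last by ring.
by rewrite addr_ge0 // subr_ge0.
Qed.

Lemma CS I (s : seq I) (x y : I -> R) A B : 0 <= A -> 0 <= B ->
  \sum_(i <- s) x i ^+ 2 <= A ^+ 2 -> \sum_(i <- s) y i ^+ 2 <= B ^+ 2 ->
  \sum_(i <- s) x i * y i <= A * B.
Proof.
move=> A0 B0 hA hB; apply: (le_trans (ler_norm _)).
rewrite -(ler_pXn2r (n := 2)) ?nnegrE ?mulr_ge0 // real_normK ?num_real //.
rewrite (le_trans (CS_sqr _ _ _)) // exprMn ler_pM //;
  by apply: sumr_ge0 => ? _; exact: sqr_ge0.
Qed.

(** [F] is the difference of the nonnegative families [F + |F|] and [|F|], whose symmetric partial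
    sums are monotone and bounded. *)
Lemma sum_cvg_abs (F : int -> R) B : sums_le (fun k => `|F k|) B ->
  cvgn (fun m => \sum_(k <- zr m) F k).
Proof.
have mono (G : int -> R) C : (forall k, 0 <= G k) -> sums_le G C ->
    cvgn (fun m => \sum_(k <- zr m) G k).
  move=> G0 hG; apply: nondecreasing_is_cvgn.
    move=> m n mn; apply: sum_uniq_sub; rewrite ?zr_uniq //.
    by move=> k; rewrite !mem_zr => /leq_trans; exact.
  by exists C => _ [n _ <-]; apply: hG; exact: zr_uniq.
move=> h; rewrite (_ : (fun m => _) = (fun m => \sum_(k <- zr m) (F k + `|F k|)
    - \sum_(k <- zr m) `|F k|)).
  apply: is_cvgB; last exact: (mono _ B).
  apply: (mono _ (B + B)) => [k|].
    by rewrite -lerBlDr sub0r; have := ler_norm (- F k); rewrite normrN; lra.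
  by apply: sums_le_le (sums_leD h h) _ => k; rewrite lerD2r ler_norm.
by apply: funext => m; rewrite big_split /= addrK.
Qed.

(** Once a symmetric partial sum is within [e] of its limit [L], a sum over higher frequencies added
    to it still stays below [L]. *)
Lemma tail_small (F : int -> R) B e : (forall k, 0 <= F k) -> sums_le F B -> 0 < e ->
  exists n, forall s, uniq s -> (forall k, k \in s -> (n < `|k|)%N) ->
    \sum_(k <- s) F k <= e.
Proof.
move=> F0 h e0; have : cvgn (fun m => \sum_(k <- zr m) F k).
  by apply: (@sum_cvg_abs _ B); apply: sums_le_le h _ => k; rewrite ger0_norm.
move=> /cvg_ex[L hL]; have hL' m : \sum_(k <- zr m) F k <= L.
  rewrite -(cvg_lim (@Rhausdorff R) hL); apply: (@nondecreasing_cvgn_le _ (fun m => \sum_(k <- zr m) F k)).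
    move=> a b ab; apply: sum_uniq_sub; rewrite ?zr_uniq //.
    by move=> k; rewrite !mem_zr => /leq_trans; exact.
  by apply/cvg_ex; exists L.
move/cvgrPdist_le: hL => /(_ e e0)[n _ hn]; exists n => s us hs.
have [m sm] := uniq_sub_zr s; have /= := hn n (leqnn n).
rewrite ger0_norm ?subr_ge0 // => hn1; apply: le_trans hn1.
have := hL' (maxn n m); rewrite -(lerD2r (- \sum_(k <- zr n) F k)); apply: le_trans.
rewrite lerBrDr -big_cat /=; apply: sum_uniq_sub => //; rewrite ?zr_uniq //.
  rewrite cat_uniq us zr_uniq andbT; apply/hasPn => k.
  by rewrite mem_zr => kn; apply/negP => /hs; lia.
move=> k; rewrite mem_cat => /orP[/sm|]; rewrite !mem_zr; lia.
Qed.

End IntSums.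

#[global] Opaque zr.

(** * Weighted square-summable sequences and their convolution *)

Section Convolution.
Context {R : realType}.
Implicit Types (a b : int -> R[i]) (th : int -> R) (A B M : R) (k : int).
Local Notation nc := (@normc R).

(** A weighted l^2 bound without a norm as an object: no finiteness condition has to be carried
    along. The sign of [M] is part of it so that squares can be compared. *)
Definition norm_le th a M :=
  0 <= M /\ sums_le (fun k => th k * nc (a k) ^+ 2) (M ^+ 2).

Definition one : int -> R := fun=> 1.

Lemma norm_le_ptw th a b c M : (forall k, 0 <= th k) -> 0 <= c ->
  (forall k, nc (b k) <= c * nc (a k)) -> norm_le th a M -> norm_le th b (c * M).
Proof.
move=> th0 c0 ba [M0 h]; split; first exact: mulr_ge0.
rewrite exprMn; apply: sums_le_le (sums_leZ (sqr_ge0 c) h) _ => k.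
rewrite /= [leRHS]mulrCA -exprMn ler_wpM2l // ler_pXn2r ?nnegrE ?mulr_ge0 ?nc_ge0 //.
Qed.

Lemma norm_le_sub th a b M : (forall k, 0 <= th k) ->
  (forall k, nc (b k) <= nc (a k)) -> norm_le th a M -> norm_le th b M.
Proof.
by move=> th0 h; rewrite -[in X in _ -> X](mul1r M); apply: norm_le_ptw => // k; rewrite mul1r.
Qed.

Lemma norm_le_W th a M M' : norm_le th a M -> M <= M' -> norm_le th a M'.
Proof.
move=> [M0 h] MM; have M'0 := le_trans M0 MM; split=> //; apply: sums_leW h _.
by rewrite ler_pXn2r.
Qed.

Lemma norm_le_th th th' a c M : 0 <= c ->
  (forall k, th' k <= c ^+ 2 * th k) -> norm_le th a M -> norm_le th' a (c * M).
Proof.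
move=> c0 h [M0 hM]; split; first exact: mulr_ge0.
rewrite exprMn; apply: sums_le_le (sums_leZ (sqr_ge0 c) hM) _ => k.
by rewrite /= [leRHS]mulrA ler_wpM2r ?sqr_ge0.
Qed.

Lemma norm_le_th1 th th' a M : (forall k, th' k <= th k) -> norm_le th a M -> norm_le th' a M.
Proof.
move=> h hM; rewrite -(mul1r M); apply: norm_le_th hM => // k.
by rewrite expr1n mul1r.
Qed.

Lemma norm_le0 th M : 0 <= M -> norm_le th (fun=> 0) M.
Proof.
move=> M0; split=> // s us; rewrite big1 ?sqr_ge0 // => k _.
by rewrite nc0 expr0n /= mulr0.
Qed.

Lemma norm_leD th a b M N : (forall k, 0 <= th k) ->
  norm_le th a M -> norm_le th b N -> norm_le th (fun k => a k + b k) (M + N).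
Proof.
move=> th0 [M0 hM] [N0 hN]; split; first exact: addr_ge0.
move=> s us.
pose x k := Num.sqrt (th k) * nc (a k); pose y k := Num.sqrt (th k) * nc (b k).
have Ex : \sum_(k <- s) x k ^+ 2 <= M ^+ 2.
  by rewrite (le_trans _ (hM s us)) // ler_sum // => k _; rewrite exprMn sqr_sqrtr.
have Ey : \sum_(k <- s) y k ^+ 2 <= N ^+ 2.
  by rewrite (le_trans _ (hN s us)) // ler_sum // => k _; rewrite exprMn sqr_sqrtr.
apply: (@le_trans _ _ (\sum_(k <- s) (x k + y k) ^+ 2)).
  apply: ler_sum => k _; rewrite -mulrDr exprMn sqr_sqrtr // ler_wpM2l //.
  by rewrite ler_pXn2r ?nnegrE ?addr_ge0 ?nc_ge0 // ncD.
have := CS M0 N0 Ex Ey; under [X in _ -> X <= _]eq_bigr do rewrite sqrrD mulr2n.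
rewrite !big_split /= sqrrD mulr2n => Exy.
by rewrite lerD // lerD // lerD.
Qed.

Lemma norm_leN th a M : norm_le th a M -> norm_le th (fun k => - a k) M.
Proof. by rewrite /norm_le => -[M0 h]; split=> //; under eq_fun do rewrite ncN. Qed.

Lemma norm_leB th a b M N : (forall k, 0 <= th k) ->
  norm_le th a M -> norm_le th b N -> norm_le th (fun k => a k - b k) (M + N).
Proof. by move=> th0 hM /norm_leN hN; exact: norm_leD. Qed.

Lemma norm_le_coef th a M k : norm_le th a M -> th k * nc (a k) ^+ 2 <= M ^+ 2.
Proof. by move=> [_ h]; exact: (sums_le_coef k h). Qed.

Lemma norm_le1_coef a M k : norm_le one a M -> nc (a k) <= M.
Proof.
move=> h; have := norm_le_coef k h; rewrite mul1r; case: h => M0 _.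
by rewrite ler_pXn2r ?nnegrE ?nc_ge0.
Qed.

(** A Fatou lemma: the bound concerns finite sums only, and these pass to the limit coefficient by
    coefficient. *)
Lemma norm_le_lim th (s : nat -> int -> R[i]) a M : (forall k, 0 <= th k) ->
  (forall k, ccvg (fun n => s n k) (a k)) -> (forall n, norm_le th (s n) M) -> norm_le th a M.
Proof.
move=> th0 hs hM; split; first by case: (hM 0%N).
move=> r ur; have h : (fun n => \sum_(k <- r) th k * nc (s n k) ^+ 2) @ \oo -->
    \sum_(k <- r) th k * nc (a k) ^+ 2.
  elim: r {ur} => [|k r IH].
    by rewrite big_nil; under eq_fun do rewrite big_nil; exact: cvg_cst.
  rewrite big_cons; under eq_fun do rewrite big_cons.
  apply: cvgD => //; apply: cvgM; first exact: cvg_cst.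
  by under eq_fun do rewrite expr2; rewrite expr2; apply: cvgM; exact: ccvg_nc.
rewrite -(cvg_lim (@Rhausdorff R) h); apply: limr_le; first by apply/cvg_ex; eexists; exact: h.
by apply: nearW => n; case: (hM n) => _; exact.
Qed.

Lemma norm_le1_sqr a A (s : seq int) : norm_le one a A -> uniq s ->
  \sum_(k <- s) nc (a k) ^+ 2 <= A ^+ 2.
Proof.
move=> [_ h] us; apply: le_trans (h s us).
by apply: ler_sum => k _; rewrite mul1r.
Qed.

Lemma norm_le1_inj a A (g : int -> int) : injective g ->
  norm_le one a A -> norm_le one (a \o g) A.
Proof. by move=> ig [A0 h]; split=> //; have := sums_le_inj ig h. Qed.

Lemma pair_sum_le a b A B k : norm_le one a A -> norm_le one b B ->
  sums_le (fun j => nc (a j) * nc (b (k - j))) (A * B).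
Proof.
move=> ha hb s us; apply: CS; [by case: ha|by case: hb| |].
  exact: norm_le1_sqr ha us.
apply: (@norm_le1_sqr (b \o (fun j => k - j)) B s _ us).
by apply: norm_le1_inj hb => i j; lia.
Qed.

(* The convolution as a limit of symmetric partial sums; it is only
   meaningful for square-summable sequences. *)
Definition conv a b k : R[i] :=
  Complex (lim ((fun m => complex.Re (\sum_(j <- zr m) a j * b (k - j))) @ \oo))
          (lim ((fun m => complex.Im (\sum_(j <- zr m) a j * b (k - j))) @ \oo)).

Lemma Re_sum I (s : seq I) (F : I -> R[i]) :
  complex.Re (\sum_(i <- s) F i) = \sum_(i <- s) complex.Re (F i).
Proof. by elim: s => [|i s IH]; rewrite ?big_nil // !big_cons -IH; case: (F i) (\sum_(_ <- _) _) => [? ?] [? ?]. Qed.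
Lemma Im_sum I (s : seq I) (F : I -> R[i]) :
  complex.Im (\sum_(i <- s) F i) = \sum_(i <- s) complex.Im (F i).
Proof. by elim: s => [|i s IH]; rewrite ?big_nil // !big_cons -IH; case: (F i) (\sum_(_ <- _) _) => [? ?] [? ?]. Qed.

Lemma ccvg_abs (F : int -> R[i]) B : sums_le (fun k => nc (F k)) B ->
  ccvg (fun m => \sum_(k <- zr m) F k)
    (Complex (lim ((fun m => complex.Re (\sum_(k <- zr m) F k)) @ \oo))
             (lim ((fun m => complex.Im (\sum_(k <- zr m) F k)) @ \oo))).
Proof.
move=> h; apply: ccvg_ReIm => /=.
  suff : cvgn (fun m => complex.Re (\sum_(k <- zr m) F k)) by [].
  under eq_fun do rewrite Re_sum.
  by apply: (@sum_cvg_abs _ _ B); apply: sums_le_le h _ => k; exact: nc_Re.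
suff : cvgn (fun m => complex.Im (\sum_(k <- zr m) F k)) by [].
under eq_fun do rewrite Im_sum.
by apply: (@sum_cvg_abs _ _ B); apply: sums_le_le h _ => k; exact: nc_Im.
Qed.

Lemma conv_cvg a b A B k : norm_le one a A -> norm_le one b B ->
  ccvg (fun m => \sum_(j <- zr m) a j * b (k - j)) (conv a b k).
Proof.
move=> ha hb; apply: (@ccvg_abs (fun j => a j * b (k - j)) (A * B)).
by apply: sums_le_le (pair_sum_le k ha hb) _ => j; rewrite normcM.
Qed.

Lemma conv_le a b A B k : norm_le one a A -> norm_le one b B -> nc (conv a b k) <= A * B.
Proof.
move=> ha hb; apply: ccvg_le (conv_cvg k ha hb) _ => m.
apply: (le_trans (nc_sum _ _)).
under eq_bigr do rewrite normcM; exact: (pair_sum_le k ha hb) (zr_uniq m).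
Qed.

(** Reduces estimates of a convolution to finite double sums of moduli, where sums may be exchanged
    freely; the bound must be uniform in the truncation [m]. *)
Lemma conv_dom a b A B (s : seq int) (x : int -> R) D :
  norm_le one a A -> norm_le one b B -> (forall k, 0 <= x k) ->
  (forall m, \sum_(k <- s) x k * \sum_(j <- zr m) nc (a j) * nc (b (k - j)) <= D) ->
  \sum_(k <- s) x k * nc (conv a b k) <= D.
Proof.
move=> ha hb x0 h.
have c : (fun m => \sum_(k <- s) x k * nc (\sum_(j <- zr m) a j * b (k - j))) @ \oo -->
    \sum_(k <- s) x k * nc (conv a b k).
  elim: s {h} => [|k r IH].
    by rewrite big_nil; under eq_fun do rewrite big_nil; exact: cvg_cst.
  rewrite big_cons; under eq_fun do rewrite big_cons.
  apply: cvgD => //; apply: cvgM; first exact: cvg_cst.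
  exact: ccvg_nc (conv_cvg k ha hb).
rewrite -(cvg_lim (@Rhausdorff R) c); apply: limr_le; first by apply/cvg_ex; eexists; exact: c.
apply: nearW => m; apply: le_trans (h m); apply: ler_sum => k _.
rewrite ler_wpM2l // (le_trans (nc_sum _ _)) //.
by apply: ler_sum => j _; rewrite normcM.
Qed.

Lemma convDl a a' b A A' B k : norm_le one a A -> norm_le one a' A' -> norm_le one b B ->
  conv (fun j => a j + a' j) b k = conv a b k + conv a' b k.
Proof.
move=> ha ha' hb; have haa := norm_leD (fun=> ler01) ha ha'.
apply: ccvg_uniq (conv_cvg k haa hb) _.
have := ccvgD (conv_cvg k ha hb) (conv_cvg k ha' hb); congr (ccvg _ _).
apply: funext => m; rewrite -big_split; apply: eq_bigr => j _ /=; exact: esym (mulrDl _ _ _).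
Qed.

Lemma convDr a b b' A B B' k : norm_le one a A -> norm_le one b B -> norm_le one b' B' ->
  conv a (fun j => b j + b' j) k = conv a b k + conv a b' k.
Proof.
move=> ha hb hb'; have hbb := norm_leD (fun=> ler01) hb hb'.
apply: ccvg_uniq (conv_cvg k ha hbb) _.
have := ccvgD (conv_cvg k ha hb) (conv_cvg k ha hb'); congr (ccvg _ _).
apply: funext => m; rewrite -big_split; apply: eq_bigr => j _ /=; exact: esym (mulrDr _ _ _).
Qed.

(** The substitution [j -> k - j] moves the summation window [[-m, m]] to [[k - m, k + m]]. The two
    windows differ by [r] and [r'], which contain high frequencies only, so the difference of the
    partial sums is a tail of an absolutely convergent series. *)
Lemma conv_sym a b A B k : norm_le one a A -> norm_le one b B ->
  conv a b k = conv b a k.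
Proof.
move=> ha hb; have c1 := conv_cvg k ha hb; have c2 := conv_cvg k hb ha.
apply: (ccvg_uniq c1); rewrite -[conv b a k]addr0.
rewrite (_ : (fun m => _) = (fun m => \sum_(j <- zr m) b j * a (k - j) +
   (\sum_(j <- zr m) a j * b (k - j) - \sum_(j <- zr m) b j * a (k - j)))); last first.
  by apply: funext => m; rewrite addrC subrK.
apply: ccvgD => //; apply/ccvgP => e e0.
pose F j := nc (a j) * nc (b (k - j)).
have F0 j : 0 <= F j by rewrite mulr_ge0 ?nc_ge0.
have [n hn] := tail_small F0 (pair_sum_le k ha hb) e0.
(* From this [m] on both windows contain every [j] with modulus at most [n]. *)
exists (n + `|k|)%N => m nm; rewrite subr0.
pose p j := (`|k - j| <= m)%N.
have E1 : \sum_(j <- zr m) b j * a (k - j) =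
    \sum_(j <- [seq k - i | i <- zr m]) a j * b (k - j).
  rewrite [RHS]big_map; apply: eq_bigr => j _.
  by rewrite mulrC subKr.
pose r := [seq j <- zr m | ~~ p j]; pose r' := [seq j <- [seq k - i | i <- zr m] | (m < `|j|)%N].
have E : \sum_(j <- zr m) a j * b (k - j) - \sum_(j <- zr m) b j * a (k - j) =
   \sum_(j <- r) a j * b (k - j) - \sum_(j <- r') a j * b (k - j).
  rewrite E1 (bigID p) /= [X in _ - X](bigID (fun j => `|j| <= m)%N) /=.
  rewrite [in RHS]/r [in RHS]/r' !big_filter.
  have -> : \sum_(j <- zr m | p j) a j * b (k - j) =
      \sum_(j <- [seq k - i | i <- zr m] | (`|j| <= m)%N) a j * b (k - j).
    rewrite -big_filter -[RHS]big_filter.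
    apply: perm_big; apply: uniq_perm; rewrite ?filter_uniq ?zr_uniq //.
      by rewrite map_inj_uniq ?zr_uniq // => i j; lia.
    move=> j; rewrite !mem_filter mem_zr andbC /p; apply/andP/andP.
      move=> [h1 h2]; split=> //; apply/mapP; exists (k - j); rewrite ?mem_zr //; lia.
    by move=> [h1 /mapP[i']]; rewrite mem_zr => h2 ej; subst j; split; lia.
  rewrite opprD addrACA subrr add0r; congr (_ - _).
  by apply: eq_bigl => j; rewrite ltnNge.
have hb2 (t : seq int) : uniq t -> (forall j, j \in t -> (n < `|j|)%N) ->
    nc (\sum_(j <- t) a j * b (k - j)) <= \sum_(j <- t) F j.
  by move=> ut ht; rewrite (le_trans (nc_sum _ _)) // ler_sum // => j _; rewrite normcM.
have ur : uniq (r ++ r').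
  rewrite cat_uniq filter_uniq ?zr_uniq //=.
  rewrite filter_uniq ?andbT; last by rewrite map_inj_uniq ?zr_uniq // => i j; lia.
  apply/hasPn => j; rewrite !mem_filter mem_zr => /andP[h1 _]; apply/negP => /andP[_]; lia.
have hr j : j \in r ++ r' -> (n < `|j|)%N.
  rewrite mem_cat => /orP[]; rewrite !mem_filter ?mem_zr /p => /andP[h1 h2]; lia.
rewrite E; apply: (le_trans _ (hn (r ++ r') ur hr)); rewrite big_cat /=.
apply: (le_trans (ncB _ _)); move: ur; rewrite cat_uniq => /and3P[u1 _ u2].
apply: lerD; apply: hb2 => // j jr; apply: hr; rewrite mem_cat jr ?orbT //.
Qed.

Definition is_real a := forall k, a (- k) = conjc (a k).

Lemma conj_sum I (s : seq I) (F : I -> R[i]) :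
  conjc (\sum_(i <- s) F i) = \sum_(i <- s) conjc (F i).
Proof. by rewrite raddf_sum. Qed.

Lemma ccvg_conj (f : nat -> R[i]) l : ccvg f l -> ccvg (fun m => conjc (f m)) (conjc l).
Proof.
rewrite /ccvg => h; under eq_fun do rewrite -nc_conj.
suff -> : (fun m => nc (conjc (conjc (f m) - conjc l))) = (fun m => nc (f m - l)) by [].
apply: funext => m; congr nc.
by case: (f m) l {h} => [? ?] [? ?] /=; congr Complex; ring.
Qed.

Lemma conv_real a b A B : norm_le one a A -> norm_le one b B ->
  is_real a -> is_real b -> is_real (conv a b).
Proof.
move=> ha hb ra rb k; apply: ccvg_uniq (conv_cvg (- k) ha hb) _.
have := ccvg_conj (conv_cvg k ha hb); congr (ccvg _ _); apply: funext => m.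
rewrite -[RHS]sum_zrN conj_sum; apply: eq_bigr => j _.
by rewrite rmorphM /= -ra -rb; congr (_ * b _); lia.
Qed.

Definition trunc n a k : R[i] := if (`|k| <= n)%N then a k else 0.

Lemma trunc_le n a k : nc (trunc n a k) <= nc (a k).
Proof. by rewrite /trunc; case: ifP => // _; rewrite nc0 nc_ge0. Qed.

Lemma trunc_real n a : is_real a -> is_real (trunc n a).
Proof.
by move=> ra k; rewrite /trunc abszN; case: ifP => // _; rewrite conjc0.
Qed.

(** With a finitely supported first factor the partial sums that define [conv] are eventually
    constant. *)
Lemma conv_trunc n a b k :
  conv (trunc n a) b k = \sum_(j <- zr n) trunc n a j * b (k - j).
Proof.
pose L := \sum_(j <- zr n) trunc n a j * b (k - j).
have h m : (n <= m)%N -> \sum_(j <- zr m) trunc n a j * b (k - j) = L.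
  move=> nm; rewrite (bigID (mem (zr n))) /= [X in _ + X]big1 ?addr0.
    rewrite -big_filter; apply: perm_big; apply: uniq_perm; rewrite ?filter_uniq ?zr_uniq //.
    by move=> j; rewrite mem_filter !mem_zr andb_idr // => /leq_trans; exact.
  by move=> j; rewrite mem_zr /trunc => /negbTE ->; rewrite mul0r.
have c : ccvg (fun m => \sum_(j <- zr m) trunc n a j * b (k - j)) L.
  by apply/ccvgP => e e0; exists n => m /h ->; rewrite subrr nc0 ltW.
rewrite -/L /conv [RHS](_ : L = Complex (complex.Re L) (complex.Im L)); last by case: L {h c}.
by congr Complex; apply: cvg_lim => //; [exact: ccvg_Re|exact: ccvg_Im].
Qed.

Lemma trunc_tail th a M e : (forall k, 0 <= th k) -> norm_le th a M -> 0 < e ->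
  exists n0, forall n, (n0 <= n)%N -> norm_le th (fun k => a k - trunc n a k) e.
Proof.
move=> th0 [M0 h] e0; have F0 k : 0 <= th k * nc (a k) ^+ 2 by rewrite mulr_ge0 ?sqr_ge0.
have [n hn] := tail_small F0 h (exprn_gt0 2 e0); exists n => m nm.
split=> [|s us]; first exact: ltW.
rewrite (bigID (fun k => `|k| <= m)%N) /= big1 ?add0r; last first.
  by move=> k km; rewrite /trunc km subrr nc0 expr0n /= mulr0.
rewrite -big_filter; apply: le_trans (hn [seq k <- s | ~~ (`|k| <= m)%N] _ _).
- rewrite !big_filter; apply: ler_sum => k /negbTE km.
  by rewrite /trunc km subr0.
- exact: filter_uniq.
- by move=> k; rewrite mem_filter -ltnNge => /andP[/(leq_ltn_trans nm)].
Qed.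

End Convolution.

Arguments conv : simpl never.

(** * Frequency sums and the nonlinearity in H^l *)

Section StaticEstimates.
Context {R : realType}.
Implicit Types (a b v w : int -> R[i]) (A B V X : R) (k : int).
Local Notation nc := (@normc R).

Definition kap k : R := 2 * pi * k%:~R.

Lemma kapN k : kap (- k) = - kap k.
Proof. by rewrite /kap mulrNz mulrN. Qed.
Lemma kapD k j : kap (k + j) = kap k + kap j.
Proof. by rewrite /kap intrD mulrDr. Qed.
Lemma kap0 : kap 0 = 0. Proof. by rewrite /kap mulr0. Qed.

Lemma kap_norm k : 4 * `|k|%N%:R <= `|kap k|.
Proof.
rewrite /kap normrM -intr_norm -natr_absz ger0_norm ?mulr_ge0 ?pi_ge0 //.
by rewrite ler_wpM2r ?ler0n //; have := pi_ge2 R; lra.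
Qed.

Lemma kap_ge4 k : k != 0 -> 4 <= `|kap k|.
Proof.
move=> k0; apply: le_trans (kap_norm k).
by rewrite ler_peMr // ler1n absz_gt0.
Qed.

Lemma sum_zrS n (F : int -> R) :
  \sum_(k <- zr n.+1) F k = F n.+1%:Z + F (- n.+1%:Z) + \sum_(k <- zr n) F k.
Proof.
have -> : F n.+1%:Z + F (- n.+1%:Z) + \sum_(k <- zr n) F k =
    \sum_(k <- [:: n.+1%:Z, - n.+1%:Z & zr n]) F k by rewrite [RHS]big_cons [X in _ = _ + X]big_cons addrA.
apply: perm_big; apply: uniq_perm; rewrite ?zr_uniq //=.
  by rewrite in_cons 2!mem_zr zr_uniq; lia.
by move=> k; rewrite mem_zr in_cons in_cons mem_zr; lia.
Qed.

(** Comparison with a telescoping series in the modulus of [k]; the factor 2 accounts for the two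
    signs. *)
Lemma sums_le_telescope (F : int -> R) (g : nat -> R) :
  (forall k, 0 <= F k) -> (forall n, 0 <= g n) -> F 0 = 0 ->
  (forall k, k != 0 -> F k <= g `|k|%N.-1 - g `|k|%N) -> sums_le F (2 * g 0%N).
Proof.
move=> F0 g0 Fz h; apply: sums_le_zr => // n.
suff : \sum_(k <- zr n) F k <= 2 * (g 0%N - g n) by have := g0 n; lra.
elim: n => [|n IH]; first by rewrite zr0 big_seq1 Fz subrr mulr0.
rewrite sum_zrS; have := h n.+1%:Z isT; have := h (- n.+1%:Z) isT.
by rewrite abszN /=; lra.
Qed.

(* [eps = e^4], so that the fractional powers of [eps] below are powers of [e]. *)
Definition De (e : R) k := 1 + e ^+ 4 * kap k ^+ 2.

Lemma De_gt0 e k : 0 < De e k.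
Proof. by rewrite ltr_pwDl // mulr_ge0 ?sqr_ge0 // (exprM e 2 2) sqr_ge0. Qed.

(** [De] behaves like 1 up to the frequency [e^-2], so the sum is of the order of the number of
    frequencies below it. With [y = 4 e^2] and [n + 1] the modulus of [k], [De] is at least half of
    [(1 + y (n + 1))^2], hence at least half of [(1 + y n) (1 + y (n + 1))], and the inverse of this
    product telescopes. *)
Lemma sum_invDe e : 0 < e ->
  sums_le (fun k => if k == 0 then 0 else (De e k)^-1) ((e^-1) ^+ 2).
Proof.
move=> e0; pose y := 4 * e ^+ 2; have y0 : 0 < y by rewrite mulr_gt0 // exprn_gt0.
pose g (n : nat) := 2 / (y * (1 + y * n%:R)).
have P n : 0 < 1 + y * n%:R by rewrite ltr_pwDl // mulr_ge0 ?ler0n // ltW.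
rewrite (_ : (e^-1) ^+ 2 = 2 * g 0%N); last first.
  by rewrite /g /y mulr0 addr0 mulr1; field; rewrite gt_eqF.
apply: sums_le_telescope => [k|n||k k0].
- by case: ifP => // _; rewrite invr_ge0 ltW // De_gt0.
- by rewrite divr_ge0 // mulr_ge0 // ltW.
- by [].
rewrite (negbTE k0) /g; have : (0 < `|k|)%N by rewrite absz_gt0.
have := kap_norm k; case: `|k|%N => // n kn _ /=.
have := P n; have := P n.+1; set p := 1 + y * n%:R; set q := 1 + y * n.+1%:R => q0 p0.
have qp : q = p + y by rewrite /q /p -natr1; ring.
have -> : 2 / (y * p) - 2 / (y * q) = 2 / (p * q).
  by rewrite qp; field; rewrite -qp !gt_eqF.
rewrite -lef_pV2 ?posrE ?invr_gt0 ?De_gt0 ?divr_gt0 ?mulr_gt0 // invrK invf_div.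
apply: (@le_trans _ _ (q ^+ 2 / 2)).
  by rewrite ler_pM2r ?invr_gt0 // expr2 ler_pM2r // qp lerDl ltW.
have : y * n.+1%:R <= e ^+ 2 * `|kap k|.
  by rewrite /y mulrAC mulrC ler_pM2l ?exprn_gt0.
have : 0 <= y * n.+1%:R by rewrite mulr_ge0 // ltW.
rewrite /De (_ : e ^+ 4 * _ = (e ^+ 2 * `|kap k|) ^+ 2); last first.
  by rewrite [RHS]exprMn -exprM real_normK ?num_real.
rewrite /q; move: (y * n.+1%:R) (e ^+ 2 * `|kap k|) => u t u0 ut.
have : u ^+ 2 <= t ^+ 2 by rewrite ler_pXn2r ?nnegrE ?(le_trans u0).
by have := sqr_ge0 (1 - u); rewrite sqrrB sqrrD !expr1n !mul1r; lra.

Qed.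

Lemma sum_invkap : sums_le (fun k => (kap k ^+ 2)^-1) 2.
Proof.
have := sums_leZ (ler0n R 2) (sum_invDe ltr01); rewrite invr1 expr1n mulr1 => h.
apply: sums_le_le h _ => k; case: eqP => [->|/eqP k0]; first by rewrite kap0 expr0n /= invr0 mulr0.
have := kap_ge4 k0; rewrite /De expr1n mul1r -(real_normK (num_real (kap k))).
move: `|kap k| => t t4; have t2 : 1 <= t ^+ 2 by nra.
rewrite -[leLHS]div1r ler_pdivrMr ?(lt_le_trans ltr01) // mulrAC.
by rewrite ler_pdivlMr; nra.
Qed.

(** Up to the factor [i], the multiplier of [(I - Delta)^-1 d/dx]. *)
Definition rk k : R := kap k / (1 + kap k ^+ 2).

Lemma kap1_gt0 k : 0 < 1 + kap k ^+ 2.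
Proof. by rewrite ltr_pwDl // sqr_ge0. Qed.

Lemma rk_sqr k : rk k ^+ 2 <= (kap k ^+ 2)^-1.
Proof.
rewrite /rk expr_div_n; have [->|k0] := eqVneq (kap k) 0.
  by rewrite expr0n /= mul0r invr0.
have : 0 < kap k ^+ 2 by rewrite exprn_even_gt0.
move: (kap k ^+ 2) => t t0; have t1 : 0 < (1 + t) ^+ 2 by rewrite exprn_gt0 // ltr_pwDl // ltW.
by rewrite ler_pdivrMr // ler_pdivlMl //; nra.
Qed.

(* The nonlinear term: the Fourier coefficients of
   [-1/2 (I - Delta)^-1 d/dx (a b)]. *)
Definition Nl a b k : R[i] := Complex 0 (- (rk k / 2)) * conv a b k.

Arguments Nl : simpl never.

Lemma nc_imag (x : R) : nc (Complex 0 x) = `|x|.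
Proof. by rewrite /= expr0n /= add0r sqrtr_sqr. Qed.

Lemma nc_Nl a b k : nc (Nl a b k) = `|rk k| / 2 * nc (conv a b k).
Proof.
by rewrite normcM nc_imag normrN normrM (@ger0_norm _ (2^-1)).
Qed.

Definition om (l : R) k : R := (1 + kap k ^+ 2) `^ l.
Definition hm (l : R) k : R := (1 + kap k ^+ 2) `^ (l / 2).

Lemma om_gt0 l k : 0 < om l k. Proof. by rewrite powR_gt0 // kap1_gt0. Qed.
Lemma om_ge0 l k : 0 <= om l k. Proof. by rewrite ltW // om_gt0. Qed.
Lemma hm_gt0 l k : 0 < hm l k. Proof. by rewrite powR_gt0 // kap1_gt0. Qed.
Lemma hm_ge0 l k : 0 <= hm l k. Proof. by rewrite ltW // hm_gt0. Qed.
Lemma hm_sqr l k : hm l k ^+ 2 = om l k.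
Proof. by rewrite /hm -powR_mulrn ?powR_ge0 // -powRrM -mulrA mulVf ?mulr1 // pnatr_eq0. Qed.

Lemma om_ge1 l k : 0 <= l -> 1 <= om l k.
Proof.
move=> l0; rewrite -(powRr0 (1 + kap k ^+ 2)); apply: ler_powR => //.
by rewrite lerDl sqr_ge0.
Qed.

Lemma om0 k : om 0 k = 1. Proof. exact: powRr0. Qed.

(** The constant comes from [1 + (x + y)^2 <= 4 (1 + max (x^2, y^2))]: of two frequencies that add
    up to [k], the larger one has at least half the modulus of [k]. *)
Definition Cl (l : R) : R := 4 `^ (l / 2).

Lemma Cl_ge0 l : 0 <= Cl l. Proof. exact: powR_ge0. Qed.

Lemma hm_split l k j : 0 <= l -> hm l k <= Cl l * (hm l j + hm l (k - j)).
Proof.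
move=> l0; have l20 : 0 <= l / 2 by rewrite divr_ge0.
have E : kap k = kap j + kap (k - j) by rewrite -kapD; congr kap; lia.
have [h|h] := leP (kap j ^+ 2) (kap (k - j) ^+ 2).
  apply: (@le_trans _ _ (Cl l * hm l (k - j))); last first.
    by rewrite ler_wpM2l ?Cl_ge0 // lerDr hm_ge0.
  rewrite /Cl /hm -powRM //; last by rewrite ltW // kap1_gt0.
  apply: ge0_ler_powR; rewrite ?nnegrE ?mulr_ge0 // ?(ltW (kap1_gt0 _)) //.
  rewrite E; move: (kap j) (kap (k - j)) h => x y h; nra.
apply: (@le_trans _ _ (Cl l * hm l j)); last first.
  by rewrite ler_wpM2l ?Cl_ge0 // lerDl hm_ge0.
rewrite /Cl /hm -powRM //; last by rewrite ltW // kap1_gt0.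
apply: ge0_ler_powR; rewrite ?nnegrE ?mulr_ge0 // ?(ltW (kap1_gt0 _)) //.
rewrite E; move: (kap j) (kap (k - j)) h => x y h; nra.
Qed.

Lemma norm_le_hm l a A : norm_le (om l) a A ->
  0 <= A /\ (forall s : seq int, uniq s -> \sum_(k <- s) (hm l k * nc (a k)) ^+ 2 <= A ^+ 2).
Proof.
move=> [A0 h]; split=> // s us; apply: le_trans (h s us).
by apply: ler_sum => k _; rewrite exprMn hm_sqr.
Qed.

Lemma om_one l a A : 0 <= l -> norm_le (om l) a A -> norm_le one a A.
Proof. by move=> l0; apply: norm_le_th1 => k; exact: om_ge1. Qed.

(** The weight goes to the higher of the two frequencies, and Cauchy-Schwarz follows. In each term
    only one factor is measured in H^l and the other one in L^2. *)
Lemma hm_conv l a b A B A0 B0 k : 0 <= l ->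
  norm_le (om l) a A -> norm_le (om l) b B -> norm_le one a A0 -> norm_le one b B0 ->
  hm l k * nc (conv a b k) <= Cl l * (A * B0 + A0 * B).
Proof.
move=> l0 hA hB hA0 hB0.
have := @conv_dom _ a b A0 B0 [:: k] (hm l) (Cl l * (A * B0 + A0 * B)) hA0 hB0 (hm_ge0 l).
rewrite big_seq1; apply => m; rewrite big_seq1.
have [A'0 sA] := norm_le_hm hA; have [B'0 sB] := norm_le_hm hB.
have inj : injective (fun j : int => k - j) by move=> i j; lia.
apply: (@le_trans _ _ (Cl l * (\sum_(j <- zr m) (hm l j * nc (a j)) * nc (b (k - j))
   + \sum_(j <- zr m) nc (a j) * (hm l (k - j) * nc (b (k - j)))))).
  rewrite -big_split mulr_sumr mulr_sumr; apply: ler_sum => j _ /=.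
  rewrite (_ : _ + _ = (hm l j + hm l (k - j)) * (nc (a j) * nc (b (k - j)))); last by ring.
  by rewrite mulrA ler_wpM2r ?mulr_ge0 ?nc_ge0 // hm_split.
rewrite ler_wpM2l ?Cl_ge0 // lerD //; apply: CS => //; try by [case: hA0|case: hB0].
- exact: sA (zr_uniq m).
- exact: (norm_le1_sqr (norm_le1_inj inj hB0) (zr_uniq m)).
- exact: norm_le1_sqr hA0 (zr_uniq m).
have := sB [seq k - j | j <- zr m]; rewrite [X in X <= _]big_map; apply.
by rewrite map_inj_uniq ?zr_uniq.
Qed.

(** [hm_conv] bounds the weighted convolution uniformly in [k], and the squares of [rk / 2] have a
    sum of at most 1/2. Keeping the L^2 bounds [A0] and [B0] apart is what later makes the
    nonlinearity small in H^l as soon as the L^2 norm is small. *)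
Lemma Nl_le l a b A B A0 B0 : 0 <= l ->
  norm_le (om l) a A -> norm_le (om l) b B -> norm_le one a A0 -> norm_le one b B0 ->
  norm_le (om l) (Nl a b) (Cl l * (A * B0 + A0 * B)).
Proof.
move=> l0 hA hB hA0 hB0; set D := Cl l * _.
have D0 : 0 <= D.
  rewrite mulr_ge0 ?Cl_ge0 // addr_ge0 // mulr_ge0 //; by [case: hA|case: hB|case: hA0|case: hB0].
split=> //; have : sums_le (fun k => D ^+ 2 / 4 * (kap k ^+ 2)^-1) (D ^+ 2 / 4 * 2).
  by apply: sums_leZ sum_invkap; rewrite divr_ge0 ?sqr_ge0.
move=> h; have {}h : sums_le (fun k => D ^+ 2 / 4 * (kap k ^+ 2)^-1) (D ^+ 2).
  by apply: sums_leW h _; have := sqr_ge0 D; lra.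
apply: sums_le_le h _ => k; rewrite nc_Nl.
have -> : om l k * (`|rk k| / 2 * nc (conv a b k)) ^+ 2 =
    rk k ^+ 2 * 4^-1 * (hm l k * nc (conv a b k)) ^+ 2.
  by rewrite -hm_sqr -(real_normK (num_real (rk k))); field.
rewrite (_ : D ^+ 2 / 4 * _ = (kap k ^+ 2)^-1 * 4^-1 * D ^+ 2); last by ring.
apply: ler_pM.
- by rewrite mulr_ge0 ?sqr_ge0.
- exact: sqr_ge0.
- by rewrite ler_pM2r ?rk_sqr.
- apply: lerXn2r; rewrite ?nnegrE //; first by rewrite mulr_ge0 ?hm_ge0 ?nc_ge0.
  exact: (hm_conv k l0 hA hB hA0 hB0).
Qed.

End StaticEstimates.

Arguments Nl : simpl never.

(** * The frequency-weighted energy *)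

Section Energy.
Context {R : realType}.
Implicit Types (a b v w : int -> R[i]) (A B V X e : R) (k p q r : int).
Local Notation nc := (@normc R).
Local Notation kap := (@kap R).
Local Notation rk := (@rk R).

Definition sD e k : R := Num.sqrt (De e k).

Lemma sD_gt0 e k : 0 < sD e k. Proof. by rewrite sqrtr_gt0 De_gt0. Qed.
Lemma sD_ge0 e k : 0 <= sD e k. Proof. exact: sqrtr_ge0. Qed.
Lemma sD_sqr e k : sD e k ^+ 2 = De e k. Proof. by rewrite sqr_sqrtr // ltW // De_gt0. Qed.

Lemma sD_ge1 e k : 1 <= sD e k.
Proof.
rewrite -(ler_pXn2r (n := 2)) ?nnegrE ?sD_ge0 // sD_sqr expr1n /De lerDl.
by rewrite mulr_ge0 ?sqr_ge0 // (exprM e 2 2) sqr_ge0.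
Qed.

Lemma sD_le e k : 0 <= e -> sD e k <= 1 + e ^+ 2 * `|kap k|.
Proof.
move=> e0; have h : 0 <= e ^+ 2 * `|kap k| by rewrite mulr_ge0 ?sqr_ge0.
rewrite -(ler_pXn2r (n := 2)) ?nnegrE ?sD_ge0 ?addr_ge0 //.
have E : (e ^+ 2 * `|kap k|) ^+ 2 = e ^+ 4 * kap k ^+ 2.
  by rewrite [LHS]exprMn -exprM real_normK ?num_real.
rewrite sD_sqr /De sqrrD expr1n mul1r E.
by rewrite lerD2r lerDl mulrn_wge0.
Qed.

(** [sD e k] is the Euclidean length of the vector [(1, e^2 kap k)]; the inequality is the triangle
    inequality for these vectors, since [(1, a + b)] is not longer than [(2, a + b)]. *)
Lemma sD_triangle e p q r : p + q + r = 0 -> sD e p <= sD e q + sD e r.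
Proof.
move=> pqr; rewrite -(ler_pXn2r (n := 2)) ?nnegrE ?sD_ge0 ?addr_ge0 ?sD_ge0 //.
rewrite sqrrD !sD_sqr /De.
have -> : kap p = - (kap q + kap r) by rewrite -kapD -kapN; congr (kap _); lia.
have E0 : 0 <= e ^+ 4 by rewrite (exprM e 2 2) sqr_ge0.
have : e ^+ 4 * (kap q * kap r) <= sD e q * sD e r.
  apply: (le_trans (ler_norm _)).
  rewrite -(ler_pXn2r (n := 2)) ?nnegrE ?mulr_ge0 ?sD_ge0 //.
  rewrite real_normK ?num_real // [leRHS]exprMn !sD_sqr /De.
  move: (kap q) (kap r) (e ^+ 4) E0 => x y E E0.
  have x0 : 0 <= E * x ^+ 2 by rewrite mulr_ge0 ?sqr_ge0.
  have y0 : 0 <= E * y ^+ 2 by rewrite mulr_ge0 ?sqr_ge0.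
  rewrite (_ : (E * (x * y)) ^+ 2 = (E * x ^+ 2) * (E * y ^+ 2)); last by ring.
  by move: (E * x ^+ 2) (E * y ^+ 2) x0 y0 => s t; nra.
rewrite sqrrN sqrrD mulr2n; move: (sD e q * sD e r) (kap q) (kap r) (e ^+ 4) E0 => S x y E E0.
by rewrite mulr2n !mulrDr; nra.
Qed.

(* [te e k = kap k ^ 2 / De e k] up to lower order terms: this energy is
   comparable to the H^1 norm below the frequency [e ^ -2] and to a large
   multiple of the L^2 norm above it. *)
Definition te e k : R := (1 + kap k ^+ 2) / De e k.
Definition ph e k : R := kap k / De e k.

Lemma te_gt0 e k : 0 < te e k.
Proof. by rewrite divr_gt0 ?De_gt0 ?kap1_gt0. Qed.
Lemma te_ge0 e k : 0 <= te e k. Proof. exact: ltW (te_gt0 e k). Qed.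

Lemma te_rk e k : te e k * rk k = ph e k.
Proof.
rewrite /te /rk /ph; field.
by rewrite !gt_eqF ?De_gt0 ?kap1_gt0.
Qed.

Lemma te_ge1 e k : 0 < e <= 1 -> 1 <= te e k.
Proof.
move=> /andP[e0 e1]; rewrite ler_pdivlMr ?De_gt0 // mul1r lerD2l.
by rewrite ler_piMl ?sqr_ge0 // exprn_ile1 // ltW.
Qed.

(** Passing from L^2 to the energy norm costs [e^-2]. The right-hand side is written as a square
    times the weight 1 to fit [norm_le_th]. *)
Lemma te_le e k : 0 < e <= 1 -> te e k <= ((e ^+ 2)^-1) ^+ 2 * 1.
Proof.
move=> /andP[e0 e1]; have e4 : 0 < e ^+ 4 by exact: exprn_gt0.
rewrite mulr1 exprVn -exprM ler_pdivrMr ?De_gt0 // ler_pdivlMl // /De mulrDr mulr1 lerD2r.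
by rewrite exprn_ile1 // ltW.
Qed.

Lemma phN e k : ph e (- k) = - ph e k.
Proof. by rewrite /ph /De kapN sqrrN mulNr. Qed.

(* With [p + q + r = 0] the symbol vanishes to leading order. *)
Lemma ph_sym e p q r : p + q + r = 0 ->
  `|ph e p + ph e q + ph e r| <= 2 * (e ^+ 4) * `|kap p * kap q * kap r|
     / (sD e p * sD e q * sD e r) * ((sD e p)^-1 + (sD e q)^-1 + (sD e r)^-1).
Proof.
move=> pqr.
have E0 : 0 <= e ^+ 4 by rewrite (exprM e 2 2) sqr_ge0.
have Er : kap r = - (kap p + kap q) by rewrite -kapD -kapN; congr (kap _); lia.
(* Three lengths that satisfy the triangle inequalities: [x^2 <= x (y + z)], and cyclically. The
   left side is [3 + e^4 (kap p ^ 2 + kap q ^ 2 + kap r ^ 2)]. *)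
have T : sD e p ^+ 2 + sD e q ^+ 2 + sD e r ^+ 2 <=
    2 * (sD e p * sD e q + sD e q * sD e r + sD e p * sD e r).
  have h1 := sD_triangle e pqr.
  have h2 : sD e q <= sD e p + sD e r by apply: sD_triangle; lia.
  have h3 : sD e r <= sD e p + sD e q by apply: sD_triangle; lia.
  move: h1 h2 h3 (sD_ge0 e p) (sD_ge0 e q) (sD_ge0 e r).
  move: (sD e p) (sD e q) (sD e r) => x y z; nra.
(* Exact after eliminating [kap r]: at [e = 0] the sum is [kap p + kap q + kap r = 0], so the
   numerator carries a factor [e^4]. *)
have -> : ph e p + ph e q + ph e r = - (e ^+ 4 * (kap p * kap q * kap r) *
    (3 + e ^+ 4 * (kap p ^+ 2 + kap q ^+ 2 + kap r ^+ 2) / 2)) / (De e p * De e q * De e r).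
  have := De_gt0 e r; have := De_gt0 e q; have := De_gt0 e p.
  rewrite /ph /De Er; move: (kap p) (kap q) (e ^+ 4) => x y E hx hy hz.
  by field; rewrite !gt_eqF.
have Dp : 0 < De e p * De e q * De e r by rewrite !mulr_gt0 // De_gt0.
rewrite normrM normrN normfV (gtr0_norm Dp) normrM normrM (ger0_norm E0).
rewrite (ger0_norm (x := 3 + _)); last first.
  by rewrite addr_ge0 // divr_ge0 // mulr_ge0 // !addr_ge0 ?sqr_ge0.
set m := `|kap p * kap q * kap r|.
have T2 : 3 + e ^+ 4 * (kap p ^+ 2 + kap q ^+ 2 + kap r ^+ 2) / 2 <=
    2 * (sD e p * sD e q + sD e q * sD e r + sD e p * sD e r).
  apply: le_trans T; rewrite !sD_sqr /De.
  have : 0 <= e ^+ 4 * (kap p ^+ 2 + kap q ^+ 2 + kap r ^+ 2).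
    by rewrite mulr_ge0 // !addr_ge0 ?sqr_ge0.
  by lra.
rewrite -!sD_sqr in Dp *.
have := sD_gt0 e p; have := sD_gt0 e q; have := sD_gt0 e r.
move: T2 Dp; set S := 3 + _; move: (sD e p) (sD e q) (sD e r) => x y z hS Dp z0 y0 x0.
rewrite ler_pdivrMr //.
have -> : 2 * e ^+ 4 * m / (x * y * z) * (x^-1 + y^-1 + z^-1) * (x ^+ 2 * y ^+ 2 * z ^+ 2)
   = e ^+ 4 * m * (2 * (x * y + y * z + x * z)).
  by field; rewrite !gt_eqF.
by rewrite ler_wpM2l // mulr_ge0 // /m normr_ge0.
Qed.

Definition ind (P : bool) : R := if P then 1 else 0.

Lemma ind_ge0 P : 0 <= ind P. Proof. by case: P. Qed.

Lemma sum_ind n q a : (forall k, (n < `|k|)%N -> a k = 0) ->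
  \sum_(r <- zr n) real_complex R (ind (q + r == 0)) * a r = a (- q).
Proof.
move=> supp; have [hq|hq] := leqP `|q| n; last first.
  rewrite supp ?abszN // big1 // => r _; have [E|_] := eqVneq; last by rewrite mul0r.
  by rewrite supp ?mulr0 //; lia.
rewrite (bigD1_seq (- q)) ?mem_zr ?abszN ?zr_uniq //= subrr eqxx mul1r big1 ?addr0 //.
move=> r rq; have [E|_] := eqVneq; last by rewrite mul0r.
by move/eqP: rq; lia.
Qed.

(** The constraint enters as an indicator over a full cube of indices, so that the three frequencies
    play the same role and can be permuted by exchanging finite sums. *)
Definition S3 n (F : int -> int -> int -> R[i]) : R[i] :=
  \sum_(p <- zr n) \sum_(q <- zr n) \sum_(r <- zr n)
     real_complex R (ind (p + q + r == 0)) * F p q r.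

Lemma S3_swap12 n F : S3 n F = S3 n (fun p q r => F q p r).
Proof.
rewrite /S3 exchange_big; apply: eq_bigr => q _; apply: eq_bigr => p _.
by apply: eq_bigr => r _; rewrite (addrC p q).
Qed.

Lemma S3_swap23 n F : S3 n F = S3 n (fun p q r => F p r q).
Proof.
rewrite /S3; apply: eq_bigr => q _; rewrite exchange_big; apply: eq_bigr => p _.
by apply: eq_bigr => r _; rewrite addrAC.
Qed.

Lemma S3D n F G : S3 n (fun p q r => F p q r + G p q r) = S3 n F + S3 n G.
Proof.
rewrite /S3 -big_split; apply: eq_bigr => p _; rewrite -big_split; apply: eq_bigr => q _.
by rewrite -big_split; apply: eq_bigr => r _; rewrite /= mulrDr.
Qed.

Definition R3 n (F : int -> int -> int -> R) : R :=
  \sum_(p <- zr n) \sum_(q <- zr n) \sum_(r <- zr n) ind (p + q + r == 0) * F p q r.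

Lemma R3_swap12 n F : R3 n F = R3 n (fun p q r => F q p r).
Proof.
rewrite /R3 exchange_big; apply: eq_bigr => q _; apply: eq_bigr => p _.
by apply: eq_bigr => r _; rewrite (addrC p q).
Qed.

Lemma R3_swap23 n F : R3 n F = R3 n (fun p q r => F p r q).
Proof.
rewrite /R3; apply: eq_bigr => q _; rewrite exchange_big; apply: eq_bigr => p _.
by apply: eq_bigr => r _; rewrite addrAC.
Qed.

Lemma R3D n F G : R3 n (fun p q r => F p q r + G p q r) = R3 n F + R3 n G.
Proof.
rewrite /R3 -big_split; apply: eq_bigr => p _; rewrite -big_split; apply: eq_bigr => q _.
by rewrite -big_split; apply: eq_bigr => r _; rewrite /= mulrDr.
Qed.

Lemma S3_le n F G :
  (forall p q r, p + q + r = 0 -> nc (F p q r) <= G p q r) -> nc (S3 n F) <= R3 n G.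
Proof.
move=> h; do 3 (apply: (le_trans (nc_sum _ _)); apply: ler_sum => ? _).
rewrite normcM nc_real ger0_norm ?ind_ge0 //; have [E|_] := eqVneq; last by rewrite !mul0r.
by rewrite /ind !mul1r h.
Qed.

(** For fixed [p] the constraint determines [r] from [q], and Cauchy-Schwarz in [q] gives [X * Y];
    the l^1 bound on [z] takes care of [p]. *)
Lemma R3_CS n (x y z : int -> R) X Y Z :
  (forall k, 0 <= x k) -> (forall k, 0 <= y k) -> (forall k, 0 <= z k) ->
  0 <= X -> 0 <= Y -> sums_le (fun k => x k ^+ 2) (X ^+ 2) -> sums_le (fun k => y k ^+ 2) (Y ^+ 2) ->
  sums_le z Z -> R3 n (fun p q r => z p * (x q * y r)) <= Z * (X * Y).
Proof.
move=> x0 y0 z0 X0 Y0 hx hy hz; rewrite /R3.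
apply: (@le_trans _ _ (\sum_(p <- zr n) z p * (X * Y))); last first.
  by rewrite -mulr_suml ler_wpM2r ?mulr_ge0 // hz // zr_uniq.
apply: ler_sum => p _.
apply: (@le_trans _ _ (\sum_(q <- zr n) z p * (x q * y (- (p + q))))).
  apply: ler_sum => q _; have [hq|hq] := boolP (- (p + q) \in zr n).
    rewrite (bigD1_seq (- (p + q))) ?zr_uniq //= subrr eqxx mul1r big1 ?addr0 //.
    move=> r rq; have [E|_] := eqVneq; last by rewrite mul0r.
    by move/eqP: rq; lia.
  rewrite big_seq_cond big1 ?mulr_ge0 // => r /andP[rn _].
  have [E|_] := eqVneq; last by rewrite mul0r.
  by move: hq rn; rewrite !mem_zr; lia.
rewrite -mulr_sumr ler_wpM2l // CS // ?hx ?zr_uniq //.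
have inj : injective (fun q : int => - (p + q)) by move=> i j; lia.
by have := sums_le_inj inj hy; apply; exact: zr_uniq.
Qed.

End Energy.

(** * Cubic, mixed and linear terms of the energy balance *)

Section Dissipation.
Context {R : realType}.
Implicit Types (a b v w : int -> R[i]) (A B V X e : R) (k p q r : int).
Local Notation nc := (@normc R).
Local Notation kap := (@kap R).
Local Notation rk := (@rk R).

Lemma Re_conjM (z w : R[i]) : `|complex.Re (conjc z * w)| <= nc z * nc w.
Proof. by rewrite -(nc_conj z) -normcM nc_Re. Qed.

(** Its square is the part [kap k ^ 2 / De e k] of the energy density. *)
Definition ze e a k := `|kap k| * nc (a k) / sD e k.

Lemma ze_ge0 e a k : 0 <= ze e a k.
Proof. by rewrite divr_ge0 ?sD_ge0 // mulr_ge0 // nc_ge0. Qed.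

Lemma ze_sle e a X : norm_le (te e) a X -> sums_le (fun k => ze e a k ^+ 2) (X ^+ 2).
Proof.
move=> [_ h]; apply: sums_le_le h _ => k.
rewrite /ze expr_div_n sD_sqr exprMn real_normK ?num_real // /te [leRHS]mulrAC.
by rewrite ler_pM2r ?invr_gt0 ?De_gt0 // ler_wpM2r ?sqr_ge0 // lerDr.
Qed.

(** One more factor [1 / sD] turns the l^2 bound into an l^1 bound at the price [1 / e], by
    Cauchy-Schwarz and [sum_invDe]. This is where one power of the gain [e^4] is spent. *)
Lemma sum_ze_sD e a X : 0 < e -> norm_le (te e) a X -> sums_le (fun k => ze e a k / sD e k) (X / e).
Proof.
move=> e0 ha s us; pose t k : R := if k == 0 then 0 else (sD e k)^-1.
rewrite (eq_bigr (fun k => ze e a k * t k)); last first.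
  move=> k _; rewrite /t; case: eqP => // ->.
  by rewrite /ze kap0 normr0 !mul0r.
apply: CS; [by case: ha|by rewrite invr_ge0 ltW|exact: (ze_sle ha)|].
apply: le_trans (sum_invDe e0 us); apply: ler_sum => k _; rewrite /t.
by case: ifP => _; rewrite ?expr0n // exprVn sD_sqr.
Qed.

(** Averaging over the position of [ph] replaces it by a third of [ph e p + ph e q + ph e r], to
    which [ph_sym] applies. In each of the three resulting terms one frequency is summed in l^1 and
    the other two in l^2, so three times the sum is at most [3 * (2 e^4) (X / e) X^2]. *)
Lemma cubic_S3 n e a X : 0 < e -> norm_le (te e) a X ->
  nc (S3 n (fun p q r => real_complex R (ph e p) * (a p * a q * a r))) <= 2 * e ^+ 3 * X ^+ 3.
Proof.
move=> e0 ha; have X0 : 0 <= X by case: ha.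
set U := S3 n _.
have E2 : U = S3 n (fun p q r => real_complex R (ph e q) * (a p * a q * a r)).
  rewrite /U S3_swap12; congr (S3 n _); apply: funext => p; apply: funext => q.
  by apply: funext => r; rewrite (mulrC (a p)).
have E3 : U = S3 n (fun p q r => real_complex R (ph e r) * (a p * a q * a r)).
  rewrite E2 S3_swap23; congr (S3 n _); apply: funext => p; apply: funext => q.
  by apply: funext => r; rewrite mulrAC.
have : nc (3 * U) <= 3 * (2 * e ^+ 3 * X ^+ 3); last first.
  rewrite normcM (_ : 3 = real_complex R 3); last by rewrite rmorph_nat.
  by rewrite nc_real normr_nat ler_pM2l.
have -> : 3 * U = S3 n (fun p q r => real_complex R (ph e p + ph e q + ph e r) * (a p * a q * a r)).
  rewrite (_ : 3 * U = U + U + U); last by ring.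
  rewrite {2}E2 {2}E3 -!S3D; congr (S3 n _); apply: funext => p; apply: funext => q.
  by apply: funext => r; rewrite -!mulrDl -!rmorphD.
pose y p := 2 * e ^+ 4 * (ze e a p / sD e p).
pose z := ze e a.
have y0 p : 0 <= y p.
  apply: mulr_ge0; first by rewrite mulr_ge0 // exprn_ge0 // ltW.
  by apply: divr_ge0; [exact: ze_ge0|exact: sD_ge0].
apply: (@le_trans _ _ (R3 n (fun p q r => y p * (z q * z r) + y q * (z p * z r) + y r * (z p * z q)))).
  apply: S3_le => p q r pqr; rewrite normcM nc_real !normcM.
  apply: le_trans (_ : _ <= (2 * (e ^+ 4) * `|kap p * kap q * kap r|
     / (sD e p * sD e q * sD e r) * ((sD e p)^-1 + (sD e q)^-1 + (sD e r)^-1)) *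
     (nc (a p) * nc (a q) * nc (a r))) _.
    by rewrite ler_wpM2r ?mulr_ge0 ?nc_ge0 // ph_sym.
  rewrite le_eqVlt; apply/orP; left; apply/eqP.
  rewrite /y /z /ze !normrM; field.
  by rewrite !gt_eqF ?sD_gt0.
have bd : R3 n (fun p q r => y p * (z q * z r)) <= (2 * e ^+ 4 * (X / e)) * (X * X).
  apply: R3_CS => //; try exact: ze_ge0; try exact: ze_sle.
  apply: sums_leZ (sum_ze_sD e0 ha); rewrite mulr_ge0 // exprn_ge0 // ltW //.
rewrite !R3D.
have -> : R3 n (fun p q r => y q * (z p * z r)) = R3 n (fun p q r => y p * (z q * z r)).
  by rewrite R3_swap12.
have -> : R3 n (fun p q r => y r * (z p * z q)) = R3 n (fun p q r => y p * (z q * z r)).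
  by rewrite R3_swap23 R3_swap12.
have -> : 3 * (2 * e ^+ 3 * X ^+ 3) = (2 * e ^+ 4 * (X / e)) * (X * X) * 3.
  by field; rewrite gt_eqF.
by lra.
Qed.

(** By the reflection [k -> -k] and the conjugate symmetry of the coefficients the pairing is the
    real part of [i / 2] times the sum of [cubic_S3]. The truncation keeps all sums finite, so that
    the symmetrization is legitimate. *)
Lemma cubic_trunc n e w X : 0 < e -> is_real w -> norm_le (te e) w X ->
  `|\sum_(k <- zr n) te e k * complex.Re (conjc (trunc n w k) * Nl (trunc n w) (trunc n w) k)|
    <= e ^+ 3 * X ^+ 3.
Proof.
move=> e0 rw hw; set a := trunc n w.
have ra : is_real a by exact: trunc_real.
have ha : norm_le (te e) a X by apply: norm_le_sub hw => k; [exact: te_ge0|exact: trunc_le].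
have supp k : (n < `|k|)%N -> a k = 0 by move=> h; rewrite /a /trunc leqNgt h.
have -> : \sum_(k <- zr n) te e k * complex.Re (conjc (a k) * Nl a a k) =
  complex.Re (Complex 0 (2^-1) * S3 n (fun p q r => real_complex R (ph e p) * (a p * a q * a r))).
  rewrite -sum_zrN /S3 mulr_sumr Re_sum; apply: eq_bigr => p _.
  rewrite /Nl conv_trunc -/a.
  have -> : \sum_(q <- zr n) \sum_(r <- zr n) real_complex R (ind (p + q + r == 0)) *
      (real_complex R (ph e p) * (a p * a q * a r)) =
     real_complex R (ph e p) * (a p * \sum_(q <- zr n) a q * a (- p - q)).
    rewrite !mulr_sumr; apply: eq_bigr => q _.
    rewrite -opprD -(sum_ind _ supp) !mulr_sumr; apply: eq_bigr => r _; ring.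
  have -> : ph e p = - (te e (- p) * rk (- p)) by rewrite te_rk phN opprK.
  rewrite ra conjcK; move: (\sum_(q <- _) _) (a p) (te e (- p)) (rk (- p)).
  by move=> [s1 s2] [a1 a2] t f /=; field.
apply: le_trans (nc_Re _) _; rewrite normcM nc_imag ger0_norm //.
by rewrite mulrC ler_pdivrMr // (le_trans (cubic_S3 n e0 ha)) // le_eqVlt; apply/orP; left; apply/eqP; ring.
Qed.

Lemma ph_sqr e k : 0 < e -> k != 0 -> ph e k ^+ 2 <= (e^-1) ^+ 4 * (De e k)^-1.
Proof.
move=> e0 k0; have e4 : 0 < e ^+ 4 by exact: exprn_gt0.
have -> : e^-1 ^+ 4 * (De e k)^-1 = 1 / (e ^+ 4 * De e k).
  by field; rewrite !gt_eqF ?De_gt0.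
rewrite /ph expr_div_n ler_pdivlMr; last by rewrite mulr_gt0 // De_gt0.
rewrite mulrAC ler_pdivrMr ?exprn_gt0 ?De_gt0 // mul1r.
rewrite (_ : kap k ^+ 2 * (e ^+ 4 * De e k) = (e ^+ 4 * kap k ^+ 2) * De e k); last by ring.
by rewrite expr2 ler_pM2r ?De_gt0 // /De lerDr.
Qed.

(** Bounds the error of truncation. The bad power of [e] is harmless, because the sum is multiplied
    by a tail that becomes arbitrarily small for fixed [e]. *)
Lemma sum_ph e w X : 0 < e -> norm_le one w X -> sums_le (fun k => `|ph e k| * nc (w k)) (X / e ^+ 3).
Proof.
move=> e0 hw s us; rewrite mulrC; apply: CS.
- by rewrite invr_ge0 exprn_ge0 // ltW.
- by case: hw.
- have := sums_leZ (c := (e^-1) ^+ 4) _ (sum_invDe e0) => /(_ _ s us) h.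
  apply: (@le_trans _ _ (e^-1 ^+ 4 * e^-1 ^+ 2)); last first.
    by rewrite -exprD -exprVn -exprM.
  apply: le_trans (h _); last by rewrite exprn_ge0 // invr_ge0 ltW.
  apply: ler_sum => k _; rewrite real_normK ?num_real //; case: eqP => [->|/eqP k0].
    by rewrite /ph kap0 mul0r expr0n mulr0.
  exact: ph_sqr.
- exact: norm_le1_sqr hw us.
Qed.

(** Removes the truncation from [cubic_trunc]: replacing [w] by its truncation changes each
    coefficient of the nonlinearity by at most [|rk|] times [X] times the l^2 size of the tail, and
    [sum_ph] sums these errors. *)
Lemma cubic_est e w X eta : 0 < e <= 1 -> is_real w -> norm_le (te e) w X -> 0 < eta ->
  exists n0, forall n, (n0 <= n)%N ->
    \sum_(k <- zr n) te e k * complex.Re (conjc (w k) * Nl w w k) <= e ^+ 3 * X ^+ 3 + eta.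
Proof.
move=> e01 rw hw eta0; have /andP[e0 _] := e01.
have h1 : norm_le one w X by apply: norm_le_th1 hw => k; exact: te_ge1.
have X0 : 0 <= X by case: hw.
(* Chosen so that the total error [(X / e^3) * (X * tau)] is below [eta], also for [X = 0]. *)
pose tau := eta * e ^+ 3 / (X ^+ 2 + 1).
have X21 : 0 < X ^+ 2 + 1 by rewrite ltr_wpDl ?sqr_ge0.
have tau0 : 0 < tau by rewrite divr_gt0 // mulr_gt0 // exprn_gt0.
have [n0 hn0] := trunc_tail (fun=> ler01) h1 tau0.
exists n0 => n /hn0; set a := trunc n w => hd.
have ha : norm_le one a X by apply: norm_le_sub h1 => // k; exact: trunc_le.
have hdif k : nc (Nl w w k - Nl a a k) <= `|rk k| * (X * tau).
  rewrite /Nl -mulrBr.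
  have -> : conv w w k - conv a a k = conv (fun j => w j - a j) w k + conv a (fun j => w j - a j) k.
    have -> : conv w w k = conv (fun j => (w j - a j) + a j) w k.
      by congr (conv _ _ k); apply: funext => j; rewrite subrK.
    rewrite (convDl k hd ha h1).
    have -> : conv a w k = conv a (fun j => (w j - a j) + a j) k.
      by congr (conv _ _ k); apply: funext => j; rewrite subrK.
    by rewrite (convDr k ha hd ha) addrA addrK.
  rewrite normcM nc_imag normrN normrM (@ger0_norm _ (2^-1)) //.
  rewrite -mulrA ler_wpM2l // [leLHS]mulrC ler_pdivrMr //.
 rewrite (le_trans (ncD _ _)) //.
  have := conv_le k hd h1; have := conv_le k ha hd; lra.
have hsum : \sum_(k <- zr n) te e k * nc (w k) * (`|rk k| * (X * tau)) <= eta.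
  apply: (@le_trans _ _ (X / e ^+ 3 * (X * tau))).
    have := sum_ph e0 h1 (zr_uniq n).
    have Xt : 0 <= X * tau by rewrite mulr_ge0 // ltW.
    move=> /(ler_wpM2r Xt); apply: le_trans; rewrite mulr_suml; apply: ler_sum => k _.
    rewrite le_eqVlt; apply/orP; left; apply/eqP.
    rewrite -te_rk (normrM (te e k)) (ger0_norm (te_ge0 _ _)); ring.
  have -> : X / e ^+ 3 * (X * tau) = eta * (X ^+ 2 / (X ^+ 2 + 1)).
    by rewrite /tau; field; rewrite !gt_eqF.
  by apply: ler_piMr; [exact: ltW|rewrite ler_pdivrMr // mul1r lerDl].
have := cubic_trunc n e0 rw hw; rewrite -/a => /ler_normlP[_ hT].
apply: (le_trans _ (lerD hT hsum)); rewrite -big_split; rewrite big_seq [leRHS]big_seq.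
apply: ler_sum => k; rewrite mem_zr => kn /=.
have ak : a k = w k by rewrite /a /trunc kn.
rewrite ak -mulrA -mulrDr ler_wpM2l ?te_ge0 // -lerBlDl -ReB -mulrBr.
apply: (le_trans (ler_norm _)); apply: (le_trans (Re_conjM _ _)).
by rewrite ler_wpM2l ?nc_ge0 // hdif.
Qed.

(** There is no cancellation in the mixed term; smallness will come from [V]. Since
    [sD <= 1 + e^2 |kap|], the modulus of [w j] is at most [z j / |kap j| + e^2 z j]. The first part
    is summable in l^1, and in the second one the factor [e^2] pays for the l^1 sum over [k]. *)
Lemma quad_est e v w X V n : 0 < e <= 1 -> w 0 = 0 -> norm_le (te e) w X -> norm_le one v V ->
  \sum_(k <- zr n) te e k * (nc (w k) * nc (Nl w v k)) <= 3 / 2 * V * X ^+ 2.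
Proof.
move=> /[dup] e01 /andP[e0 e1] w0 hw hv.
have h1 : norm_le one w X by apply: norm_le_th1 hw => k; exact: te_ge1.
have X0 : 0 <= X by case: hw. have V0 : 0 <= V by case: hv.
pose z := ze e w; pose x k := z k / sD e k / 2; pose u j := z j / `|kap j|.
have z0 k : 0 <= z k by exact: ze_ge0.
have x0 k : 0 <= x k by exact: divr_ge0 (divr_ge0 (z0 k) (sD_ge0 e k)) (ler0n R 2).
have u0 k : 0 <= u k by rewrite divr_ge0.
have zs : sums_le (fun k => z k ^+ 2) (X ^+ 2) by exact: ze_sle.
rewrite (eq_bigr (fun k => x k * nc (conv w v k))); last first.
  move=> k _; rewrite nc_Nl /x /z /ze.
  rewrite (_ : te e k * _ = (te e k * `|rk k|) * (nc (w k) * nc (conv w v k) / 2)); last by ring.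
  rewrite -(ger0_norm (te_ge0 e k)) -normrM te_rk /ph normrM normfV (gtr0_norm (De_gt0 e k)) -sD_sqr.
  by field; rewrite gt_eqF // sD_gt0.
apply: (conv_dom h1 hv x0) => m.
have inj k : injective (fun j : int => k - j) by move=> i j; lia.
have inj' k : injective (fun j : int => j - k) by move=> i j; lia.
(* [3 / 2] stands for the square root of the bound 2 in [sum_invkap]. *)
have hu : \sum_(j <- zr m) u j <= X * (3 / 2).
  apply: CS => //; first exact: zs (zr_uniq m).
  apply: (@le_trans _ _ 2); last by lra.
  apply: le_trans (sum_invkap (zr_uniq m)); apply: ler_sum => k _.
  by rewrite exprVn real_normK ?num_real.
have hx : \sum_(k <- zr n) x k <= X / e / 2.
  rewrite -mulr_suml ler_pM2r //; exact: (sum_ze_sD e0 hw (zr_uniq n)).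
have xs : \sum_(k <- zr n) x k ^+ 2 <= (X / 2) ^+ 2.
  rewrite [leRHS]exprMn; apply: (@le_trans _ _ (\sum_(k <- zr n) z k ^+ 2 * (2^-1) ^+ 2)); last first.
    by rewrite -mulr_suml ler_wpM2r ?sqr_ge0 // zs // zr_uniq.
  apply: ler_sum => k _; rewrite exprMn ler_wpM2r ?sqr_ge0 //.
  apply: lerXn2r; rewrite ?nnegrE //; first exact: divr_ge0 (z0 k) (sD_ge0 e k).
  by rewrite ler_pdivrMr ?sD_gt0 // ler_peMr // sD_ge1.
apply: (@le_trans _ _ (\sum_(k <- zr n) \sum_(j <- zr m) (u j * (x k * nc (v (k - j)))
    + e ^+ 2 * (x k * (z j * nc (v (k - j))))))).
  apply: ler_sum => k _; rewrite mulr_sumr; apply: ler_sum => j _.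
  rewrite (_ : _ + _ = x k * ((u j + e ^+ 2 * z j) * nc (v (k - j)))); last by ring.
  rewrite ler_wpM2l // ler_wpM2r ?nc_ge0 //.
  have [->|j0] := eqVneq j 0.
    by rewrite w0 nc0 addr_ge0 // mulr_ge0 // sqr_ge0.
  have kj : 0 < `|kap j| by rewrite (lt_le_trans _ (kap_ge4 j0)).
  rewrite /u /z /ze (_ : _ + _ = nc (w j) * ((1 + e ^+ 2 * `|kap j|) / sD e j)); last first.
    by field; rewrite !gt_eqF ?sD_gt0.
  by rewrite ler_peMr ?nc_ge0 // ler_pdivlMr ?sD_gt0 // mul1r sD_le // ltW.
under eq_bigr do rewrite big_split; rewrite big_split /=.
have B1 : \sum_(k <- zr n) \sum_(j <- zr m) u j * (x k * nc (v (k - j))) <= X * (3 / 2) * (X / 2 * V).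
  rewrite exchange_big /=; apply: (@le_trans _ _ (\sum_(j <- zr m) u j * (X / 2 * V))).
    apply: ler_sum => j _; rewrite -mulr_sumr ler_wpM2l // CS ?divr_ge0 //.
    exact: (norm_le1_sqr (norm_le1_inj (inj' j) hv) (zr_uniq n)).
  by rewrite -mulr_suml ler_wpM2r ?mulr_ge0.
have B2 : \sum_(k <- zr n) \sum_(j <- zr m) e ^+ 2 * (x k * (z j * nc (v (k - j))))
    <= e ^+ 2 * (X / e / 2 * (X * V)).
  apply: (@le_trans _ _ (\sum_(k <- zr n) e ^+ 2 * (x k * (X * V)))).
    apply: ler_sum => k _; rewrite -!mulr_sumr ler_wpM2l ?sqr_ge0 // ler_wpM2l //.
    apply: CS => //; first exact: zs (zr_uniq m).
    exact: (norm_le1_sqr (norm_le1_inj (inj k) hv) (zr_uniq m)).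
  by rewrite -mulr_sumr ler_wpM2l ?sqr_ge0 // -mulr_suml ler_wpM2r ?mulr_ge0.
have E : e ^+ 2 * (X / e / 2 * (X * V)) = e * (X ^+ 2 * V) / 2 by field; rewrite gt_eqF.
have XV := mulr_ge0 (sqr_ge0 X) V0.
by have := ler_wpM2r XV e1; move: B1 B2; rewrite E; lra.
Qed.

(** Expands the square of one explicit Euler step. The bound on the pairing is required only on
    large windows and up to a slack [eta], which is the form that [cubic_est] provides; any window
    can be enlarged, because the summands are nonnegative. *)
Lemma step_energy (th : int -> R) w (G : int -> R[i]) X Y c h D :
  (forall k, 0 <= th k) -> 0 <= h -> 2 * c * h <= 1 -> norm_le th w X -> norm_le th G Y ->
  (forall eta, 0 < eta -> exists n0, forall n, (n0 <= n)%N ->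
    \sum_(k <- zr n) th k * complex.Re (conjc (w k) * G k)
      <= - c * (\sum_(k <- zr n) th k * nc (w k) ^+ 2) + D + eta) ->
  sums_le (fun k => th k * nc (w k + real_complex R h * G k) ^+ 2)
    ((1 - 2 * c * h) * X ^+ 2 + 2 * h * D + h ^+ 2 * Y ^+ 2).
Proof.
move=> th0 h0 ch [X0 hw] [Y0 hG] hD; set B := _ + _ + _.
have F0 k : 0 <= th k * nc (w k + real_complex R h * G k) ^+ 2 by rewrite mulr_ge0 ?sqr_ge0.
apply: sums_le_zr => // n; apply/ler_addgt0Pr => d d0.
(* The slack enters with the factor [2 * h], which may vanish; [2 * h + 1] does not. *)
have dh : 0 < d / (2 * h + 1) by apply: divr_gt0 => //; rewrite ltr_wpDl // mulr_ge0.
have [n0 hn0] := hD _ dh.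
have := hn0 (maxn n n0) (leq_maxr _ _); set m := maxn n n0 => hm.
apply: (@le_trans _ _ (\sum_(k <- zr m) th k * nc (w k + real_complex R h * G k) ^+ 2)).
  apply: sum_uniq_sub; rewrite ?zr_uniq // => k; rewrite !mem_zr => /leq_trans; apply.
  exact: leq_maxl.
rewrite (eq_bigr (fun k => th k * nc (w k) ^+ 2 + 2 * h * (th k * complex.Re (conjc (w k) * G k))
   + h ^+ 2 * (th k * nc (G k) ^+ 2))); last first.
  by move=> k _; rewrite !nc_sqr; case: (w k) (G k) => [x1 x2] [y1 y2] /=; ring.
rewrite !big_split /= -!mulr_sumr.
have := hw _ (zr_uniq m); have := hG _ (zr_uniq m).
move: hm; set Sw := \sum_(k <- zr m) th k * nc (w k) ^+ 2; set T := \sum_(k <- zr m) th k * complex.Re _.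
set SG := \sum_(k <- zr m) th k * nc (G k) ^+ 2 => hT hSG hSw.
have h21 : 0 < 2 * h + 1 by rewrite ltr_wpDl // mulr_ge0.
have : 2 * h * T <= 2 * h * (- c * Sw + D + d / (2 * h + 1)) by rewrite ler_wpM2l // mulr_ge0.
have : 2 * h * (d / (2 * h + 1)) <= d.
  by rewrite mulrCA ler_piMr ?ltW // ltr_pdivrMr // mul1r ltrDl.
have : h ^+ 2 * SG <= h ^+ 2 * Y ^+ 2 by rewrite ler_wpM2l // sqr_ge0.
have : (1 - 2 * c * h) * Sw <= (1 - 2 * c * h) * X ^+ 2 by rewrite ler_wpM2l // subr_ge0.
rewrite /B; lra.
Qed.

Variables (lam : int -> R[i]) (c : R).
Hypothesis lam_neg : forall k, k != 0 -> complex.Re (lam k) <= - c.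

(** The right-hand side of the equation for [w = u - v], where [N(u, u) - N(v, v)] has been expanded
    by bilinearity. *)
Definition Gf v w k := lam k * w k + (Nl w w k + (Nl v w k + Nl w v k)).

Lemma lam_sum (th : int -> R) w (N : int -> R[i]) n :
  (forall k, 0 <= th k) -> w 0 = 0 ->
  \sum_(k <- zr n) th k * complex.Re (conjc (w k) * (lam k * w k + N k)) <=
  - c * (\sum_(k <- zr n) th k * nc (w k) ^+ 2) +
  \sum_(k <- zr n) th k * complex.Re (conjc (w k) * N k).
Proof.
move=> th0 w0; rewrite mulr_sumr -big_split; apply: ler_sum => k _ /=.
rewrite mulrCA -mulrDr ler_wpM2l // nc_sqr.
have [->|/lam_neg] := eqVneq k 0.
  by rewrite w0 conjc0 !mul0r /= expr0n /= !(addr0, mulr0).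
case: (w k) (lam k) (N k) => [x1 x2] [l1 l2] [y1 y2] /= hl.
have := sqr_ge0 x1; have := sqr_ge0 x2; nra.
Qed.

(** The two mixed terms coincide by symmetry of the convolution, hence [3 V], twice the [3 / 2] of
    [quad_est]. *)
Lemma dissip_te e v w X V : 0 < e <= 1 -> is_real w -> w 0 = 0 ->
  norm_le (te e) w X -> norm_le one v V -> forall eta, 0 < eta -> exists n0, forall n, (n0 <= n)%N ->
  \sum_(k <- zr n) te e k * complex.Re (conjc (w k) * Gf v w k) <=
    - c * (\sum_(k <- zr n) te e k * nc (w k) ^+ 2) + (e ^+ 3 * X + 3 * V) * X ^+ 2 + eta.
Proof.
move=> e01 rw w0 hw hv eta eta0.
have [n0 hn0] := cubic_est e01 rw hw eta0; exists n0 => n /hn0 h3.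
apply: (le_trans (lam_sum _ _ (te_ge0 e) w0)); rewrite -addrA lerD2l.
have hq := quad_est n e01 w0 hw hv.
have h1 : norm_le one w X by apply: norm_le_th1 hw => k; exact: te_ge1.
apply: (@le_trans _ _ (\sum_(k <- zr n) te e k * complex.Re (conjc (w k) * Nl w w k) +
   2 * \sum_(k <- zr n) te e k * (nc (w k) * nc (Nl w v k)))); last by move: h3 hq; lra.
rewrite mulr_sumr -big_split; apply: ler_sum => k _; cbn beta.
have ReD (x y : R[i]) : complex.Re (x + y) = complex.Re x + complex.Re y.
  by case: x y => [? ?] [? ?].
rewrite !mulrDr !ReD mulrDr lerD2l [leRHS]mulrCA ler_wpM2l ?te_ge0 //.
have -> : Nl v w k = Nl w v k by rewrite /Nl (conv_sym k hv h1).
by have /ler_normlP[_] := Re_conjM (w k) (Nl w v k); lra.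
Qed.

(** A direct bound on the nonlinearity, without cancellation: the part quadratic in [w] costs only
    its L^2 size [X0], which is small once the L^2 norm has decayed. *)
Lemma dissip_om l v w X X0 V : 0 <= l -> w 0 = 0 -> X0 <= X ->
  norm_le (om l) w X -> norm_le one w X0 -> norm_le (om l) v V ->
  forall eta, 0 < eta -> exists n0, forall n, (n0 <= n)%N ->
  \sum_(k <- zr n) om l k * complex.Re (conjc (w k) * Gf v w k) <=
    - c * (\sum_(k <- zr n) om l k * nc (w k) ^+ 2)
     + Cl l * (2 * X0 + 4 * V) * X ^+ 2 + eta.
Proof.
move=> l0 w0 X0X hw hw0 hv eta eta0; exists 0%N => n _.
apply: (le_trans (lam_sum _ _ (om_ge0 l) w0)); rewrite -addrA lerD2l.
have hv0 := om_one l0 hv.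
have N1 := Nl_le l0 hw hw hw0 hw0; have N2 := Nl_le l0 hv hw hv0 hw0.
have N3 := Nl_le l0 hw hv hw0 hv0.
have := norm_leD (om_ge0 l) N1 (norm_leD (om_ge0 l) N2 N3).
have X00 : 0 <= X0 by case: hw0. have V0 : 0 <= V by case: hv.
set N := (fun k => _); set Y := _ + (_ + _) => hN.
apply: (@le_trans _ _ (X * Y)); last first.
  have : Y <= Cl l * (2 * X0 + 4 * V) * X.
    have := ler_wpM2l (Cl_ge0 l) (ler_wpM2l V0 X0X); rewrite /Y; lra.
  have Xp : 0 <= X by case: hw.
  by move=> /(ler_wpM2l Xp); rewrite expr2; lra.
have [Xp sw] := norm_le_hm hw; have [Yp sN] := norm_le_hm hN.
apply: le_trans (CS Xp Yp (sw _ (zr_uniq n)) (sN _ (zr_uniq n))).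
apply: ler_sum => k _; rewrite -hm_sqr.
rewrite (_ : hm l k * nc (w k) * _ = hm l k ^+ 2 * (nc (w k) * nc (N k))); last by ring.
rewrite ler_wpM2l ?sqr_ge0 //.
by have /ler_normlP[_] := Re_conjM (w k) (N k).
Qed.

End Dissipation.

(** * Fourier series of functions and distributions *)

Section TrigCompleteness.
Context {R : realType}.
Implicit Types (g q h : R -> R) (k j : int) (x : R).
Local Notation kap := (@kap R).
Local Notation mu := (@lebesgue_measure R).
Local Notation I01 := (`[0, 1]%classic : set R).

Definition cs k x := cos (kap k * x).
Definition sn k x := sin (kap k * x).

Lemma measurable_cs k : measurable_fun setT (cs k).
Proof.
apply: continuous_measurable_fun => x; apply: continuous_comp; last exact: continuous_cos.
by apply: continuousM; [exact: cst_continuous|exact: cvg_id].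
Qed.
Lemma measurable_sn k : measurable_fun setT (sn k).
Proof.
apply: continuous_measurable_fun => x; apply: continuous_comp; last exact: continuous_sin.
by apply: continuousM; [exact: cst_continuous|exact: cvg_id].
Qed.

Lemma cs_bound k x : `|cs k x| <= 1.
Proof. by rewrite ler_norml cos_geN1 cos_le1. Qed.
Lemma sn_bound k x : `|sn k x| <= 1.
Proof. by rewrite ler_norml sin_geN1 sin_le1. Qed.

Lemma csN k x : cs (- k) x = cs k x.
Proof. by rewrite /cs kapN mulNr cosN. Qed.
Lemma snN k x : sn (- k) x = - sn k x.
Proof. by rewrite /sn kapN mulNr sinN. Qed.
Lemma csD k j x : cs (k + j) x = cs k x * cs j x - sn k x * sn j x.
Proof. by rewrite /cs kapD mulrDl cosD. Qed.
Lemma snD k j x : sn (k + j) x = sn k x * cs j x + cs k x * sn j x.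
Proof. by rewrite /sn kapD mulrDl sinD. Qed.

Definition integ (D : set R) g := mu.-integrable D (EFin \o g).
Definition mb h := measurable_fun setT h /\ exists B, forall x, `|h x| <= B.

Lemma mb_cs k : mb (cs k).
Proof. by split; [exact: measurable_cs|exists 1; exact: cs_bound]. Qed.
Lemma mb_sn k : mb (sn k).
Proof. by split; [exact: measurable_sn|exists 1; exact: sn_bound]. Qed.
Lemma mb_cst c : mb (cst c).
Proof. by split; [exact: measurable_cst|exists `|c|]. Qed.
Lemma mbD h q : mb h -> mb q -> mb (fun x => h x + q x).
Proof.
move=> [mh [B hB]] [mq [C hC]]; split; first exact: measurable_funD.
by exists (B + C) => x; rewrite (le_trans (ler_normD _ _)) // lerD.
Qed.
Lemma mbM h q : mb h -> mb q -> mb (fun x => h x * q x).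
Proof.
move=> [mh [B hB]] [mq [C hC]]; split; first exact: measurable_funM.
by exists (B * C) => x; rewrite normrM ler_pM.
Qed.

Lemma integ_mulb D g h : measurable D -> integ D g -> mb h -> integ D (fun x => h x * g x).
Proof.
move=> mD ig [mh [B hB]].
have bh : [bounded h x | x in D].
  exists B; split; first by exact: num_real.
  by move=> M BM x _; exact: le_trans (hB x) (ltW BM).
rewrite /integ (_ : EFin \o _ = ((EFin \o h) \* (EFin \o g))%E).
  exact: (@integrableMr _ _ _ mu D mD h _ (measurable_funTS mh) bh ig).
by apply: funext => x /=; rewrite EFinM.
Qed.

Lemma integD D g h : measurable D -> integ D g -> integ D h -> integ D (fun x => g x + h x).
Proof.
move=> mD ig ih; rewrite /integ (_ : EFin \o _ = ((EFin \o g) \+ (EFin \o h))%E).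
  exact: (@integrableD _ _ _ mu D mD _ _ ig ih).
by apply: funext => x /=; rewrite EFinD.
Qed.

Lemma integZ D g c : measurable D -> integ D g -> integ D (fun x => c * g x).
Proof. by move=> mD ig; exact: integ_mulb ig (mb_cst c). Qed.

Lemma integ_mb D h : measurable D -> (mu D < +oo)%E -> mb h -> integ D h.
Proof.
move=> mD D1 [mh [B hB]]; apply: measurable_bounded_integrable => //; first exact: measurable_funTS.
by exists B; split=> [|M BM x _]; [exact: num_real|exact: le_trans (hB x) (ltW BM)].
Qed.

Lemma integS D E f : measurable D -> measurable E -> E `<=` D -> integ D f -> integ E f.
Proof. by move=> mD mE ED; apply: integrableS. Qed.

Lemma integ_meas D f : integ D f -> measurable_fun D f.
Proof. by move=> /measurable_int /measurable_EFinP. Qed.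

Lemma integ_norm D f : integ D f -> integ D (fun x => `|f x|).
Proof. by move=> /integrable_norm. Qed.

Lemma mu_itv_lt (a b : R) : (mu `[a, b]%classic < +oo)%E.
Proof. by rewrite lebesgue_measure_itv /=; case: ifP => _; rewrite ?ltry. Qed.

Lemma RintZ D c f : measurable D -> integ D f ->
  \int[mu]_(x in D) (c * f x) = c * \int[mu]_(x in D) f x.
Proof. by move=> mD hf; exact: RintegralZl. Qed.

Lemma RintD D f h : measurable D -> integ D f -> integ D h ->
  \int[mu]_(x in D) (f x + h x) = \int[mu]_(x in D) f x + \int[mu]_(x in D) h x.
Proof. by move=> mD hf hh; exact: RintegralD. Qed.

Lemma Rint_le D f h : measurable D -> integ D f -> integ D h ->
  (forall x, D x -> f x <= h x) -> \int[mu]_(x in D) f x <= \int[mu]_(x in D) h x.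
Proof. by move=> mD hf hh fh; exact: (@le_Rintegral _ _ _ mu D f h mD hf hh fh). Qed.

Lemma Rint_norm D f : measurable D -> integ D f ->
  `|\int[mu]_(x in D) f x| <= \int[mu]_(x in D) `|f x|.
Proof. by move=> mD hf; exact: le_normr_Rintegral. Qed.

Lemma Rint_eq D f h : (forall x, D x -> f x = h x) ->
  \int[mu]_(x in D) f x = \int[mu]_(x in D) h x.
Proof. by move=> e; apply: eq_Rintegral => x; rewrite inE => /e. Qed.

Lemma Rint_cst a b c : a <= b -> \int[mu]_(x in `[a, b]) c = c * (b - a).
Proof.
move=> ab; have h := @Rintegral_cst _ _ _ mu `[a, b]%classic (measurable_itv _) c.
have E : mu `[a, b]%classic = (b - a)%:E.
  rewrite lebesgue_measure_itv /= lte_fin.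
  case: ltP => // ba; have -> : a = b by apply/eqP; rewrite eq_le ab ba.
  by rewrite subrr.
by rewrite h; congr (_ * _); rewrite [X in fine X]E.
Qed.

Lemma ae_mono (P Q : R -> Prop) : (forall x, P x -> Q x) ->
  {ae mu, forall x, P x} -> {ae mu, forall x, Q x}.
Proof. by move=> h; apply: negligibleS => x /= nq /h. Qed.

Lemma ae_and (P Q : R -> Prop) : {ae mu, forall x, P x} -> {ae mu, forall x, Q x} ->
  {ae mu, forall x, P x /\ Q x}.
Proof.
move=> hP hQ; apply: (negligibleS _ (negligibleU hP hQ)) => x /= /not_andP.
by move=> [] ?; [left|right].
Qed.

Lemma dom_cvg D (f_ : nat -> R -> R) (f G : R -> R) : measurable D ->
  (forall n, integ D (f_ n)) -> measurable_fun D f ->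
  {ae mu, forall x, D x -> (fun n => f_ n x) @ \oo --> f x} -> integ D G ->
  (forall x n, D x -> `|f_ n x| <= G x) ->
  integ D f /\ (fun n => \int[mu]_(x in D) f_ n x) @ \oo --> \int[mu]_(x in D) f x.
Proof.
move=> mD if_ mf fcv iG fG.
have cv : {ae mu, forall x, D x -> (fun n => (f_ n x)%:E) @ \oo --> (f x)%:E}.
  apply: ae_mono fcv => x h Dx; apply: cvg_EFin; first exact: nearW.
  exact: h.
have dm : {ae mu, forall x n, D x -> (`|(f_ n x)%:E| <= (G x)%:E)%E}.
  by apply: aeW => x n Dx; rewrite abse_EFin lee_fin fG.
have mf' : measurable_fun D (EFin \o f) by exact/measurable_EFinP.
have [ifi _ h] := @dominated_convergence _ _ _ mu D mD (fun n x => (f_ n x)%:E)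
   (fun x => (f x)%:E) (fun x => (G x)%:E) (fun n => measurable_int mu (if_ n)) mf' cv iG dm.
split=> //; apply: (fine_cvg); rewrite fineK //; exact: integrable_fin_num.
Qed.

Lemma ae_eq_Rint D (f h : R -> R) : measurable D -> measurable_fun D f -> measurable_fun D h ->
  {ae mu, forall x, D x -> f x = h x} -> \int[mu]_(x in D) f x = \int[mu]_(x in D) h x.
Proof.
move=> mD mf mh fh; congr fine; apply: ae_eq_integral => //; try exact/measurable_EFinP.
by apply: ae_mono fh => x e Dx /=; rewrite e.
Qed.

Variable g : R -> R.
Hypothesis ig : integ I01 g.
Hypothesis gcs : forall k, \int[mu]_(x in I01) (cs k x * g x) = 0.
Hypothesis gsn : forall k, \int[mu]_(x in I01) (sn k x * g x) = 0.

(** A class of factors that the addition formulas make stable under multiplication by [cs j] and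
    [sn j]. The hypotheses on [g] say that it contains the constant 1. *)
Definition orth q := mb q /\
  forall k, \int[mu]_(x in I01) (cs k x * (q x * g x)) = 0 /\
            \int[mu]_(x in I01) (sn k x * (q x * g x)) = 0.

Let mI : measurable I01. Proof. exact: measurable_itv. Qed.

Lemma orthD a b q h : orth q -> orth h -> orth (fun x => a * q x + b * h x).
Proof.
move=> [mq hq] [mh hh]; split; first by apply: mbD; apply: mbM => //; exact: mb_cst.
have iq := integ_mulb mI ig mq; have ih := integ_mulb mI ig mh.
move=> k; have [q1 q2] := hq k; have [h1 h2] := hh k.
split.
  rewrite (eq_Rintegral mu (g := fun x => a * (cs k x * (q x * g x)) + b * (cs k x * (h x * g x)))).
    have i1 := integ_mulb mI iq (mb_cs k); have i2 := integ_mulb mI ih (mb_cs k).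
    rewrite RintegralD //; [|exact: integZ|exact: integZ].
    by rewrite !RintegralZl // q1 h1 !mulr0 addr0.
  by move=> x _; ring.
rewrite (eq_Rintegral mu (g := fun x => a * (sn k x * (q x * g x)) + b * (sn k x * (h x * g x)))).
  have i1 := integ_mulb mI iq (mb_sn k); have i2 := integ_mulb mI ih (mb_sn k).
  rewrite RintegralD //; [|exact: integZ|exact: integZ].
  by rewrite !RintegralZl // q2 h2 !mulr0 addr0.
by move=> x _; ring.
Qed.

Lemma orth_cs j q : orth q -> orth (fun x => cs j x * q x).
Proof.
move=> [mq hq]; split; first by apply: mbM => //; exact: mb_cs.
have iq := integ_mulb mI ig mq.
move=> k; have [q1 q2] := hq (k + j); have [h1 h2] := hq (k - j); split.
  rewrite (eq_Rintegral mu (g := fun x => 2^-1 * (cs (k + j) x * (q x * g x)) + 2^-1 * (cs (k - j) x * (q x * g x)))).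
    have i1 := integ_mulb mI iq (mb_cs (k + j)); have i2 := integ_mulb mI iq (mb_cs (k - j)).
    rewrite RintegralD //; [|exact: integZ|exact: integZ].
    by rewrite !RintegralZl // q1 h1 !mulr0 addr0.
  by move=> x _; rewrite !csD csN snN; field.
rewrite (eq_Rintegral mu (g := fun x => 2^-1 * (sn (k + j) x * (q x * g x)) + 2^-1 * (sn (k - j) x * (q x * g x)))).
  have i1 := integ_mulb mI iq (mb_sn (k + j)); have i2 := integ_mulb mI iq (mb_sn (k - j)).
  rewrite RintegralD //; [|exact: integZ|exact: integZ].
  by rewrite !RintegralZl // q2 h2 !mulr0 addr0.
by move=> x _; rewrite !snD csN snN; field.
Qed.

Lemma orth_sn j q : orth q -> orth (fun x => sn j x * q x).
Proof.
move=> [mq hq]; split; first by apply: mbM => //; exact: mb_sn.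
have iq := integ_mulb mI ig mq.
move=> k; have [q1 q2] := hq (k + j); have [h1 h2] := hq (k - j); split.
  rewrite (eq_Rintegral mu (g := fun x => 2^-1 * (sn (k + j) x * (q x * g x)) + (- 2^-1) * (sn (k - j) x * (q x * g x)))).
    have i1 := integ_mulb mI iq (mb_sn (k + j)); have i2 := integ_mulb mI iq (mb_sn (k - j)).
    rewrite RintegralD //; [|exact: integZ|exact: integZ].
    by rewrite !RintegralZl // q2 h2 !mulr0 addr0.
  by move=> x _; rewrite !snD csN snN; field.
rewrite (eq_Rintegral mu (g := fun x => (- 2^-1) * (cs (k + j) x * (q x * g x)) + 2^-1 * (cs (k - j) x * (q x * g x)))).
  have i1 := integ_mulb mI iq (mb_cs (k + j)); have i2 := integ_mulb mI iq (mb_cs (k - j)).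
  rewrite RintegralD //; [|exact: integZ|exact: integZ].
  by rewrite !RintegralZl // q1 h1 !mulr0 addr0.
by move=> x _; rewrite !csD csN snN; field.
Qed.

Lemma orth_ext q h : q =1 h -> orth q -> orth h.
Proof. by move=> /funext ->. Qed.

Lemma orth1 : orth (cst 1).
Proof.
split; first exact: mb_cst.
move=> k; split; [rewrite -[RHS](gcs k)|rewrite -[RHS](gsn k)];
  by apply: eq_Rintegral => x _ /=; rewrite mul1r.
Qed.

(* These multipliers form an algebra, and bounded pointwise limits of its
   elements [(1 - p ^ n) ^ 2 ^ n] are indicators of arcs. *)
Definition mult p := forall q, orth q -> orth (fun x => p x * q x).

Lemma multC c : mult (cst c).
Proof. by move=> q /[dup] oq /(orthD c 0 oq); apply: orth_ext => x /=; rewrite mul0r addr0. Qed.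
Lemma multD p r : mult p -> mult r -> mult (fun x => p x + r x).
Proof.
move=> hp hr q /[dup] /hp op /hr /(orthD 1 1 op).
by apply: orth_ext => x; rewrite !mul1r mulrDl.
Qed.
Lemma multM p r : mult p -> mult r -> mult (fun x => p x * r x).
Proof. by move=> hp hr q /hr /hp; apply: orth_ext => x; rewrite mulrA. Qed.
Lemma multX p n : mult p -> mult (fun x => p x ^+ n).
Proof.
move=> hp; elim: n => [|n IH]; first exact: multC.
by under eq_fun do rewrite exprS; exact: multM.
Qed.

(** Bernoulli's inequality on both sides of the threshold: the power is at least [1 - (2 c)^n],
    which tends to 1 if [c < 1/2], and at most [(2 c)^-n], which tends to 0 if [c > 1/2]. The
    exponent [2 ^ n] places the jump at [1/2]. *)
Lemma bernoulli_step (c : R) : 0 <= c <= 1 -> c != 2^-1 ->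
  (fun n => (1 - c ^+ n) ^+ (2 ^ n)) @ \oo --> (if c < 2^-1 then 1 else 0 : R).
Proof.
move=> /andP[c0 c1] ch; case: ifPn => [c2|].
  have c2' : 2 * c < 1 by rewrite -lter_pdivlMl // mulr1.
  apply: (@squeeze_cvgr _ _ _ _ (fun n => 1 - (2 * c) ^+ n) (cst 1)).
  - near=> n; have h01 : 0 <= 1 - c ^+ n <= 1.
      by rewrite subr_ge0 exprn_ile1 //= gerBl exprn_ge0.
    rewrite /= (@exprn_ile1 _ _ (1 - c ^+ n)) ?andbT; try by case/andP: h01.
    have bern (y : R) m : 0 <= y <= 1 -> 1 - m%:R * y <= (1 - y) ^+ m.
      move=> /andP[y0 y1]; elim: m => [|m IH]; first by rewrite mul0r subr0 expr0.
      rewrite exprS; apply: (@le_trans _ _ ((1 - y) * (1 - m%:R * y))).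
        have : 0 <= m%:R * y ^+ 2 by rewrite mulr_ge0 ?sqr_ge0.
        by rewrite -natr1; lra.
      by rewrite ler_wpM2l // subr_ge0.
    apply: le_trans (bern (c ^+ n) (2 ^ n)%N _); last by rewrite exprn_ge0 //= exprn_ile1.
    by rewrite exprMn natrX.
  - rewrite -[X in _ --> X](subr0 1); apply: cvgB; first exact: cvg_cst.
    by apply: cvg_expr; rewrite ger0_norm // mulr_ge0.
  - exact: cvg_cst.
rewrite -leNgt le_eqVlt eq_sym (negbTE ch) /= => c2.
have c2' : 1 < 2 * c by rewrite -lter_pdivrMl // mulr1.
have cp : 0 < 2 * c by exact: lt_trans c2'.
apply: (@squeeze_cvgr _ _ _ _ (fun=> 0 : R) (fun n => ((2 * c)^-1) ^+ n)).
- near=> n; have h01 : 0 <= 1 - c ^+ n <= 1.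
    by rewrite subr_ge0 exprn_ile1 //= gerBl exprn_ge0.
  rewrite exprn_ge0 /=; last by case/andP: h01.
  have bern (y : R) m : 0 <= y <= 1 -> (1 - y) ^+ m * (1 + m%:R * y) <= 1.
    move=> /andP[y0 y1]; elim: m => [|m IH]; first by rewrite mul0r addr0 expr0 mulr1.
    apply: le_trans IH; rewrite exprSr -mulrA ler_wpM2l ?exprn_ge0 ?subr_ge0 //.
    have my : 0 <= m%:R * y by exact: mulr_ge0.
    rewrite -natr1; have : 0 <= m%:R * y * y by exact: mulr_ge0.
    have yy : 0 <= y * y by exact: mulr_ge0.
    by lra.
  have := bern (c ^+ n) (2 ^ n)%N; rewrite exprn_ge0 //= exprn_ile1 // => /(_ isT).
  rewrite natrX -exprMn exprVn => h; rewrite -[leRHS]div1r ler_pdivlMr ?exprn_gt0 //.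
  apply: le_trans h; rewrite ler_wpM2l ?exprn_ge0 ?lerDr //; by case/andP: h01.
- exact: cvg_cst.
- by apply: cvg_expr; rewrite ger0_norm ?invr_ge0 ?ltW // invf_lt1.
Unshelve. all: by end_near. Qed.

(** The indicator of an arc is the bounded pointwise limit of multipliers applied to 1, so dominated
    convergence transfers the orthogonality to it; the mode 0 then gives the integral of [g] over
    the arc. *)
Lemma orth_prefix b : 0 < b < 1 -> \int[mu]_(x in `[0, b]) g x = 0.
Proof.
move=> /andP[b0 b1].
pose C x : R := cos (2 * pi * (x - b / 2)); pose s : R := cos (pi * b).
(* A trigonometric polynomial with values in [[0, 1]] that crosses [1/2] exactly at the end points
   of the arc: the cosine centred at [b / 2] exceeds [cos (pi * b)] inside the arc and is smaller
   outside. *)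
pose c x := 2^-1 + (s - C x) / 4.
have mc : mult c.
  rewrite (_ : c = fun x => (2^-1 + s / 4) + ((- 4^-1 * cos (pi * b)) * cs 1 x + (- 4^-1 * sin (pi * b)) * sn 1 x)).
    apply: multD; first exact: multC.
    apply: multD; apply: multM; try exact: multC; [exact: orth_cs|exact: orth_sn].
  apply: funext => x; rewrite /c /C /cs /sn /kap mulr1 (_ : 2 * pi * (x - b / 2) = 2 * pi * x - pi * b); last by field.
  by rewrite cosB; field.
have c01 x : 0 <= c x <= 1.
  have := cos_geN1 (2 * pi * (x - b / 2)); have := cos_le1 (2 * pi * (x - b / 2)).
  by have := cos_geN1 (pi * b); have := cos_le1 (pi * b); rewrite /c /C /s; lra.
pose q n x := (1 - c x ^+ n) ^+ (2 ^ n).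
have oq n : orth (q n).
  have : mult (q n).
    apply: multX; apply: multD; first exact: multC.
    have -> : (fun x => - c x ^+ n) = (fun x => (-1) * c x ^+ n) by apply: funext => x; rewrite mulN1r.
    by apply: multM; [exact: multC|exact: multX].
  by move=> /(_ _ orth1); apply: orth_ext => x /=; rewrite mulr1.
have q01 n x : 0 <= q n x <= 1.
  have /andP[h0 h1] := c01 x; apply/andP; split.
    by apply: exprn_ge0; rewrite subr_ge0 exprn_ile1.
  by apply: exprn_ile1; rewrite ?subr_ge0 ?exprn_ile1 // gerBl exprn_ge0.
have iq0 n : \int[mu]_(x in I01) (q n x * g x) = 0.
  have [_ /(_ 0) [h _]] := oq n; rewrite -[RHS]h; apply: eq_Rintegral => x _.
  by rewrite /cs kap0 mul0r cos0 mul1r.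
have pb : 0 < pi * b < pi by rewrite mulr_gt0 ?pi_gt0 //= gtr_pMr ?pi_gt0.
have sign1 x : 0 < x < b -> c x < 2^-1.
  move=> /andP[x0 xb]; rewrite /c gtrDl pmulr_llt0 ?invr_gt0 // subr_lt0 /s /C.
  have -> : cos (2 * pi * (x - b / 2)) = cos `|2 * pi * (x - b / 2)|.
    by rewrite cos_norm.
  have p0 := pi_gt0 R.
  rewrite ltr_cos ?in_itv /=; last first.
    + by case/andP: pb => h1 h2; rewrite !ltW.
    + rewrite normr_ge0 /= ler_norml; case/andP: pb => h1 h2; nra.
  by rewrite ltr_norml; nra.
have sign2 x : b < x < 1 -> 2^-1 < c x.
  move=> /andP[x0 xb]; rewrite /c ltrDl pmulr_lgt0 ?invr_gt0 // subr_gt0 /s /C.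
  have p0 := pi_gt0 R.
  have -> : cos (2 * pi * (x - b / 2)) = - cos `|2 * pi * (x - b / 2) - pi|.
    by rewrite cos_norm (cosB _ pi) cospi sinpi; ring.
  have -> : cos (pi * b) = - cos (pi - pi * b).
    by rewrite (cosB pi) cospi sinpi; ring.
  rewrite ltrN2.
  rewrite ltr_cos ?in_itv /=; last first.
    + by case/andP: pb => h1 h2; rewrite subr_ge0 ltW //= lerBlDr lerDl ltW.
    + rewrite normr_ge0 /= ler_norml; case/andP: pb => h1 h2; nra.
  by rewrite ltr_norml; nra.
pose chi x : R := if c x < 2^-1 then 1 else 0.
have mchi : measurable_fun setT chi.
  have mc' : measurable_fun setT c.
    have [[h _] _] := mc _ orth1; apply: eq_measurable_fun h => x _ /=; exact: mulr1.
  apply: (measurable_fun_ifT (measurable_fun_ltr mc' (measurable_cst _))) => //; exact: measurable_cst.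
have mbq n : mb (q n) by case: (oq n).
have mbchi : mb chi.
  by split=> //; exists 1 => x; rewrite /chi; case: ifP => _; rewrite ?normr1 ?normr0.
have ae3 : {ae mu, forall x : R, [/\ x <> 0, x <> b & x <> 1]}.
  have s1 a : {ae mu, forall x : R, x <> a}.
    exists [set a]; split; [exact: measurable_set1|exact: lebesgue_measure_set1|].
    by move=> x /= /contrapT.
  by apply: ae_mono (ae_and (s1 0) (ae_and (s1 b) (s1 1))) => x [? [? ?]].
have cvq : {ae mu, forall x, I01 x -> (fun n => q n x * g x) @ \oo --> chi x * g x}.
  apply: ae_mono ae3 => x [nx0 nxb nx1]; rewrite /= in_itv /= => /andP[x0 x1].
  apply: cvgM; last exact: cvg_cst.
  apply: bernoulli_step => //.
  have x0' : 0 < x by rewrite lt_neqAle x0 andbT eq_sym; exact/eqP.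
  have x1' : x < 1 by rewrite lt_neqAle x1 andbT; exact/eqP.
  case: (ltgtP x b) => [xb|bx|//].
    by rewrite lt_eqF // sign1 // x0'.
  by rewrite gt_eqF // sign2 // bx.
have ichi := integ_mulb mI ig mbchi.
have chi0 : \int[mu]_(x in I01) (chi x * g x) = 0.
  have dq x n : I01 x -> `|q n x * g x| <= `|g x|.
    move=> _; rewrite normrM ler_piMl //.
    by have /andP[h0 h1] := q01 n x; rewrite ger0_norm.
  have [_] := dom_cvg mI (fun n => integ_mulb mI ig (mbq n)) (integ_meas ichi) cvq (integ_norm ig) dq.
  under eq_fun do rewrite iq0.
  by move=> /cvg_lim <- //; rewrite lim_cst.
rewrite -[RHS]chi0.
have -> : (`[0, b]%classic : set R) = I01 `&` `[0, b].
  rewrite setIC; apply/esym/setIidPl => x /=; rewrite !in_itv /= => /andP[-> xb].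
  exact: le_trans xb (ltW b1).
rewrite Rintegral_mkcondr; apply: ae_eq_Rint => //.
- apply: measurable_funTS; apply/(measurable_restrictT _ _).1 => //.
  apply: measurable_funS (integ_meas ig) => //.
  by move=> x /=; rewrite !in_itv /= => /andP[-> xb]; exact: le_trans xb (ltW b1).
- exact: integ_meas ichi.
apply: ae_mono ae3 => x [nx0 nxb nx1]; rewrite /= in_itv /= => /andP[x0 x1].
have x0' : 0 < x by rewrite lt_neqAle x0 andbT eq_sym; exact/eqP.
have x1' : x < 1 by rewrite lt_neqAle x1 andbT; exact/eqP.
rewrite patchE /chi; case: (ltgtP x b) => [xb|bx|//].
  by rewrite mem_set ?sign1 ?mul1r ?x0' //= in_itv /= x0 ltW.
rewrite memNset /=; last by rewrite in_itv /= x0 /= leNgt bx.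
by rewrite ltNge ltW ?sign2 ?bx // mul0r.
Qed.

(** By [orth_prefix] the primitive of [g] vanishes on the interval, and by Lebesgue differentiation
    its derivative is [g] almost everywhere. *)
Lemma trig_complete : {ae mu, forall x, I01 x -> g x = 0}.
Proof.
pose G := g \_ I01.
have iG : integ setT G.
  have := (@integrable_mkcond _ _ _ mu I01 (EFin \o g) mI).1 ig.
  by rewrite restrict_EFin.
have locG : locally_integrable setT G.
  by apply: open_integrable_locally => //; exact: openT.
have FG := @FTC1 _ G (BLeft 0) (fun y => integS measurableT (measurable_itv _) (@subsetT _ _) iG) locG.
have s1 a : {ae mu, forall x : R, x <> a}.
  exists [set a]; split; [exact: measurable_set1|exact: lebesgue_measure_set1|].
  by move=> x /= /contrapT.
apply: ae_mono (ae_and FG (ae_and (s1 0) (s1 1))) => x [h [nx0 nx1]].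
rewrite /= in_itv /= => /andP[x0 x1].
have x0' : 0 < x by rewrite lt_neqAle x0 andbT eq_sym; exact/eqP.
have x1' : x < 1 by rewrite lt_neqAle x1 andbT; exact/eqP.
have [|_] := h; first by rewrite /= lte_fin.
rewrite {2}/G patchE mem_set /=; last by rewrite in_itv /= x0 x1.
move=> <-; rewrite derive1E.
rewrite (@near_eq_derive _ _ _ _ (fun=> 0)) ?derive_cst ?oner_neq0 //.
near=> y; have y01 : 0 < y < 1.
  by apply/andP; split; near: y; [exact: lt_nbhsr|exact: lt_nbhsl].
rewrite -[RHS](orth_prefix y01); apply: eq_Rintegral => z.
rewrite inE /= in_itv /= => /andP[z0 zy]; rewrite /G patchE mem_set //= in_itv /= z0 /=.
by case/andP: y01 => _ /ltW; exact: le_trans.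
Unshelve. all: by end_near. Qed.

End TrigCompleteness.

(** * Fourier coefficients of integrable functions *)

Section FourierCoefficients.
Context {R : realType}.
Implicit Types (g q h f : R -> R) (k j : int) (x : R) (n : nat) (z : R[i]).
Local Notation nc := (@normc R).
Local Notation kap := (@kap R).
Local Notation mu := (@lebesgue_measure R).
Local Notation I01 := (`[0, 1]%classic : set R).

Let mI : measurable I01. Proof. exact: measurable_itv. Qed.

Lemma is_derive_cs k x : is_derive x 1 (cs k) (- (kap k * sn k x)).
Proof.
have dw : is_derive x 1 (fun y : R => kap k * y) (kap k).
  by apply: is_derive_eq; rewrite /GRing.scale /= mulr1.
have -> : - (kap k * sn k x) = - sin (kap k * x) * kap k by rewrite mulNr mulrC.
exact: (@is_derive1_comp R cos (fun y => kap k * y)).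
Qed.

Lemma is_derive_sn k x : is_derive x 1 (sn k) (kap k * cs k x).
Proof.
have dw : is_derive x 1 (fun y : R => kap k * y) (kap k).
  by apply: is_derive_eq; rewrite /GRing.scale /= mulr1.
have -> : kap k * cs k x = cos (kap k * x) * kap k by rewrite mulrC.
exact: (@is_derive1_comp R sin (fun y => kap k * y)).
Qed.

Lemma continuous_cs k : continuous (@cs R k).
Proof. by move=> x; apply: differentiable_continuous; apply/derivable1_diffP; case: (is_derive_cs k x). Qed.
Lemma continuous_sn k : continuous (@sn R k).
Proof. by move=> x; apply: differentiable_continuous; apply/derivable1_diffP; case: (is_derive_sn k x). Qed.

Lemma cs0 k : cs k 0 = 1 :> R. Proof. by rewrite /cs mulr0 cos0. Qed.
Lemma sn0 k : sn k 0 = 0 :> R. Proof. by rewrite /sn mulr0 sin0. Qed.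

Lemma cs_sn_per k x : cs k (x + 1) = cs k x /\ sn k (x + 1) = sn k x.
Proof.
have [/smooth_periodicP[_ hc] /smooth_periodicP[_ hs]] :=
  (smooth_periodic_cos_sin k (1 : R) 0, smooth_periodic_cos_sin k (0 : R) 1).
have := hc x; have := hs x; rewrite /cs /sn /kap /= !mul1r !mul0r !addr0 !add0r.
by move=> -> ->.
Qed.

Lemma cs1 k : cs k 1 = 1 :> R. Proof. by have [h _] := cs_sn_per k 0; rewrite add0r in h; rewrite h cs0. Qed.
Lemma sn1 k : sn k 1 = 0 :> R. Proof. by have [_ h] := cs_sn_per k 0; rewrite add0r in h; rewrite h sn0. Qed.

Lemma ibp (F G f g : R -> R) : (forall x, is_derive x 1 F (f x)) -> continuous f ->
  (forall x, is_derive x 1 G (g x)) -> continuous g ->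
  \int[mu]_(x in I01) (F x * g x) = (F 1 * G 1 - F 0 * G 0) - \int[mu]_(x in I01) (f x * G x).
Proof.
move=> dF cf dG cg.
have dco (H h : R -> R) : (forall x, is_derive x 1 H (h x)) -> derivable_oo_LRcontinuous H 0 1.
  move=> dH; have cH : continuous H.
    by move=> x; apply: differentiable_continuous; apply/derivable1_diffP; case: (dH x).
  split; first by move=> x _; case: (dH x).
    exact: cvg_at_right_filter (cH 0).
  exact: cvg_at_left_filter (cH 1).
apply: Rintegration_by_parts => //.
- exact: continuous_subspaceT.
- exact: dco dF.
- by move=> x _; rewrite derive1E; case: (dF x).
- exact: continuous_subspaceT.
- exact: dco dG.
- by move=> x _; rewrite derive1E; case: (dG x).
Qed.

Lemma int_cs k : \int[mu]_(x in I01) cs k x = (k == 0)%:R.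
Proof.
have [->|k0] := eqVneq k 0.
  rewrite (eq_Rintegral mu (g := cst 1)); last by move=> x _; rewrite /cs kap0 mul0r cos0.
  by rewrite Rint_cst ?ler01 // subr0 mul1r.
have kn0 : kap k != 0 by rewrite -normr_gt0 (lt_le_trans _ (kap_ge4 k0)).
have d1 (x : R) : is_derive x 1 (cst 1 : R -> R) ((cst 0 : R -> R) x) by exact: is_derive_cst.
have c1 : continuous (cst 0 : R -> R) by move=> x; exact: cst_continuous.
have d2 x : is_derive x 1 (fun x => (kap k)^-1 * sn k x) (cs k x).
  have h := is_derive_sn k x.
  apply: is_derive_eq; rewrite /GRing.scale /= ?mulr0 ?addr0 ?add0r.
  by rewrite mulrA mulVf ?oppr_eq0 // mul1r.
have := ibp d1 c1 d2 (@continuous_cs k).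
rewrite sn0 sn1 !mulr0 subrr sub0r.
under eq_Rintegral do rewrite mul1r.
move=> ->; under eq_Rintegral do rewrite mul0r.
by rewrite Rint_cst ?ler01 // mul0r oppr0.
Qed.

Lemma int_sn k : \int[mu]_(x in I01) sn k x = 0.
Proof.
have [->|k0] := eqVneq k 0.
  rewrite (eq_Rintegral mu (g := cst 0)); last by move=> x _; rewrite /sn kap0 mul0r sin0.
  by rewrite Rint_cst ?ler01 // mul0r.
have kn0 : kap k != 0 by rewrite -normr_gt0 (lt_le_trans _ (kap_ge4 k0)).
have d1 (x : R) : is_derive x 1 (cst 1 : R -> R) ((cst 0 : R -> R) x) by exact: is_derive_cst.
have c1 : continuous (cst 0 : R -> R) by move=> x; exact: cst_continuous.
have d2 x : is_derive x 1 (fun x => (- kap k)^-1 * cs k x) (sn k x).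
  have h := is_derive_cs k x.
  apply: is_derive_eq; rewrite /GRing.scale /= ?mulr0 ?addr0 ?add0r.
  by field.
have := ibp d1 c1 d2 (@continuous_sn k).
rewrite cs0 cs1 !mulr1 subrr sub0r.
under eq_Rintegral do rewrite mul1r.
move=> ->; under eq_Rintegral do rewrite mul0r.
by rewrite Rint_cst ?ler01 // mul0r oppr0.
Qed.

Definition fc f k : R[i] :=
  Complex (\int[mu]_(x in I01) (cs k x * f x)) (- \int[mu]_(x in I01) (sn k x * f x)).

Lemma fc_lin a f g k : integ I01 f -> integ I01 g ->
  fc (fun x => a * f x + g x) k = real_complex R a * fc f k + fc g k.
Proof.
move=> hf hg; have c1 := integ_mulb mI hf (mb_cs k); have c2 := integ_mulb mI hg (mb_cs k).
have s1 := integ_mulb mI hf (mb_sn k); have s2 := integ_mulb mI hg (mb_sn k).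
rewrite /fc /=; congr Complex.
  rewrite (eq_Rintegral mu (g := fun x => a * (cs k x * f x) + cs k x * g x)); last by move=> x _; ring.
  by rewrite RintD ?RintZ //; [ring|exact: integZ].
rewrite (eq_Rintegral mu (g := fun x => a * (sn k x * f x) + sn k x * g x)); last by move=> x _; ring.
by rewrite RintD ?RintZ //; [ring|exact: integZ].
Qed.

Lemma integ_mbI h : mb h -> integ I01 h.
Proof. by apply: integ_mb => //; exact: mu_itv_lt. Qed.

Lemma fc_real f : integ I01 f -> is_real (fc f).
Proof.
move=> hf k; rewrite /fc /= opprK; congr Complex.
  by apply: eq_Rintegral => x _; rewrite csN.
have := RintZ (-1) mI (integ_mulb mI hf (mb_sn k)).
rewrite mulN1r => E; rewrite -[RHS]opprK -E; congr (- _).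
by apply: eq_Rintegral => x _; rewrite snN; ring.
Qed.

Lemma fc_le f B k : mb f -> (forall x, `|f x| <= B) -> nc (fc f k) <= 2 * B.
Proof.
move=> mf fB; apply: (le_trans (nc_le _)) => /=; rewrite normrN.
have B0 : 0 <= B := le_trans (normr_ge0 _) (fB 0).
have bd (h : R -> R) : mb h -> (forall x, `|h x| <= B) -> `|\int[mu]_(x in I01) h x| <= B.
  move=> mh hB; apply: (le_trans (Rint_norm mI (integ_mbI mh))).
  apply: (@le_trans _ _ (\int[mu]_(x in I01) cst B x)).
    apply: Rint_le => //; first exact: integ_norm (integ_mbI mh).
    exact: integ_mbI (mb_cst _).
  by rewrite Rint_cst ?ler01 // subr0 mulr1.
rewrite mulr2n mulrDl mul1r lerD //; apply: bd.
- by apply: mbM => //; exact: mb_cs.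
- by move=> x; rewrite normrM -[leRHS]mul1r ler_pM ?cs_bound.
- by apply: mbM => //; exact: mb_sn.
- by move=> x; rewrite normrM -[leRHS]mul1r ler_pM ?sn_bound.
Qed.

Definition ee k x : R[i] := Complex (cs k x) (sn k x).

Lemma mb_ee z k : mb (fun x => complex.Re (z * ee k x)).
Proof.
case: z => a b; rewrite /ee /=.
have -> : (fun x => a * cs k x - b * sn k x) = (fun x => a * cs k x + (- b) * sn k x).
  by apply: funext => x; rewrite mulNr.
by apply: mbD; apply: mbM; do ?[exact: mb_cst|exact: mb_cs|exact: mb_sn].
Qed.

(** The real part of [z * ee k] is half of [z * ee k] plus its conjugate, which lives at the
    frequency [- k]; for [k = 0] both contributions fall on the same mode. *)
Lemma fc_ee z k j : fc (fun x => complex.Re (z * ee k x)) j =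
  real_complex R (2^-1) * ((if j == k then z else 0) + (if j == - k then conjc z else 0)).
Proof.
case: z => a b.
have ic m := integ_mbI (mb_cs m); have is_ m := integ_mbI (mb_sn m).
have lin (c1 c2 c3 c4 : R) :
   \int[mu]_(x in I01) (c1 * cs (j - k) x + (c2 * cs (j + k) x + (c3 * sn (j - k) x + c4 * sn (j + k) x))) =
     c1 * (j == k)%:R + c2 * (j == - k)%:R.
  rewrite !RintD ?RintZ //; try (do ?[apply: integD => //]; exact: integZ).
  by rewrite !int_cs !int_sn !mulr0 !addr0 subr_eq0 addr_eq0.
rewrite /fc /ee /=.
rewrite (eq_Rintegral mu (g := fun x => (a / 2) * cs (j - k) x + ((a / 2) * cs (j + k) x +
   ((b / 2) * sn (j - k) x + (- b / 2) * sn (j + k) x)))); last first.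
  by move=> x _; rewrite !csD !snD !csN !snN; field.
rewrite lin (eq_Rintegral mu (g := fun x => (- b / 2) * cs (j - k) x + ((b / 2) * cs (j + k) x +
   ((a / 2) * sn (j - k) x + (a / 2) * sn (j + k) x)))); last first.
  by move=> x _; rewrite !csD !snD !csN !snN; field.
rewrite lin.
by case: (j == k); case: (j == - k) => /=; congr Complex; field.
Qed.

(** For conjugate-symmetric [c] this is the usual symmetric partial sum; the real part taken in each
    term keeps the function real-valued. *)
Definition tp (c : int -> R[i]) n x := \sum_(k <- zr n) complex.Re (c k * ee k x).

Lemma mb_sum (s : seq int) (F : int -> R -> R) : (forall k, mb (F k)) ->
  mb (fun x => \sum_(k <- s) F k x).
Proof.
move=> hF; elim: s => [|k s IH].
  by under eq_fun do rewrite big_nil; exact: mb_cst.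
by under eq_fun do rewrite big_cons; exact: mbD.
Qed.

Lemma mb_tp c n : mb (tp c n).
Proof. by apply: mb_sum => k; exact: mb_ee. Qed.

Lemma fc_sum (s : seq int) (F : int -> R -> R) j : (forall k, integ I01 (F k)) ->
  fc (fun x => \sum_(k <- s) F k x) j = \sum_(k <- s) fc (F k) j.
Proof.
move=> hF.
have is_ r : integ I01 (fun x => \sum_(k <- r) F k x).
  elim: r => [|k r IH]; first by rewrite (_ : (fun x => _) = cst 0) ?integ_mbI //; [exact: mb_cst|apply: funext => x; rewrite big_nil].
  by rewrite (_ : (fun x => _) = (fun x => F k x + \sum_(i <- r) F i x)); [exact: integD|apply: funext => x; rewrite big_cons].
elim: s => [|k s IH].
  rewrite big_nil /fc.
  under eq_Rintegral do rewrite big_nil mulr0.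
  under [X in - X]eq_Rintegral do rewrite big_nil mulr0.
  by rewrite Rint_cst ?ler01 // mul0r oppr0.
rewrite big_cons -IH; under eq_fun do rewrite big_cons.
have -> : (fun x => F k x + \sum_(i <- s) F i x) = (fun x => 1 * F k x + \sum_(i <- s) F i x).
  by apply: funext => x; rewrite mul1r.
by rewrite fc_lin // rmorph1 mul1r.
Qed.

Lemma fc_tp c n j : is_real c -> (`|j| <= n)%N -> fc (tp c n) j = c j.
Proof.
move=> rc jn; rewrite /tp fc_sum; last by move=> k; exact: integ_mbI (mb_ee _ _).
under eq_bigr do rewrite fc_ee.
rewrite -mulr_sumr big_split /=.
have E1 : \sum_(k <- zr n) (if j == k then c k else 0) = c j.
  rewrite (bigD1_seq j) ?mem_zr ?zr_uniq //= eqxx big1 ?addr0 //.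
  by move=> k kj; rewrite eq_sym (negbTE kj).
have E2 : \sum_(k <- zr n) (if j == - k then conjc (c k) else 0) = c j.
  rewrite (bigD1_seq (- j)) ?mem_zr ?abszN ?zr_uniq //= opprK eqxx rc conjcK big1 ?addr0 //.
  by move=> k kj; case: eqP => // jk; move/eqP: kj; lia.
by rewrite E1 E2; case: (c j) => a b /=; congr Complex; field.
Qed.

(** Otherwise a null set would contain an interval of positive length around [x] within [[0, 1]]. *)
Lemma ae_dense (P : R -> Prop) x e : {ae mu, forall y, I01 y -> P y} -> I01 x -> 0 < e ->
  exists y, [/\ I01 y, `|x - y| <= e & P y].
Proof.
move=> [N [mN N0 hN]]; rewrite /= in_itv /= => /andP[x0 x1] e0.
pose a := Num.max 0 (x - e); pose b := Num.min 1 (x + e).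
have ab : a < b.
  by rewrite /a /b gt_max !lt_min; apply/andP; split; apply/andP; split; lra.
apply: contrapT => /forallNP h.
have sub : `[a, b]%classic `<=` N.
  move=> y; rewrite /= in_itv /= /a /b ge_max le_min => /andP[/andP[y0 y1] /andP[y2 y3]].
  apply: hN => /= Py; apply: (h y); split.
  - by rewrite /= in_itv /= y0 y2.
  - by rewrite ler_norml; lra.
  - by apply: Py; rewrite /= in_itv /= y0 y2.
have : (mu `[a, b]%classic <= mu N)%E.
  by apply: le_measure => //; rewrite inE //; exact: measurable_itv.
rewrite N0 lebesgue_measure_itv /= lte_fin ab -EFinD lee_fin; lra.
Qed.

End FourierCoefficients.

(** * Uniform convergence of the Fourier series of a smooth function *)

Section SmoothExpansion.
Context {R : realType}.
Implicit Types (g q h f : R -> R) (k : int) (x : R) (n m j : nat) (z : R[i]) (phi psi : test R).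
Local Notation nc := (@normc R).
Local Notation kap := (@kap R).
Local Notation mu := (@lebesgue_measure R).
Local Notation I01 := (`[0, 1]%classic : set R).

Let mI : measurable I01. Proof. exact: measurable_itv. Qed.

Lemma smooth_is_derive f x : smooth f -> is_derive x 1 f (derive1 f x).
Proof. by move=> sf; have := sf 0%N x => /= df; rewrite derive1E; apply: DeriveDef. Qed.

Lemma smooth_cts f : smooth f -> continuous f.
Proof.
move=> sf x; apply: differentiable_continuous; apply/derivable1_diffP.
exact: (sf 0%N x).
Qed.

Lemma periodic_frac f x : periodic1 f -> exists y, I01 y /\ f x = f y.
Proof.
move=> pf; have pn n y : f (y + n%:R) = f y.
  by elim: n => [|n IH]; rewrite ?addr0 // -natr1 addrA pf.
exists (x - (Num.floor x)%:~R); split.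
  have := floor_itv x; rewrite /= in_itv /= intrD => /andP[h1 h2].
  by apply/andP; split; lra.
case: (Num.floor x) => n; first by rewrite -[in LHS](subrK (n%:R) x) pn.
by rewrite NegzE mulrNz opprK -[X in _ + X]/(n.+1%:R) pn.
Qed.

Lemma periodic_bounded f : continuous f -> periodic1 f -> exists B, forall x, `|f x| <= B.
Proof.
move=> cf pf.
have cI : {within `[0, 1], continuous (fun x => `|f x|)}.
  apply: continuous_subspaceT => x; apply: continuous_comp; first exact: cf.
  exact: norm_continuous.
have [c _ hc] := EVT_max ler01 cI.
exists `|f c| => x; have [y [yI ->]] := periodic_frac x pf.
by apply: hc; move: yI; rewrite /=.
Qed.

Lemma smooth_mb f : smooth f -> periodic1 f -> mb f.
Proof.
move=> sf pf; split; first exact: continuous_measurable_fun (smooth_cts sf).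
exact: periodic_bounded (smooth_cts sf) pf.
Qed.

Lemma periodic_derive1 f : periodic1 f -> periodic1 (derive1 f).
Proof.
move=> pf x; rewrite /derive1.
by under [in LHS]eq_fun do rewrite addrA !pf.
Qed.

Lemma fc_derive f k : smooth f -> periodic1 f -> fc (derive1 f) k = Complex 0 (kap k) * fc f k.
Proof.
move=> sf pf.
have f01 : f 1 = f 0 by rewrite -[1]add0r pf.
have df x := smooth_is_derive x sf.
have cf' : continuous (derive1 f) by apply: smooth_cts; exact: smooth_derive.
have if_ := integ_mbI (smooth_mb sf pf).
have dc x := is_derive_cs k x; have ds x := is_derive_sn k x.
have cc : continuous (fun x => - (kap k * sn k x)).
  by move=> x; apply: cvgN; apply: cvgM; [exact: cvg_cst|exact: continuous_sn].
have css : continuous (fun x => kap k * cs k x).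
  by move=> x; apply: cvgM; [exact: cvg_cst|exact: continuous_cs].
rewrite /fc (ibp dc cc df cf') (ibp ds css df cf').
rewrite cs0 cs1 sn0 sn1 f01 !mul1r !mul0r !subrr !sub0r opprK.
have i1 := integ_mulb mI if_ (mb_sn k); have i2 := integ_mulb mI if_ (mb_cs k).
rewrite (eq_Rintegral mu (g := fun x => (- kap k) * (sn k x * f x))); last by move=> x _; ring.
rewrite [X in Complex _ X](eq_Rintegral mu (g := fun x => kap k * (cs k x * f x))); last by move=> x _; ring.
by rewrite !RintZ //=; congr Complex; ring.
Qed.

(** Two derivatives multiply the coefficient by [- kap k ^ 2], and the coefficients of the bounded
    second derivative are bounded. *)
Lemma fc_decay f : smooth f -> periodic1 f -> exists B, 0 <= B /\
  forall k, k != 0 -> nc (fc f k) <= B * (kap k ^+ 2)^-1.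
Proof.
move=> sf pf; have s2 := smooth_derive (smooth_derive sf).
have p2 := periodic_derive1 (periodic_derive1 pf).
have [B hB] := periodic_bounded (smooth_cts s2) p2.
have B0 : 0 <= B := le_trans (normr_ge0 _) (hB 0).
exists (2 * B); split; first exact: mulr_ge0.
move=> k k0; have kp : 0 < kap k ^+ 2.
  by rewrite -(real_normK (num_real (kap k))) exprn_gt0 // (lt_le_trans _ (kap_ge4 k0)).
rewrite ler_pdivlMr //; apply: le_trans (fc_le k (smooth_mb s2 p2) hB).
rewrite (fc_derive k (smooth_derive sf) (periodic_derive1 pf)) (fc_derive k sf pf).
rewrite !normcM !nc_imag.
by rewrite mulrA -expr2 real_normK ?num_real // mulrC.
Qed.

Lemma nc_ee k x : nc (ee k x) = 1.
Proof. by rewrite /ee /= /cs /sn cos2Dsin2 sqrtr1. Qed.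

Lemma zr_diff n m (F : int -> R) : (n <= m)%N ->
  \sum_(k <- zr m) F k - \sum_(k <- zr n) F k =
  \sum_(k <- [seq k <- zr m | (n < absz k)%N]) F k.
Proof.
move=> nm; apply/eqP; rewrite subr_eq -big_cat /=; apply/eqP.
apply: perm_big; apply: uniq_perm; rewrite ?zr_uniq //.
  rewrite cat_uniq zr_uniq filter_uniq ?zr_uniq //= andbT.
  by apply/hasPn => k; rewrite mem_zr => kn; rewrite mem_filter ltnNge kn.
by move=> k; rewrite mem_cat mem_filter !mem_zr; lia.
Qed.

(** The series converges absolutely and uniformly to some [G] with the same coefficients as [f].
    Completeness gives [f = G] almost everywhere, and continuity of [f] minus a partial sum extends
    the estimate from a dense set to every point; continuity of [G] itself is never established. *)
Lemma tp_uniform f : smooth f -> periodic1 f -> forall e, 0 < e ->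
  exists n0, forall n, (n0 <= n)%N -> forall x, `|f x - tp (fc f) n x| <= e.
Proof.
move=> sf pf e e0; have [B [B0 hB]] := fc_decay sf pf.
have if_ := integ_mbI (smooth_mb sf pf).
(* At [k = 0] the inverse of [kap k ^ 2] is 0 by convention, so the zeroth mode is added
   separately. *)
pose b k := (if k == 0 then nc (fc f 0) else 0) + B * (kap k ^+ 2)^-1.
have b0 k : 0 <= b k.
  by rewrite addr_ge0 ?mulr_ge0 ?invr_ge0 ?sqr_ge0 //; case: ifP => // _; exact: nc_ge0.
have fb k x : `|complex.Re (fc f k * ee k x)| <= b k.
  apply: (le_trans (nc_Re _)); rewrite normcM nc_ee mulr1 /b.
  case: eqP => [->|/eqP k0]; last by rewrite add0r hB.
  by rewrite lerDl mulr_ge0 ?invr_ge0 ?sqr_ge0.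
have hb : sums_le b (nc (fc f 0) + B * 2).
  apply: sums_leD; last exact: sums_leZ sum_invkap.
  move=> s us; have [s0|s0] := boolP (0 \in s).
    rewrite (bigD1_seq 0) //= big1 ?addr0 // => k /negbTE k0; by rewrite k0.
  rewrite big_seq_cond big1 ?nc_ge0 // => k /andP[ks _].
  by case: eqP => // k0; move: s0; rewrite -k0 ks.
have [n0 hn0] := tail_small b0 hb e0.
have hd n m x : (n0 <= n)%N -> (n <= m)%N -> `|tp (fc f) m x - tp (fc f) n x| <= e.
  move=> nn nm; rewrite /tp zr_diff //; apply: (le_trans (ler_norm_sum _ _ _)).
  apply: le_trans (hn0 [seq k <- zr m | (n < absz k)%N] _ _).
  - by apply: ler_sum => k _; exact: fb.
  - exact: filter_uniq (zr_uniq m).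
  - by move=> k; rewrite mem_filter => /andP[/(leq_ltn_trans nn)].
have cvx x : cvgn (fun m => tp (fc f) m x).
  by apply: (@sum_cvg_abs _ _ (nc (fc f 0) + B * 2)); apply: sums_le_le hb _ => k; exact: fb.
pose G x := lim ((fun m => tp (fc f) m x) @ \oo).
have bd n x : `|tp (fc f) n x| <= nc (fc f 0) + B * 2.
  apply: (le_trans (ler_norm_sum _ _ _)); apply: le_trans (hb _ (zr_uniq n)).
  by apply: ler_sum => k _; exact: fb.
have Gn n x : (n0 <= n)%N -> `|G x - tp (fc f) n x| <= e.
  move=> nn; have h : (fun m => `|tp (fc f) m x - tp (fc f) n x|) @ \oo --> `|G x - tp (fc f) n x|.
    by apply: cvg_norm; apply: cvgB; [exact: cvx|exact: cvg_cst].
  rewrite -(cvg_lim (@Rhausdorff R) h); apply: limr_le; first by apply/cvg_ex; eexists; exact: h.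
  by near=> m; apply: hd => //; near: m; exact: nbhs_infty_ge.
have mG : mb G.
  split.
    apply: (@measurable_fun_cvg _ _ _ setT (fun m => tp (fc f) m)); first by move=> m; case: (mb_tp (fc f) m).
    by move=> x _; exact: cvx.
  exists (e + (nc (fc f 0) + B * 2)) => x.
  by rewrite -(subrK (tp (fc f) n0 x) (G x)) (le_trans (ler_normD _ _)) // lerD // Gn.
have iG := integ_mbI mG.
have rf := fc_real if_.
have lim_coef (c : R -> R) : mb c ->
   (fun n => \int[mu]_(x in I01) (c x * tp (fc f) n x)) @ \oo --> \int[mu]_(x in I01) (c x * G x).
  move=> mc; have [mc1 [C hC]] := mc.
  have it n := integ_mbI (mbM mc (mb_tp (fc f) n)).
  have cv : {ae mu, forall x, I01 x -> (fun n => c x * tp (fc f) n x) @ \oo --> c x * G x}.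
    by apply: aeW => x _; apply: cvgM; [exact: cvg_cst|exact: cvx].
  have dm x n : I01 x -> `|c x * tp (fc f) n x| <= cst (C * (nc (fc f 0) + B * 2)) x.
    by move=> _; rewrite normrM ler_pM.
  by have [_] := dom_cvg mI it (integ_meas (integ_mbI (mbM mc mG))) cv (integ_mbI (mb_cst _)) dm.
have evt k (P : nat -> R) (l : R) : (forall n, (absz k <= n)%N -> P n = l) -> P @ \oo --> l.
  move=> h; apply: (@cvg_trans _ ((fun=> l) @ \oo)); last exact: cvg_cst.
  by apply: near_eq_cvg; near=> n; rewrite h //; near: n; exact: nbhs_infty_ge.
have fG k : fc G k = fc f k.
  have h1 := lim_coef _ (mb_cs k); have h2 := lim_coef _ (mb_sn k).
  have e1 := evt k (fun n => \int[mu]_(x in I01) (cs k x * tp (fc f) n x)) (complex.Re (fc f k)).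
  have e2 := evt k (fun n => \int[mu]_(x in I01) (sn k x * tp (fc f) n x)) (- complex.Im (fc f k)).
  have {}e1 := e1 (fun n kn => congr1 (@complex.Re R) (fc_tp rf kn)).
  have {}e2 : (fun n => \int[mu]_(x in I01) (sn k x * tp (fc f) n x)) @ \oo --> - complex.Im (fc f k).
    by apply: e2 => n kn; rewrite -(fc_tp rf kn) /= opprK.
  rewrite (_ : fc f k = Complex (complex.Re (fc f k)) (- - complex.Im (fc f k))); last by rewrite opprK; case: (fc f k).
  rewrite [LHS]/fc; congr Complex; first exact: (cvg_unique _ h1 e1).
  by congr (- _); exact: (cvg_unique _ h2 e2).
(* All Fourier coefficients of [r] vanish, so [trig_complete] applies to it. *)
pose r x := 1 * f x + (- 1) * G x.
have ir : integ I01 r by apply: integD => //; exact: integZ.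
have zr_ k : \int[mu]_(x in I01) (cs k x * r x) = 0 /\ \int[mu]_(x in I01) (sn k x * r x) = 0.
  have i1 := integ_mulb mI if_ (mb_cs k); have i2 := integ_mulb mI if_ (mb_sn k).
  have i3 := integ_mulb mI iG (mb_cs k); have i4 := integ_mulb mI iG (mb_sn k).
  have := fG k; rewrite /fc => -[E1 /oppr_inj E2]; split.
    rewrite (eq_Rintegral mu (g := fun x => cs k x * f x + (-1) * (cs k x * G x))); last by move=> x _; rewrite /r; ring.
    by rewrite RintD ?RintZ //; [rewrite E1; ring|exact: integZ].
  rewrite (eq_Rintegral mu (g := fun x => sn k x * f x + (-1) * (sn k x * G x))); last by move=> x _; rewrite /r; ring.
  by rewrite RintD ?RintZ //; [rewrite E2; ring|exact: integZ].
have aez := trig_complete ir (fun k => (zr_ k).1) (fun k => (zr_ k).2).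
exists n0 => n nn.
have cr : continuous (fun x => f x - tp (fc f) n x).
  move=> x; apply: cvgB; first exact: smooth_cts.
  rewrite /tp; elim: (zr n) => [|k s IH].
    by rewrite (_ : (fun y => _) = cst 0) ?big_nil; [exact: cst_continuous|apply: funext => y; rewrite big_nil].
  rewrite big_cons (_ : (fun y => _) = fun y => complex.Re (fc f k * ee k y) + \sum_(j <- s) complex.Re (fc f j * ee j y)); last by apply: funext => y; rewrite big_cons.
  apply: cvgD => //; case: (fc f k) => a c; rewrite /ee /=.
  apply: cvgB; apply: cvgM; do ?[exact: cvg_cst|exact: continuous_cs|exact: continuous_sn].
have pr : periodic1 (fun x => f x - tp (fc f) n x).
  move=> x; rewrite pf; congr (_ - _); apply: eq_bigr => k _.
  by rewrite /ee; have [-> ->] := cs_sn_per k x.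
suff hI x : I01 x -> `|f x - tp (fc f) n x| <= e.
  move=> x; have [y [/hI + E]] := periodic_frac x pr.
  by rewrite -E.
move=> xI; apply/ler_addgt0Pr => d d0.
have /cvgrPdist_le /(_ d d0) := cr x.
rewrite near_simpl => -[/= del del0 hdel].
(* A point close to [x] where [f] and [G] agree; half of [del] because the neighbourhood is open. *)
have [y [yI yx yP]] := ae_dense aez xI (divr_gt0 del0 (ltr0n R 2)).
have {}hdel := hdel y; rewrite /ball_ /= in hdel.
have {}hdel := hdel (le_lt_trans yx _).
have d2 : del / 2 < del by rewrite ltr_pdivrMr // ltr_pMr // ltr1n.
have {}hdel := hdel d2.
have yE : f y = G y by have := yP; rewrite /r; lra.
have := Gn n y nn; rewrite -yE => hy.
rewrite -(subrK (f y - tp (fc f) n y) (f x - tp (fc f) n x)).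
by apply: (le_trans (ler_normD _ _)); rewrite addrC lerD.
Unshelve. all: by end_near. Qed.

End SmoothExpansion.

(** * Distributions and their Fourier coefficients *)

Section DistributionExpansion.
Context {R : realType}.
Implicit Types (f : R -> R) (k : int) (x : R) (n m j : nat) (z : R[i]) (phi psi : test R) (u v w : dist R) (c : int -> R[i]).
Local Notation nc := (@normc R).
Local Notation kap := (@kap R).
Local Notation mu := (@lebesgue_measure R).
Local Notation I01 := (`[0, 1]%classic : set R).

Let mI : measurable I01. Proof. exact: measurable_itv. Qed.

Lemma test_smooth phi : smooth (val phi).
Proof. by case: phi => f /= /smooth_periodicP[]. Qed.
Lemma test_per phi : periodic1 (val phi).
Proof. by case: phi => f /= /smooth_periodicP[]. Qed.
Lemma test_integ phi : integ I01 (val phi).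
Proof. exact: integ_mbI (smooth_mb (@test_smooth phi) (@test_per phi)). Qed.

Lemma smoothn f j : smooth f -> smooth (derive1n j f).
Proof. by move=> sf; elim: j => [//|j IH]; rewrite derive1nS; exact: smooth_derive. Qed.
Lemma periodicn f j : periodic1 f -> periodic1 (derive1n j f).
Proof. by move=> sf; elim: j => [//|j IH]; rewrite derive1nS; exact: periodic_derive1. Qed.

Lemma is_derive_tp c n x :
  is_derive x 1 (tp c n) (tp (fun k => Complex 0 (kap k) * c k) n x).
Proof.
rewrite /tp; elim: (zr n) => [|k s IH].
  rewrite big_nil (_ : (fun x => _) = cst 0); first exact: is_derive_cst.
  by apply: funext => y; rewrite big_nil.
rewrite big_cons (_ : (fun x => _) = (fun x => complex.Re (c k * ee k x)) + (fun x => \sum_(i <- s) complex.Re (c i * ee i x))); last first.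
  by apply: funext => y; rewrite big_cons.
apply: is_deriveD; case: (c k) => a b; rewrite /ee /=.
have dc := is_derive_cs k x; have ds := is_derive_sn k x.
apply: is_derive_eq; rewrite /GRing.scale /=; ring.
Qed.

Lemma derive_tp f n : smooth f -> periodic1 f ->
  derive1 (tp (fc f) n) = tp (fc (derive1 f)) n.
Proof.
move=> sf pf; apply: funext => x; rewrite derive1E.
have h := is_derive_tp (fc f) n x; rewrite derive_val.
by apply: eq_bigr => k _; rewrite fc_derive.
Qed.

Lemma derive1n_tp f n j : smooth f -> periodic1 f ->
  derive1n j (tp (fc f) n) = tp (fc (derive1n j f)) n.
Proof.
move=> sf pf; elim: j => [//|j IH].
by rewrite !derive1nS IH (@derive_tp _ n (@smoothn _ j sf) (@periodicn _ j pf)).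
Qed.

Definition tsum phi n : test R :=
  \sum_(k <- zr n) trig k (complex.Re (fc (val phi) k)) (- complex.Im (fc (val phi) k)).

Lemma val_tsum phi n : val (tsum phi n) = tp (fc (val phi)) n.
Proof.
apply: funext => x; rewrite /tsum /tp; elim: (zr n) => [|k s IH].
  by rewrite !big_nil.
rewrite !big_cons -IH /= fctE; congr (_ + _).
by case: (fc (val phi) k) => a b; rewrite /ee /cs /sn /kap /=; ring.
Qed.

Lemma trig_split k (a b : R) : trig k a b = a *: trig k 1 0 + b *: trig k 0 1.
Proof.
apply: val_inj => /=; apply: funext => x.
rewrite !fctE /GRing.scale /=; ring.
Qed.

Lemma dist_add u phi psi : scalar u -> u (phi + psi) = u phi + u psi.
Proof. by move=> lu; have := lu 1 phi psi; rewrite scale1r mul1r. Qed.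
Lemma dist0 u : scalar u -> u 0 = 0.
Proof. by move=> lu; have := dist_add 0 0 lu; rewrite addr0 => h; lra. Qed.
Lemma dist_scale u a phi : scalar u -> u (a *: phi) = a * u phi.
Proof. by move=> lu; have := lu a phi 0; rewrite addr0 (dist0 lu) addr0. Qed.
Lemma dist_sum u (s : seq int) (F : int -> test R) : scalar u ->
  u (\sum_(k <- s) F k) = \sum_(k <- s) u (F k).
Proof.
move=> lu; elim: s => [|k s IH]; first by rewrite !big_nil dist0.
by rewrite !big_cons dist_add // IH.
Qed.

Definition pairn c phi n := \sum_(k <- zr n) complex.Re (c k * conjc (fc (val phi) k)).

Lemma dist_tsum u phi n : scalar u -> u (tsum phi n) = pairn (fourier u) phi n.
Proof.
move=> lu; rewrite dist_sum //; apply: eq_bigr => k _.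
rewrite trig_split dist_add // !dist_scale // /fourier.
by case: (fc _ k) => a b /=; ring.
Qed.

(** A distribution has a finite order [N], so it suffices that the Fourier series of [phi] converges
    uniformly together with its derivatives up to [N]. Differentiation commutes with taking partial
    sums, and [tp_uniform] applies to each derivative. *)
Lemma dist_fourier u phi : is_distribution u -> pairn (fourier u) phi @ \oo --> u phi.
Proof.
move=> [lu [N [C hC]]]; apply/cvgrPdist_le => e e0.
(* The constant [C] of the continuity bound may be negative or zero. *)
pose d := e / (`|C| + 1).
have C1 : 0 < `|C| + 1 by rewrite ltr_wpDl.
have d0 : 0 < d by rewrite divr_gt0.
have sf := @test_smooth phi; have pf := @test_per phi.
have [n0 hn0] : exists n0, forall n, (n0 <= n)%N -> forall j x, (j <= N)%N ->
    `|derive1n j (val phi) x - tp (fc (derive1n j (val phi))) n x| <= d.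
  elim: N {hC} => [|N [n0 IH]].
    have [n0 h] := tp_uniform sf pf d0; exists n0 => n nn j x.
    by rewrite leqn0 => /eqP -> /=; exact: h.
  have [n1 h] := tp_uniform (@smoothn _ N.+1 sf) (@periodicn _ N.+1 pf) d0.
  exists (maxn n0 n1) => n; rewrite geq_max => /andP[h0 h1] j x.
  by rewrite leq_eqVlt => /orP[/eqP->|/IH]; [exact: h|exact].
exists n0 => // n /= nn; rewrite -dist_tsum //.
have -> : u phi - u (tsum phi n) = u (phi - tsum phi n).
  have -> : phi - tsum phi n = (-1) *: tsum phi n + phi by rewrite scaleN1r addrC.
  by rewrite lu; ring.
have h : forall j x, (j <= N)%N -> `|derive1n j (val (phi - tsum phi n)) x| <= d.
  move=> j x jN; have := hn0 n nn j x jN.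
  have -> : val (phi - tsum phi n) = (-1) *: (val (tsum phi n) : R -> R^o) + val phi.
    by apply: funext => y; rewrite scaleN1r addrC.
  rewrite (derive1n_linear (-1) j (@test_smooth (tsum phi n)) (@test_smooth phi)).
  by rewrite val_tsum derive1n_tp // !fctE scaleN1r addrC.
apply: (le_trans (hC _ d h)); apply: (@le_trans _ _ (`|C| * d)).
  by rewrite ler_wpM2r ?ler_norm // ltW.
rewrite /d mulrCA ler_piMr ?ltW // ltr_pdivrMr // mul1r; lra.
Qed.

(** Applying [1 - d^2/dx^2] multiplies the coefficient by [1 + kap k ^ 2], uses two derivatives and
    at most doubles the bounds on the remaining ones. *)
Lemma fc_pow f k p (B : R) : smooth f -> periodic1 f ->
  (forall j x, (j <= p.*2)%N -> `|derive1n j f x| <= B) ->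
  (1 + kap k ^+ 2) ^+ p * nc (fc f k) <= 2 * (2 ^+ p * B).
Proof.
elim: p f B => [|p IH] f B sf pf hB.
  rewrite !expr0 !mul1r; apply: fc_le (smooth_mb sf pf) _ => x; exact: (hB 0%N).
pose g : R -> R := (-1) *: (derive1 (derive1 f) : R -> R^o) + f.
have s2 := smooth_derive (smooth_derive sf).
have p2 := periodic_derive1 (periodic_derive1 pf).
have sg : smooth g by exact: smooth_linear.
have pg : periodic1 g by move=> x; rewrite /g !fctE p2 pf.
have gk : fc g k = real_complex R (1 + kap k ^+ 2) * fc f k.
  have -> : fc g k = real_complex R (-1) * fc (derive1 (derive1 f)) k + fc f k.
    exact: (fc_lin (-1) k (integ_mbI (smooth_mb s2 p2)) (integ_mbI (smooth_mb sf pf))).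
  rewrite (fc_derive k (smooth_derive sf) (periodic_derive1 pf)) (fc_derive k sf pf).
  by case: (fc f k) => a b /=; congr Complex; ring.
have hg j x : (j <= p.*2)%N -> `|derive1n j g x| <= 2 * B.
  move=> jp; rewrite /g derive1n_linear // !fctE.
  have := hB j.+2 x; have := hB j x; rewrite -!derive1Sn doubleS !ltnS => h1 h2.
  apply: (le_trans (ler_normD _ _)); rewrite normrM normrN1 mul1r.
  have := h1 (leq_trans jp (leqW (leqnSn _))); have := h2 jp; lra.
have := IH g (2 * B) sg pg hg; rewrite gk normcM nc_real ger0_norm ?addr_ge0 ?sqr_ge0 //.
rewrite (_ : (1 + kap k ^+ 2) ^+ p.+1 * nc (fc f k) = (1 + kap k ^+ 2) ^+ p * ((1 + kap k ^+ 2) * nc (fc f k))); last by rewrite exprSr mulrA.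
by rewrite (_ : 2 * (2 ^+ p.+1 * B) = 2 * (2 ^+ p * (2 * B))) //; rewrite exprSr -!mulrA.
Qed.

Definition polyb c := exists (m : nat) (C : R), 0 <= C /\
  forall k, nc (c k) <= C * (1 + kap k ^+ 2) ^+ m.

(** The inverse of [fourier] on conjugate-symmetric sequences of polynomial growth; the limit is
    meaningful for sequences that satisfy [polyb]. *)
Definition realize c : dist R := fun phi => lim (pairn c phi @ \oo).

Lemma sum_inv1kap : sums_le (fun k => (1 + kap k ^+ 2)^-1) 3.
Proof.
have h : sums_le (fun k => (if k == 0 then 1 else 0) + (kap k ^+ 2)^-1 : R) (1 + 2).
  apply: sums_leD; last exact: sum_invkap.
  move=> s us; have [s0|s0] := boolP (0 \in s).
    rewrite (bigD1_seq 0) //= big1 ?addr0 // => k /negbTE k0; by rewrite k0.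
  rewrite big_seq_cond big1 ?ler01 // => k /andP[ks _].
  by case: eqP => // k0; move: s0; rewrite -k0 ks.
have -> : (3 : R) = 1 + 2 by lra.
apply: sums_le_le h _ => k; case: eqP => [->|/eqP k0].
  by rewrite kap0 expr0n /= addr0 invr1 invr0 addr0.
have kp : 0 < kap k ^+ 2.
  by rewrite -(real_normK (num_real (kap k))) exprn_gt0 // (lt_le_trans _ (kap_ge4 k0)).
by rewrite add0r lef_pV2 ?posrE ?kap1_gt0 // lerDr.
Qed.

(** Against coefficients of growth [m], decay of order [m + 1] of the test function leaves the
    summable factor [(1 + kap k ^ 2)^-1], whose sum is at most 3. *)
Lemma pair_sle c m (C B : R) phi : 0 <= C -> (forall k, nc (c k) <= C * (1 + kap k ^+ 2) ^+ m) ->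
  (forall j x, (j <= m.+1.*2)%N -> `|derive1n j (val phi) x| <= B) ->
  sums_le (fun k => `|complex.Re (c k * conjc (fc (val phi) k))|) (3 * (C * (2 * (2 ^+ m.+1 * B)))).
Proof.
move=> C0 hc hB.
have B0 : 0 <= B by apply: le_trans (hB 0%N 0 isT); exact: normr_ge0.
rewrite mulrC; apply: sums_le_le (sums_leZ _ sum_inv1kap) _; first by rewrite !mulr_ge0 // exprn_ge0.
move=> k; apply: (le_trans (nc_Re _)); rewrite normcM nc_conj.
rewrite ler_pdivlMr ?kap1_gt0 //.
have h2 := fc_pow k (@test_smooth phi) (@test_per phi) hB.
have t0 : 0 < 1 + kap k ^+ 2 by exact: kap1_gt0.
move: h2; set t := 1 + kap k ^+ 2 in t0 *; set D := 2 * _ => h2.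
apply: (@le_trans _ _ (C * t ^+ m * nc (fc (val phi) k) * t)).
  by rewrite ler_pM2r // ler_wpM2r ?nc_ge0 // hc.
rewrite (_ : C * t ^+ m * nc (fc (val phi) k) * t = C * (t ^+ m.+1 * nc (fc (val phi) k))).
  by rewrite ler_wpM2l.
by rewrite exprS; ring.
Qed.

Lemma fc_lin_test a phi psi k :
  fc (val (a *: phi + psi)) k = real_complex R a * fc (val phi) k + fc (val psi) k.
Proof. exact: (fc_lin a k (test_integ phi) (test_integ psi)). Qed.

Lemma realize_cvg c phi : polyb c -> pairn c phi @ \oo --> realize c phi.
Proof.
move=> [m [C [C0 hc]]].
have [B hB] : exists B, forall j x, (j <= m.+1.*2)%N -> `|derive1n j (val phi) x| <= B.
  elim: m.+1.*2 => [|p [B IH]].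
    have [B h] := periodic_bounded (smooth_cts (@test_smooth phi)) (@test_per phi).
    by exists B => j x; rewrite leqn0 => /eqP ->; exact: h.
  have [B' h] := periodic_bounded (smooth_cts (@smoothn _ p.+1 (@test_smooth phi))) (@periodicn _ p.+1 (@test_per phi)).
  exists (Num.max B B') => j x; rewrite leq_eqVlt le_max => /orP[/eqP->|/IH ->//].
  by rewrite h orbT.
exact: sum_cvg_abs (pair_sle C0 hc hB).
Qed.

Lemma realize_is_distribution c : polyb c -> is_distribution (realize c).
Proof.
move=> pc; split.
  move=> a phi psi; have h1 := @realize_cvg c phi pc; have h2 := @realize_cvg c psi pc.
  apply: (cvg_unique (@Rhausdorff R) (@realize_cvg c (a *: phi + psi) pc)).
  rewrite (_ : pairn c _ = fun n => a * pairn c phi n + pairn c psi n); last first.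
    apply: funext => n; rewrite /pairn mulr_sumr -big_split; apply: eq_bigr => k _.
    rewrite fc_lin_test; case: (c k) (fc _ k) (fc _ k) => [? ?] [? ?] [? ?] /=; ring.
  exact: (cvgD (cvgM (cvg_cst _) h1) h2).
have [m [C [C0 hc]]] := pc; exists m.+1.*2, (3 * (C * (2 * 2 ^+ m.+1))) => phi B hB.
have hB' j x : (j <= m.+1.*2)%N -> `|derive1n j (val phi) x| <= B by exact: hB.
have hs := pair_sle C0 hc hB'.
have h : (fun n => `|pairn c phi n|) @ \oo --> `|realize c phi|.
  by apply: cvg_norm; exact: (@realize_cvg c phi pc).
rewrite -(cvg_lim (@Rhausdorff R) h); apply: limr_le; first by apply/cvg_ex; eexists; exact: h.
apply: nearW => n; apply: (le_trans (ler_norm_sum _ _ _)).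
by apply: le_trans (hs _ (zr_uniq n)) _; rewrite le_eqVlt; apply/orP; left; apply/eqP; ring.
Qed.

(** A trigonometric test function meets only the modes [k] and [- k]. By conjugate symmetry each of
    them contributes one half of the result, also when they coincide. *)
Lemma fourier_realize c : polyb c -> is_real c -> fourier (realize c) = c.
Proof.
move=> pc rc; apply: funext => k.
have tr a b : val (trig k a b) = (fun x => complex.Re (Complex a (- b) * ee k x)).
  by apply: funext => x; rewrite /ee /cs /sn /kap /=; ring.
have ev a b : realize c (trig k a b) = complex.Re (c k * Complex a b).
  apply: (cvg_unique (@Rhausdorff R) (@realize_cvg c (trig k a b) pc)).
  apply: (@cvg_trans _ ((fun=> complex.Re (c k * Complex a b)) @ \oo)); last exact: cvg_cst.
  apply: near_eq_cvg; near=> n.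
  have kn : (absz k <= n)%N by near: n; exact: nbhs_infty_ge.
  rewrite /pairn; under eq_bigr do rewrite tr fc_ee.
  rewrite (eq_bigr (fun j : int => (if j == k then complex.Re (c k * Complex a b) / 2 else 0)
     + (if j == - k then complex.Re (c k * Complex a b) / 2 else 0))); last first.
    move=> j _; have [->|jk] := eqVneq j k; have [jk'|jk'] := eqVneq _ (- k).
    - have E : c k = conjc (c k) by rewrite -rc -jk'.
      have q0 : complex.Im (c k) = 0.
        by move: (congr1 (@complex.Im R) E); case: (c k) => ? ? /=; lra.
      by case: (c k) q0 => p q /= ->; field.
    - by case: (c k) => ? ? /=; field.
    - by rewrite jk' rc; case: (c k) => ? ? /=; field.
    - by case: (c j) => ? ? /=; field.
  have S1 (X : R) (p : int) : (absz p <= n)%N -> \sum_(j <- zr n) (if j == p then X else 0) = X.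
    move=> pn; rewrite (bigD1_seq p) ?mem_zr ?zr_uniq //= eqxx big1 ?addr0 //.
    by move=> j /negbTE ->.
  by rewrite big_split /= !S1 ?abszN //; field.
rewrite /fourier !ev; case: (c k) => a b /=; congr Complex; ring.
Unshelve. all: by end_near. Qed.

End DistributionExpansion.

(** * Limit theorems for integrals and square-integrable functions *)

Section LebesgueTools.
Context {R : realType}.
Implicit Types (f g h : R -> R) (D : set R) (x : R) (n m : nat).
Local Notation mu := (@lebesgue_measure R).

Lemma RintE D f : measurable D -> integ D f ->
  (\int[mu]_(x in D) (f x)%:E = (\int[mu]_(x in D) f x)%:E)%E.
Proof. by move=> mD hf; rewrite /Rintegral fineK //; exact: integrable_fin_num. Qed.

Lemma nonneg_integ D f (B : R) : measurable D -> measurable_fun D f ->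
  (forall x, D x -> 0 <= f x) -> (\int[mu]_(x in D) (f x)%:E <= B%:E)%E ->
  integ D f /\ \int[mu]_(x in D) f x <= B.
Proof.
move=> mD mf f0 fB.
have hf : integ D f.
  apply/integrableP; split; first exact/measurable_EFinP.
  rewrite (@eq_integral _ _ _ mu D (fun x => (f x)%:E)); first exact: le_lt_trans fB (ltry _).
  by move=> x; rewrite inE => Dx; rewrite /= ger0_norm // f0.
by split=> //; rewrite -lee_fin -RintE.
Qed.

Lemma limn_einf_le (u : nat -> \bar R) (B : \bar R) :
  (forall n, (u n <= B)%E) -> (limn_einf u <= B)%E.
Proof.
move=> h; rewrite limn_einf_lim; apply: lime_le; first exact: is_cvg_einfs.
apply: nearW => n; apply: le_trans (h n).
by apply: ereal_inf_lbound; exists n => /=.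
Qed.

Lemma fatou_real D (s : nat -> R -> R) f (B : R) : measurable D ->
  (forall n, integ D (s n)) -> (forall n x, D x -> 0 <= s n x) ->
  (forall n, \int[mu]_(x in D) s n x <= B) -> measurable_fun D f ->
  (forall x, D x -> 0 <= f x) ->
  {ae mu, forall x, D x -> (fun n => s n x) @ \oo --> f x} ->
  integ D f /\ \int[mu]_(x in D) f x <= B.
Proof.
move=> mD hs s0 hB mf f0 cv; apply: nonneg_integ => //.
have [N [mN N0 hN]] := cv.
have mDN : measurable (D `\` N) by exact: measurableD.
have mfE : measurable_fun D (fun x => (f x)%:E) by exact/measurable_EFinP.
rewrite (@ge0_negligible_integral _ _ _ mu D N) //.
have ms n : measurable_fun (D `\` N) (fun x => (s n x)%:E).
  by apply: measurable_funS (measurable_int mu (hs n)) => // x [].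
have := @fatou _ _ _ mu _ mDN (fun n x => (s n x)%:E) ms (fun n x (Dx : (D `\` N) x) => s0 n x Dx.1).
rewrite (@eq_integral _ _ _ mu (D `\` N) (fun x => (f x)%:E)); last first.
  move=> x; rewrite inE => -[Dx Nx].
  have h : (fun n => (s n x)%:E) @ \oo --> (f x)%:E.
    apply: cvg_EFin; first exact: nearW.
    by apply: contrapT => nh; apply: Nx; apply: hN => /= /(_ Dx).
  by rewrite is_cvg_limn_einfE ?(cvg_lim _ h) //; apply/cvg_ex; eexists; exact: h.
move/le_trans; apply; apply: limn_einf_le => n.
apply: (@le_trans _ _ (\int[mu]_(x in D) (s n x)%:E)%E); last by rewrite RintE // lee_fin.
apply: ge0_subset_integral => //; first exact: measurable_int (hs n).
by move=> x Dx; rewrite lee_fin s0.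
Qed.

(** Beppo Levi: by Fatou the monotone limit, taken as an upper limit in the extended reals so that
    it is measurable, has a finite integral and hence is finite almost everywhere. *)
Lemma bounded_ae D (S : nat -> R -> R) (B : R) : measurable D ->
  (forall n, integ D (S n)) -> (forall x, D x -> 0 <= S 0%N x) ->
  (forall x n m, D x -> (n <= m)%N -> S n x <= S m x) ->
  (forall n, \int[mu]_(x in D) S n x <= B) ->
  {ae mu, forall x, D x -> exists M, forall n, S n x <= M}.
Proof.
move=> mD hS S0 mono hB.
have S0' n x : D x -> 0 <= S n x by move=> Dx; rewrite (le_trans (S0 x Dx)) // mono.
have ms n : measurable_fun D (fun x => (S n x)%:E) by exact: measurable_int (hS n).
pose F x := limn_esup (fun n => (S n x)%:E).
have mF : measurable_fun D F by exact: measurable_fun_limn_esup.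
have cv x : D x -> cvgn (fun n => (S n x)%:E).
  move=> Dx; apply: ereal_nondecreasing_is_cvgn => n m nm; rewrite lee_fin; exact: mono.
have geF n x : D x -> ((S n x)%:E <= F x)%E.
  move=> Dx; rewrite /F is_cvg_limn_esupE; last exact: cv.
  rewrite (cvg_lim _ (ereal_nondecreasing_cvgn _)) //; last first.
    by move=> a b ab; rewrite lee_fin; exact: mono.
  by apply: ereal_sup_ubound; exists n.
have F0 x : D x -> (0 <= F x)%E.
  by move=> Dx; apply: le_trans (geF 0%N x Dx); rewrite lee_fin S0'.
have iF : mu.-integrable D F.
  apply/integrableP; split=> //.
  rewrite (@eq_integral _ _ _ mu D F); last by move=> x; rewrite inE => Dx; rewrite gee0_abs ?F0.
  have := @fatou _ _ _ mu _ mD (fun n x => (S n x)%:E) ms (fun n x Dx => S0' n x Dx).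
  rewrite (@eq_integral _ _ _ mu D F); last first.
    by move=> x; rewrite inE => Dx; rewrite /F is_cvg_limn_einfE ?is_cvg_limn_esupE //; exact: cv.
  move/le_lt_trans; apply; apply: (@le_lt_trans _ _ B%:E); last exact: ltry.
  by apply: limn_einf_le => n; rewrite RintE // lee_fin.
have := @integrable_ae _ _ _ mu D mD F iF.
apply: ae_mono => x h Dx; exists (fine (F x)) => n.
by have := geF n x Dx; rewrite -{1}(fineK (h Dx)) lee_fin.
Qed.

(** The upper limit is measurable whether or not the sequence converges; [fine] supplies a default
    value where it is infinite. *)
Lemma lim_measurable D (s : nat -> R -> R) : measurable D ->
  (forall n, measurable_fun D (s n)) ->
  exists g, measurable_fun D g /\ forall x l, D x -> (fun n => s n x) @ \oo --> l -> g x = l.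
Proof.
move=> mD ms; exists (fun x => fine (limn_esup (fun n => (s n x)%:E))); split.
  apply: (measurableT_comp (f := fine)); first exact: fine_measurable.
  by apply: measurable_fun_limn_esup => n; exact/measurable_EFinP.
move=> x l Dx h.
have {}h : (fun n => (s n x)%:E) @ \oo --> l%:E by apply: cvg_EFin => //; exact: nearW.
by rewrite is_cvg_limn_esupE ?(cvg_lim _ h) //; apply/cvg_ex; eexists; exact: h.
Qed.

Definition sqint D h := measurable_fun D h /\ integ D (fun x => h x ^+ 2).

Lemma sqint_mul D f g : measurable D -> sqint D f -> sqint D g -> integ D (fun x => f x * g x).
Proof.
move=> mD [mf hf] [mg hg].
apply: (@le_integrable _ _ _ mu D mD _ (EFin \o (fun x => f x ^+ 2 + g x ^+ 2))).
- by apply/measurable_EFinP; exact: measurable_funM.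
- move=> x Dx; rewrite /= lee_fin (ger0_norm (x := f x ^+ 2 + g x ^+ 2)) ?addr_ge0 ?sqr_ge0 // ler_norml.
  have := sqr_ge0 (f x + g x); have := sqr_ge0 (f x - g x).
  rewrite sqrrB sqrrD; have := sqr_ge0 (f x); have := sqr_ge0 (g x).
  by move=> h1 h2 h3 h4; apply/andP; split; lra.
- exact: integD.
Qed.

Lemma sqint_lin D a f g : measurable D -> sqint D f -> sqint D g ->
  sqint D (fun x => a * f x + g x).
Proof.
move=> mD [mf hf] [mg hg]; split.
  by apply: measurable_funD => //; apply: measurable_funM => //; exact: measurable_cst.
rewrite (_ : (fun x => _) = (fun x => a ^+ 2 * f x ^+ 2 + ((2 * a) * (f x * g x) + g x ^+ 2))).
  apply: integD => //; first exact: integZ.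
  by apply: integD => //; apply: integZ => //; exact: sqint_mul.
by apply: funext => x; ring.
Qed.

Lemma sqintB D f g : measurable D -> sqint D f -> sqint D g ->
  sqint D (fun x => f x - g x).
Proof.
move=> mD hf hg; have := sqint_lin (-1) mD hg hf; congr (sqint _ _).
by apply: funext => x; rewrite mulN1r addrC.
Qed.

Lemma sqint_mb D h : measurable D -> (mu D < +oo)%E -> mb h -> sqint D h.
Proof.
move=> mD D1 mh; split; first by case: mh => mh _; exact: measurable_funTS.
by apply: integ_mb => //; under eq_fun do rewrite expr2; exact: mbM.
Qed.

Lemma Rint_ge0 D f : (forall x, D x -> 0 <= f x) -> 0 <= \int[mu]_(x in D) f x.
Proof. by move=> f0; exact: Rintegral_ge0. Qed.

(** The polynomial [t^2 A + 2 t B + C] is the integral of a square, hence nonnegative for every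
    [t]. *)
Lemma int_CS D f g : measurable D -> sqint D f -> sqint D g ->
  (\int[mu]_(x in D) (f x * g x)) ^+ 2 <=
    (\int[mu]_(x in D) f x ^+ 2) * (\int[mu]_(x in D) g x ^+ 2).
Proof.
move=> mD hf hg.
set B := \int[mu]_(x in D) (f x * g x); set A := \int[mu]_(x in D) f x ^+ 2; set C := \int[mu]_(x in D) g x ^+ 2.
have q t : 0 <= t ^+ 2 * A + 2 * t * B + C.
  have -> : t ^+ 2 * A + 2 * t * B + C = \int[mu]_(x in D) (t * f x + g x) ^+ 2.
    rewrite (Rint_eq (h := fun x => t ^+ 2 * f x ^+ 2 + ((2 * t) * (f x * g x) + g x ^+ 2))); last by move=> x _; ring.
    have i1 : integ D (fun x => t ^+ 2 * f x ^+ 2) by apply: integZ => //; case: hf.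
    have i2 : integ D (fun x => (2 * t) * (f x * g x)) by apply: integZ => //; exact: sqint_mul.
    have i3 : integ D (fun x => g x ^+ 2) by case: hg.
    rewrite RintD //; last exact: integD.
    rewrite RintD // !RintZ //; [by rewrite addrA|exact: sqint_mul|by case: hf].
  by apply: Rint_ge0 => x _; exact: sqr_ge0.
have A0 : 0 <= A by apply: Rint_ge0 => x _; exact: sqr_ge0.
have C0 : 0 <= C by apply: Rint_ge0 => x _; exact: sqr_ge0.
have [A00|Ap] := eqVneq A 0.
  have [-> |B0] := eqVneq B 0; first by rewrite expr0n /= mulr_ge0.
  (* For [A = 0] the polynomial is affine, and at this [t] it would equal -1. *)
  have := q (- (C + 1) / (2 * B)); rewrite A00 mulr0 add0r.
  have -> : 2 * (- (C + 1) / (2 * B)) * B = - (C + 1) by field.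
  lra.
have {}Ap : 0 < A by rewrite lt_neqAle eq_sym Ap.
have := q (- B / A).
have -> : (- B / A) ^+ 2 * A + 2 * (- B / A) * B + C = C - B ^+ 2 / A by field; rewrite gt_eqF.
by rewrite subr_ge0 ler_pdivrMr // mulrC.
Qed.

End LebesgueTools.

(** * Squares of square-integrable distributions *)

Section RieszFischer.
Context {R : realType}.
Implicit Types (f g h : R -> R) (x : R) (n m : nat) (k : int) (c : int -> R[i]) (phi : test R) (u : dist R).
Local Notation nc := (@normc R).
Local Notation mu := (@lebesgue_measure R).
Local Notation I01 := (`[0, 1]%classic : set R).

Let mI : measurable I01. Proof. exact: measurable_itv. Qed.

Lemma sqint_integ h : sqint I01 h -> integ I01 h.
Proof.
move=> hh; have := sqint_mul mI (sqint_mb mI (mu_itv_lt 0 1) (mb_cst 1)) hh.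
by congr (integ _ _); apply: funext => x /=; rewrite mul1r.
Qed.

Lemma sum_ord_mono (F : nat -> R) n m : (forall j, 0 <= F j) -> (n <= m)%N ->
  \sum_(j < n) F j <= \sum_(j < m) F j.
Proof.
move=> F0 nm; rewrite (big_ord_widen m F nm) [leRHS](bigID (fun j : 'I_m => (j < n)%N)) /=.
by rewrite lerDl sumr_ge0.
Qed.

Lemma sqint_tp c n : sqint I01 (tp c n).
Proof. exact: sqint_mb mI (mu_itv_lt 0 1) (mb_tp c n). Qed.

Lemma int_tp c n g : integ I01 g ->
  \int[mu]_(x in I01) (tp c n x * g x) = \sum_(k <- zr n) complex.Re (c k * conjc (fc g k)).
Proof.
move=> ig.
have sumI (s : seq int) (F : int -> R -> R) : (forall k, integ I01 (F k)) ->
    integ I01 (fun x => \sum_(k <- s) F k x) /\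
    \int[mu]_(x in I01) (\sum_(k <- s) F k x) = \sum_(k <- s) \int[mu]_(x in I01) F k x.
  move=> hF; elim: s => [|k s [IH1 IH2]].
    rewrite big_nil (_ : (fun x => _) = cst 0); last by apply: funext => x; rewrite big_nil.
    split; first exact: integ_mbI (mb_cst _).
    by rewrite (Rint_eq (h := cst 0)) ?Rint_cst ?mul0r // => x _; rewrite big_nil.
  rewrite big_cons (_ : (fun x => _) = (fun x => F k x + \sum_(i <- s) F i x)); last first.
    by apply: funext => x; rewrite big_cons.
  split; first exact: integD.
  by rewrite -IH2 -RintD //; apply: Rint_eq => x _; rewrite big_cons.
have i1 k : integ I01 (fun x => complex.Re (c k * ee k x) * g x) by exact: integ_mulb (mb_ee _ _).
rewrite (Rint_eq (h := fun x => \sum_(k <- zr n) complex.Re (c k * ee k x) * g x)); last first.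
  by move=> x _; rewrite mulr_suml.
rewrite (sumI _ _ i1).2; apply: eq_bigr => k _.
have ic := integ_mulb mI ig (mb_cs k); have is_ := integ_mulb mI ig (mb_sn k).
case: (c k) => a b; rewrite /ee /fc /=.
rewrite (Rint_eq (h := fun x => a * (cs k x * g x) + (- b) * (sn k x * g x))); last by move=> x _; ring.
by rewrite RintD ?RintZ //; [ring|exact: integZ|exact: integZ].
Qed.

Definition cut n c k : R[i] := if (n < absz k)%N then c k else 0.

Lemma tp_diff c n m x : (n <= m)%N -> tp c m x - tp c n x = tp (cut n c) m x.
Proof.
move=> nm; rewrite /tp zr_diff // big_filter big_mkcond; apply: eq_bigr => k _.
by rewrite /cut; case: ifP => // _; rewrite mul0r.
Qed.

Lemma int_tp_sqr c n m (e : R) : is_real c -> (n <= m)%N ->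
  (forall s, uniq s -> (forall k, k \in s -> (n < absz k)%N) -> \sum_(k <- s) nc (c k) ^+ 2 <= e) ->
  \int[mu]_(x in I01) (tp c m x - tp c n x) ^+ 2 <= e.
Proof.
move=> rc nm he.
have rd : is_real (cut n c).
  by move=> k; rewrite /cut abszN; case: ifP => // _; rewrite conjc0.
rewrite (Rint_eq (h := fun x => tp (cut n c) m x * tp (cut n c) m x)); last first.
  by move=> x _; rewrite tp_diff // expr2.
rewrite int_tp; last exact: integ_mbI (mb_tp _ _).
rewrite (eq_big_seq (fun k => nc (cut n c k) ^+ 2)); last first.
  move=> k; rewrite mem_zr => km; rewrite fc_tp // nc_sqr.
  by case: (cut n c k) => a b /=; ring.
apply: le_trans (he [seq k <- zr m | (n < absz k)%N] _ _); last 2 first.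
- exact: filter_uniq (zr_uniq m).
- by move=> k; rewrite mem_filter => /andP[].
rewrite big_filter [leRHS]big_mkcond; apply: ler_sum => k _.
by rewrite /cut; case: ifP => // _; rewrite nc0 expr0n.
Qed.

(** Along a subsequence with rapidly decreasing tails the increments of the partial sums have
    summable L^1 norms, so these sums converge almost everywhere. Fatou's lemma then bounds the L^2
    distance between the limit and every partial sum. *)
Lemma riesz_fischer c (M : R) : is_real c -> norm_le one c M ->
  exists h, sqint I01 h /\ forall e, 0 < e -> exists n0, forall n, (n0 <= n)%N ->
    \int[mu]_(x in I01) (h x - tp c n x) ^+ 2 <= e.
Proof.
move=> rc [M0 hM].
have F0 (k : int) : 0 <= one k * nc (c k) ^+ 2 by rewrite mul1r sqr_ge0.
have tl e : 0 < e -> exists n0, forall s, uniq s -> (forall k, k \in s -> (n0 < absz k)%N) ->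
    \sum_(k <- s) nc (c k) ^+ 2 <= e.
  move=> e0; have [n0 h] := tail_small F0 hM e0; exists n0 => s us hs.
  by apply: le_trans (h s us hs); apply: ler_sum => k _; rewrite mul1r.
(* The square of [2^-j]: Cauchy-Schwarz on the unit interval turns an L^2 norm [2^-j] into the same
   L^1 bound. *)
pose e_ j : R := (4^-1) ^+ j.
have e_0 j : 0 < e_ j by rewrite exprn_gt0.
pose N0 j := projT1 (cid (tl (e_ j) (e_0 j))).
have hN0 j : forall s, uniq s -> (forall k, k \in s -> (N0 j < absz k)%N) ->
    \sum_(k <- s) nc (c k) ^+ 2 <= e_ j by exact: projT2 (cid (tl (e_ j) (e_0 j))).
(* The maxima make the subsequence monotone and let it exceed every index. *)
pose N := fix N j := if j is i.+1 then maxn (N i) (maxn (N0 j) j) else N0 0%N.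
have N0N j : (N0 j <= N j)%N by case: j => //= j; rewrite !leq_max leqnn orbT.
have Nmono i j : (i <= j)%N -> (N i <= N j)%N.
  elim: j => [|j IH]; first by rewrite leqn0 => /eqP ->.
  by rewrite leq_eqVlt => /orP[/eqP->//|/IH /= h]; rewrite (leq_trans h) ?leq_maxl.
have hN j s : uniq s -> (forall k, k \in s -> (N j < absz k)%N) -> \sum_(k <- s) nc (c k) ^+ 2 <= e_ j.
  by move=> us hs; apply: hN0 => // k /hs; exact: leq_ltn_trans.
pose d j x := `|tp c (N j.+1) x - tp c (N j) x|.
have sqd j : sqint I01 (fun x => tp c (N j.+1) x - tp c (N j) x).
  exact: sqintB (sqint_tp c (N j.+1)) (sqint_tp c (N j)).
have id_ j : integ I01 (d j) by exact: integ_norm (sqint_integ (sqd j)).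
have intd j : \int[mu]_(x in I01) d j x <= 2^-1 ^+ j.
  have h := @int_CS _ I01 (d j) (cst 1) mI _ (sqint_mb mI (mu_itv_lt 0 1) (mb_cst 1)).
  have sd : sqint I01 (d j).
    split; first exact: integ_meas (id_ j).
    have [_] := sqd j; congr (integ _ _); apply: funext => x.
    by rewrite /d real_normK ?num_real.
  have {h} := h sd; rewrite [X in _ <= _ * X](Rint_eq (h := cst 1)); last by move=> x _; rewrite expr1n.
  rewrite Rint_cst ?ler01 // subr0 !mulr1.
  rewrite (Rint_eq (h := d j)); last by move=> x _; rewrite mulr1.
  move=> h; rewrite -(ler_pXn2r (n := 2)) ?nnegrE ?exprn_ge0 ?invr_ge0 //; last first.
    by apply: Rint_ge0 => x _; exact: normr_ge0.
  apply: (le_trans h); rewrite (_ : (2^-1 ^+ j) ^+ 2 = e_ j); last first.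
    by rewrite /e_ -exprM mulnC exprM; congr (_ ^+ _); field.
  rewrite (Rint_eq (h := fun x => (tp c (N j.+1) x - tp c (N j) x) ^+ 2)); last first.
    by move=> x _; rewrite /d real_normK ?num_real.
  apply: int_tp_sqr => //; first exact: Nmono.
  exact: hN.
pose S n x := \sum_(j < n) d j x.
have iS n : integ I01 (S n) /\ \int[mu]_(x in I01) S n x <= 2.
  suff [h1 h2] : integ I01 (S n) /\ \int[mu]_(x in I01) S n x <= 2 - 2 * 2^-1 ^+ n.
    by split=> //; apply: (le_trans h2); rewrite gerBl mulr_ge0 // exprn_ge0.
  elim: n => [|n [IH1 IH2]].
    rewrite /S (_ : (fun x => _) = cst 0); last by apply: funext => x; rewrite big_ord0.
    split; first exact: integ_mbI (mb_cst _).
    by rewrite (Rint_eq (h := cst 0)) ?Rint_cst ?mul0r ?expr0 ?mulr1 ?subrr // => x _; rewrite big_ord0.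
  rewrite /S (_ : (fun x => _) = (fun x => S n x + d n x)); last by apply: funext => x; rewrite big_ord_recr.
  split; first exact: integD.
  rewrite RintD //; have := intd n; rewrite exprS; move: IH2; lra.
have bS := @bounded_ae _ I01 S 2 mI (fun n => (iS n).1) _ _ (fun n => (iS n).2).
have S0 x : I01 x -> 0 <= S 0%N x by rewrite /S big_ord0.
have Smono x n m : I01 x -> (n <= m)%N -> S n x <= S m x.
  by move=> _ nm; apply: (sum_ord_mono (F := fun j => d j x)) => // j; exact: normr_ge0.
have {}bS := bS S0 Smono.
have cvae : {ae mu, forall x, I01 x -> cvgn (fun j => tp c (N j) x)}.
  apply: ae_mono bS => x h /h [B hB].
  have cs_ : cvgn (fun n => \sum_(j < n) (tp c (N j.+1) x - tp c (N j) x)).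
    have : cvgn (fun n => \sum_(j < n) (d j x + (tp c (N j.+1) x - tp c (N j) x))).
      apply: nondecreasing_is_cvgn.
        move=> n m nm; apply: (sum_ord_mono (F := fun j => d j x + (tp c (N j.+1) x - tp c (N j) x))) => // j.
        by have := ler_norm (- (tp c (N j.+1) x - tp c (N j) x)); rewrite normrN /d; lra.
      exists (B + B) => _ [n _ <-]; rewrite big_split lerD //; first exact: hB.
      by apply: le_trans (hB n); apply: ler_sum => j _; exact: ler_norm.
    have : cvgn (fun n => \sum_(j < n) d j x).
      by apply: nondecreasing_is_cvgn; [move=> n m nm; apply: (sum_ord_mono (F := fun j => d j x)) => // j; exact: normr_ge0|exists B => _ [n _ <-]; exact: hB].
    move=> /cvg_ex[l1 h1] /cvg_ex[l2 h2].
    have -> : (fun n => \sum_(j < n) (tp c (N j.+1) x - tp c (N j) x)) =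
      (fun n => \sum_(j < n) (d j x + (tp c (N j.+1) x - tp c (N j) x)) - \sum_(j < n) d j x).
      by apply: funext => n; rewrite [X in _ = X - _]big_split /= addrAC subrr add0r.
    by apply/cvg_ex; exists (l2 - l1); apply: cvgB.
  have -> : (fun j => tp c (N j) x) = (fun n => tp c (N 0%N) x + \sum_(j < n) (tp c (N j.+1) x - tp c (N j) x)).
    apply: funext => n; rewrite -(big_mkord predT (fun j => tp c (N j.+1) x - tp c (N j) x)) telescope_sumr //.
    by rewrite addrC subrK.
  by apply: is_cvgD => //; exact: is_cvg_cst.
have [h [mh hh]] := lim_measurable mI (fun j => integ_meas (sqint_integ (sqint_tp c (N j)))).
have {}cvae : {ae mu, forall x, I01 x -> (fun j => tp c (N j) x) @ \oo --> h x}.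
  apply: ae_mono cvae => x cx Ix; have {}cx := cx Ix.
  by rewrite (hh x _ Ix cx).
(* Fatou along the subsequence, started at an index [j0] where it has passed [n]. *)
have est n (e : R) : (forall s, uniq s -> (forall k, k \in s -> (n < absz k)%N) -> \sum_(k <- s) nc (c k) ^+ 2 <= e) ->
   integ I01 (fun x => (h x - tp c n x) ^+ 2) /\ \int[mu]_(x in I01) (h x - tp c n x) ^+ 2 <= e.
  move=> he; pose p := fun j => N (n + j)%N.
  have np : exists j0, (n <= N j0)%N.
    by exists n; case: n {he p} => //= n; rewrite !leq_max leqnn !orbT.
  have [j0 hj0] := np.
  apply: (@fatou_real _ I01 (fun j x => (tp c (N (j + j0)%N) x - tp c n x) ^+ 2)) => //.
  - by move=> j; have [] := sqintB mI (sqint_tp c (N (j + j0)%N)) (sqint_tp c n).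
  - by move=> j x _; exact: sqr_ge0.
  - move=> j; apply: int_tp_sqr => //.
    by rewrite (leq_trans hj0) // Nmono // leq_addl.
  - apply: measurable_funX; apply: measurable_funB => //.
    exact: integ_meas (sqint_integ (sqint_tp c n)).
  - by move=> x _; exact: sqr_ge0.
  - apply: ae_mono cvae => x cx Ix; have {}cx := cx Ix.
    under eq_fun do rewrite expr2; rewrite expr2.
    have h1 : (fun j => tp c (N (j + j0)%N) x - tp c n x) @ \oo --> h x - tp c n x.
      apply: cvgB; last exact: cvg_cst.
      by have := cx; rewrite -(cvg_shiftn j0).
    exact: (cvgM h1 h1).
exists h; split.
  have [n0 hn0] := tl 1 ltr01; have [i0 _] := est _ _ hn0.
  have sq : sqint I01 (fun x => h x - tp c n0 x).
    split=> //; apply: measurable_funB => //.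
    exact: integ_meas (sqint_integ (sqint_tp c n0)).
  have := sqint_lin 1 mI sq (sqint_tp c n0); congr (sqint _ _).
  by apply: funext => x; rewrite mul1r subrK.
move=> e e0; have [n0 hn0] := tl e e0; exists n0 => n nn.
have [] // := est n e _ => s us hs; apply: hn0 => // k /hs; exact: leq_ltn_trans.
Qed.

End RieszFischer.

(** * The square of an L^2 distribution as a convolution *)

Section SquareDensity.
Context {R : realType}.
Implicit Types (f g h : R -> R) (x : R) (n m : nat) (k j : int) (c : int -> R[i]) (phi : test R) (u w : dist R).
Local Notation nc := (@normc R).
Local Notation mu := (@lebesgue_measure R).
Local Notation I01 := (`[0, 1]%classic : set R).

Let mI : measurable I01. Proof. exact: measurable_itv. Qed.

Lemma trigN k (a b : R) : trig (- k) a b = trig k a (- b).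
Proof.
apply: val_inj => /=; apply: funext => x.
have := csN k x; have := snN k x; rewrite /cs /sn /kap => -> ->; ring.
Qed.

Lemma fourier_real u : scalar u -> is_real (fourier u).
Proof.
move=> lu k; rewrite /fourier !trigN oppr0 /= opprK; congr Complex.
have -> : trig k 0 (- 1) = (-1) *: trig k 0 1 :> test R.
  apply: val_inj => /=; apply: funext => x.
  rewrite !fctE /GRing.scale /=; ring.
by rewrite dist_scale // mulN1r opprK.
Qed.

Definition L2lim c h := forall e, 0 < e -> exists n0, forall n, (n0 <= n)%N ->
    \int[mu]_(x in I01) (h x - tp c n x) ^+ 2 <= e.

Lemma weak_lim c h g : sqint I01 h -> L2lim c h -> sqint I01 g ->
  (fun n => \sum_(k <- zr n) complex.Re (c k * conjc (fc g k))) @ \oo --> \int[mu]_(x in I01) (h x * g x).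
Proof.
move=> sh hl sg; set G := \int[mu]_(x in I01) g x ^+ 2.
have G0 : 0 <= G by apply: Rint_ge0 => x _; exact: sqr_ge0.
apply/cvgrPdist_le => e e0.
have d0 : 0 < e ^+ 2 / (G + 1) by rewrite divr_gt0 ?exprn_gt0 // ltr_wpDl.
have [n0 hn0] := hl _ d0; exists n0 => // n /= nn.
rewrite -int_tp; last exact: sqint_integ.
have i1 := sqint_mul mI sh sg; have i2 := sqint_mul mI (sqint_tp c n) sg.
have -> : \int[mu]_(x in I01) (h x * g x) - \int[mu]_(x in I01) (tp c n x * g x) =
    \int[mu]_(x in I01) ((h x - tp c n x) * g x).
  rewrite [RHS](Rint_eq (h := fun x => h x * g x + (-1) * (tp c n x * g x))); last by move=> x _; ring.
  by rewrite RintD ?RintZ ?mulN1r //; exact: integZ.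
rewrite -(ler_pXn2r (n := 2)) ?nnegrE ?(ltW e0) // real_normK ?num_real //.
apply: (le_trans (int_CS mI (sqintB mI sh (sqint_tp c n)) sg)).
apply: (@le_trans _ _ (e ^+ 2 / (G + 1) * G)); first by rewrite ler_wpM2r // hn0.
rewrite mulrAC -mulrA ler_piMr ?sqr_ge0 // ler_pdivrMr ?ltr_wpDl // mul1r lerDl //.
Qed.

Lemma density_sqint u h : is_L2_density u h -> sqint I01 h.
Proof. by case. Qed.

Lemma density_coef u h : is_L2_density u h -> fc h = fourier u.
Proof.
move=> [_ _ hu]; apply: funext => k; rewrite /fc /fourier !hu /=; congr Complex.
  by apply: Rint_eq => x _; rewrite /cs /kap; ring.
by congr (- _); apply: Rint_eq => x _; rewrite /sn /kap; ring.
Qed.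

Lemma density_exists u (M : R) : is_distribution u -> norm_le one (fourier u) M ->
  exists h, is_L2_density u h /\ L2lim (fourier u) h.
Proof.
move=> hu hM; have rc := fourier_real (proj1 hu).
have [h [sh hl]] := riesz_fischer rc hM; exists h; split=> //.
case: (sh) => mh ih; split=> // phi.
have sphi : sqint I01 (val phi).
  by apply: sqint_mb => //; [exact: mu_itv_lt|exact: smooth_mb (@test_smooth _ phi) (@test_per _ phi)].
exact: (cvg_unique (@Rhausdorff R) (@dist_fourier _ u phi hu) (weak_lim sh hl sphi)).
Qed.

(** Holds for every density of [u], because by completeness two densities agree almost everywhere.
    This generality matters, since [dist_sqr] is defined through an unspecified density. *)
Lemma density_parseval u h (M : R) g : is_distribution u -> norm_le one (fourier u) M ->
  is_L2_density u h -> sqint I01 g ->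
  (fun n => \sum_(k <- zr n) complex.Re (fourier u k * conjc (fc g k))) @ \oo --> \int[mu]_(x in I01) (h x * g x).
Proof.
move=> hu hM dh sg; have [h' [dh' hl]] := density_exists hu hM.
have sh := density_sqint dh; have sh' := density_sqint dh'.
have ih := sqint_integ sh; have ih' := sqint_integ sh'.
have ir : integ I01 (fun x => h x - h' x) by exact: sqint_integ (sqintB mI sh sh').
have E (q : R -> R) : mb q -> \int[mu]_(x in I01) (q x * h x) = \int[mu]_(x in I01) (q x * h' x) ->
    \int[mu]_(x in I01) (q x * (h x - h' x)) = 0.
  move=> mq e; have i1 := integ_mulb mI ih mq; have i2 := integ_mulb mI ih' mq.
  rewrite (Rint_eq (h := fun x => q x * h x + (-1) * (q x * h' x))); last by move=> x _; ring.
  by rewrite RintD ?RintZ //; [rewrite e; ring|exact: integZ].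
have cc k : fc h k = fc h' k by rewrite (density_coef dh) (density_coef dh').
have z : {ae mu, forall x, I01 x -> h x - h' x = 0}.
  apply: trig_complete => // k; apply: E; do ?[exact: mb_cs|exact: mb_sn].
    exact: (congr1 (@complex.Re R) (cc k)).
  by apply: oppr_inj; exact: (congr1 (@complex.Im R) (cc k)).
have -> : \int[mu]_(x in I01) (h x * g x) = \int[mu]_(x in I01) (h' x * g x).
  apply: ae_eq_Rint => //; [exact: integ_meas (sqint_mul mI sh sg)|exact: integ_meas (sqint_mul mI sh' sg)|].
  by apply: ae_mono z => x e Ix; move/eqP: (e Ix); rewrite subr_eq0 => /eqP ->.
exact: weak_lim.
Qed.

Lemma sqint_mulb q h : mb q -> sqint I01 h -> sqint I01 (fun x => h x * q x).
Proof.
move=> mq [mh ih]; split.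
  by apply: measurable_funM => //; case: mq => mq _; exact: measurable_funTS.
have := integ_mulb mI ih (mbM mq mq); congr (integ _ _); apply: funext => x; ring.
Qed.

(** Parseval for [h] against [h * cs k] and [h * sn k], whose coefficients are half sums and half
    differences of shifted coefficients of [h]. The limits are the convolutions at [k] and [- k],
    which are conjugate to each other. *)
Lemma density_conv u h (M : R) k : is_distribution u -> norm_le one (fourier u) M ->
  is_L2_density u h ->
  \int[mu]_(x in I01) (h x * (h x * cs k x)) = complex.Re (conv (fourier u) (fourier u) k) /\
  \int[mu]_(x in I01) (h x * (h x * sn k x)) = - complex.Im (conv (fourier u) (fourier u) k).
Proof.
move=> hu hM dh; have sh := density_sqint dh; have ih := sqint_integ sh.
have rc := fourier_real (proj1 hu); have ec := density_coef dh.
have Ic j := integ_mulb mI ih (mb_cs j); have Is j := integ_mulb mI ih (mb_sn j).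
set c := fourier u in rc ec hM *.
have rcv := conv_real hM hM rc rc.
have fcc j : fc (fun x => h x * cs k x) j = real_complex R (2^-1) * (c (j - k) + c (j + k)).
  rewrite -ec /fc /=; congr Complex.
    rewrite (Rint_eq (h := fun x => 2^-1 * (cs (j - k) x * h x) + 2^-1 * (cs (j + k) x * h x))).
      by rewrite RintD ?RintZ //; [ring|exact: integZ|exact: integZ].
    by move=> x _; rewrite !csD csN snN; field.
  rewrite (Rint_eq (h := fun x => 2^-1 * (sn (j - k) x * h x) + 2^-1 * (sn (j + k) x * h x))).
    by rewrite RintD ?RintZ //; [ring|exact: integZ|exact: integZ].
  by move=> x _; rewrite !snD csN snN; field.
have fcs j : fc (fun x => h x * sn k x) j = Complex 0 (2^-1) * (c (j + k) - c (j - k)).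
  rewrite -ec /fc /=; congr Complex.
    rewrite (Rint_eq (h := fun x => 2^-1 * (sn (j + k) x * h x) + (- 2^-1) * (sn (j - k) x * h x))).
      by rewrite RintD ?RintZ //; [ring|exact: integZ|exact: integZ].
    by move=> x _; rewrite !snD csN snN; field.
  rewrite (Rint_eq (h := fun x => 2^-1 * (cs (j - k) x * h x) + (- 2^-1) * (cs (j + k) x * h x))).
    by rewrite RintD ?RintZ //; [ring|exact: integZ|exact: integZ].
  by move=> x _; rewrite !csD csN snN; field.
have cj j : conjc (c (j - k)) = c (k - j) by rewrite -rc opprB.
have cj' j : conjc (c (j + k)) = c (- k - j) by rewrite -rc opprD addrC.
have cv := conv_cvg k hM hM; have cvN := conv_cvg (- k) hM hM.
split.
  have h1 := density_parseval hu hM dh (sqint_mulb (mb_cs k) sh).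
  apply: (cvg_unique (@Rhausdorff R) h1).
  have h2 := cvgD (cvgM (@cvg_cst _ (2^-1 : R) _ \oo _) (ccvg_Re cv)) (cvgM (@cvg_cst _ (2^-1 : R) _ \oo _) (ccvg_Re cvN)).
  rewrite (_ : complex.Re _ = 2^-1 * complex.Re (conv c c k) + 2^-1 * complex.Re (conv c c (- k))); last first.
    by rewrite rcv; case: (conv c c k) => a b /=; field.
  rewrite (_ : (fun n => _) = (fun n => 2^-1 * complex.Re (\sum_(j <- zr n) c j * c (k - j)) +
      2^-1 * complex.Re (\sum_(j <- zr n) c j * c (- k - j)))); first exact: h2.
  apply: funext => n; rewrite !Re_sum !mulr_sumr -big_split; apply: eq_bigr => j _.
  rewrite fcc -cj -cj' -/c; case: (c j) (c (j - k)) (c (j + k)) => [? ?] [? ?] [? ?] /=; ring.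
have h1 := density_parseval hu hM dh (sqint_mulb (mb_sn k) sh).
apply: (cvg_unique (@Rhausdorff R) h1).
have h2 := cvgD (cvgM (@cvg_cst _ (- 2^-1 : R) _ \oo _) (ccvg_Im cv)) (cvgM (@cvg_cst _ (2^-1 : R) _ \oo _) (ccvg_Im cvN)).
rewrite (_ : - complex.Im _ = - 2^-1 * complex.Im (conv c c k) + 2^-1 * complex.Im (conv c c (- k))); last first.
  by rewrite rcv; case: (conv c c k) => a b /=; field.
rewrite (_ : (fun n => _) = (fun n => - 2^-1 * complex.Im (\sum_(j <- zr n) c j * c (k - j)) +
    2^-1 * complex.Im (\sum_(j <- zr n) c j * c (- k - j)))); first exact: h2.
apply: funext => n; rewrite !Im_sum !mulr_sumr -big_split; apply: eq_bigr => j _.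
rewrite fcs -cj -cj' -/c; case: (c j) (c (j - k)) (c (j + k)) => [? ?] [? ?] [? ?] /=; ring.
Qed.

Lemma dist_sqrP u (M : R) : is_distribution u -> norm_le one (fourier u) M ->
  is_distribution (dist_sqr u) /\ fourier (dist_sqr u) = conv (fourier u) (fourier u).
Proof.
move=> hu hM; have [h0 [dh0 _]] := density_exists hu hM.
have : [set w | exists h, is_L2_density u h /\
    forall phi, w phi = \int[mu]_(x in `[0, 1]) (h x ^+ 2 * val phi x)] (dist_sqr u).
  (* The defining set is inhabited, so [xget] returns one of its members and not the default; what
     follows uses only the defining property. *)
  by apply: xgetPex; exists (fun phi => \int[mu]_(x in `[0, 1]) (h0 x ^+ 2 * val phi x)), h0.
move=> [h [dh hw]]; have [_ ih2] := density_sqint dh.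
have ip phi : integ I01 (fun x => h x ^+ 2 * val phi x).
  have := integ_mulb mI ih2 (smooth_mb (@test_smooth _ phi) (@test_per _ phi)).
  by congr (integ _ _); apply: funext => x; rewrite mulrC.
split; first split.
- move=> a phi psi; rewrite !hw.
  rewrite (Rint_eq (h := fun x => a * (h x ^+ 2 * val phi x) + h x ^+ 2 * val psi x)).
    by rewrite RintD ?RintZ //; exact: integZ.
  move=> x _; have -> : val (a *: phi + psi) x = a * val phi x + val psi x by [].
  by ring.
- exists 0%N, (\int[mu]_(x in I01) h x ^+ 2) => phi B hB; rewrite hw.
  apply: (le_trans (Rint_norm mI (ip phi))); rewrite mulrC -RintZ //.
  apply: Rint_le => //; [exact: integ_norm|exact: integZ|].
  move=> x _; rewrite normrM (ger0_norm (sqr_ge0 _)) mulrC ler_wpM2r ?sqr_ge0 //.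
  exact: (hB 0%N).
apply: funext => k; have [h1 h2] := density_conv k hu hM dh.
rewrite /fourier !hw; rewrite (_ : conv _ _ k = Complex (complex.Re (conv (fourier u) (fourier u) k)) (complex.Im (conv (fourier u) (fourier u) k))); last by case: (conv _ _ k).
congr Complex.
  by rewrite -h1; apply: Rint_eq => x _; rewrite /cs /kap /=; ring.
by rewrite -[RHS]opprK -h2; congr (- _); apply: Rint_eq => x _; rewrite /sn /kap /=; ring.
Qed.

End SquareDensity.

(** * Sobolev norms, resolvent and semigroup *)

Section Sobolev.
Context {R : realType}.
Implicit Types (l M e a : R) (k : int) (u v w : dist R) (phi : test R) (c : int -> R[i]).
Local Notation nc := (@normc R).
Local Notation rc := (real_complex R).

Let k1p k : 0 < 1 + kap k ^+ 2 :> R. Proof. exact: kap1_gt0. Qed.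
Let k1n k : 1 + kap k ^+ 2 != 0 :> R. Proof. by rewrite gt_eqF // kap1_gt0. Qed.
Let k1le k : 1 <= 1 + kap k ^+ 2 :> R. Proof. by rewrite lerDl sqr_ge0. Qed.

Lemma poweR_half_le (x : \bar R) M : (0 <= x)%E -> 0 <= M ->
  (x `^ 2^-1 <= M%:E)%E = (x <= (M ^+ 2)%:E)%E.
Proof.
move=> x0 M0; rewrite poweR12_sqrt //; case: x x0 => [r| |] //=; rewrite ?lee_fin => r0.
by rewrite -[in RHS](sqr_sqrtr r0) ler_pXn2r // nnegrE ?sqrtr_ge0.
Qed.

(** The bridge between the extended-real norm of the statement and the real bounds on finite sums in
    which all estimates are made. *)
Lemma sob_le l u M : 0 <= M ->
  (sobolev_norm l u <= M%:E)%E <-> norm_le (om l) (fourier u) M.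
Proof.
move=> M0; rewrite /sobolev_norm poweR_half_le //; last first.
  by apply: esum_ge0 => k _; rewrite lee_fin mulr_ge0 ?sqr_ge0 ?powR_ge0.
split=> [h|[_ h]].
  split=> // s us.
  have hs : (\sum_(k \in [set` s]) (om l k * nc (fourier u k) ^+ 2)%:E <= (M ^+ 2)%:E)%E.
    apply: le_trans h; apply: ereal_sup_ubound; exists [set` s] => //.
    by split=> //; exact: finite_seq.
  by move: hs; rewrite -fsbig_seq // sumEFin lee_fin.
apply: ge_ereal_sup => _ [A [fA _] <-].
by rewrite fsbig_finite //= sumEFin lee_fin; apply: h; exact: finmap.fset_uniq.
Qed.

Lemma sobolev_ge0 l u : (0 <= sobolev_norm l u)%E.
Proof. exact: poweR_ge0. Qed.

Lemma sob_cvg0 l (T : Type) (F : set_system T) (g : T -> dist R) : Filter F ->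
  (sobolev_norm l (g t) @[t --> F] --> 0%E) <->
  (forall e, 0 < e -> \forall t \near F, norm_le (om l) (fourier (g t)) e).
Proof.
move=> FF; split=> [/fine_cvgP[fin /cvgrPdist_le h] e e0|h].
  have := h _ e0; apply: filterS2 fin => t ft; rewrite sub0r normrN => he.
  apply/sob_le; first exact: ltW.
  by rewrite -(fineK ft) lee_fin; apply: le_trans he; exact: ler_norm.
have hle e : 0 < e -> \forall t \near F, (sobolev_norm l (g t) <= e%:E)%E.
  by move=> e0; have := h _ e0; apply: filterS => t; rewrite -sob_le // ltW.
apply/fine_cvgP; split.
  have := hle 1 ltr01; apply: filterS => t ht.
  by rewrite ge0_fin_numE ?sobolev_ge0 //; apply: le_lt_trans ht _; rewrite ltry.
apply/cvgrPdist_le => e e0; have := hle _ e0; apply: filterS => t ht.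
have ft : sobolev_norm l (g t) \is a fin_num.
  by rewrite ge0_fin_numE ?sobolev_ge0 //; apply: le_lt_trans ht _; rewrite ltry.
rewrite sub0r normrN ger0_norm; last exact: fine_ge0 (sobolev_ge0 _ _).
by rewrite -lee_fin (fineK ft).
Qed.

Lemma sob_lty l u : (sobolev_norm l u < +oo)%E <-> exists M, norm_le (om l) (fourier u) M.
Proof.
split=> [h|[M hM]]; last first.
  by apply: le_lt_trans (ltry M); apply/sob_le => //; case: hM.
exists (fine (sobolev_norm l u)); apply/sob_le; first exact: fine_ge0 (sobolev_ge0 _ _).
by rewrite fineK // ge0_fin_numE // sobolev_ge0.
Qed.

Lemma HperP l u : Hper l u <-> is_distribution u /\ exists M, norm_le (om l) (fourier u) M.
Proof. by split=> -[du /sob_lty h]. Qed.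

Lemma fourier_lin a u v k : fourier (a *: u + v) k = rc a * fourier u k + fourier v k.
Proof.
apply/eqP; rewrite eq_complex /= !fctE /GRing.scale /=.
by apply/andP; split; apply/eqP; ring.
Qed.

Lemma fourier0 k : fourier (0 : dist R) k = 0.
Proof. by rewrite /fourier /=; congr Complex; rewrite oppr0. Qed.
Lemma fourierZ a u k : fourier (a *: u) k = rc a * fourier u k.
Proof. by have := fourier_lin a u 0 k; rewrite addr0 fourier0 addr0. Qed.
Lemma fourierD u v k : fourier (u + v) k = fourier u k + fourier v k.
Proof. by have := fourier_lin 1 u v k; rewrite scale1r rmorph1 mul1r. Qed.
Lemma fourierN u k : fourier (- u) k = - fourier u k.
Proof. by rewrite -scaleN1r fourierZ rmorphN1 mulN1r. Qed.
Lemma fourierB u v k : fourier (u - v) k = fourier u k - fourier v k.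
Proof. by rewrite fourierD fourierN. Qed.

Lemma is_dist_lin a u v : is_distribution u -> is_distribution v ->
  is_distribution (a *: u + v).
Proof.
move=> [lu [N [C hC]]] [lv [N' [C' hC']]]; split.
  move=> b phi psi; rewrite !fctE (lu b phi psi) (lv b phi psi) /GRing.scale /=; ring.
exists (maxn N N'), (`|a| * C + C') => phi B hB; rewrite !fctE /GRing.scale /=.
rewrite mulrDl; apply: (le_trans (ler_normD _ _)); rewrite lerD //.
  rewrite normrM -mulrA ler_wpM2l //; apply: hC => j x jN; apply: hB.
  by rewrite leq_max jN.
by apply: hC' => j x jN; apply: hB; rewrite leq_max jN orbT.
Qed.

Lemma is_dist0 : is_distribution (0 : dist R).
Proof.
split; first by move=> b phi psi; rewrite /GRing.scale /= mulr0 addr0.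
by exists 0%N, 0 => phi B _; rewrite normr0 mul0r.
Qed.
Lemma is_distZ a u : is_distribution u -> is_distribution (a *: u).
Proof. by move=> du; have := is_dist_lin a du is_dist0; rewrite addr0. Qed.
Lemma is_distD u v : is_distribution u -> is_distribution v -> is_distribution (u + v).
Proof. by move=> du dv; have := is_dist_lin 1 du dv; rewrite scale1r. Qed.
Lemma is_distB u v : is_distribution u -> is_distribution v -> is_distribution (u - v).
Proof. by move=> du dv; rewrite addrC -scaleN1r; exact: is_dist_lin. Qed.

Lemma dist_ext u v : is_distribution u -> is_distribution v ->
  fourier u = fourier v -> u = v.
Proof.
move=> du dv e; apply: funext => phi; have h := dist_fourier (phi := phi) du.
by rewrite e in h; exact: (cvg_unique (@Rhausdorff R) h (dist_fourier (phi := phi) dv)).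
Qed.

Lemma test_derive_lin a phi psi :
  test_derive (a *: phi + psi) = a *: test_derive phi + test_derive psi.
Proof.
by apply: val_inj; exact: (derive1n_linear a 1 (@test_smooth _ phi) (@test_smooth _ psi)).
Qed.

Lemma is_dist_dx u : is_distribution u -> is_distribution (dx u).
Proof.
move=> [lu [N [C hC]]]; split.
  move=> a phi psi; rewrite /dx test_derive_lin (lu a) /GRing.scale /=; ring.
exists N.+1, C => phi B hB; rewrite /dx normrN; apply: hC => j x jN /=.
by rewrite -derive1Sn; exact: hB.
Qed.

Lemma test_derive_trig k (a b : R) :
  test_derive (trig k a b) = trig k (b * kap k) (- (a * kap k)) :> test R.
Proof.
apply: val_inj => /=; apply: funext => x; rewrite derive1E.
have -> : (fun x : R => a * cos (2 * pi * k%:~R * x) + b * sin (2 * pi * k%:~R * x))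
          = (fun x => a * cs k x + b * sn k x) by [].
have hc := is_derive_cs k x; have hs := is_derive_sn k x.
have h : is_derive x 1 (fun x => a * cs k x + b * sn k x)
   (a * (- (kap k * sn k x)) + b * (kap k * cs k x)).
  by apply: is_derive_eq; rewrite /GRing.scale /=; ring.
rewrite (@derive_val _ _ _ _ _ _ _ h) /cs /sn /kap; ring.
Qed.

Lemma fourier_dx u k : scalar u -> fourier (dx u) k = Complex 0 (kap k) * fourier u k.
Proof.
move=> lu; rewrite /fourier /dx !test_derive_trig !mul0r !mul1r oppr0.
rewrite (trig_split k 0 (- kap k)) (trig_split k (kap k) 0) !scale0r addr0 add0r.
rewrite !dist_scale //; apply/eqP; rewrite eq_complex /=.
by apply/andP; split; apply/eqP; ring.
Qed.

(** For negative [l] the weight decays, but only polynomially; [m] is an integer above [- l / 2]. *)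
Lemma polyb_nle l c M : norm_le (om l) c M -> polyb c.
Proof.
move=> h; have M0 : 0 <= M by case: h.
have [m hmm] : exists m : nat, - (l / 2) <= m%:R.
  exists (Num.bound `|l / 2|); apply: (le_trans (y := `|l / 2|)).
    by rewrite -normrN ler_norm.
  by rewrite ltW // archi_boundP.
exists m, M; split=> // k.
have hk : hm l k * nc (c k) <= M.
  rewrite -(ler_pXn2r (n := 2)) ?nnegrE ?mulr_ge0 ?hm_ge0 ?nc_ge0 //.
  by rewrite exprMn hm_sqr; exact: norm_le_coef h.
apply: (@le_trans _ _ (M * (1 + kap k ^+ 2) `^ (- (l / 2)))).
  by rewrite powRN ler_pdivlMr ?powR_gt0 ?kap1_gt0 // mulrC.
rewrite ler_wpM2l // -(powR_mulrn m (ltW (k1p k))).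
by rewrite ler_powR.
Qed.

(** A solution is obtained by dividing the coefficients by [1 + kap k ^ 2] and realizing the result,
    so the [xget] in [resolvent] yields a solution of the equation. *)
Lemma resolvent_ex w : is_distribution w -> polyb (fourier w) ->
  is_distribution (resolvent w) /\ resolvent w - dx (dx (resolvent w)) = w.
Proof.
move=> dw pw; have rw := fourier_real (proj1 dw).
pose c k := rc (1 + kap k ^+ 2)^-1 * fourier w k.
have pc : polyb c.
  case: pw => m [C [C0 h]]; exists m, C; split=> // k; rewrite normcM nc_real.
  apply: le_trans (h k); rewrite -[leRHS]mul1r ler_wpM2r ?nc_ge0 //.
  rewrite ger0_norm ?invr_ge0 ?(ltW (k1p _)) // invf_le1 ?k1p //.
have rc' : is_real c.
  move=> k; rewrite /c kapN sqrrN rw; case: (fourier w k) => x y /=.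
  by congr Complex; ring.
have dc := realize_is_distribution pc; have fcc := fourier_realize pc rc'.
suff h : [set v | is_distribution v /\ v - dx (dx v) = w] (resolvent w) by [].
apply: xgetPex; exists (realize c); split=> //.
apply: dist_ext => //; first by apply: is_distB => //; do 2 apply: is_dist_dx.
apply: funext => k; rewrite fourierB fourier_dx; last by case: (is_dist_dx dc).
rewrite fourier_dx; last by case: dc.
rewrite fcc /c; case: (fourier w k) => x y; have k1 := k1p k.
apply/eqP; rewrite eq_complex /=; apply/andP; split; apply/eqP; field;
 exact: k1n.
Qed.

Lemma fourier_resolvent w k : is_distribution w -> polyb (fourier w) ->
  fourier (resolvent w) k = rc (1 + kap k ^+ 2)^-1 * fourier w k.
Proof.
move=> dw pw; have [dr e] := resolvent_ex dw pw.
rewrite -[in RHS]e fourierB fourier_dx; last by case: (is_dist_dx dr).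
rewrite fourier_dx; last by case: dr.
case: (fourier _ k) => x y; have k1 := k1p k.
apply/eqP; rewrite eq_complex /=; apply/andP; split; apply/eqP; field;
 exact: k1n.
Qed.

(** The symbol [- (beta + gamma kap^2 + i kap) / (1 + kap^2)] of [opA beta gamma]. *)
Definition lamA (beta gamma : R) k : R[i] :=
  Complex (- ((beta + gamma * kap k ^+ 2) / (1 + kap k ^+ 2))) (- (kap k / (1 + kap k ^+ 2))).

Lemma polyb_le c c' C n : 0 <= C -> (forall k, nc (c' k) <= C * (1 + kap k ^+ 2) ^+ n * nc (c k)) ->
  polyb c -> polyb c'.
Proof.
move=> C0 h [m [D [D0 hD]]]; exists (n + m)%N, (C * D); split; first exact: mulr_ge0.
move=> k; apply: (le_trans (h k)).
have h0 : 0 <= C * (1 + kap k ^+ 2) ^+ n by rewrite mulr_ge0 // exprn_ge0 // ltW // kap1_gt0.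
by apply: (le_trans (ler_wpM2l h0 (hD k))); rewrite exprD mulrACA.
Qed.

Lemma polybD c c' : polyb c -> polyb c' -> polyb (fun k => c k + c' k).
Proof.
move=> [m [C [C0 hC]]] [n [D [D0 hD]]]; exists (maxn m n), (C + D); split; first exact: addr_ge0.
move=> k; apply: (le_trans (ncD _ _)); rewrite mulrDl.
have k1 := k1le k.
apply: lerD.
  by apply: (le_trans (hC k)); rewrite ler_wpM2l // ler_weXn2l // leq_maxl.
by apply: (le_trans (hD k)); rewrite ler_wpM2l // ler_weXn2l // leq_maxr.
Qed.

Lemma opA_coef beta gamma v : is_distribution v -> polyb (fourier v) ->
  is_distribution (opA beta gamma v) /\
  forall k, fourier (opA beta gamma v) k = lamA beta gamma k * fourier v k.
Proof.
move=> dv pv; have ddv := is_dist_dx dv; have dddv := is_dist_dx ddv.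
have fw j : fourier (- dx v - beta *: v + gamma *: dx (dx v)) j =
   Complex (- (beta + gamma * kap j ^+ 2)) (- kap j) * fourier v j.
  rewrite fourierD fourierB fourierN !fourierZ !fourier_dx; try by [case: ddv|case: dv].
  case: (fourier v j) => x y; apply/eqP; rewrite eq_complex /=.
  by apply/andP; split; apply/eqP; ring.
have dw : is_distribution (- dx v - beta *: v + gamma *: dx (dx v)).
  apply: is_distD; last exact: is_distZ.
  by apply: is_distB; [rewrite -scaleN1r; exact: is_distZ|exact: is_distZ].
have pw : polyb (fourier (- dx v - beta *: v + gamma *: dx (dx v))).
  apply: (@polyb_le (fourier v) _ (`|beta| + `|gamma| + 1) 1%N) => // j.
  rewrite fw normcM expr1 ler_wpM2r ?nc_ge0 //; apply: (le_trans (nc_le _)) => /=.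
  rewrite !normrN; move: (kap j) => x.
  have := ler_normD beta (gamma * x ^+ 2); rewrite normrM (ger0_norm (sqr_ge0 x)).
  have x2 : `|x| <= 1 + x ^+ 2.
    by rewrite -(real_normK (num_real x)); have := sqr_ge0 (`|x| - 1); nra.
  have := normr_ge0 beta; have := normr_ge0 gamma; have := sqr_ge0 x; nra.
split=> [|k]; first exact: (proj1 (resolvent_ex dw pw)).
rewrite /opA fourier_resolvent // fw /lamA; case: (fourier v k) => x y; have k1 := k1p k.
apply/eqP; rewrite eq_complex /=; apply/andP; split; apply/eqP; field;
 exact: k1n.
Qed.

Lemma lamA_real beta gamma : is_real (lamA beta gamma).
Proof. by move=> k; rewrite /lamA kapN sqrrN /= mulNr opprK. Qed.

Lemma lamA_le beta gamma k : nc (lamA beta gamma k) <= `|beta| + `|gamma| + 1.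
Proof.
apply: (le_trans (nc_le _)) => /=; rewrite !normrN (normrM (beta + _)) (normrM (kap k)) normfV.
have k1 := k1p k; rewrite (gtr0_norm k1) -mulrDl ler_pdivrMr //.
move: (kap k) k1 => x k1.
have := ler_normD beta (gamma * x ^+ 2); rewrite normrM (ger0_norm (sqr_ge0 x)).
have x2 : `|x| <= 1 + x ^+ 2.
  by rewrite -(real_normK (num_real x)); have := sqr_ge0 (`|x| - 1); nra.
have := mulr_ge0 (normr_ge0 beta) (sqr_ge0 x); have := normr_ge0 beta.
have := normr_ge0 gamma; have := sqr_ge0 x; nra.
Qed.

(** With [x = kap k ^ 2], the function [(beta + gamma x) / (1 + x)] is monotone on [x >= 4 pi^2],
    hence at least the smaller of its value at [4 pi^2] and its limit [gamma]. The assumption on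
    [gamma] says that both are positive. *)
Lemma lamA_neg beta gamma : Num.max 0 (- (beta / (4 * pi ^+ 2))) < gamma ->
  exists2 c : R, 0 < c & forall k, k != 0 -> complex.Re (lamA beta gamma k) <= - c.
Proof.
rewrite gt_max => /andP[g0 hg].
set P : R := 4 * pi ^+ 2.
have P0 : 0 < P by rewrite mulr_gt0 // exprn_gt0 // pi_gt0.
have bg : 0 < beta + P * gamma.
  by have := hg; rewrite ltrNl ltr_pdivlMr // -/P; lra.
exists (Num.min gamma ((beta + P * gamma) / (1 + P))).
  by rewrite lt_min g0 divr_gt0 // addr_gt0.
move=> k k0; have k1 := k1p k; rewrite /lamA [complex.Re _]/= lerN2.
have hk : P <= kap k ^+ 2.
  have k2 : 1 <= (k%:~R : R) ^+ 2.
    by rewrite -rmorphXn /= -[1]/(1%:~R) ler_int -gtz0_ge1 exprn_even_gt0.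
  rewrite /kap; have -> : (2 * pi * k%:~R) ^+ 2 = P * k%:~R ^+ 2 by rewrite /P; ring.
  by rewrite ler_peMr // ltW.
move: (kap k ^+ 2) hk k1 => x hk k1; have P1 : 0 < 1 + P by lra.
rewrite ge_min; have [h|h] := leP gamma beta.
  by rewrite ler_pdivlMr // (_ : gamma * (1 + x) <= _) //; nra.
apply/orP; right; rewrite ler_pdivrMr // [leRHS]mulrAC ler_pdivlMr //.
nra.
Qed.

Lemma norm_le_resolvent l c M : norm_le (om (l - 2)) c M ->
  norm_le (om l) (fun k => rc (1 + kap k ^+ 2)^-1 * c k) M.
Proof.
move=> [M0 h]; split=> //; apply: sums_le_le h _ => k.
rewrite normcM nc_real exprMn mulrA ler_wpM2r ?sqr_ge0 //.
have k1 := k1p k; rewrite /om real_normK ?num_real // powRB; last first.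
  by apply/implyP => _; rewrite k1n.
rewrite -[X in _ / X]/(_ `^ (2%:R)) powR_mulrn ?(ltW k1) // exprVn.
by rewrite mulrC.
Qed.

Lemma forcing_coef l f u M D : 0 <= l -> is_distribution f -> norm_le (om (l - 2)) (fourier f) D ->
  is_distribution u -> norm_le (om l) (fourier u) M ->
  is_distribution (resolvent (f - u_ux u)) /\
  forall k, fourier (resolvent (f - u_ux u)) k =
    rc (1 + kap k ^+ 2)^-1 * fourier f k + Nl (fourier u) (fourier u) k.
Proof.
move=> l0 df hf du hu; have hu1 := om_one l0 hu.
have [dq fq] := dist_sqrP du hu1.
have dux : is_distribution (u_ux u) by apply: is_distZ; exact: is_dist_dx.
have fux k : fourier (u_ux u) k = Complex 0 (kap k / 2) * conv (fourier u) (fourier u) k.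
  rewrite fourierZ fourier_dx; last by case: dq.
  rewrite fq; case: (conv _ _ k) => x y; apply/eqP; rewrite eq_complex /=.
  by apply/andP; split; apply/eqP; field.
have pw : polyb (fourier (f - u_ux u)).
  rewrite (_ : fourier _ = fun k => fourier f k + - fourier (u_ux u) k); last first.
    by apply: funext => k; rewrite fourierB.
  apply: polybD; first exact: polyb_nle hf.
  have p1 : polyb (fun=> rc (M * M)).
    exists 0%N, `|M * M|; split=> // k; first by rewrite nc_real expr0 mulr1.
  apply: (polyb_le (n := 1) _ _ p1) => [|k]; first exact: ler01.
  rewrite ncN fux normcM nc_imag expr1 mul1r nc_real.
  apply: ler_pM; rewrite ?nc_ge0 ?normr_ge0 //.
    rewrite normrM (@ger0_norm _ (2^-1)) //; move: (kap k) => x.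
    rewrite -(real_normK (num_real x)); have := sqr_ge0 (`|x| - 1); nra.
  by apply: (le_trans (conv_le k hu1 hu1)); exact: ler_norm.
have dw := is_distB df dux.
split; first exact: (proj1 (resolvent_ex dw pw)).
move=> k; rewrite fourier_resolvent // fourierB mulrBr; congr (_ + _).
rewrite fux /Nl /rk; case: (conv _ _ k) => x y; have k1 := k1p k.
apply/eqP; rewrite eq_complex /=; apply/andP; split; apply/eqP; field;
 exact: k1n.
Qed.

End Sobolev.

(** * Exponentials of the symbols *)

Section ComplexExponential.
Context {R : realType}.
Implicit Types (z : R[i]) (t s h B : R).
Local Notation nc := (@normc R).
Local Notation rc := (real_complex R).

Definition cexp z t : R[i] :=
  Complex (expR (complex.Re z * t) * cos (complex.Im z * t))
          (expR (complex.Re z * t) * sin (complex.Im z * t)).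

Lemma cexp0 z : cexp z 0 = 1.
Proof. by rewrite /cexp !mulr0 expR0 cos0 sin0 mulr1 mulr0. Qed.

Lemma cexpD z s t : cexp z (s + t) = cexp z s * cexp z t.
Proof.
rewrite /cexp !mulrDr expRD cosD sinD; apply/eqP; rewrite eq_complex /=.
by apply/andP; split; apply/eqP; ring.
Qed.

Lemma cexp_conj z t : cexp (conjc z) t = conjc (cexp z t).
Proof. by case: z => a b; rewrite /cexp /= mulNr cosN sinN mulrN. Qed.

Lemma nc_cexp z t : nc (cexp z t) = expR (complex.Re z * t).
Proof.
rewrite -[RHS]ger0_norm ?expR_ge0 // -sqrtr_sqr /cexp /=; congr Num.sqrt.
by rewrite !exprMn -mulrDr cos2Dsin2 mulr1.
Qed.

Lemma nc_cexp_le1 z t : complex.Re z <= 0 -> 0 <= t -> nc (cexp z t) <= 1.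
Proof. by move=> z0 t0; rewrite nc_cexp -expR0 ler_expR mulr_le0_ge0. Qed.

Lemma is_derive_cexp z t :
  is_derive t 1 (fun t => complex.Re (cexp z t)) (complex.Re (z * cexp z t)) /\
  is_derive t 1 (fun t => complex.Im (cexp z t)) (complex.Im (z * cexp z t)).
Proof.
case: z => a b; rewrite /cexp /=.
have dl c : is_derive t 1 (fun y : R => c * y) c.
  by apply: is_derive_eq; rewrite /GRing.scale /= mulr1.
have de : is_derive t 1 (fun y : R => expR (a * y)) (expR (a * t) * a).
  by have := dl a => da; exact: (@is_derive1_comp R expR (fun y => a * y)).
have dc : is_derive t 1 (fun y : R => cos (b * y)) (- sin (b * t) * b).
  by have := dl b => db; exact: (@is_derive1_comp R cos (fun y => b * y)).
have ds : is_derive t 1 (fun y : R => sin (b * y)) (cos (b * t) * b).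
  by have := dl b => db; exact: (@is_derive1_comp R sin (fun y => b * y)).
by split; apply: is_derive_eq; rewrite /GRing.scale /=; ring.
Qed.

Lemma mvt_bound (f f' : R -> R) h B : 0 <= h ->
  (forall x : R, is_derive x 1 f (f' x)) -> (forall x, 0 <= x <= h -> `|f' x| <= B) ->
  `|f h - f 0| <= B * h.
Proof.
move=> h0 df hB.
have cf : {within `[0, h], continuous f}.
  apply: continuous_subspaceT => x; apply: differentiable_continuous.
  by apply/derivable1_diffP; case: (df x).
have [x xI ->] := MVT_segment h0 (fun x _ => df x) cf.
rewrite subr0 normrM (ger0_norm h0) ler_wpM2r //; apply: hB.
by move: xI; rewrite in_itv.
Qed.

(** The mean value theorem for the real and the imaginary part separately, hence the factor 2. *)
Lemma cexp_lip z h : complex.Re z <= 0 -> 0 <= h ->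
  nc (cexp z h - 1) <= 2 * nc z * h.
Proof.
move=> z0 h0; apply: (le_trans (nc_le _)).
have b x : 0 <= x <= h -> nc (z * cexp z x) <= nc z.
  case/andP=> x0 _; rewrite normcM ler_piMr ?nc_ge0 //; exact: nc_cexp_le1.
have hr : `|complex.Re (cexp z h) - complex.Re (cexp z 0)| <= nc z * h.
  apply: (@mvt_bound (fun t => complex.Re (cexp z t)) (fun x => complex.Re (z * cexp z x))) => // [x|x /b hx].
    exact: (proj1 (is_derive_cexp z x)).
  by apply: le_trans hx; exact: nc_Re.
have hi : `|complex.Im (cexp z h) - complex.Im (cexp z 0)| <= nc z * h.
  apply: (@mvt_bound (fun t => complex.Im (cexp z t)) (fun x => complex.Im (z * cexp z x))) => // [x|x /b hx].
    exact: (proj2 (is_derive_cexp z x)).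
  by apply: le_trans hx; exact: nc_Im.
rewrite ReB ImB; move: hr hi; rewrite cexp0 => hr hi; lra.
Qed.

Lemma cexp_quad z h : complex.Re z <= 0 -> 0 <= h ->
  nc (cexp z h - 1 - z * rc h) <= 4 * nc z ^+ 2 * h ^+ 2.
Proof.
move=> z0 h0; apply: (le_trans (nc_le _)).
have b x : 0 <= x <= h -> nc (z * (cexp z x - 1)) <= 2 * nc z ^+ 2 * h.
  case/andP=> x0 xh; rewrite normcM.
  apply: (le_trans (ler_wpM2l (nc_ge0 _) (cexp_lip z0 x0))).
  have := ler_wpM2l (sqr_ge0 (nc z)) xh; lra.
have hr : `|(complex.Re (cexp z h) - complex.Re z * h) -
            (complex.Re (cexp z 0) - complex.Re z * 0)|
          <= 2 * nc z ^+ 2 * h * h.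
  apply: (@mvt_bound (fun t => complex.Re (cexp z t) - complex.Re z * t) (fun x => complex.Re (z * cexp z x) - complex.Re z)) => // [x|x /b hx].
    have d := proj1 (is_derive_cexp z x).
    by apply: is_derive_eq; rewrite /GRing.scale /= mulr1.
  by rewrite -ReB -[X in _ - X]mulr1 -mulrBr; apply: le_trans hx; exact: nc_Re.
have hi : `|(complex.Im (cexp z h) - complex.Im z * h) -
            (complex.Im (cexp z 0) - complex.Im z * 0)|
          <= 2 * nc z ^+ 2 * h * h.
  apply: (@mvt_bound (fun t => complex.Im (cexp z t) - complex.Im z * t) (fun x => complex.Im (z * cexp z x) - complex.Im z)) => // [x|x /b hx].
    have d := proj2 (is_derive_cexp z x).
    by apply: is_derive_eq; rewrite /GRing.scale /= mulr1.
  by rewrite -ImB -[X in _ - X]mulr1 -mulrBr; apply: le_trans hx; exact: nc_Im.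
have E1 : complex.Re (1 : R[i]) = 1 by [].
have E2 : complex.Im (1 : R[i]) = 0 by [].
move: hr hi; rewrite cexp0 E1 E2 !mulr0 !subr0 => hr hi.
have -> : complex.Re (cexp z h - 1 - z * rc h) =
   complex.Re (cexp z h) - complex.Re z * h - 1.
  by case: (z) (cexp z h) => [? ?] [? ?] /=; ring.
have -> : complex.Im (cexp z h - 1 - z * rc h) =
   complex.Im (cexp z h) - complex.Im z * h.
  by case: (z) (cexp z h) => [? ?] [? ?] /=; ring.
lra.
Qed.

(** Compares [n] steps of an approximate evolution [a] with the exact one [b]: the error [d] of one
    step grows to about [n * d]. *)
Lemma pow_dist (a b : R[i]) d n : nc b <= 1 -> nc (a - b) <= d ->
  nc (a ^+ n - b ^+ n) <= n%:R * d * (1 + d) ^+ n.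
Proof.
move=> b1 ad; have d0 : 0 <= d := le_trans (nc_ge0 _) ad.
have a1 : nc a <= 1 + d.
  rewrite -[a](subrK b) addrC; apply: (le_trans (ncD _ _)); exact: lerD.
elim: n => [|n IH]; first by rewrite !expr0 subrr nc0 mul0r mul0r.
have -> : a ^+ n.+1 - b ^+ n.+1 = a * (a ^+ n - b ^+ n) + (a - b) * b ^+ n.
  rewrite !exprS; ring.
apply: (le_trans (ncD _ _)); rewrite !normcM.
have h1 : nc a * nc (a ^+ n - b ^+ n) <= (1 + d) * (n%:R * d * (1 + d) ^+ n).
  by apply: ler_pM => //; exact: nc_ge0.
have bn : nc (b ^+ n) <= 1.
  elim: (n) => [|j IHj]; first by rewrite expr0 normc1.
  by rewrite exprS normcM mulr_ile1 ?nc_ge0.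
have h2 : nc (a - b) * nc (b ^+ n) <= d * (1 + d) ^+ n.+1.
  apply: ler_pM; rewrite ?nc_ge0 //; apply: (le_trans bn).
  by apply: exprn_ege1; rewrite lerDl.
apply: (le_trans (lerD h1 h2)); rewrite exprS -[in leRHS]natr1; lra.
Qed.

End ComplexExponential.

(** * Single modes and the separation of the symbols *)

Section Semigroup.
Context {R : realType}.
Implicit Types (l M e a t s h : R) (k m : int) (u v w : dist R) (c : int -> R[i]) (z : R[i]).
Local Notation nc := (@normc R).
Local Notation rc := (real_complex R).

Lemma near_right0 (P : R -> Prop) : (\forall x \near 0^'+, P x) ->
  exists2 e, 0 < e & forall x, 0 < x < e -> P x.
Proof.
case=> e /= e0 h; exists e => // x /andP[x0 xe]; apply: h => //=.
by rewrite sub0r normrN gtr0_norm.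
Qed.

Lemma norm_le_fin (th : int -> R) c n : (forall k, 0 <= th k) ->
  (forall k, (n < `|k|)%N -> c k = 0) -> exists M, norm_le th c M.
Proof.
move=> th0 hc; set B := \sum_(k <- zr n) th k * nc (c k) ^+ 2.
have F0 k : 0 <= th k * nc (c k) ^+ 2 by rewrite mulr_ge0 // sqr_ge0.
have B0 : 0 <= B by apply: sumr_ge0 => k _.
exists (Num.sqrt B); split; first exact: sqrtr_ge0.
rewrite sqr_sqrtr // => s us; rewrite (bigID (fun k => (`|k| <= n)%N)) /=.
rewrite [X in _ + X]big1 ?addr0; last first.
  by move=> k; rewrite -ltnNge => /hc ->; rewrite nc0 expr0n mulr0.
rewrite -big_filter; apply: sum_uniq_sub => //; [exact: filter_uniq|exact: zr_uniq|].
by move=> k; rewrite mem_filter mem_zr => /andP[].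
Qed.

Lemma Hper0P l v : Hper0 l v <->
  [/\ is_distribution v, exists M, norm_le (om l) (fourier v) M & fourier v 0 = 0].
Proof.
by split=> [[/HperP[dv hv] m0]|[dv hv m0]] //; split=> //; apply/HperP.
Qed.

Lemma realize_Hper0 l c M : norm_le (om l) c M -> is_real c -> c 0 = 0 ->
  Hper0 l (realize c) /\ fourier (realize c) = c.
Proof.
move=> hc rc0 c0; have pc := polyb_nle hc; have e := fourier_realize pc rc0.
split=> //; apply/Hper0P; split; first exact: realize_is_distribution.
- by exists M; rewrite e.
- by rewrite e.
Qed.

Lemma Hper0_lin l a u v : 0 <= l -> Hper0 l u -> Hper0 l v -> Hper0 l (a *: u + v).
Proof.
move=> l0 /Hper0P[du [M hM] u0] /Hper0P[dv [N hN] v0]; apply/Hper0P; split.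
- exact: is_dist_lin.
- exists (nc (rc a) * M + N).
  rewrite (_ : fourier _ = fun k => rc a * fourier u k + fourier v k); last first.
    by apply: funext => k; rewrite fourier_lin.
  apply: norm_leD => //; first exact: om_ge0.
  apply: norm_le_ptw hM; [exact: om_ge0|exact: nc_ge0|].
  by move=> k; rewrite normcM.
- by rewrite fourier_lin u0 v0 mulr0 addr0.
Qed.

Lemma Hper00 l : 0 <= l -> Hper0 l (0 : dist R).
Proof.
move=> l0; apply/Hper0P; split; first exact: is_dist0.
  exists 0; rewrite (_ : fourier _ = fun=> 0); first exact: norm_le0.
  by apply: funext => k; rewrite fourier0.
by rewrite fourier0.
Qed.

Lemma Hper0Z l a u : 0 <= l -> Hper0 l u -> Hper0 l (a *: u).
Proof. by move=> l0 hu; have := Hper0_lin a l0 hu (Hper00 l0); rewrite addr0. Qed.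

(** A real distribution cannot carry the frequency [m] alone, hence the conjugate value at [- m]. *)
Definition mode m z k : R[i] := if k == m then z else if k == - m then conjc z else 0.

Lemma mode_Hper0 l m z : m != 0 ->
  Hper0 l (realize (mode m z)) /\ fourier (realize (mode m z)) = mode m z.
Proof.
move=> m0.
have [M hM] : exists M, norm_le (om l) (mode m z) M.
  apply: (@norm_le_fin _ _ `|m|%N); first exact: om_ge0.
  move=> k hk; rewrite /mode; case: eqVneq => [e|_]; first by move: hk; rewrite e ltnn.
  by case: eqVneq => [e|//]; move: hk; rewrite e abszN ltnn.
apply: (realize_Hper0 hM).
  move=> k; rewrite /mode.
  have [->|h1] := eqVneq k m.
    by rewrite eqxx; have /negPf -> : - m != m by apply/eqP; lia.
  have [->|h2] := eqVneq k (- m).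
    by rewrite opprK eqxx conjcK.
  have /negPf -> : - k != m by apply/eqP; move/eqP: h2; lia.
  have /negPf -> : - k != - m by apply/eqP; move/eqP: h1; lia.
  by rewrite conjc0.
by rewrite /mode eq_sym (negPf m0) eq_sym oppr_eq0 (negPf m0).
Qed.

(** The imaginary parts suffice: [x / (1 + x^2) - y / (1 + y^2)] has the numerator
    [(y - x) (x y - 1)]. Since [|x|], [|y|] and [|x - y|] are at least 4, this numerator dominates
    [1 + x^2], which makes the lower bound independent of [k]. *)
Lemma lamA_sep beta gamma m k : m != 0 -> k != 0 -> k != m ->
  ((1 + `|kap m|) * (1 + kap m ^+ 2))^-1 <= nc (lamA beta gamma k - lamA beta gamma m).
Proof.
move=> m0 k0 km; apply: le_trans (nc_Im _); rewrite ImB /lamA /=.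
have := @kap_ge4 R _ m0; have := @kap_ge4 R _ k0.
have := @kap_ge4 R (k - m); rewrite subr_eq0 => /(_ km).
rewrite kapD kapN; move: (kap k) (kap m) => x y hxy hx hy.
have px : 0 < 1 + x ^+ 2 by rewrite ltr_pwDl // sqr_ge0.
have py : 0 < 1 + y ^+ 2 by rewrite ltr_pwDl // sqr_ge0.
have -> : - (x / (1 + x ^+ 2)) - - (y / (1 + y ^+ 2)) =
  (x - y) * (x * y - 1) / ((1 + x ^+ 2) * (1 + y ^+ 2)).
  by field; rewrite ?gt_eqF.
rewrite normrM normfV (@gtr0_norm _ ((1 + _) * _)) ?mulr_gt0 //.
rewrite ler_pdivlMr ?mulr_gt0 // mulrC ler_pdivrMr; last first.
  by rewrite mulr_gt0 // ltr_pwDl.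
rewrite (mulrC (1 + `|y|)) mulrA mulrAC ler_wpM2r ?(ltW py) //.
rewrite normrM.
have h1 : `|x| * `|y| - 1 <= `|x * y - 1|.
  by rewrite -normrM; apply: le_trans (lerB_dist _ _); rewrite normr1.
have h2 : `|x| <= `|x - y| + `|y|.
  by rewrite -[in leLHS](subrK y x); exact: ler_normD.
have h3 : 3 * `|x| <= `|x * y - 1| by nra.
have h4 : `|x| <= `|x - y| * (1 + `|y|) by nra.
rewrite mulrAC.
apply: (@le_trans _ _ (`|x| * (3 * `|x|))).
  rewrite -(real_normK (num_real x)); nra.
by apply: ler_pM.
Qed.

End Semigroup.

(** * Identification of the semigroup on every mode *)

Section SemigroupCoefficients.
Context {R : realType}.
Variables (l beta gamma c0 : R) (S : R -> dist R -> dist R).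
Hypothesis l0 : 0 <= l.
Hypothesis c0_gt0 : 0 < c0.
Hypothesis lam_neg : forall k, k != 0 -> complex.Re (lamA beta gamma k) <= - c0.
Hypothesis hS : C0_semigroup_generated_by l (opA beta gamma) S.
Implicit Types (M e a t s h : R) (k m : int) (u v w : dist R) (z : R[i]).
Local Notation nc := (@normc R).
Local Notation rc := (real_complex R).
Local Notation A := (opA beta gamma).
Local Notation lam := (lamA beta gamma).
Local Notation H0 := (Hper0 l).

Let SH t v : 0 <= t -> H0 v -> H0 (S t v).
Proof. by move=> t0; case: hS => /(_ t t0)[h _ _] _ _ _ _; exact: h. Qed.

Let Slin t a v w : 0 <= t -> H0 v -> H0 w -> S t (a *: v + w) = a *: S t v + S t w.
Proof. by move=> t0; case: hS => /(_ t t0)[_ h _] _ _ _ _; exact: h. Qed.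

Let Sbound t : 0 <= t -> exists2 M, 0 <= M &
  forall v X, H0 v -> norm_le (om l) (fourier v) X -> norm_le (om l) (fourier (S t v)) (M * X).
Proof.
move=> t0; case: hS => /(_ t t0)[_ _ [M hM]] _ _ _ _; exists `|M| => // v X hv hX.
have X0 : 0 <= X by case: hX.
apply/sob_le; first exact: mulr_ge0.
apply: (le_trans (hM v hv)); rewrite EFinM.
apply: (@le_trans _ _ (`|M|%:E * sobolev_norm l v)%E).
  by apply: lee_wpmul2r; [exact: sobolev_ge0|rewrite lee_fin ler_norm].
by apply: lee_wpmul2l; [rewrite lee_fin|apply/sob_le].
Qed.

Let Hpb v : H0 v -> is_distribution v /\ polyb (fourier v).
Proof. by case/Hper0P => dv [M hM] _; split=> //; exact: polyb_nle hM. Qed.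

Let Acoef v k : H0 v -> fourier (A v) k = lam k * fourier v k.
Proof. by case/Hpb => dv pv; exact: (proj2 (opA_coef beta gamma dv pv)). Qed.

Let AH v : H0 v -> H0 (A v).
Proof.
move=> hv; have [dv pv] := Hpb hv; case/Hper0P: (hv) => _ [M hM] v0.
apply/Hper0P; split; first exact: (proj1 (opA_coef beta gamma dv pv)).
  exists ((`|beta| + `|gamma| + 1) * M).
  apply: norm_le_ptw hM; [exact: om_ge0|by rewrite !addr_ge0|].
  by move=> k; rewrite Acoef // normcM ler_wpM2r ?nc_ge0 // lamA_le.
by rewrite Acoef // v0 mulr0.
Qed.

Let derive0 v e : H0 v -> 0 < e -> exists2 d, 0 < d & forall h, 0 < h < d ->
  norm_le (om l) (fourier (h^-1 *: (S h v - v) - A v)) e.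
Proof.
move=> hv e0; apply: near_right0.
have [_ _ _ _ h] := hS; exact: (iffLR (sob_cvg0 _ _ _) (h v hv) e e0).
Qed.

(** [S t] commutes with the difference quotients of the semigroup and is bounded, so it commutes
    with their limit [A] in every coefficient. *)
Let coefA m t v : 0 <= t -> H0 v -> fourier (S t (A v)) m = lam m * fourier (S t v) m.
Proof.
move=> t0 hv; have [M M0 hM] := Sbound t0; have hSv := SH t0 hv; have hAv := AH hv.
apply/eqP; rewrite -subr_eq0; apply/eqP; apply: eq0_normc; apply/eqP.
rewrite eq_le nc_ge0 andbT; apply/ler_addgt0Pl => e e0; rewrite addr0.
(* The error [e'] of one difference quotient is kept, and that of the other one is multiplied by the
   bound [M] of [S t]. *)
pose e' := e / (M + 1); have e'0 : 0 < e' by rewrite divr_gt0 // ltr_wpDl.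
have [d1 d10 h1] := derive0 hv e'0; have [d2 d20 h2] := derive0 hSv e'0.
pose h := Num.min d1 d2 / 2.
have md : 0 < Num.min d1 d2 by rewrite lt_min d10.
have hh : 0 < h by rewrite divr_gt0.
have hm : h < Num.min d1 d2 by rewrite /h; lra.
have /h1 b1 : 0 < h < d1 by move: hm; rewrite lt_min hh => /andP[].
have /h2 b2 : 0 < h < d2 by move: hm; rewrite lt_min hh => /andP[].
have hShv := SH (ltW hh) hv.
have hd : H0 (S h v - v) by rewrite addrC -scaleN1r; exact: Hper0_lin.
have hD : H0 (h^-1 *: (S h v - v) - A v).
  by rewrite addrC -scaleN1r; apply: Hper0_lin => //; exact: Hper0Z.
have b3 := hM _ _ hD b1.
have comm : S t (S h v) = S h (S t v).
  have [_ _ sg _ _] := hS.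
  by rewrite -(sg t h v t0 (ltW hh) hv) -(sg h t v (ltW hh) t0 hv) addrC.
have eq1 : S t (h^-1 *: (S h v - v) - A v) = h^-1 *: (S h (S t v) - S t v) - S t (A v).
  rewrite addrC -scaleN1r Slin //; last exact: Hper0Z.
  rewrite scaleN1r addrC; congr (_ - _).
  have -> : h^-1 *: (S h v - v) = h^-1 *: (S h v - v) + (0 : dist R) by rewrite addr0.
  rewrite Slin //; last exact: Hper00.
  have -> : S t 0 = 0 :> dist R.
    have := Slin 1 t0 (Hper00 l0) (Hper00 l0).
    by rewrite !scale1r addr0 -{1}[S t 0]addr0 => /addrI.
  rewrite addr0; congr (_ *: _).
  by rewrite addrC -scaleN1r Slin // scaleN1r addrC comm.
rewrite eq1 in b3.
have c3 := norm_le1_coef m (om_one l0 b3); have c2 := norm_le1_coef m (om_one l0 b2).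
rewrite fourierB in c3; rewrite fourierB Acoef // in c2.
set D := fourier (h^-1 *: _) m in c2 c3.
rewrite (_ : _ - _ = (D - lam m * fourier (S t v) m) - (D - fourier (S t (A v)) m)); last by ring.
apply: (le_trans (ncB _ _)); apply: (le_trans (lerD c2 c3)).
by rewrite -[X in X + _]mul1r -mulrDl addrC /e' mulrCA divff ?mulr1 // gt_eqF // ltr_wpDl.
Qed.

(** Because the symbols are separated, such a [v] is [(A - lam m) (A - lam (- m)) v'] for some [v']
    in the same space. This operator is real, namely [A^2 - 2 p A + (p^2 + q^2)] with
    [lam m = p + i q], and by [coefA] the coefficient [m] after [S t] is annihilated by it. *)
Let coef_zero m t v : m != 0 -> 0 <= t -> H0 v -> fourier v m = 0 -> fourier (S t v) m = 0.
Proof.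
move=> m0 t0 hv vm; case/Hper0P: (hv) => dv [M hM] v0.
have rv := fourier_real (proj1 dv).
pose d := ((1 + `|kap m|) * (1 + kap m ^+ 2))^-1 : R.
have d0 : 0 < d by rewrite invr_gt0 mulr_gt0 ?kap1_gt0 // ltr_pwDl.
(* At [k = m] and [k = - m] both numerator and denominator vanish, and the quotient is 0. *)
pose c k := fourier v k / ((lam k - lam m) * (lam k - lam (- m))).
have vm' : fourier v (- m) = 0 by rewrite rv vm conjc0.
have m0' : - m != 0 by rewrite oppr_eq0.
have lsep k : k != 0 -> k != m -> d <= nc (lam k - lam m) by move=> *; exact: lamA_sep.
have lsep' k : k != 0 -> k != - m -> d <= nc (lam k - lam (- m)).
  by move=> k0 km; have := lamA_sep beta gamma m0' k0 km; rewrite kapN normrN sqrrN.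
have hc : norm_le (om l) c (d^-1 ^+ 2 * M).
  apply: norm_le_ptw hM; [exact: om_ge0|exact: sqr_ge0|] => k; rewrite /c.
  have [->|k0] := eqVneq k 0; first by rewrite v0 mul0r nc0 mulr0.
  have [->|km] := eqVneq k m; first by rewrite vm mul0r nc0 mulr0.
  have [->|km'] := eqVneq k (- m); first by rewrite vm' mul0r nc0 mulr0.
  have h1 := lsep k k0 km; have h2 := lsep' k k0 km'.
  rewrite normcM normcV normcM mulrC ler_wpM2r ?nc_ge0 //.
  rewrite expr2 invfM; apply: ler_pM; rewrite ?invr_ge0 ?nc_ge0 // lef_pV2 // posrE //.
    exact: lt_le_trans h1.
  exact: lt_le_trans h2.
have rc' : is_real c.
  move=> k; rewrite /c rv !lamA_real rmorphM fmorphV rmorphM !rmorphB.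
  by rewrite [X in _ / X = _]mulrC; congr (_ / (_ * (_ - _))); symmetry; exact: conjcK.
have c00 : c 0 = 0 by rewrite /c v0 mul0r.
have [hv' fv'] := realize_Hper0 hc rc' c00; set v' := realize c in hv' fv'.
pose p := complex.Re (lam m); pose q := complex.Im (lam m).
(* [w1] and [w2] evaluate the quadratic polynomial in [A] by Horner's scheme. *)
pose w1 := (- 2 * p) *: v' + A v'.
have hw1 : H0 w1 by apply: Hper0_lin => //; exact: AH.
pose w2 := (p ^+ 2 + q ^+ 2) *: v' + A w1.
have hw2 : H0 w2 by apply: Hper0_lin => //; exact: AH.
have e2 : v = w2.
  apply: dist_ext => //; first by case/Hper0P: hw2.
  apply: funext => k; rewrite fourier_lin Acoef // fourier_lin Acoef // fv' /c.
  have [->|k0] := eqVneq k 0; first by rewrite v0 mul0r !mulr0 addr0 mulr0 addr0.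
  have [->|km] := eqVneq k m; first by rewrite vm mul0r !mulr0 addr0 mulr0 addr0.
  have [->|km'] := eqVneq k (- m); first by rewrite vm' mul0r !mulr0 addr0 mulr0 addr0.
  have n1 : lam k - lam m != 0.
    apply/eqP => h; have := lsep k k0 km; rewrite h nc0; lra.
  have n2 : lam k - lam (- m) != 0.
    apply/eqP => h; have := lsep' k k0 km'; rewrite h nc0; lra.
  set D := (lam k - lam m) * (lam k - lam (- m)).
  have D0 : D != 0 by rewrite mulf_neq0.
  have -> : rc (p ^+ 2 + q ^+ 2) * (fourier v k / D) +
    lam k * (rc (- 2 * p) * (fourier v k / D) + lam k * (fourier v k / D))
    = (rc (p ^+ 2 + q ^+ 2) + rc (- 2 * p) * lam k + lam k ^+ 2) * (fourier v k / D) by ring.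
  have -> : rc (p ^+ 2 + q ^+ 2) + rc (- 2 * p) * lam k + lam k ^+ 2 = D.
    rewrite /D lamA_real /p /q expr2; case: (lam k) (lam m) => x y [p' q'] /=.
    by apply/eqP; rewrite eq_complex /=; apply/andP; split; apply/eqP; ring.
  by rewrite mulrCA divff // mulr1.
rewrite e2 Slin //; last exact: AH.
rewrite fourier_lin coefA // Slin //; last exact: AH.
rewrite fourier_lin coefA // /p /q.
case: (lam m) (fourier (S t v') m) => x y [x' y'] /=.
by apply/eqP; rewrite eq_complex /=; apply/andP; split; apply/eqP; ring.
Qed.

Let md m z := realize (mode m z).
(** The multiplier by which [S t] acts on the mode [m]; it is shown to equal [cexp (lam m) t]. *)
Let sm m t := fourier (S t (md m 1)) m.

Let coef_eq m t v w : m != 0 -> 0 <= t -> H0 v -> H0 w -> fourier v m = fourier w m ->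
  fourier (S t v) m = fourier (S t w) m.
Proof.
move=> m0 t0 hv hw e.
have hd : H0 ((-1) *: w + v) by exact: Hper0_lin.
have := coef_zero m0 t0 hd; rewrite fourier_lin e => h.
have {}h : fourier (S t ((-1) *: w + v)) m = 0.
  by apply: h; rewrite rmorphN1 mulN1r addNr.
move: h; rewrite Slin // fourier_lin rmorphN1 mulN1r => /eqP.
by rewrite addrC subr_eq0 => /eqP.
Qed.

Let modeE m z : mode m z m = z. Proof. by rewrite /mode eqxx. Qed.

(** [S t] is only real-linear, but on the mode [m] it also commutes with multiplication by [lam m],
    by [coefA]. As [lam m] has a nonzero imaginary part, it commutes with multiplication by [i]. *)
Let mode_lin m t z : m != 0 -> 0 <= t -> fourier (S t (md m z)) m = sm m t * z.
Proof.
move=> m0 t0.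
have hm y := mode_Hper0 l y m0.
have T1 (y y' : R[i]) (a : R) :
  fourier (S t (md m (rc a * y + y'))) m =
  rc a * fourier (S t (md m y)) m + fourier (S t (md m y')) m.
  rewrite -fourier_lin -Slin //; try exact: (proj1 (hm _)).
  apply: coef_eq => //; first exact: (proj1 (hm _)).
    by apply: Hper0_lin => //; exact: (proj1 (hm _)).
  by rewrite fourier_lin !(proj2 (hm _)) !modeE.
have T0 : fourier (S t (md m 0)) m = 0.
  apply: coef_zero => //; first exact: (proj1 (hm _)).
  by rewrite (proj2 (hm _)) modeE.
have TZ (y : R[i]) (a : R) : fourier (S t (md m (rc a * y))) m = rc a * fourier (S t (md m y)) m.
  by have := T1 y 0 a; rewrite !addr0 T0 addr0.
have TL (y : R[i]) : fourier (S t (md m (lam m * y))) m = lam m * fourier (S t (md m y)) m.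
  rewrite -coefA //; last exact: (proj1 (hm _)).
  apply: coef_eq => //; first exact: (proj1 (hm _)).
    by apply: AH; exact: (proj1 (hm _)).
  by rewrite Acoef ?(proj2 (hm _)) ?modeE //; exact: (proj1 (hm _)).
have q0 : complex.Im (lam m) != 0.
  have k1 : 0 < 1 + kap m ^+ 2 :> R by exact: kap1_gt0.
  rewrite /lamA /= oppr_eq0 mulf_eq0 invr_eq0 negb_or (gt_eqF k1) andbT.
  by rewrite -normr_gt0; have := @kap_ge4 R _ m0; lra.
set q := complex.Im (lam m) in q0; set p := complex.Re (lam m).
have lpq : lam m = rc p + Complex 0 q.
  by rewrite /p /q; case: (lam m) => x y; apply/eqP; rewrite eq_complex /= addr0 add0r !eqxx.
have TI : fourier (S t (md m (Complex 0 1))) m = Complex 0 1 * sm m t.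
  have := T1 1 (Complex 0 q) p; have := TL 1.
  rewrite !mulr1 lpq => ->.
  rewrite -/(sm m t) mulrDl => /addrI.
  have -> : Complex 0 q = rc q * Complex 0 1 by apply/eqP; rewrite eq_complex /= !mulr0 !mul0r subr0 mulr1 addr0 !eqxx.
  rewrite TZ -mulrA => /mulfI h; apply/esym/h.
  by rewrite -(rmorph0 rc) (inj_eq (@complexI R)).
have -> : z = rc (complex.Re z) * 1 + rc (complex.Im z) * Complex 0 1.
  by case: z => x y; apply/eqP; rewrite eq_complex /=; apply/andP; split; apply/eqP; ring.
rewrite T1 TZ TI -/(sm m t).
by case: z (sm m t) => x y [x' y']; apply/eqP; rewrite eq_complex /=; apply/andP; split; apply/eqP; ring.
Qed.

Let coef_sm m t v : m != 0 -> 0 <= t -> H0 v -> fourier (S t v) m = sm m t * fourier v m.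
Proof.
move=> m0 t0 hv; rewrite -mode_lin //.
have hm := mode_Hper0 l (fourier v m) m0.
by apply: coef_eq => //; rewrite /md ?(proj2 hm) ?modeE //; case: hm.
Qed.

Let sm_pow m h n : m != 0 -> 0 <= h -> sm m (n%:R * h) = sm m h ^+ n.
Proof.
move=> m0 h0; have hm := mode_Hper0 l 1 m0.
elim: n => [|n IH].
  rewrite mul0r expr0 /sm; have [_ e _ _ _] := hS.
  by rewrite e ?(proj2 hm) ?modeE //; case: hm.
rewrite -natr1 mulrDl mul1r exprS -IH /sm.
have n0 : 0 <= n%:R * h by rewrite mulr_ge0.
have [_ _ sg _ _] := hS; rewrite addrC sg //; last by case: hm.
by rewrite coef_sm //; apply: SH => //; case: hm.
Qed.

(** [sm m] and [cexp (lam m)] are multiplicative in time and agree to first order at 0. Dividing [t]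
    into [n] small steps and raising to the power [n], the total error tends to 0. *)
Lemma semigroup_coef m t v : 0 <= t -> H0 v -> fourier (S t v) m = cexp (lam m) t * fourier v m.
Proof.
move=> t0 hv; have [->|m0] := eqVneq m 0.
  by case/Hper0P: (hv) => _ _ ->; case/Hper0P: (SH t0 hv) => _ _ ->; rewrite mulr0.
rewrite coef_sm //; congr (_ * _).
have hm := mode_Hper0 l 1 m0.
have lneg : complex.Re (lam m) <= 0 by apply: le_trans (lam_neg m0) _; rewrite lerNl oppr0 ltW.
have loc e : 0 < e -> exists2 d, 0 < d & forall h, 0 < h < d -> nc (sm m h - cexp (lam m) h) <= e * h.
  move=> e0; pose L := nc (lam m); have L0 : 0 <= L := nc_ge0 _.
  have [d d0 hd] := derive0 (proj1 hm) (divr_gt0 e0 (ltr0n R 2)).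
  (* Half of [e] covers the difference quotient, the other half the Taylor remainder [4 L^2 h^2] of
     the exponential. *)
  pose d' := Num.min d (e / (8 * L ^+ 2 + 1)).
  have L1 : 0 < 8 * L ^+ 2 + 1 by rewrite ltr_wpDl // mulr_ge0 // sqr_ge0.
  exists d'; first by rewrite lt_min d0 divr_gt0.
  move=> h /andP[h0]; rewrite lt_min => /andP[h1 h2].
  have /hd b1 : 0 < h < d by rewrite h0.
  have := norm_le1_coef m (om_one l0 b1).
  rewrite fourierB (Acoef _ (proj1 hm)) fourierZ fourierB (proj2 hm) modeE mulr1 => b2.
  have b3 : nc (sm m h - 1 - lam m * rc h) <= e / 2 * h.
    have -> : sm m h - 1 - lam m * rc h = rc h * (rc h^-1 * (sm m h - 1) - lam m).
      rewrite mulrBr mulrA -rmorphM divff ?gt_eqF // rmorph1 mul1r; ring.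
    by rewrite normcM nc_real gtr0_norm // mulrC ler_wpM2r // ltW.
  have b4 := cexp_quad lneg (ltW h0); rewrite -/L in b4.
  rewrite (_ : _ - _ = (sm m h - 1 - lam m * rc h) - (cexp (lam m) h - 1 - lam m * rc h)); last by ring.
  apply: (le_trans (ncB _ _)).
  have : h * (8 * L ^+ 2 + 1) < e by rewrite -ltr_pdivlMr.
  move: b3 b4 h0; nra.
apply/eqP; rewrite -subr_eq0; apply/eqP; apply: eq0_normc; apply/eqP.
rewrite eq_le nc_ge0 andbT; apply/ler_addgt0Pl => e e0; rewrite addr0.
have t1 : 0 < t + 1 by lra.
(* [pow_dist] gives the error [e' t (1 + e' h)^n]; as [e' <= 1], the last factor is at most
   [expR t]. *)
pose e' := Num.min 1 (e / ((t + 1) * expR t)).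
have e'0 : 0 < e' by rewrite lt_min ltr01 divr_gt0 // mulr_gt0 // expR_gt0.
have [d d0 hd] := loc e' e'0.
pose n := (Num.bound (t / d)).+1; pose h := t / n%:R.
have n0 : 0 < n%:R :> R by rewrite ltr0n.
have [tz|tp] := eqVneq t 0.
  by have := @sm_pow m 0 0 m0 (lexx 0); rewrite mul0r expr0 tz cexp0 => ->; rewrite subrr nc0 ltW.
have tp0 : 0 < t by rewrite lt_neqAle eq_sym tp.
have h0 : 0 < h by rewrite divr_gt0.
have hdd : h < d.
  rewrite /h ltr_pdivrMr // mulrC -ltr_pdivrMr //.
  apply: (@lt_trans _ _ (Num.bound (t / d))%:R); last by rewrite ltr_nat.
  by rewrite archi_boundP // divr_ge0 // ltW.
have /hd b : 0 < h < d by rewrite h0.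
have tn : t = n%:R * h by rewrite /h mulrC divfK // gt_eqF.
have cpow j : cexp (lam m) (j%:R * h) = cexp (lam m) h ^+ j.
  elim: j => [|j IH]; first by rewrite mul0r cexp0 expr0.
  by rewrite -natr1 mulrDl mul1r addrC cexpD IH exprS.
rewrite tn sm_pow ?(ltW h0) // cpow.
apply: (le_trans (pow_dist n (nc_cexp_le1 lneg (ltW h0)) b)).
have -> : n%:R * (e' * h) = e' * t by rewrite tn; ring.
have e1 : (1 + e' * h) ^+ n <= expR t.
  rewrite tn expRM_natl.
  rewrite lerXn2r ?nnegrE ?expR_ge0 //; first by rewrite addr_ge0 // mulr_ge0 // ltW.
  apply: le_trans (expR_ge1Dx h); rewrite lerD2l ler_piMl ?(ltW h0) //.
  by rewrite /e' ge_min lexx.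
have e2 : e' * ((t + 1) * expR t) <= e.
  by rewrite -ler_pdivlMr ?mulr_gt0 ?expR_gt0 // /e' ge_min lexx orbT.
apply: le_trans e2; rewrite [leRHS]mulrA; apply: ler_pM => //.
- by apply: mulr_ge0 => //; exact: ltW.
- by rewrite exprn_ge0 // addr_ge0 // mulr_ge0 // ltW.
- by rewrite ler_wpM2l ?(ltW e'0) // lerDl.
Qed.

End SemigroupCoefficients.

(** * Bochner integrals *)

Section NonMeasurableIntegrands.
Context {R : realType}.
Implicit Types (f g h : R -> R) (D A B : set R) (x : R).
Local Notation mu := (@lebesgue_measure R).

(* The integral of a nonnegative function is a supremum over simple functions,
   hence monotone without any measurability assumption. *)
Lemma int_mono A B (F G : R -> \bar R) : A `<=` B ->
  (forall x, A x -> (0 <= F x)%E) -> (forall x, B x -> (0 <= G x)%E) ->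
  (forall x, A x -> (F x <= G x)%E) ->
  (\int[mu]_(x in A) F x <= \int[mu]_(x in B) G x)%E.
Proof.
move=> AB F0 G0 FG; rewrite (@integral_mkcond _ _ _ mu A F) (@integral_mkcond _ _ _ mu B G).
have F0' x : (0 <= (F \_ A) x)%E by exact: erestrict_ge0.
have G0' x : (0 <= (G \_ B) x)%E by exact: erestrict_ge0.
rewrite !ge0_integralTE //; apply: ge_ereal_sup => _ [h hF <-].
apply: ereal_sup_ubound; exists h => // x; apply: (le_trans (hF x)).
rewrite /patch; case: ifPn => [|_]; last by exact: G0'.
by rewrite inE => Ax; rewrite ifT ?FG // inE; exact: AB.
Qed.

Lemma int_mono_ael D g (F : R -> \bar R) : measurable D -> measurable_fun D g ->
  (forall x, D x -> 0 <= g x) -> (forall x, D x -> (0 <= F x)%E) ->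
  {ae mu, forall x, D x -> ((g x)%:E <= F x)%E} ->
  (\int[mu]_(x in D) (g x)%:E <= \int[mu]_(x in D) F x)%E.
Proof.
move=> mD mg g0 F0 [N [mN N0 hN]].
have mgE : measurable_fun D (fun x => (g x)%:E) by exact/measurable_EFinP.
rewrite (@ge0_negligible_integral _ _ _ mu D N) //.
apply: int_mono => [x []//|x [Dx _]|//|x [Dx Nx]]; first by rewrite lee_fin g0.
by apply: contrapT => nh; apply: Nx; apply: hN => /= /(_ Dx).
Qed.

(** As [F] may fail to be measurable, a null set is not removed from its integral. Instead [g] is
    raised to [+oo] on the exceptional set: the raised function dominates [F] everywhere, is
    measurable and has the same integral as [g]. *)
Lemma int_mono_aer D (F : R -> \bar R) g : measurable D -> measurable_fun D g ->
  (forall x, D x -> 0 <= g x) -> (forall x, D x -> (0 <= F x)%E) ->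
  {ae mu, forall x, D x -> (F x <= (g x)%:E)%E} ->
  (\int[mu]_(x in D) F x <= \int[mu]_(x in D) (g x)%:E)%E.
Proof.
move=> mD mg g0 F0 [N [mN N0 hN]].
pose G x := ((g x)%:E + +oo * (\1_N x)%:E)%E.
have G0 x : D x -> (0 <= G x)%E.
  by move=> Dx; rewrite adde_ge0 // ?lee_fin ?g0 // mule_ge0 // lee_fin.
have mG : measurable_fun D G.
  apply: emeasurable_funD; first exact/measurable_EFinP.
  apply: measurable_funeM; apply/measurable_EFinP.
  exact: measurable_funTS (measurable_indic _).
apply: (@le_trans _ _ (\int[mu]_(x in D) G x)%E).
  apply: int_mono => // x Dx; rewrite /G indicE.
  have [xN|/negP nN] := boolP (x \in N).
    by rewrite mule1 addey ?leey // -ltNye ltNyr.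
  rewrite mule0 adde0; apply: contrapT => nh; apply: nN; rewrite inE.
  by apply: hN => /= /(_ Dx).
rewrite (@ge0_negligible_integral _ _ _ mu D N) //.
apply: int_mono => [x []//|x [Dx _]|x Dx|x [Dx Nx]]; rewrite ?G0 ?lee_fin ?g0 //.
by rewrite /G indicE memNset // mule0 adde0.
Qed.

Lemma integ_le D f g : measurable D -> measurable_fun D f -> integ D g ->
  (forall x, D x -> `|f x| <= g x) -> integ D f.
Proof.
move=> mD mf ig h; apply: (@le_integrable _ _ _ mu D mD _ (EFin \o g)) => //.
  by apply/measurable_EFinP.
by move=> x Dx /=; rewrite lee_fin; apply: (le_trans (h x Dx)); exact: ler_norm.
Qed.

Lemma integ_cst D (c : R) : measurable D -> (mu D < +oo)%E -> integ D (fun=> c).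
Proof. by move=> mD D1; apply: integ_mb => //; exact: mb_cst. Qed.

Lemma Rint_le_ae D f g : measurable D -> integ D f -> integ D g ->
  {ae mu, forall x, D x -> f x <= g x} ->
  \int[mu]_(x in D) f x <= \int[mu]_(x in D) g x.
Proof.
move=> mD hf hg fg.
have mm : measurable_fun D (fun x => Num.min (f x) (g x)).
  by apply: measurable_minr; exact: integ_meas.
have im : integ D (fun x => Num.min (f x) (g x)).
  have ia : integ D (fun x => `|f x| + `|g x|) by apply: integD => //; exact: integ_norm.
  apply: (integ_le mD mm ia) => x _.
  rewrite minEle; case: ifP => _; by rewrite ?lerDl ?lerDr.
rewrite (@ae_eq_Rint _ D f (fun x => Num.min (f x) (g x))) //; last 2 first.
- exact: integ_meas.
- by apply: ae_mono fg => x h Dx; rewrite min_l // h.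
by apply: Rint_le => // x _; rewrite ge_min lexx orbT.
Qed.

End NonMeasurableIntegrands.

(** * Integrals of complex-valued functions and of sequences of them *)

Section ComplexIntegral.
Context {R : realType}.
Implicit Types (D : set R) (f g : R -> R[i]) (z : R[i]) (x : R).
Local Notation mu := (@lebesgue_measure R).
Local Notation nc := (@normc R).
Local Notation rc := (real_complex R).

Definition cmeas D g := measurable_fun D (fun x => complex.Re (g x)) /\
  measurable_fun D (fun x => complex.Im (g x)).
Definition cinteg D g := integ D (fun x => complex.Re (g x)) /\
  integ D (fun x => complex.Im (g x)).
Definition cint D g : R[i] := Complex (\int[mu]_(x in D) complex.Re (g x))
  (\int[mu]_(x in D) complex.Im (g x)).

Lemma Re_add z w : complex.Re (z + w) = complex.Re z + complex.Re w.
Proof. by case: z w => [? ?] [? ?]. Qed.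
Lemma Im_add z w : complex.Im (z + w) = complex.Im z + complex.Im w.
Proof. by case: z w => [? ?] [? ?]. Qed.
Lemma Re_mul z w : complex.Re (z * w) =
  complex.Re z * complex.Re w + (- complex.Im z) * complex.Im w.
Proof. by case: z w => [? ?] [? ?] /=; rewrite mulNr. Qed.
Lemma Im_mul z w : complex.Im (z * w) =
  complex.Re z * complex.Im w + complex.Im z * complex.Re w.
Proof. by case: z w => [? ?] [? ?]. Qed.

Lemma cmeas_cst D z : cmeas D (fun=> z).
Proof. by split; exact: measurable_cst. Qed.
Lemma cmeasD D f g : cmeas D f -> cmeas D g -> cmeas D (fun x => f x + g x).
Proof.
move=> [f1 f2] [g1 g2]; split.
  by under eq_fun do rewrite Re_add; exact: measurable_funD.
by under eq_fun do rewrite Im_add; exact: measurable_funD.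
Qed.
Lemma cmeasM D f g : cmeas D f -> cmeas D g -> cmeas D (fun x => f x * g x).
Proof.
move=> [f1 f2] [g1 g2]; split.
  under eq_fun do rewrite Re_mul.
  apply: measurable_funD; apply: measurable_funM => //.
  exact: (measurableT_comp (@oppr_measurable R setT)).
by under eq_fun do rewrite Im_mul; apply: measurable_funD; exact: measurable_funM.
Qed.
Lemma cmeasS D E f : measurable D -> E `<=` D -> cmeas D f -> cmeas E f.
Proof. by move=> mD ED [f1 f2]; split; exact: measurable_funS ED _. Qed.

Lemma nc_sqrt z : nc z = Num.sqrt (complex.Re z ^+ 2 + complex.Im z ^+ 2).
Proof. by case: z. Qed.

Lemma measurable_sqrt D (f : R -> R) : measurable_fun D f ->
  measurable_fun D (fun x => Num.sqrt (f x)).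
Proof.
move=> mf; have ms : measurable_fun setT (@Num.sqrt R).
  by apply: continuous_measurable_fun; exact: sqrt_continuous.
exact: (measurableT_comp ms mf).
Qed.

Lemma measurable_nc D g : cmeas D g -> measurable_fun D (fun x => nc (g x)).
Proof.
move=> [g1 g2]; under eq_fun do rewrite nc_sqrt; apply: measurable_sqrt.
by apply: measurable_funD; under eq_fun do rewrite expr2; exact: measurable_funM.
Qed.

Lemma cinteg_cmeas D g : cinteg D g -> cmeas D g.
Proof. by move=> [? ?]; split; exact: integ_meas. Qed.

Lemma cinteg_nc D g : measurable D -> cinteg D g -> integ D (fun x => nc (g x)).
Proof.
move=> mD hg; have mg := measurable_nc (cinteg_cmeas hg); case: hg => g1 g2.
apply: (integ_le mD mg (integD mD (integ_norm g1) (integ_norm g2))) => x _.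
by rewrite ger0_norm ?nc_ge0 // nc_le.
Qed.

Lemma nc_cinteg D g (h : R -> R) : measurable D -> cmeas D g -> integ D h ->
  (forall x, D x -> nc (g x) <= h x) -> cinteg D g.
Proof.
move=> mD [g1 g2] ih hh; split; apply: (integ_le mD _ ih) => // x Dx.
  exact: le_trans (nc_Re _) (hh x Dx).
exact: le_trans (nc_Im _) (hh x Dx).
Qed.

Lemma cintegD D f g : measurable D -> cinteg D f -> cinteg D g -> cinteg D (fun x => f x + g x).
Proof.
move=> mD [f1 f2] [g1 g2]; split.
  rewrite (_ : (fun x => _) = (fun x => complex.Re (f x) + complex.Re (g x))); first exact: integD.
  by apply: funext => x; rewrite Re_add.
rewrite (_ : (fun x => _) = (fun x => complex.Im (f x) + complex.Im (g x))); first exact: integD.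
by apply: funext => x; rewrite Im_add.
Qed.
Lemma cintegZ D z g : measurable D -> cinteg D g -> cinteg D (fun x => z * g x).
Proof.
move=> mD [g1 g2]; split.
  rewrite (_ : (fun x => _) = (fun x => complex.Re z * complex.Re (g x) + (- complex.Im z) * complex.Im (g x))).
    by apply: integD => //; exact: integZ.
  by apply: funext => x; rewrite Re_mul.
rewrite (_ : (fun x => _) = (fun x => complex.Re z * complex.Im (g x) + complex.Im z * complex.Re (g x))).
  by apply: integD => //; exact: integZ.
by apply: funext => x; rewrite Im_mul.
Qed.
Lemma cintegB D f g : measurable D -> cinteg D f -> cinteg D g -> cinteg D (fun x => f x - g x).
Proof.
move=> mD hf hg; rewrite (_ : (fun x => _) = (fun x => f x + (-1) * g x)).
  by apply: cintegD => //; exact: cintegZ.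
by apply: funext => x; rewrite mulN1r.
Qed.
Lemma cintegS D E f : measurable D -> measurable E -> E `<=` D -> cinteg D f -> cinteg E f.
Proof. by move=> mD mE ED [f1 f2]; split; exact: integS ED _. Qed.

Lemma cintD D f g : measurable D -> cinteg D f -> cinteg D g ->
  cint D (fun x => f x + g x) = cint D f + cint D g.
Proof.
move=> mD [f1 f2] [g1 g2]; apply/eqP; rewrite eq_complex /=; apply/andP; split; apply/eqP.
  rewrite -RintD //; apply: Rint_eq => x _; exact: Re_add.
rewrite -RintD //; apply: Rint_eq => x _; exact: Im_add.
Qed.
Lemma cintZ D z g : measurable D -> cinteg D g ->
  cint D (fun x => z * g x) = z * cint D g.
Proof.
move=> mD [g1 g2]; case: z => a b; rewrite /cint.
have -> : \int[mu]_(x in D) complex.Re (Complex a b * g x) =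
   a * \int[mu]_(x in D) complex.Re (g x) + (- b) * \int[mu]_(x in D) complex.Im (g x).
  rewrite -!RintZ // -RintD //; try exact: integZ.
  by apply: Rint_eq => x _; rewrite Re_mul.
have -> : \int[mu]_(x in D) complex.Im (Complex a b * g x) =
   a * \int[mu]_(x in D) complex.Im (g x) + b * \int[mu]_(x in D) complex.Re (g x).
  rewrite -!RintZ // -RintD //; try exact: integZ.
  by apply: Rint_eq => x _; rewrite Im_mul.
by apply/eqP; rewrite eq_complex /= mulNr !eqxx.
Qed.
Lemma cintB D f g : measurable D -> cinteg D f -> cinteg D g ->
  cint D (fun x => f x - g x) = cint D f - cint D g.
Proof.
move=> mD hf hg; rewrite -(mulN1r (cint D g)) -cintZ // -cintD //; last exact: cintegZ.
by congr (cint _ _); apply: funext => x; rewrite mulN1r.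
Qed.
Lemma cint_eq D f g : (forall x, D x -> f x = g x) -> cint D f = cint D g.
Proof.
move=> e; rewrite /cint; congr Complex; apply: Rint_eq => x Dx; by rewrite e.
Qed.
Lemma cint_ae D f g : measurable D -> cmeas D f -> cmeas D g ->
  {ae mu, forall x, D x -> f x = g x} -> cint D f = cint D g.
Proof.
move=> mD [f1 f2] [g1 g2] e; rewrite /cint; congr Complex; apply: ae_eq_Rint => //;
 by apply: ae_mono e => x h Dx; rewrite h.
Qed.

Lemma cint_norm D g : measurable D -> cinteg D g ->
  nc (cint D g) <= 2 * \int[mu]_(x in D) nc (g x).
Proof.
move=> mD hg; have ig := cinteg_nc mD hg; case: hg => g1 g2.
apply: (le_trans (nc_le _)) => /=; rewrite mulr_natl mulr2n; apply: lerD.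
  apply: (le_trans (Rint_norm mD g1)); apply: Rint_le => //; first exact: integ_norm.
  by move=> x _; exact: nc_Re.
apply: (le_trans (Rint_norm mD g2)); apply: Rint_le => //; first exact: integ_norm.
by move=> x _; exact: nc_Im.
Qed.

Lemma integ_sum (I : Type) D (s : seq I) (F : I -> R -> R) : measurable D -> (mu D < +oo)%E ->
  (forall k, integ D (F k)) -> integ D (fun x => \sum_(k <- s) F k x).
Proof.
move=> mD D1 hF; elim: s => [|k s IH].
  rewrite (_ : (fun x => _) = cst 0); first exact: integ_cst.
  by apply: funext => x; rewrite big_nil.
rewrite (_ : (fun x => _) = (fun x => F k x + \sum_(k <- s) F k x)); first exact: integD.
by apply: funext => x; rewrite big_cons.
Qed.

Lemma Rint_sum (I : Type) D (s : seq I) (F : I -> R -> R) : measurable D -> (mu D < +oo)%E ->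
  (forall k, integ D (F k)) ->
  \int[mu]_(x in D) (\sum_(k <- s) F k x) = \sum_(k <- s) \int[mu]_(x in D) F k x.
Proof.
move=> mD D1 hF; elim: s => [|k s IH].
  rewrite big_nil; transitivity (0 * \int[mu]_(x in D) (0 : R)); last by rewrite mul0r.
  rewrite -RintZ //; last exact: integ_cst.
  by apply: Rint_eq => x _; rewrite big_nil mul0r.
rewrite big_cons -IH -RintD //; last exact: integ_sum.
by apply: Rint_eq => x _; rewrite big_cons.
Qed.

(** The weighted norm cut off at frequency [n]. It is measurable in [x] whenever the coefficients
    are, and therefore stands in for the full norm in integrals. *)
Definition pn (th : int -> R) (G : int -> R -> R[i]) n x :=
  Num.sqrt (\sum_(k <- zr n) th k * nc (G k x) ^+ 2).

Lemma pn_ge0 th G n x : 0 <= pn th G n x. Proof. exact: sqrtr_ge0. Qed.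

Lemma pn_sqr th G n x : (forall k, 0 <= th k) ->
  pn th G n x ^+ 2 = \sum_(k <- zr n) th k * nc (G k x) ^+ 2.
Proof.
by move=> th0; rewrite sqr_sqrtr //; apply: sumr_ge0 => k _; rewrite mulr_ge0 // sqr_ge0.
Qed.

Lemma pn_le th G n x M : norm_le th (G^~ x) M -> pn th G n x <= M.
Proof.
case=> M0 h; rewrite -(ger0_norm M0) -sqrtr_sqr ler_wsqrtr //; apply: h; exact: zr_uniq.
Qed.

Lemma measurable_pn D th G n : (forall k, cmeas D (G k)) -> measurable_fun D (pn th G n).
Proof.
move=> mG; apply: measurable_sqrt; elim: (zr n) => [|k s IH].
  by under eq_fun do rewrite big_nil; exact: measurable_cst.
under eq_fun do rewrite big_cons; apply: measurable_funD => //.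
apply: measurable_funM; first exact: measurable_cst.
by under eq_fun do rewrite expr2; apply: measurable_funM; exact: measurable_nc.
Qed.

Lemma integ_pn D th G n : measurable D -> (mu D < +oo)%E -> (forall k, 0 <= th k) ->
  (forall k, cinteg D (G k)) -> integ D (pn th G n).
Proof.
move=> mD D1 th0 hG.
have i k : integ D (fun x => Num.sqrt (th k) * nc (G k x)) by apply: integZ => //; exact: cinteg_nc.
apply: (integ_le mD _ (@integ_sum _ D (zr n) _ mD D1 i)).
  by apply: measurable_pn => k; exact: cinteg_cmeas.
move=> x _; rewrite ger0_norm ?pn_ge0 //.
have s0 (s : seq int) : 0 <= \sum_(k <- s) Num.sqrt (th k) * nc (G k x).
  by apply: sumr_ge0 => k _; rewrite mulr_ge0 ?sqrtr_ge0 ?nc_ge0.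
rewrite -(ler_pXn2r (n := 2)) ?nnegrE ?pn_ge0 // pn_sqr //.
elim: (zr n) => [|k s IH]; first by rewrite !big_nil expr0n.
rewrite !big_cons sqrrD exprMn sqr_sqrtr // -addrA lerD2l.
apply: (le_trans IH); rewrite lerDr mulrn_wge0 // mulr_ge0 // mulr_ge0 ?sqrtr_ge0 ?nc_ge0 //.
Qed.

(* Minkowski's integral inequality, by pairing with the integral itself. *)
Lemma norm_le_cint D th G B : measurable D -> (mu D < +oo)%E -> (forall k, 0 <= th k) ->
  (forall k, cinteg D (G k)) -> 0 <= B ->
  (forall n, \int[mu]_(x in D) pn th G n x <= B) ->
  norm_le th (fun k => cint D (G k)) B.
Proof.
move=> mD D1 th0 hG B0 hB; split=> //; apply: sums_le_zr.
  by move=> k; rewrite mulr_ge0 // sqr_ge0.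
move=> n; set c := fun k => cint D (G k); set Q := \sum_(k <- _) _.
have Q0 : 0 <= Q by apply: sumr_ge0 => k _; rewrite mulr_ge0 // sqr_ge0.
pose X := Num.sqrt Q; have X2 : X ^+ 2 = Q by rewrite sqr_sqrtr.
have X0 : 0 <= X by exact: sqrtr_ge0.
suff XB : X <= B by rewrite -X2 ler_pXn2r ?nnegrE.
have [->//|Xn] := eqVneq X 0.
have Xp : 0 < X by rewrite lt_neqAle eq_sym Xn.
suff : X * X <= X * B by rewrite ler_pM2l.
rewrite -expr2 X2.
pose F k x := th k * (complex.Re (c k) * complex.Re (G k x) + complex.Im (c k) * complex.Im (G k x)).
have iF k : integ D (F k).
  by apply: integZ => //; apply: integD => //; apply: integZ => //; case: (hG k).
have -> : Q = \int[mu]_(x in D) (\sum_(k <- zr n) F k x).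
  rewrite Rint_sum //; apply: eq_bigr => k _; rewrite RintZ //; last first.
    by apply: integD => //; apply: integZ => //; case: (hG k).
  rewrite RintD //; try by [apply: integZ => //; case: (hG k)].
  rewrite !RintZ //; try by [case: (hG k)].
  by rewrite nc_sqr !expr2.
apply: (@le_trans _ _ (\int[mu]_(x in D) (X * pn th G n x))); last first.
  by rewrite RintZ ?ler_wpM2l //; exact: integ_pn.
apply: Rint_le => //; first exact: integ_sum.
  by apply: integZ => //; exact: integ_pn.
move=> x _.
apply: (@le_trans _ _ (\sum_(k <- zr n) (Num.sqrt (th k) * nc (c k)) * (Num.sqrt (th k) * nc (G k x)))).
  apply: ler_sum => k _; rewrite mulrACA -expr2 sqr_sqrtr // /F ler_wpM2l //.
  have := Re_conjM (c k) (G k x); case: (c k) (G k x) => a b [a' b'] /= h.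
  apply: le_trans h; apply: le_trans (ler_norm _); lra.
apply: CS => //; first exact: pn_ge0.
  rewrite X2 le_eqVlt; apply/orP; left; apply/eqP; apply: eq_bigr => k _.
  by rewrite exprMn sqr_sqrtr.
rewrite pn_sqr // le_eqVlt; apply/orP; left; apply/eqP; apply: eq_bigr => k _.
by rewrite exprMn sqr_sqrtr.
Qed.

Lemma norm_le_cint_bound (a b : R) th G B : a <= b -> (forall k, 0 <= th k) ->
  (forall k, cinteg `[a, b] (G k)) -> 0 <= B ->
  {ae mu, forall x, `[a, b]%classic x -> norm_le th (G^~ x) B} ->
  norm_le th (fun k => cint `[a, b] (G k)) (B * (b - a)).
Proof.
move=> ab th0 hG B0 hB; have D1 := mu_itv_lt a b.
have mD : measurable (`[a, b]%classic : set R) by exact: measurable_itv.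
apply: norm_le_cint => //; first by rewrite mulr_ge0 // subr_ge0.
move=> n; rewrite -(Rint_cst B ab); apply: Rint_le_ae => //; [exact: integ_pn|exact: integ_cst|].
by apply: ae_mono hB => x h Dx; exact: pn_le (h Dx).
Qed.

End ComplexIntegral.

(** * Fourier coefficients of a Bochner integral *)

Section Bochner.
Context {R : realType}.
Implicit Types (D : set R) (l B M e : R) (H : R -> dist R) (s : @simple_fun R) (k j : int) (x : R) (n m : nat).
Local Notation mu := (@lebesgue_measure R).
Local Notation nc := (@normc R).
Local Notation rc := (real_complex R).

Lemma fourier_sum (I : Type) (r : seq I) (F : I -> dist R) k :
  fourier (\sum_(i <- r) F i) k = \sum_(i <- r) fourier (F i) k.
Proof.
elim: r => [|i r IH]; first by rewrite !big_nil fourier0.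
by rewrite !big_cons fourierD IH.
Qed.

Lemma fourier_simple s x k :
  fourier (simple_val s x) k = \sum_(p <- s) rc (\1_(p.1) x) * fourier p.2 k.
Proof. by rewrite fourier_sum; apply: eq_bigr => p _; rewrite fourierZ. Qed.

Definition csimple s k x := fourier (simple_val s x) k.

Lemma csimple_cons p s k :
  csimple (p :: s) k = fun x => fourier p.2 k * rc (\1_(p.1) x) + csimple s k x.
Proof. by apply: funext => x; rewrite /csimple /simple_val big_cons fourierD fourierZ mulrC. Qed.

Lemma csimple_nil k : csimple [::] k = fun=> 0.
Proof. by apply: funext => x; rewrite /csimple /simple_val big_nil fourier0. Qed.

Lemma cinteg_indic D (A : set R) : measurable D -> (mu D < +oo)%E -> measurable A ->
  cinteg D (fun x => rc (\1_A x)).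
Proof.
move=> mD D1 mA; split => /=; last exact: integ_cst.
apply: integ_mb => //; split; first exact: measurable_indic.
by exists 1 => x; rewrite indicE; case: (x \in A); rewrite ?normr1 ?normr0.
Qed.

Lemma cint_indic D (A : set R) : measurable D -> (mu D < +oo)%E -> measurable A ->
  cint D (fun x => rc (\1_A x)) = rc (fine (mu (A `&` D))).
Proof.
move=> mD D1 mA; rewrite /cint /=; congr Complex.
  by rewrite /Rintegral integral_indic.
have -> : \int[mu]_(x in D) (0 : R) = 0 * \int[mu]_(x in D) (0 : R).
  by rewrite -RintZ //; [apply: Rint_eq => x _; rewrite mul0r|exact: integ_cst].
by rewrite mul0r.
Qed.

Lemma csimple_int D s k : measurable D -> (mu D < +oo)%E ->
  (forall p, p \in s -> measurable p.1) ->
  cinteg D (csimple s k) /\ cint D (csimple s k) = fourier (simple_integral D s) k.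
Proof.
move=> mD D1; elim: s => [|p s IH] ms.
  rewrite csimple_nil /simple_integral big_nil fourier0.
  have i0 : cinteg D (fun=> 0) by split; exact: integ_cst.
  split=> //; rewrite -[RHS](mul0r (cint D (fun=> 0))) -cintZ //.
  by apply: cint_eq => x _; rewrite mul0r.
have mp : measurable p.1 by apply: ms; rewrite mem_head.
have [i1 e1] : cinteg D (csimple s k) /\ cint D (csimple s k) = fourier (simple_integral D s) k.
  by apply: IH => q qs; apply: ms; rewrite in_cons qs orbT.
have i2 := cinteg_indic mD D1 mp; have i3 := cintegZ (fourier p.2 k) mD i2.
rewrite csimple_cons; split; first exact: cintegD.
rewrite cintD // cintZ // cint_indic // e1 /simple_integral big_cons fourierD fourierZ.
by rewrite mulrC.
Qed.

Lemma csimple_cmeas s k : (forall p, p \in s -> measurable p.1) -> cmeas setT (csimple s k).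
Proof.
elim: s => [|p s IH] ms; first by rewrite csimple_nil; exact: cmeas_cst.
rewrite csimple_cons; apply: cmeasD.
  apply: cmeasM; first exact: cmeas_cst.
  by split => /=; [apply: measurable_indic; apply: ms; rewrite mem_head|exact: measurable_cst].
by apply: IH => q qs; apply: ms; rewrite in_cons qs orbT.
Qed.

Lemma psum_sob l (u : dist R) n :
  ((pn (om l) (fun k (_ : R) => fourier u k) n 0)%:E <= sobolev_norm l u)%E.
Proof.
have [fu|] := boolP (sobolev_norm l u \is a fin_num); last first.
  by rewrite ge0_fin_numE ?sobolev_ge0 // ltey negbK => /eqP ->; rewrite leey.
rewrite -(fineK fu) lee_fin; apply: pn_le; apply/sob_le; last by rewrite fineK.
exact: fine_ge0 (sobolev_ge0 _ _).
Qed.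

Lemma coef_pn l (c : int -> R[i]) k : 0 <= l ->
  nc (c k) <= pn (om l) (fun k (_ : R) => c k) `|k|%N 0.
Proof.
move=> l0; rewrite -(ler_pXn2r (n := 2)) ?nnegrE ?nc_ge0 ?pn_ge0 //.
rewrite pn_sqr; last exact: om_ge0.
rewrite (bigD1_seq k) ?mem_zr ?zr_uniq //=.
have h : nc (c k) ^+ 2 <= om l k * nc (c k) ^+ 2.
  by rewrite ler_peMl ?sqr_ge0 // om_ge1.
apply: (le_trans h); rewrite lerDl; apply: sumr_ge0 => j _.
by rewrite mulr_ge0 ?sqr_ge0 // om_ge0.
Qed.

Lemma coef_sob l (u : dist R) k : 0 <= l -> ((nc (fourier u k))%:E <= sobolev_norm l u)%E.
Proof. by move=> l0; apply: le_trans (psum_sob l u `|k|%N); rewrite lee_fin coef_pn. Qed.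

(** One family of measurable functions serves all modes at once, at every point where all
    coefficients converge. *)
Lemma coef_version D (c : nat -> int -> R -> R[i]) (F : R -> int -> R[i]) : measurable D ->
  (forall n k, cmeas D (c n k)) ->
  exists G : int -> R -> R[i], (forall k, cmeas D (G k)) /\
    forall x, D x -> (forall k, ccvg (fun n => c n k x) (F x k)) -> forall k, F x k = G k x.
Proof.
move=> mD hc.
have h k := lim_measurable mD (fun n => proj1 (hc n k)).
have h' k := lim_measurable mD (fun n => proj2 (hc n k)).
have [gr hgr] := choice h; have [gi hgi] := choice h'.
exists (fun k x => Complex (gr k x) (gi k x)); split.
  by move=> k; split; [exact: (proj1 (hgr k))|exact: (proj1 (hgi k))].
move=> x Dx hx k; have cv := hx k.
rewrite (proj2 (hgr k) x _ Dx (ccvg_Re cv)) (proj2 (hgi k) x _ Dx (ccvg_Im cv)).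
by case: (F x k).
Qed.

Lemma sob_ccvg l (u : nat -> dist R) (v : dist R) k :
  sobolev_norm l (v - u n) @[n --> \oo] --> 0%E ->
  ccvg (fun n => fourier (u n) k) (fourier v k).
Proof.
move/sob_cvg0 => h; apply/ccvgP => e e0.
have om0 := om_gt0 l k.
have e'0 : 0 < Num.sqrt (om l k) * e by rewrite mulr_gt0 // sqrtr_gt0.
have [m _ hm] := h _ e'0; exists m => n mn; have := hm n mn.
move=> /(norm_le_coef k) h2.
rewrite ncBC -fourierB -(ler_pXn2r (n := 2)) ?nnegrE ?nc_ge0 ?(ltW e0) // -(ler_pM2l om0).
by apply: (le_trans h2); rewrite [leLHS]exprMn sqr_sqrtr // ltW.
Qed.

Lemma strongly_version l D H : measurable D -> strongly_measurable l D H ->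
  exists G : int -> R -> R[i], (forall k, cmeas D (G k)) /\
    {ae mu, forall x, D x -> forall k, fourier (H x) k = G k x}.
Proof.
move=> mD [s [ss scv]].
have mc n k : cmeas D (csimple (s n) k).
  apply: (@cmeasS _ setT) => //; apply: csimple_cmeas => p ps; exact: (proj1 (ss n p ps)).
have [G [mG hG]] := coef_version (fun x => fourier (H x)) mD mc.
exists G; split=> //; apply: ae_mono scv => x h Dx; apply: hG => // k.
exact: (sob_ccvg k (h Dx)).
Qed.

Lemma norm_le_simple l s : is_simple l s -> exists M, forall x, norm_le (om l) (fourier (simple_val s x)) M.
Proof.
move=> ss; have : forall p, p \in s -> exists M, norm_le (om l) (fourier p.2) M.
  by move=> p /ss[_ /HperP[_]].
elim: s {ss} => [|p s IH] hs.
  exists 0 => x; rewrite (_ : fourier _ = fun=> 0); first exact: norm_le0.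
  by apply: funext => k; rewrite /simple_val big_nil fourier0.
have [M hM] := hs p (mem_head _ _).
have [N hN] : exists N, forall x, norm_le (om l) (fourier (simple_val s x)) N.
  by apply: IH => q qs; apply: hs; rewrite in_cons qs orbT.
exists (M + N) => x.
rewrite (_ : fourier _ = fun k => rc (\1_(p.1) x) * fourier p.2 k + fourier (simple_val s x) k).
  apply: norm_leD => //; first exact: om_ge0.
  apply: norm_le_sub hM; first exact: om_ge0.
  move=> k; rewrite normcM nc_real indicE; case: (x \in p.1).
    by rewrite normr1 mul1r.
  by rewrite normr0 mul0r nc_ge0.
by apply: funext => k; rewrite /simple_val big_cons fourierD fourierZ.
Qed.

(** Everything later needed from a Bochner integral, expressed by coefficients. Integrability comes
    from one approximant within distance 1 in the mean: it is bounded by some [C], so the cut-off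
    norms exceed [C] by a function whose integral is at most 1. The integral of a coefficient is the
    limit of those of the simple functions. *)
Lemma bochner_coef l D H (I : dist R) : 0 <= l -> measurable D -> (mu D < +oo)%E ->
  is_bochner_integral l D H I ->
  exists G : int -> R -> R[i],
    [/\ forall k, cinteg D (G k),
        {ae mu, forall x, D x -> forall k, fourier (H x) k = G k x},
        forall k, fourier I k = cint D (G k) &
        exists2 B, 0 <= B & forall n, \int[mu]_(x in D) pn (om l) G n x <= B].
Proof.
move=> l0 mD D1 [hH hI [s [[ss scv] icv Icv]]].
have [G [mG hG]] := @strongly_version l D H mD (ex_intro _ s (conj ss scv)).
have ms n p : p \in s n -> measurable p.1 by move=> /(ss n)[].
have om0' k : 0 <= om l k := om_ge0 l k.
have mpn n : measurable_fun D (pn (om l) G n) by exact: measurable_pn.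
have icvP e : 0 < e -> exists N, forall n, (N <= n)%N ->
    (\int[mu]_(x in D) sobolev_norm l (H x - simple_val (s n) x)%R <= e%:E)%E.
  move=> e0; have /fine_cvgP[[N1 _ fin] /cvgrPdist_le/(_ _ e0)[N2 _ h]] := icv.
  exists (maxn N1 N2) => n; rewrite geq_max => /andP[/fin /= fn /h /=].
  rewrite sub0r normrN => hn; rewrite -(fineK fn) lee_fin; apply: le_trans hn; exact: ler_norm.
have [N hN] := icvP 1 ltr01; have {}hN := hN N (leqnn N).
have [C hC] := norm_le_simple (ss N).
have C0 : 0 <= C by case: (hC 0).
(* A measurable lower bound for the norm of [H x] minus the simple function, which itself is not
   known to be measurable in [x]. *)
pose g n x := Num.max 0 (pn (om l) G n x - C).
have mg n : measurable_fun D (g n).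
  by apply: measurable_maxr; [exact: measurable_cst|apply: measurable_funB => //; exact: measurable_cst].
have gle n : integ D (g n) /\ \int[mu]_(x in D) g n x <= 1.
  apply: nonneg_integ => //; first by move=> x _; rewrite le_max lexx.
  apply: le_trans hN; apply: int_mono_ael => //; first by move=> x _; rewrite le_max lexx.
    by move=> x _; exact: sobolev_ge0.
  apply: ae_mono hG => x e Dx; have {}e := e Dx.
  have [fu|] := boolP (sobolev_norm l (H x - simple_val (s N) x) \is a fin_num); last first.
    by rewrite ge0_fin_numE ?sobolev_ge0 // ltey negbK => /eqP ->; rewrite leey.
  have f0 : 0 <= fine (sobolev_norm l (H x - simple_val (s N) x)) by exact: fine_ge0 (sobolev_ge0 _ _).
  rewrite -(fineK fu) lee_fin /g ge_max f0 lerBlDr; apply: pn_le.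
  rewrite (_ : G^~ x = fun k => fourier (H x - simple_val (s N) x) k + fourier (simple_val (s N) x) k).
    by apply: norm_leD => //; apply/sob_le => //; rewrite fineK.
  by apply: funext => k; rewrite fourierB subrK e.
have ic c := @integ_cst R D c mD D1.
have ipn n : integ D (pn (om l) G n).
  apply: (integ_le mD (mpn n) (integD mD (proj1 (gle n)) (ic C))) => x _.
  by rewrite ger0_norm ?pn_ge0 // -lerBlDr /g le_max lexx orbT.
have iG k : cinteg D (G k).
  apply: (nc_cinteg mD (mG k) (ipn `|k|%N)) => x _.
  by have := coef_pn (G^~ x) k l0; rewrite /pn.
exists G; split=> //; last first.
  exists (1 + \int[mu]_(x in D) C); first by rewrite addr_ge0 // Rint_ge0.
  move=> n; apply: (@le_trans _ _ (\int[mu]_(x in D) (g n x + C))).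
    apply: Rint_le => //; first by apply: integD => //; case: (gle n).
    by move=> x _; rewrite -lerBlDr /g le_max lexx orbT.
  by rewrite RintD ?lerD2r //; case: (gle n).
move=> k; have c1 := sob_ccvg (u := fun n => simple_integral D (s n)) k Icv.
apply: (ccvg_uniq c1); apply/ccvgP => e e0.
have [m hm] := icvP (e / 2) (divr_gt0 e0 (ltr0n R 2)); exists m => n mn.
have [i1 e1] := csimple_int k mD D1 (ms n).
rewrite -e1 -cintB //; apply: (le_trans (cint_norm mD (cintegB mD i1 (iG k)))).
rewrite mulrC -ler_pdivlMr //.
have inc := cinteg_nc mD (cintegB mD i1 (iG k)).
rewrite -lee_fin -RintE //; apply: le_trans (hm n mn).
apply: int_mono_ael => //; first exact: integ_meas.
- by move=> x _; exact: nc_ge0.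
- by move=> x _; exact: sobolev_ge0.
apply: ae_mono hG => x e' Dx; rewrite -(e' Dx) ncBC /csimple -fourierB.
exact: coef_sob.
Qed.

End Bochner.

(** * Construction of Bochner integrals from coefficients *)

Section BochnerIntro.
Context {R : realType}.
Implicit Types (D : set R) (l B M e : R) (H : R -> dist R) (s : @simple_fun R) (k j : int) (x : R) (n m : nat) (z : R[i]).
Local Notation mu := (@lebesgue_measure R).
Local Notation nc := (@normc R).
Local Notation rc := (real_complex R).

(** Rounds [g] down to multiples of [1 / N]. Finitely many level sets suffice where [g] is bounded
    by [B], and [M] exceeds the indices that occur there. *)
Lemma discretize D (g : R -> R) B (N : nat) : measurable D -> measurable_fun D g ->
  (0 < N)%N -> exists s : seq (set R * R), (forall p, p \in s -> measurable p.1) /\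
  forall x, D x -> `|g x| <= B ->
    `|g x - \sum_(p <- s) p.2 * \1_(p.1) x| <= N%:R^-1.
Proof.
move=> mD mg N0; have NR : 0 < N%:R :> R by rewrite ltr0n.
pose A (j : int) := D `&` g @^-1` `[j%:~R / N%:R, (j + 1)%:~R / N%:R[%classic.
pose M := (Num.bound (`|B| * N%:R)).+1.
exists [seq (A j, j%:~R / N%:R : R) | j <- zr M]; split.
  by move=> p /mapP[j _ ->] /=; apply: mg => //; exact: measurable_itv.
move=> x Dx gB; rewrite big_map /=.
pose y := g x * N%:R; pose j0 := Num.floor y.
have /andP[j1 j2] : (j0%:~R <= y < (j0 + 1)%:~R).
  by rewrite /j0 floor_itv.
have inA j : (x \in A j) = (j == j0).
  apply/idP/eqP => [|->].
    rewrite inE => -[_]; rewrite /= in_itv /= ler_pdivrMr // ltr_pdivlMr // => h.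
    by rewrite /j0 (floor_def h).
  rewrite inE; split=> //=; rewrite in_itv /= ler_pdivrMr // ltr_pdivlMr //.
  by rewrite j1 j2.
have j0M : j0 \in zr M.
  rewrite mem_zr -(ler_nat R) /M natr_absz intr_norm.
  have h1 : `|y| <= `|B| * N%:R.
    rewrite /y normrM (@gtr0_norm _ N%:R) // ler_wpM2r // (le_trans gB) //; exact: ler_norm.
  have h2 : `|B| * N%:R < (Num.bound (`|B| * N%:R))%:R by rewrite archi_boundP // mulr_ge0.
  move: h1; rewrite ler_norml => /andP[h3 h4].
  move: j2; rewrite intrD => j2.
  by rewrite -natr1 ler_norml; apply/andP; split; lra.
rewrite (bigD1_seq j0) ?zr_uniq //= big1 ?addr0.
  rewrite indicE inA eqxx mulr1.
  have e : g x = y / N%:R by rewrite /y mulfK // gt_eqF.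
  rewrite e -mulrBl normrM normfV (@gtr0_norm _ N%:R) // ler_piMl ?invr_ge0 //.
  by move: j2; rewrite intrD => j2; rewrite ler_norml; apply/andP; split; lra.
by move=> j /negPf jj0; rewrite indicE inA jj0 mulr0.
Qed.

Lemma csimple_cat s s' k x : csimple (s ++ s') k x = csimple s k x + csimple s' k x.
Proof. by rewrite /csimple /simple_val big_cat fourierD. Qed.

Lemma csimple_map (s : seq (set R * R)) (v : dist R) k x :
  csimple [seq (p.1, p.2 *: v) | p <- s] k x =
  rc (\sum_(p <- s) p.2 * \1_(p.1) x) * fourier v k.
Proof.
rewrite /csimple fourier_simple big_map /= rmorph_sum mulr_suml.
by apply: eq_bigr => p _; rewrite fourierZ mulrA rmorphM (mulrC (rc p.2)).
Qed.

(** Induction on the number of modes: the real and the imaginary part of the next coefficient are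
    discretized separately and attached to the modes with values 1 and [i], and conjugate symmetry
    takes care of the negative frequency. *)
Lemma simple_modes D l (G : int -> R -> R[i]) B N n : measurable D -> (0 < N)%N ->
  (forall k, cmeas D (G k)) ->
  exists s, is_simple l s /\ forall x, D x -> (forall k, nc (G k x) <= B) ->
    is_real (G^~ x) -> G 0 x = 0 ->
    (forall j, nc (trunc n (G^~ x) j - csimple s j x) <= 2 / N%:R) /\
    (forall j, (n < `|j|)%N -> csimple s j x = 0).
Proof.
move=> mD N0 mG; elim: n => [|n [s [ss hs]]].
  exists [::]; split=> // x Dx hB rG G0; split=> j; last by rewrite csimple_nil.
  rewrite csimple_nil subr0 /trunc leqn0 absz_eq0; case: eqP => [->|_].
    by rewrite G0 nc0 divr_ge0.
  by rewrite nc0 divr_ge0.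
pose m := n.+1%:Z; have m0 : m != 0 by [].
have [s1 [ms1 h1]] := discretize B mD (proj1 (mG m)) N0.
have [s2 [ms2 h2]] := discretize B mD (proj2 (mG m)) N0.
have [hm1 fm1] := mode_Hper0 l (1 : R[i]) m0.
have [hm2 fm2] := mode_Hper0 l (Complex 0 1 : R[i]) m0.
exists (s ++ ([seq (p.1, p.2 *: realize (mode m 1)) | p <- s1] ++
              [seq (p.1, p.2 *: realize (mode m (Complex 0 1))) | p <- s2])); split.
  have hz (a : R) z : Hper l (a *: realize (mode m z)).
    have [/Hper0P[dz [M hM] _] _] := mode_Hper0 l z m0.
    apply/HperP; split; first exact: is_distZ.
    exists (nc (rc a) * M); apply: norm_le_ptw hM; [exact: om_ge0|exact: nc_ge0|].
    by move=> k; rewrite fourierZ normcM.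
  move=> p; rewrite !mem_cat => /or3P[/ss //|/mapP[q qs ->]|/mapP[q qs ->]] /=.
    by split; [exact: ms1|exact: hz].
  by split; [exact: ms2|exact: hz].
move=> x Dx hB rG G0; have [e1 e2] := hs x Dx hB rG G0.
have r1 := h1 x Dx (le_trans (nc_Re _) (hB m)).
have r2 := h2 x Dx (le_trans (nc_Im _) (hB m)).
set p1 := \sum_(p <- s1) _ in r1; set p2 := \sum_(p <- s2) _ in r2.
have E j : csimple (s ++ ([seq (p.1, p.2 *: realize (mode m 1)) | p <- s1] ++
              [seq (p.1, p.2 *: realize (mode m (Complex 0 1))) | p <- s2])) j x =
   csimple s j x + (if j == m then Complex p1 p2 else if j == - m then conjc (Complex p1 p2) else 0).
  rewrite !csimple_cat !csimple_map fm1 fm2 -/p1 -/p2 /mode; congr (_ + _).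
  case: ifP => _; [|case: ifP => _]; apply/eqP; rewrite eq_complex /=.
  - by apply/andP; split; apply/eqP; ring.
  - by apply/andP; split; apply/eqP; ring.
  - by apply/andP; split; apply/eqP; ring.
have main : nc (G m x - Complex p1 p2) <= 2 / N%:R.
  apply: (le_trans (nc_le _)); rewrite ReB ImB /=; lra.
split=> j; rewrite E.
  have [->|jm] := eqVneq j m.
    by rewrite e2 ?add0r // /trunc (_ : (`|m| <= n.+1)%N) //; lia.
  have [->|jm'] := eqVneq j (- m).
    have mn : (`|m| <= n.+1)%N by rewrite /m; lia.
    have nm : (n < `|- m|)%N by rewrite /m; lia.
    rewrite e2 // add0r /trunc abszN mn.
    by rewrite rG -rmorphB nc_conj.
  rewrite addr0; have := e1 j; rewrite /trunc.
  by rewrite (_ : (`|j| <= n.+1)%N = (`|j| <= n)%N) //; move: jm jm'; rewrite /m; lia.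
move=> jn; rewrite e2 ?add0r; last lia.
have /negPf -> : j != m by apply/eqP => h; move: jn; rewrite h /m; lia.
by have /negPf -> : j != - m by apply/eqP => h; move: jn; rewrite h /m; lia.
Qed.

Lemma ecvg0 (F : nat -> \bar R) (a : nat -> R) :
  (forall n, (0 <= F n <= (a n)%:E)%E) -> a @ \oo --> (0 : R) -> F @ \oo --> 0%E.
Proof.
move=> h ha; apply: (@squeeze_cvge _ _ _ R (fun=> 0%E) F (EFin \o a)).
- exact: nearW.
- exact: cvg_cst.
- by apply: cvg_EFin => //; exact: nearW.
Qed.

Lemma tail_norm th (a : int -> R[i]) n (Q : R) : (forall k, 0 <= th k) ->
  (forall m, \sum_(k <- zr m) th k * nc (a k) ^+ 2 <= Q) ->
  norm_le th (fun k => a k - trunc n a k) (Num.sqrt (Q - \sum_(k <- zr n) th k * nc (a k) ^+ 2)).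
Proof.
move=> th0 hQ; have hn := hQ n; split; first exact: sqrtr_ge0.
have F0 k : 0 <= th k * nc (a k) ^+ 2 by rewrite mulr_ge0 // sqr_ge0.
have hs := sums_le_zr F0 hQ.
rewrite sqr_sqrtr ?subr_ge0 // => s us; rewrite lerBrDr.
rewrite (bigID (fun k => (n < `|k|)%N)) /= [X in _ + X + _]big1 ?addr0; last first.
  by move=> k nk; rewrite /trunc leqNgt nk subrr nc0 expr0n mulr0.
rewrite -big_filter (eq_big_seq (fun k => th k * nc (a k) ^+ 2)); last first.
  by move=> k; rewrite mem_filter => /andP[nk _]; rewrite /trunc leqNgt nk subr0.
rewrite -big_cat; apply: hs; rewrite cat_uniq filter_uniq // zr_uniq andbT /=.
by apply/hasPn => k; rewrite mem_zr mem_filter ltnNge => ->.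
Qed.

(** The approximants keep the modes up to [n] and discretize them with an error below [1 / (n + 1)].
    The norm of the discarded modes is bounded by the measurable function [tau n], which tends to 0
    and is dominated by [B], so that its integral tends to 0 as well. *)
Lemma bochner_intro l D H (I : dist R) (G : int -> R -> R[i]) B : 0 <= l ->
  measurable D -> (mu D < +oo)%E -> (forall x, D x -> Hper0 l (H x)) ->
  (forall x, D x -> norm_le (om l) (fourier (H x)) B) -> 0 <= B ->
  (forall k, cinteg D (G k)) -> {ae mu, forall x, D x -> forall k, fourier (H x) k = G k x} ->
  Hper l I -> (forall k, fourier I k = cint D (G k)) ->
  is_bochner_integral l D H I.
Proof.
move=> l0 mD D1 hH hB B0 iG hG hI eI.
have om0' k : 0 <= om l k := om_ge0 l k.
have mG k : cmeas D (G k) := cinteg_cmeas (iG k).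
have ex n : exists s, is_simple l s /\ forall x, D x -> (forall k, fourier (H x) k = G k x) ->
   norm_le (om l) (fun k => trunc n (G^~ x) k - csimple s k x) (n.+1%:R^-1).
  pose Q := Num.sqrt (\sum_(k <- zr n) om l k).
  (* An error of [2 / N] in each of the modes up to [n] amounts to at most [Q * (2 / N)] in norm. *)
  pose N := (Num.bound (2 * Q * n.+1%:R)).+1.
  have [s [ss hs]] := @simple_modes D l G B N n mD isT mG.
  exists s; split=> // x Dx e.
  have E : G^~ x = fourier (H x) by apply: funext => k; rewrite e.
  have /Hper0P[dH _ H0] := hH x Dx.
  have [h1 h2] : (forall j, nc (trunc n (G^~ x) j - csimple s j x) <= 2 / N%:R) /\
    (forall j, (n < `|j|)%N -> csimple s j x = 0).
    apply: hs => //; last by rewrite -e.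
      by move=> k; rewrite -e; exact: norm_le1_coef (om_one l0 (hB x Dx)).
    by rewrite E; exact: fourier_real (proj1 dH).
  have NR : 0 < N%:R :> R by rewrite ltr0n.
  have Q0 : 0 <= \sum_(k <- zr n) om l k by apply: sumr_ge0.
  have QN : Q * (2 / N%:R) <= n.+1%:R^-1.
    rewrite mulrA ler_pdivrMr // ler_pdivlMl ?ltr0n //.
    have -> : n.+1%:R * (Q * 2) = 2 * Q * n.+1%:R by ring.
    apply: ltW; apply: (@lt_trans _ _ (Num.bound (2 * Q * n.+1%:R))%:R).
      by rewrite archi_boundP // !mulr_ge0 // sqrtr_ge0.
    by rewrite ltr_nat.
  apply: norm_le_W QN; split; first by rewrite mulr_ge0 ?sqrtr_ge0 // divr_ge0.
  move=> r ur; rewrite exprMn sqr_sqrtr // mulr_suml.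
  rewrite (bigID (fun k => (`|k| <= n)%N)) /= [X in _ + X]big1 ?addr0; last first.
    by move=> k; rewrite -ltnNge => nk; rewrite h2 // /trunc leqNgt nk subrr nc0 expr0n mulr0.
  rewrite -big_filter.
  apply: (@le_trans _ _ (\sum_(k <- [seq k <- r | (`|k| <= n)%N]) om l k * (2 / N%:R) ^+ 2)).
    by apply: ler_sum => k _; rewrite ler_wpM2l // ler_pXn2r ?nnegrE ?nc_ge0 // divr_ge0.
  apply: sum_uniq_sub; [exact: filter_uniq|exact: zr_uniq| |].
    by move=> k; rewrite mem_filter mem_zr => /andP[].
  by move=> k; rewrite mulr_ge0 // sqr_ge0.
have [s hs] := choice ex.
pose S n x := \sum_(k <- zr n) om l k * nc (G k x) ^+ 2.
have mS n : measurable_fun D (S n).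
  rewrite /S; elim: (zr n) => [|k r IH].
    by under eq_fun do rewrite big_nil; exact: measurable_cst.
  under eq_fun do rewrite big_cons; apply: measurable_funD => //.
  apply: measurable_funM; first exact: measurable_cst.
  by under eq_fun do rewrite expr2; apply: measurable_funM; exact: measurable_nc.
have [Q [mQ hQ]] := lim_measurable mD mS.
have F0 x k : 0 <= om l k * nc (G k x) ^+ 2 by rewrite mulr_ge0 // sqr_ge0.
have Smono x n m : (n <= m)%N -> S n x <= S m x.
  move=> nm; apply: sum_uniq_sub; rewrite ?zr_uniq //.
  by move=> k; rewrite !mem_zr => kn; exact: leq_trans nm.
have good x : D x -> (forall k, fourier (H x) k = G k x) ->
   norm_le (om l) (G^~ x) B /\ (fun n => S n x) @ \oo --> Q x /\ forall n, S n x <= Q x.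
  move=> Dx e; have E : G^~ x = fourier (H x) by apply: funext => k; rewrite e.
  have hBx : norm_le (om l) (G^~ x) B by rewrite E; exact: hB.
  have SB n : S n x <= B ^+ 2 by case: hBx => _ h; apply: h; exact: zr_uniq.
  have cv : cvgn (fun n => S n x).
    apply: nondecreasing_is_cvgn; first by move=> n m; exact: Smono.
    by exists (B ^+ 2) => _ [n _ <-].
  have e' : Q x = limn (fun n => S n x) := hQ x _ Dx cv.
  split=> //; rewrite e'; split=> // n.
  by apply: nondecreasing_cvgn_le => // i j; exact: Smono.
(* By [tail_norm] the second entry is the norm of the tail at almost every point; the minimum with
   [B] also controls the exceptional points, where [Q] is arbitrary. *)
pose tau n x := Num.min B (Num.sqrt (Q x - S n x)).
have tau0 n x : 0 <= tau n x by rewrite le_min B0 sqrtr_ge0.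
have mtau n : measurable_fun D (tau n).
  apply: measurable_minr; first exact: measurable_cst.
  by apply: measurable_sqrt; exact: measurable_funB.
have iB := @integ_cst R D B mD D1.
have itau n : integ D (tau n).
  by apply: (integ_le mD (mtau n) iB) => x _; rewrite ger0_norm // ge_min lexx.
have tnle x n : D x -> (forall k, fourier (H x) k = G k x) ->
   norm_le (om l) (fun k => G k x - trunc n (G^~ x) k) (tau n x).
  move=> Dx e; have [h1 [_ h2]] := good x Dx e; rewrite /tau minEle; case: ifP => _.
    apply: norm_le_sub h1 => // k; rewrite /trunc; case: ifP => _; last by rewrite subr0.
    by rewrite subrr nc0 nc_ge0.
  exact: (tail_norm (a := G^~ x) n om0' h2).
have gle x n : D x -> (forall k, fourier (H x) k = G k x) ->
   norm_le (om l) (fun k => G k x - csimple (s n) k x) (tau n x + n.+1%:R^-1).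
  move=> Dx e; have h := norm_leD om0' (tnle x n Dx e) (proj2 (hs n) x Dx e).
  by move: h; congr (norm_le _ _ _); apply: funext => k; rewrite addrA subrK.
have sums_le' x n : D x -> (forall k, fourier (H x) k = G k x) ->
   (sobolev_norm l (H x - simple_val (s n) x)%R <= (tau n x + n.+1%:R^-1)%:E)%E.
  move=> Dx e; apply/sob_le; first by rewrite addr_ge0.
  rewrite (_ : fourier _ = fun k => G k x - csimple (s n) k x); first exact: gle.
  by apply: funext => k; rewrite fourierB e.
have tcv x : D x -> (forall k, fourier (H x) k = G k x) -> (fun n => tau n x) @ \oo --> (0 : R).
  move=> Dx e; have [_ [cv _]] := good x Dx e.
  have c2 : (fun n => Num.sqrt (Q x - S n x)) @ \oo --> Num.sqrt (Q x - Q x).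
    apply: continuous_cvg; first exact: sqrt_continuous.
    exact: (cvgB (cvg_cst (Q x)) cv).
  rewrite subrr sqrtr0 in c2.
  apply/cvgrPdist_le => eps eps0; have /cvgrPdist_le/(_ _ eps0) := c2; apply: filterS => n.
  rewrite !sub0r !normrN !ger0_norm ?sqrtr_ge0 // => h.
  by rewrite ge_min h orbT.
pose a n := \int[mu]_(x in D) (tau n x + n.+1%:R^-1).
have ia n : integ D (fun x => tau n x + n.+1%:R^-1) by apply: integD => //; exact: integ_cst.
have harm : (fun n => n.+1%:R^-1 : R) @ \oo --> (0 : R) by exact: cvg_harmonic.
have acv : a @ \oo --> (0 : R).
  have [_ c1] : integ D (fun=> 0 : R) /\ (fun n => \int[mu]_(x in D) tau n x) @ \oo --> \int[mu]_(x in D) (0 : R).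
    apply: (@dom_cvg _ D tau (fun=> 0) (fun=> B)) => //.
      by apply: ae_mono hG => x e Dx; exact: tcv Dx (e Dx).
    by move=> x n _; rewrite ger0_norm // ge_min lexx.
  have e0 (c : R) : \int[mu]_(x in D) c = c * \int[mu]_(x in D) (1 : R).
    rewrite -RintZ //; last exact: integ_cst.
    by apply: Rint_eq => x _; rewrite mulr1.
  rewrite e0 mul0r in c1.
  have c3 : (fun n => \int[mu]_(x in D) tau n x + n.+1%:R^-1 * \int[mu]_(x in D) (1 : R)) @ \oo --> (0 + 0 * \int[mu]_(x in D) (1 : R)).
    exact: (cvgD c1 (cvgM harm (cvg_cst _))).
  rewrite mul0r addr0 in c3; rewrite (_ : a = fun n => \int[mu]_(x in D) tau n x + n.+1%:R^-1 * \int[mu]_(x in D) (1 : R)) //.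
  by apply: funext => n; rewrite /a RintD // -?e0 //; exact: integ_cst.
split.
- by move=> x Dx; case: (hH x Dx).
- exact: hI.
exists s; split.
- split; first by move=> n; case: (hs n).
  apply: ae_mono hG => x e Dx; have {}e := e Dx.
  apply: (@ecvg0 _ (fun n => tau n x + n.+1%:R^-1)).
    by move=> n; rewrite sobolev_ge0 sums_le'.
  by rewrite -(addr0 (0 : R)); exact: (cvgD (tcv x Dx e) harm).
- apply: (ecvg0 (a := a)) => // n; apply/andP; split.
    by apply: integral_ge0 => x _; exact: sobolev_ge0.
  rewrite /a -RintE //; apply: int_mono_aer => //.
  + exact: integ_meas.
  + by move=> x _; rewrite addr_ge0.
  + by move=> x _; exact: sobolev_ge0.
  + by apply: ae_mono hG => x e Dx; exact: sums_le' Dx (e Dx).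
- apply: (ecvg0 (a := a)) => // n; rewrite sobolev_ge0 /=.
  have a0 : 0 <= a n by apply: Rint_ge0 => x _; rewrite addr_ge0.
  apply/sob_le => //.
  have ms p : p \in s n -> measurable p.1 by case: (hs n) => + _ => /(_ p) h /h[].
  rewrite (_ : fourier _ = fun k => cint D (fun x => G k x - csimple (s n) k x)); last first.
    apply: funext => k; have [i1 e1] := csimple_int k mD D1 ms.
    by rewrite cintB // fourierB e1 eI.
  have i1 k : cinteg D (fun x => G k x - csimple (s n) k x).
    by have [i1 _] := csimple_int k mD D1 ms; exact: cintegB.
  apply: norm_le_cint => // m; apply: Rint_le_ae => //; first exact: integ_pn.
  by apply: ae_mono hG => x e Dx; exact: pn_le (gle x n Dx (e Dx)).
Qed.

End BochnerIntro.

(** * Mild solutions *)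

Section Duhamel.
Context {R : realType}.
Variables (lam : int -> R[i]) (Lam : R).
Hypothesis lam_neg : forall k, complex.Re (lam k) <= 0.
Hypothesis lam_le : forall k, normc (lam k) <= Lam.
Implicit Types (D : set R) (a b t s h T M K e : R) (k : int) (z : R[i]) (th : int -> R)
  (u v B : R -> int -> R[i]) (G : int -> R -> R[i]).
Local Notation mu := (@lebesgue_measure R).
Local Notation nc := (@normc R).
Local Notation rc := (real_complex R).

Let mI a b : measurable (`[a, b]%classic : set R). Proof. exact: measurable_itv. Qed.

Lemma measurable_cexp_aff z t r D : cmeas D (fun s => cexp z (t + r * s)).
Proof.
have ml (c : R) : measurable_fun setT (fun s : R => c * (t + r * s)).
  apply: measurable_funM; first exact: measurable_cst.
  apply: measurable_funD; first exact: measurable_cst.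
  by apply: measurable_funM; [exact: measurable_cst|exact: measurable_id].
have me (c : R) : measurable_fun setT (fun s : R => expR (c * (t + r * s))).
  exact: (measurableT_comp (@measurable_expR R) (ml c)).
have mc (c : R) : measurable_fun setT (fun s : R => cos (c * (t + r * s))).
  apply: (measurableT_comp _ (ml c)); apply: continuous_measurable_fun; exact: continuous_cos.
have mn (c : R) : measurable_fun setT (fun s : R => sin (c * (t + r * s))).
  apply: (measurableT_comp _ (ml c)); apply: continuous_measurable_fun; exact: continuous_sin.
by split; apply: measurable_funTS; rewrite /cexp; apply: measurable_funM.
Qed.

Lemma measurable_cexp z t D : cmeas D (fun s => cexp z (t - s)).
Proof.
have := measurable_cexp_aff z t (- 1) D; congr (cmeas _ _).
by apply: funext => s; rewrite mulN1r.
Qed.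

Lemma nc_cexp_abs z t : nc (cexp z t) <= expR (nc z * `|t|).
Proof.
rewrite nc_cexp ler_expR; apply: (le_trans (ler_norm _)).
by rewrite normrM ler_wpM2r // nc_Re.
Qed.

Lemma cinteg_cexp z t a b (g : R -> R[i]) : cinteg `[a, b] g ->
  cinteg `[a, b] (fun s => cexp z (t - s) * g s).
Proof.
move=> hg; pose C := expR (nc z * (`|t| + (`|a| + `|b|))).
apply: (@nc_cinteg _ _ _ (fun s => C * nc (g s))) => //.
- by apply: cmeasM; [exact: measurable_cexp|exact: cinteg_cmeas].
- by apply: integZ => //; exact: cinteg_nc.
move=> s; rewrite /= in_itv /= => /andP[sa sb]; rewrite normcM ler_wpM2r ?nc_ge0 //.
apply: (le_trans (nc_cexp_abs _ _)); rewrite ler_expR ler_wpM2l ?nc_ge0 //.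
apply: (le_trans (ler_normB _ _)); rewrite lerD2l ler_norml.
have := ler_norm b; have := ler_norm (- a); rewrite normrN.
have := normr_ge0 a; have := normr_ge0 b; move=> *; apply/andP; split; lra.
Qed.

Lemma Rint_split a b c (f : R -> R) : a <= b -> b <= c -> integ `[a, c] f ->
  \int[mu]_(x in `[a, c]) f x = \int[mu]_(x in `[a, b]) f x + \int[mu]_(x in `[b, c]) f x.
Proof.
move=> ab bc hf.
have h := @Rintegral_itvB R f (BLeft a) (BRight c) b hf.
have h2 : \int[mu]_(x in `]b, c]) f x = \int[mu]_(x in `[b, c]) f x.
  apply: Rintegral_itv_obnd_cbnd.
  apply: (integS _ _ _ hf) => //.
  by move=> x /=; rewrite !in_itv /= => /andP[? ?]; apply/andP; split=> //; lra.
by rewrite -h2 -h ?bnd_simp // addrC subrK.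
Qed.

Lemma cint_split a b c (g : R -> R[i]) : a <= b -> b <= c -> cinteg `[a, c] g ->
  cint `[a, c] g = cint `[a, b] g + cint `[b, c] g.
Proof.
move=> ab bc [g1 g2]; apply/eqP; rewrite eq_complex /=.
by rewrite -!Rint_split // !eqxx.
Qed.

Lemma cinteg_cst a b z : cinteg `[a, b] (fun=> z).
Proof. by split; apply: integ_cst => //; exact: mu_itv_lt. Qed.

Lemma cint_cst a b z : a <= b -> cint `[a, b] (fun=> z) = rc (b - a) * z.
Proof.
move=> ab; rewrite /cint !Rint_cst //; case: z => x y.
by apply/eqP; rewrite eq_complex /=; apply/andP; split; apply/eqP; ring.
Qed.

(** A single forcing [G] serves all times up to [T]; it is indexed by the mode first, since
    integrability is asked of each mode separately. *)
Definition duhamel T u G := (forall k, cinteg `[0, T] (G k)) /\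
  forall t k, 0 <= t <= T ->
    u t k = cexp (lam k) t * u 0 k + cint `[0, t] (fun s => cexp (lam k) (t - s) * G k s).

Lemma itvS a b c d : a <= c -> d <= b -> (`[c, d] `<=` (`[a, b] : set R)).
Proof.
move=> ac db x /=; rewrite !in_itv /= => /andP[? ?]; apply/andP; split; lra.
Qed.

Lemma duh_step T u G t h k : duhamel T u G -> 0 <= t -> 0 <= h -> t + h <= T ->
  u (t + h) k = cexp (lam k) h * u t k +
    cint `[t, t + h] (fun s => cexp (lam k) (t + h - s) * G k s).
Proof.
move=> [iG hu] t0 h0 thT.
have tT : t <= T by lra.
have i0 : cinteg `[0, t + h] (G k) by apply: cintegS (iG k) => //; exact: itvS.
have i1 : cinteg `[0, t] (G k) by apply: cintegS (iG k) => //; exact: itvS.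
rewrite hu; last by rewrite addr_ge0.
rewrite (hu t) ?t0 // (@cint_split 0 t) //; [|lra|exact: cinteg_cexp].
rewrite mulrDr addrA; congr (_ + _ + _); first by rewrite mulrA -cexpD addrC.
rewrite -cintZ //; last exact: cinteg_cexp.
by apply: cint_eq => s _; rewrite mulrA -cexpD; congr (cexp _ _ * _); ring.
Qed.

Lemma duh_sub T u u' G G' : duhamel T u G -> duhamel T u' G' ->
  duhamel T (fun t k => u t k - u' t k) (fun k s => G k s - G' k s).
Proof.
move=> [iG hu] [iG' hu']; split=> [k|t k /[dup] tT /andP[t0 t1]]; first exact: cintegB.
rewrite hu // hu' //.
have i0 : cinteg `[0, t] (G k) by apply: cintegS (iG k) => //; exact: itvS.
have i1 : cinteg `[0, t] (G' k) by apply: cintegS (iG' k) => //; exact: itvS.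
rewrite (cint_eq (f := fun s => cexp (lam k) (t - s) * (G k s - G' k s)) (g := fun s => cexp (lam k) (t - s) * G k s - cexp (lam k) (t - s) * G' k s)).
  by rewrite cintB //; [cbv beta; ring|exact: cinteg_cexp|exact: cinteg_cexp].
by move=> s _; rewrite mulrBr.
Qed.

Lemma duh_lip T u G th M K t h : duhamel T u G -> (forall k, 0 <= th k) -> 0 <= K ->
  (forall t, 0 <= t <= T -> norm_le th (u t) M) ->
  {ae mu, forall s, `[0, T]%classic s -> norm_le th (G^~ s) K} ->
  0 <= t -> 0 <= h -> t + h <= T ->
  norm_le th (fun k => u (t + h) k - u t k) ((2 * Lam * M + K) * h).
Proof.
move=> du th0 K0 hM hK t0 h0 thT.
have Lam0 : 0 <= Lam := le_trans (nc_ge0 _) (lam_le 0).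
have tT : t <= T by lra.
have iG k : cinteg `[t, t + h] (G k).
  by case: du => iG _; apply: cintegS (iG k) => //; exact: itvS.
rewrite (_ : (fun k => _) = fun k => (cexp (lam k) h - 1) * u t k +
    cint `[t, t + h] (fun s => cexp (lam k) (t + h - s) * G k s)); last first.
  by apply: funext => k; rewrite (duh_step k du) //; ring.
rewrite mulrDl; apply: norm_leD => //.
  rewrite mulrAC; apply: norm_le_ptw (hM t _) => //; last by rewrite t0.
    by rewrite !mulr_ge0.
  move=> k; rewrite normcM ler_wpM2r ?nc_ge0 //.
  apply: (le_trans (cexp_lip (lam_neg k) h0)).
  by rewrite ler_wpM2r // ler_wpM2l.
have tth : t <= t + h by lra.
have -> : K * h = K * (t + h - t) by ring.
apply: (@norm_le_cint_bound _ _ _ _ (fun k s => cexp (lam k) (t + h - s) * G k s)) => //.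
  by move=> k; exact: cinteg_cexp.
apply: ae_mono hK => s hs /[dup] sI; rewrite /= in_itv /= => /andP[s0 s1].
have sT : `[0, T]%classic s by rewrite /= in_itv /=; apply/andP; split; lra.
apply: norm_le_sub (hs sT) => // k; rewrite normcM ler_piMl ?nc_ge0 //.
by apply: nc_cexp_le1; rewrite ?lam_neg // subr_ge0.
Qed.

(** [B] is the forcing defined at every time and Lipschitz, [G] its integrable version. The defect
    of the Euler step consists of the Taylor remainder of the exponential applied to [u t], the
    factor [cexp - 1] under the integral, and the variation of [B] over the step; each is of order
    [h^2] and accounts for one term of the constant. *)
Lemma duh_second T u G B th M K K' t h : duhamel T u G -> (forall k, 0 <= th k) -> 0 <= K -> 0 <= K' ->
  (forall t, 0 <= t <= T -> norm_le th (u t) M) ->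
  (forall s, 0 <= s <= T -> norm_le th (B s) K) ->
  (forall s r, 0 <= s -> 0 <= r -> s + r <= T -> norm_le th (fun k => B (s + r) k - B s k) (K' * r)) ->
  {ae mu, forall s, `[0, T]%classic s -> forall k, B s k = G k s} ->
  0 <= t -> 0 <= h -> t + h <= T ->
  norm_le th (fun k => u (t + h) k - (u t k + rc h * (lam k * u t k + B t k)))
    ((4 * Lam ^+ 2 * M + 2 * Lam * K + K') * h ^+ 2).
Proof.
move=> du th0 K0 K'0 hM hK hK' hB t0 h0 thT.
have Lam0 : 0 <= Lam := le_trans (nc_ge0 _) (lam_le 0).
have tT : t <= T by lra.
have tth : t <= t + h by lra.
have iG k : cinteg `[t, t + h] (G k).
  by case: du => iG _; apply: cintegS (iG k) => //; exact: itvS.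
rewrite (_ : (fun k => _) = fun k => (cexp (lam k) h - 1 - lam k * rc h) * u t k +
    cint `[t, t + h] (fun s => cexp (lam k) (t + h - s) * G k s - B t k)); last first.
  apply: funext => k; rewrite (duh_step k du) // cintB //; [|exact: cinteg_cexp|exact: cinteg_cst].
  rewrite cint_cst // (_ : t + h - t = h); [ring|by rewrite addrAC subrr add0r].
have -> : (4 * Lam ^+ 2 * M + 2 * Lam * K + K') * h ^+ 2 =
   (4 * Lam ^+ 2 * h ^+ 2) * M + (2 * Lam * h * K + K' * h) * (t + h - t) by ring.
apply: norm_leD => //.
  apply: norm_le_ptw (hM t _) => //; last by rewrite t0.
    by rewrite !mulr_ge0 // sqr_ge0.
  move=> k; rewrite normcM ler_wpM2r ?nc_ge0 //.
  apply: (le_trans (cexp_quad (lam_neg k) h0)).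
  rewrite ler_wpM2r ?sqr_ge0 // ler_wpM2l // ler_pXn2r ?nnegrE ?nc_ge0 //.
apply: (@norm_le_cint_bound _ _ _ _ (fun k s => cexp (lam k) (t + h - s) * G k s - B t k)) => //.
- by move=> k; apply: cintegB => //; [exact: cinteg_cexp|exact: cinteg_cst].
- by rewrite addr_ge0 ?mulr_ge0.
apply: ae_mono hB => s hs /[dup] sI; rewrite /= in_itv /= => /andP[s0 s1].
have sT' : 0 <= s <= T by apply/andP; split; lra.
have sT : `[0, T]%classic s by rewrite /= in_itv.
have {}hs := hs sT.
rewrite (_ : (fun k => _) = fun k => (cexp (lam k) (t + h - s) - 1) * B s k + (B s k - B t k)); last first.
  by apply: funext => k; rewrite -hs; ring.
apply: norm_leD => //.
  apply: norm_le_ptw (hK s sT') => //; first by rewrite !mulr_ge0.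
  move=> k; rewrite normcM ler_wpM2r ?nc_ge0 //.
  have r0 : 0 <= t + h - s by lra.
  apply: (le_trans (cexp_lip (lam_neg k) r0)).
  apply: ler_pM; rewrite ?mulr_ge0 ?nc_ge0 //; first by rewrite ler_wpM2l.
  lra.
have := hK' t (s - t) t0; rewrite subr_ge0 (addrC t) subrK => /(_ s0).
case/andP: sT' => _ sT'; move=> /(_ sT') h'; apply: norm_le_W h' _.
by rewrite ler_wpM2l //; lra.
Qed.

End Duhamel.

(** * Mild solutions and Duhamel's formula *)

Section MildSolutions.
Context {R : realType}.
Variables (l Lam : R) (lam : int -> R[i]) (S : R -> dist R -> dist R).
Hypothesis l0 : 0 <= l.
Hypothesis lam_neg : forall k, complex.Re (lam k) <= 0.
Hypothesis lam_le : forall k, normc (lam k) <= Lam.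
Hypothesis SH : forall t v, 0 <= t -> Hper0 l v -> Hper0 l (S t v).
Hypothesis Scoef : forall t v k, 0 <= t -> Hper0 l v ->
  fourier (S t v) k = cexp (lam k) t * fourier v k.
Variables (f : R -> dist R) (delta : R).
Hypothesis hf : forall t, 0 <= t ->
  [/\ is_distribution (f t), norm_le (om (l - 2)) (fourier (f t)) delta & fourier (f t) 0 = 0].
Implicit Types (a b t s h T M K e : R) (k : int) (z : R[i]) (u : R -> dist R) (G : int -> R -> R[i]).
Local Notation mu := (@lebesgue_measure R).
Local Notation nc := (@normc R).
Local Notation rc := (real_complex R).

Let mI a b : measurable (`[a, b]%classic : set R). Proof. exact: measurable_itv. Qed.

Definition rf s k := rc (1 + kap k ^+ 2)^-1 * fourier (f s) k.
Definition forcing u s k := rf s k + Nl (fourier (u s)) (fourier (u s)) k.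

Lemma Nl_zero (a b : int -> R[i]) : Nl a b 0 = 0.
Proof. by rewrite /Nl /rk kap0 !mul0r oppr0 mul0r. Qed.

Lemma rf_le s : 0 <= s -> norm_le (om l) (rf s) delta.
Proof. by move=> s0; have [_ h _] := hf s0; exact: norm_le_resolvent. Qed.

Lemma forcing_le u s M : 0 <= s -> norm_le (om l) (fourier (u s)) M ->
  norm_le (om l) (forcing u s) (delta + Cl l * (M * M + M * M)).
Proof.
move=> s0 hM; apply: norm_leD; [exact: om_ge0|exact: rf_le|].
by apply: Nl_le => //; exact: om_one hM.
Qed.

Lemma forcing_H0 u s : 0 <= s -> Hper0 l (u s) ->
  Hper0 l (resolvent (f s - u_ux (u s))) /\
  fourier (resolvent (f s - u_ux (u s))) = forcing u s.
Proof.
move=> s0 /Hper0P[du [M hM] u0]; have [df hd f0] := hf s0.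
have [dr fr] := forcing_coef l0 df hd du hM.
have e : fourier (resolvent (f s - u_ux (u s))) = forcing u s by apply: funext => k; rewrite fr.
split=> //; apply/Hper0P; split=> //; rewrite e.
  by eexists; exact: forcing_le hM.
by rewrite /forcing /rf f0 mulr0 add0r Nl_zero.
Qed.

Lemma mild_duhamel u T : mild_solution l S f u -> 0 <= T ->
  exists G, [/\ duhamel lam T (fun t k => fourier (u t) k) G,
    {ae mu, forall s, `[0, T]%classic s -> forall k, forcing u s k = G k s} &
    exists M, forall t, 0 <= t <= T -> norm_le (om l) (fourier (u t)) M].
Proof.
move=> hu T0.
have uH t : 0 <= t -> Hper0 l (u t) by move=> t0; case: (hu t t0).
have coefS t s k : 0 <= s -> s <= t ->
    fourier (S (t - s) (resolvent (f s - u_ux (u s)))) k = cexp (lam k) (t - s) * forcing u s k.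
  move=> s0 st; have [h1 h2] := forcing_H0 s0 (uH s s0).
  by rewrite Scoef ?subr_ge0 // h2.
have [_ [I hI _]] := hu T T0.
have [GT [iGT eGT _ [P P0 hP]]] := bochner_coef l0 (mI 0 T) (mu_itv_lt 0 T) hI.
(* Undoes the propagator from [s] to [T]; the inverse is harmless, since the symbols are bounded and
   the time is finite. *)
pose G k s := cexp (lam k) (0 - (T - s)) * GT k s.
have iG k : cinteg `[0, T] (G k).
  have mG : cmeas `[0, T] (G k).
    apply: cmeasM; last exact: cinteg_cmeas.
    have := measurable_cexp_aff (lam k) (- T) 1 `[0, T]; congr (cmeas _ _).
    by apply: funext => s; congr (cexp _ _); ring.
  apply: (@nc_cinteg _ _ _ (fun s => expR (Lam * T) * nc (GT k s))) => //.
    by apply: integZ => //; exact: cinteg_nc.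
  move=> s; rewrite /= in_itv /= => /andP[s0 sT]; rewrite normcM ler_wpM2r ?nc_ge0 //.
  apply: (le_trans (nc_cexp_abs _ _)); rewrite ler_expR sub0r normrN ger0_norm ?subr_ge0 //.
  by apply: ler_pM; rewrite ?nc_ge0 ?subr_ge0 //; lra.
have eG : {ae mu, forall s, `[0, T]%classic s -> forall k, forcing u s k = G k s}.
  apply: ae_mono eGT => s e sI; have {}e := e sI; move: sI; rewrite /= in_itv /= => /andP[s0 sT] k.
  by rewrite /G -e coefS // mulrA -cexpD sub0r addNr cexp0 mul1r.
have dG : duhamel lam T (fun t k => fourier (u t) k) G.
  split=> // t k /andP[t0 tT]; have [_ [It hIt ->]] := hu t t0.
  have [Gt [iGt eGt fI _]] := bochner_coef l0 (mI 0 t) (mu_itv_lt 0 t) hIt.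
  rewrite fourierD (Scoef _ t0 (uH 0 (lexx 0))) fI; congr (_ + _).
  have sub : `[0, t]%classic `<=` (`[0, T]%classic : set R) by exact: itvS.
  apply: cint_ae => //; first exact: cinteg_cmeas.
    by apply: cmeasM; [exact: measurable_cexp|exact: cmeasS (cinteg_cmeas (iG k))].
  apply: ae_mono (ae_and eG eGt) => s [e1 e2] sI.
  rewrite -(e2 sI) -(e1 (sub _ sI)); move: sI; rewrite /= in_itv /= => /andP[s0 st].
  exact: coefS.
exists G; split=> //.
have [N hN] : exists N, norm_le (om l) (fourier (u 0)) N by case/Hper0P: (uH 0 (lexx 0)).
(* No bound on [u] that is uniform in time is available yet. [P] bounds the integrated cut-off norms
   of [GT], and the backward propagator from [T] to [t] costs at most [expR (Lam * T)]. *)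
exists (N + expR (Lam * T) * P) => t /[dup] tI /andP[t0 tT].
rewrite (_ : fourier (u t) = fun k => cexp (lam k) t * fourier (u 0) k +
   cint `[0, t] (fun s => cexp (lam k) (t - s) * G k s)); last first.
  by apply: funext => k; case: dG => _ h; rewrite -h.
have om0' k : 0 <= om l k := om_ge0 l k.
have iGt k : cinteg `[0, t] (G k) by apply: cintegS (iG k) => //; exact: itvS.
apply: norm_leD => //.
  apply: norm_le_sub hN => // k; rewrite normcM ler_piMl ?nc_ge0 //; exact: nc_cexp_le1.
have D1 := mu_itv_lt 0 t; have D1T := mu_itv_lt 0 T.
apply: (@norm_le_cint _ _ _ (fun k s => cexp (lam k) (t - s) * G k s)) => //.
- by move=> k; exact: cinteg_cexp.
- by rewrite mulr_ge0 // expR_ge0.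
move=> n.
have iT : integ `[0, T] (pn (om l) GT n) by exact: integ_pn.
have it : integ `[0, t] (pn (om l) GT n) by apply: integS iT => //; exact: itvS.
apply: (@le_trans _ _ (expR (Lam * T) * \int[mu]_(x in `[0, t]) pn (om l) GT n x)).
  rewrite -RintZ //; apply: Rint_le => //; [|exact: integZ|].
    by apply: integ_pn => // k; exact: cinteg_cexp.
  move=> s; rewrite /= in_itv /= => /andP[s0 st].
  rewrite -(ler_pXn2r (n := 2)) ?nnegrE ?mulr_ge0 ?pn_ge0 ?expR_ge0 //.
  rewrite exprMn !pn_sqr // mulr_sumr; apply: ler_sum => k _.
  rewrite [leRHS]mulrCA ler_wpM2l // -exprMn ler_pXn2r ?nnegrE ?nc_ge0 ?mulr_ge0 ?expR_ge0 ?nc_ge0 //.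
  rewrite /G mulrA normcM ler_wpM2r ?nc_ge0 // -cexpD.
  apply: (le_trans (nc_cexp_abs _ _)); rewrite ler_expR.
  have -> : t - s + (0 - (T - s)) = - (T - t) by ring.
  rewrite normrN ger0_norm ?subr_ge0 //.
  by apply: ler_pM; rewrite ?nc_ge0 ?subr_ge0 //; lra.
rewrite ler_wpM2l ?expR_ge0 //; apply: le_trans (hP n).
rewrite -lee_fin -!RintE //; apply: ge0_subset_integral => //; last exact: itvS.
- by exact: measurable_int iT.
- by move=> x _; rewrite lee_fin pn_ge0.
Qed.

(** The integral is taken to be [u t - S t (u 0)], whose coefficients are given by Duhamel's
    formula; the uniform bound on the forcing makes [bochner_intro] applicable. *)
Lemma mild_intro u G M : (forall t, 0 <= t -> Hper0 l (u t)) ->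
  (forall t, 0 <= t -> norm_le (om l) (fourier (u t)) M) ->
  (forall T, 0 <= T -> duhamel lam T (fun t k => fourier (u t) k) G) ->
  (forall T, 0 <= T -> {ae mu, forall s, `[0, T]%classic s -> forall k, forcing u s k = G k s}) ->
  mild_solution l S f u.
Proof.
move=> uH hM dG eG t t0; split; first exact: uH.
have [iG hd] := dG t t0.
have S0H : Hper0 l (S t (u 0)) by apply: SH => //; exact: uH.
have IH : Hper0 l (u t - S t (u 0)).
  by rewrite addrC -scaleN1r; apply: Hper0_lin => //; exact: uH.
exists (u t - S t (u 0)); last by rewrite addrC subrK.
have B0 : 0 <= delta + Cl l * (M * M + M * M).
  have [d0 _] := rf_le (lexx 0); have [M0 _] := hM 0 (lexx 0).
  by rewrite addr_ge0 // mulr_ge0 ?Cl_ge0 // addr_ge0 // mulr_ge0.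
have coefS s k : 0 <= s -> s <= t ->
    fourier (S (t - s) (resolvent (f s - u_ux (u s)))) k = cexp (lam k) (t - s) * forcing u s k.
  move=> s0 st; have [h1 h2] := forcing_H0 s0 (uH s s0).
  by rewrite Scoef ?subr_ge0 // h2.
apply: (@bochner_intro _ _ _ _ _ (fun k s => cexp (lam k) (t - s) * G k s) (delta + Cl l * (M * M + M * M))) => //.
- exact: mu_itv_lt.
- move=> s; rewrite /= in_itv /= => /andP[s0 st]; apply: SH; first by rewrite subr_ge0.
  by have [] := forcing_H0 s0 (uH s s0).
- move=> s; rewrite /= in_itv /= => /andP[s0 st].
  apply: norm_le_sub (forcing_le s0 (hM s s0)); first exact: om_ge0.
  move=> k; rewrite coefS // normcM ler_piMl ?nc_ge0 //.
  by apply: nc_cexp_le1; rewrite ?lam_neg // subr_ge0.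
- by move=> k; exact: cinteg_cexp.
- apply: ae_mono (eG t t0) => s e sI k; rewrite -(e sI).
  by move: sI; rewrite /= in_itv /= => /andP[s0 st]; exact: coefS.
- by case: IH.
- move=> k; have h := hd t k; rewrite t0 lexx in h; cbv beta in h.
  by rewrite fourierB (Scoef _ t0 (uH 0 (lexx 0))) (h isT) addrAC subrr add0r.
Qed.

End MildSolutions.

(** * Global stability *)

Section Gronwall.
Context {R : realType}.
Implicit Types (X Y K M c t h e : R) (th : int -> R) (w Gm : R -> int -> R[i]).
Local Notation nc := (@normc R).
Local Notation rc := (real_complex R).

(** The time is explicit because [expR y >= 1 + y] already suffices. *)
Lemma expR_decay_small c X e : 0 < c -> 0 <= X -> 0 < e ->
  exists2 T, 0 <= T & forall t, T <= t -> expR (- (c * t / 2)) * X <= e.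
Proof.
move=> c0 X0 e0; exists (2 * X / (c * e)); first by rewrite divr_ge0 ?mulr_ge0 // ltW // mulr_gt0.
move=> t; rewrite ler_pdivrMr ?mulr_gt0 // => h.
have t0 : 0 <= t by rewrite -(pmulr_lge0 _ (mulr_gt0 c0 e0)); apply: le_trans h; rewrite mulr_ge0.
have y0 : 0 <= c * t / 2 by rewrite divr_ge0 ?mulr_ge0 // ltW.
rewrite expRN mulrC ler_pdivrMr ?expR_gt0 //.
apply: (@le_trans _ _ (e * (1 + c * t / 2))); last by rewrite ler_wpM2l ?expR_ge1Dx // ltW.
lra.
Qed.

(* Explicit Euler steps: the consistency error K h^2 per step accumulates to
   O(h), which vanishes as the step size tends to zero. *)
Lemma energy_decay th w Gm c t0 t1 M Y K X0 Xb : (forall k, 0 <= th k) -> 0 < c -> t0 <= t1 ->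
  0 <= K ->
  (forall t, t0 <= t <= t1 -> norm_le th (Gm t) Y) ->
  (forall t h, t0 <= t -> 0 <= h -> t + h <= t1 ->
     norm_le th (fun k => w (t + h) k - (w t k + rc h * Gm t k)) (K * h ^+ 2)) ->
  (forall t X, t0 <= t <= t1 -> X <= Xb -> norm_le th (w t) X ->
     forall eta, 0 < eta -> exists n0, forall n, (n0 <= n)%N ->
     \sum_(k <- zr n) th k * complex.Re (conjc (w t k) * Gm t k) <=
       - c * (\sum_(k <- zr n) th k * nc (w t k) ^+ 2) + c / 2 * X ^+ 2 + eta) ->
  norm_le th (w t0) X0 -> X0 < Xb ->
  norm_le th (w t1) (expR (- (c * (t1 - t0) / 2)) * X0).
Proof.
move=> th0 c0 t01 K0 hY hK hD hX X0b.
have X00 : 0 <= X0 by case: hX.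
have Y0 : 0 <= Y by case: (hY t0); rewrite ?lexx.
have Xb0 : 0 <= Xb by apply: ltW; exact: le_lt_trans X0b.
set tau := t1 - t0; have tau0 : 0 <= tau by rewrite subr_ge0.
pose Z := Num.sqrt (Xb ^+ 2 + Y ^+ 2).
have Z0 : 0 <= Z by exact: sqrtr_ge0.
(* With [Z] a bound for the norm after an Euler step, [Q * h ^+ 2] collects the quadratic term of
   the step, its cross term with the consistency error, and the square of that error. *)
pose Q := Y ^+ 2 + 2 * Z * K + K ^+ 2.
have Q0 : 0 <= Q by rewrite !addr_ge0 ?sqr_ge0 // !mulr_ge0.
split; first by rewrite mulr_ge0 ?expR_ge0.
rewrite exprMn -expRM_natl.
have -> : 2%:R * - (c * tau / 2) = - (c * tau) by field.
move=> s us; apply/ler_addgt0Pl => e e0; rewrite addrC.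
have gap : 0 < Xb ^+ 2 - X0 ^+ 2 by rewrite subr_gt0 ltr_pXn2r ?nnegrE.
(* The bounds on [h] make its powers at most 1, keep [2 * c * h] below 1, and keep the accumulated
   error [tau * h * Q] below the distance to the ceiling [Xb ^+ 2] and below [e]. *)
pose h1 := Num.min (Num.min 1 (2 * c)^-1) (Num.min ((Xb ^+ 2 - X0 ^+ 2) / (tau * Q + 1)) (e / (tau * Q + 1))).
have tQ : 0 < tau * Q + 1 by rewrite ltr_wpDl // mulr_ge0.
have h10 : 0 < h1.
  by rewrite !lt_min ltr01 invr_gt0 mulr_gt0 //= !divr_gt0.
pose n := (Num.bound (tau / h1)).+1; have n0 : 0 < n%:R :> R by rewrite ltr0n.
pose h := tau / n%:R; have hh0 : 0 <= h by rewrite divr_ge0 // ltW.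
have hh1 : h <= h1.
  rewrite /h ler_pdivrMr // mulrC -ler_pdivrMr //.
  apply: ltW; apply: (@lt_trans _ _ (Num.bound (tau / h1))%:R); last by rewrite ltr_nat.
  by rewrite archi_boundP // divr_ge0 // ltW.
have nh : n%:R * h = tau by rewrite /h mulrC divfK // gt_eqF.
have := hh1; rewrite !le_min => /andP[/andP[h_1 h_2] /andP[h_3 h_4]].
have h2c : 2 * c * h <= 1 by move: h_2; rewrite -[leRHS]mul1r ler_pdivlMr ?mulr_gt0 // mulrC.
have h3 : tau * h * Q <= Xb ^+ 2 - X0 ^+ 2.
  move: h_3; rewrite ler_pdivlMr // => h_3; apply: le_trans h_3; rewrite -mulrA mulrCA mulrDr; lra.
have h4 : tau * h * Q <= e.
  move: h_4; rewrite ler_pdivlMr // => h_4; apply: le_trans h_4; rewrite -mulrA mulrCA mulrDr; lra.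
have hQ : 0 <= Q * h ^+ 2 by rewrite mulr_ge0 // sqr_ge0.
have ch01 : 0 <= 1 - c * h <= 1.
  have : 0 <= c * h by rewrite mulr_ge0 // ltW.
  by move: h2c; rewrite -mulrA; clear => *; apply/andP; split; lra.
have /andP[ch0 ch1] := ch01.
pose E i := (1 - c * h) ^+ i * X0 ^+ 2 + i%:R * (Q * h ^+ 2).
have E0 i : 0 <= E i by rewrite addr_ge0 ?mulr_ge0 ?exprn_ge0.
have Eb i : (i <= n)%N -> E i <= Xb ^+ 2.
  move=> i_n; apply: (@le_trans _ _ (X0 ^+ 2 + tau * h * Q)); last by rewrite -lerBrDl.
  apply: lerD; first by rewrite ler_piMl ?sqr_ge0 // exprn_ile1.
  rewrite -nh (_ : n%:R * h * h * Q = n%:R * (Q * h ^+ 2)); last by ring.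
  by rewrite ler_wpM2r // ler_nat.
(* A bootstrap: the dissipation hypothesis holds only below [Xb], and [E i <= Xb ^+ 2] keeps it
   available for the next step. *)
have main i : (i <= n)%N -> norm_le th (w (t0 + i%:R * h)) (Num.sqrt (E i)).
  elim: i => [|i IH] i_n.
    by rewrite mul0r addr0 /E expr0 mul0r addr0 mul1r sqrtr_sqr ger0_norm.
  have {}IH := IH (ltnW i_n); set t := t0 + i%:R * h in IH.
  have ih : i%:R * h <= tau by rewrite -nh ler_wpM2r // ler_nat ltnW.
  have ih0 : 0 <= i%:R * h by rewrite mulr_ge0.
  have i1h : i.+1%:R * h <= tau by rewrite -nh ler_wpM2r // ler_nat.
  have tt : t0 <= t <= t1 by rewrite /t lerDl ih0 -lerBrDl.
  have e1 : t0 + i.+1%:R * h = t + h by rewrite -natr1 mulrDl mul1r addrA.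
  have th1 : t + h <= t1 by rewrite -e1 -lerBrDl.
  have Ei := Eb i (ltnW i_n).
  have sE : Num.sqrt (E i) <= Xb.
    by rewrite -(ger0_norm Xb0) -sqrtr_sqr ler_wsqrtr.
  have st := step_energy th0 hh0 h2c IH (hY t tt) (hD t _ tt sE IH).
  rewrite sqr_sqrtr // in st.
  pose W := (1 - c * h) * E i + h ^+ 2 * Y ^+ 2.
  have W0 : 0 <= W by rewrite addr_ge0 ?mulr_ge0 ?sqr_ge0.
  have n1 : norm_le th (fun k => w t k + rc h * Gm t k) (Num.sqrt W).
    split; first exact: sqrtr_ge0.
    rewrite sqr_sqrtr //; apply: sums_leW st _.
    by rewrite le_eqVlt (_ : (_ == W) = true) //; apply/eqP; rewrite /W; field.
  have WZ : Num.sqrt W <= Z.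
    apply: ler_wsqrtr; rewrite /W; apply: lerD.
      by apply: le_trans Ei; rewrite ler_piMl.
    by rewrite ler_piMl ?sqr_ge0 // exprn_ile1.
  rewrite e1.
  have n2 := norm_leD th0 n1 (hK t h (proj1 (andP tt)) hh0 th1).
  rewrite (_ : w (t + h) = fun k => (w t k + rc h * Gm t k) + (w (t + h) k - (w t k + rc h * Gm t k))); last first.
    by apply: funext => k; ring.
  have hle : h ^+ 2 <= 1 by rewrite exprn_ile1.
  have b1 : Num.sqrt W * (K * h ^+ 2) *+ 2 <= 2 * Z * K * h ^+ 2.
    by have := ler_wpM2r (mulr_ge0 K0 (sqr_ge0 h)) WZ; rewrite mulr2n; clear; lra.
  have b2 : (K * h ^+ 2) ^+ 2 <= K ^+ 2 * h ^+ 2.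
    have e4 : (K * h ^+ 2) ^+ 2 = K ^+ 2 * (h ^+ 2 * h ^+ 2) by ring.
    have k2 : h ^+ 2 * h ^+ 2 <= h ^+ 2 by rewrite ler_piMr ?sqr_ge0.
    by rewrite e4; exact: ler_wpM2l (sqr_ge0 K) _ _ k2.
  have b3 : (1 - c * h) * E i <= (1 - c * h) ^+ i.+1 * X0 ^+ 2 + i%:R * (Q * h ^+ 2).
    by rewrite /E mulrDr mulrA -exprS lerD2l ler_piMl // mulr_ge0.
  have b4 : E i.+1 = (1 - c * h) ^+ i.+1 * X0 ^+ 2 + i%:R * (Q * h ^+ 2) + Q * h ^+ 2.
    by rewrite /E -natr1 mulrDl mul1r addrA.
  have b5 : Q * h ^+ 2 = Y ^+ 2 * h ^+ 2 + 2 * Z * K * h ^+ 2 + K ^+ 2 * h ^+ 2 by rewrite /Q; ring.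
  have b6 : (Num.sqrt W + K * h ^+ 2) ^+ 2 <= E i.+1.
    by rewrite sqrrD (sqr_sqrtr W0) b4 /W; move: b1 b2 b3 b5; clear; lra.
  apply: norm_le_W n2 _; have s0 : 0 <= Num.sqrt W + K * h ^+ 2.
    by apply: addr_ge0; [exact: sqrtr_ge0|apply: mulr_ge0 => //; exact: sqr_ge0].
  by rewrite -(ger0_norm s0) -sqrtr_sqr ler_wsqrtr.
have [_ fin] := main n (leqnn n); rewrite nh sqr_sqrtr // in fin.
have e1 : t0 + tau = t1 by rewrite /tau addrC subrK.
rewrite e1 in fin; apply: (le_trans (fin s us)); rewrite /E; apply: lerD.
  rewrite ler_wpM2r ?sqr_ge0 // -nh.
  have -> : - (c * (n%:R * h)) = n%:R * (- (c * h)) by ring.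
  rewrite expRM_natl lerXn2r ?nnegrE ?expR_ge0 //.
  exact: expR_ge1Dx.
by apply: le_trans h4; rewrite -nh le_eqVlt; apply/orP; left; apply/eqP; ring.
Qed.

End Gronwall.

(** * Bilinearity and Lipschitz continuity of the nonlinearity *)

Section NlBilinear.
Context {R : realType}.
Implicit Types (a b : int -> R[i]) (A B L l : R) (k : int).
Local Notation nc := (@normc R).

Lemma NlDl a a' b A A' B k : norm_le one a A -> norm_le one a' A' -> norm_le one b B ->
  Nl (fun j => a j + a' j) b k = Nl a b k + Nl a' b k.
Proof. by move=> ha ha' hb; rewrite /Nl (convDl k ha ha' hb) mulrDr. Qed.

Lemma NlDr a b b' A B B' k : norm_le one a A -> norm_le one b B -> norm_le one b' B' ->
  Nl a (fun j => b j + b' j) k = Nl a b k + Nl a b' k.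
Proof. by move=> ha hb hb'; rewrite /Nl (convDr k ha hb hb') mulrDr. Qed.

(** Through [N(a', b') - N(a, b) = N(a' - a, b') + N(a, b' - b)]. *)
Lemma Nl_lip l a a' b b' M L L' : 0 <= l -> norm_le (om l) a M -> norm_le (om l) b M ->
  norm_le (om l) a' M -> norm_le (om l) b' M ->
  norm_le (om l) (fun k => a' k - a k) L -> norm_le (om l) (fun k => b' k - b k) L' ->
  norm_le (om l) (fun k => Nl a' b' k - Nl a b k) (Cl l * (2 * L * M + 2 * M * L')).
Proof.
move=> l0 ha hb ha' hb' hL hL'.
have o := @om_one R l _ _ l0.
have -> : (fun k => Nl a' b' k - Nl a b k) =
   (fun k => Nl (fun j => a' j - a j) b' k + Nl a (fun j => b' j - b j) k).
  apply: funext => k.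
  have f1 : (fun j => (a' j - a j) + a j) = a' by apply: funext => j; rewrite subrK.
  have f2 : (fun j => (b' j - b j) + b j) = b' by apply: funext => j; rewrite subrK.
  have e1 : Nl a' b' k = Nl (fun j => a' j - a j) b' k + Nl a b' k.
    by rewrite -{1}f1; exact: NlDl k (o _ _ hL) (o _ _ ha) (o _ _ hb').
  have e2 : Nl a b' k = Nl a (fun j => b' j - b j) k + Nl a b k.
    by rewrite -{1}f2; exact: NlDr k (o _ _ ha) (o _ _ hL') (o _ _ hb).
  by rewrite e1 e2; ring.
have -> : Cl l * (2 * L * M + 2 * M * L') = Cl l * (L * M + L * M) + Cl l * (M * L' + M * L') by ring.
apply: norm_leD; first exact: om_ge0.
  by apply: Nl_le => //; exact: o.
by apply: Nl_le => //; exact: o.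
Qed.

End NlBilinear.

(** * Decay of the difference of two solutions *)

Section Stability.
Context {R : realType}.
Variables (l Lam c0 : R) (lam : int -> R[i]) (S : R -> dist R -> dist R).
Hypothesis l0 : 0 <= l.
Hypothesis c00 : 0 < c0.
Hypothesis lam_neg : forall k, complex.Re (lam k) <= - c0.
Hypothesis lam_le : forall k, normc (lam k) <= Lam.
Hypothesis Scoef : forall t v k, 0 <= t -> Hper0 l v ->
  fourier (S t v) k = cexp (lam k) t * fourier v k.
Variables (f : R -> dist R) (delta : R).
Hypothesis hf : forall t, 0 <= t ->
  [/\ is_distribution (f t), norm_le (om (l - 2)) (fourier (f t)) delta & fourier (f t) 0 = 0].
Variables (u v : R -> dist R) (V : R).
Hypothesis hu : mild_solution l S f u.
Hypothesis hv : mild_solution l S f v.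
Hypothesis hV : forall t, 0 <= t -> norm_le (om l) (fourier (v t)) V.
Hypothesis V1 : 12 * V <= c0.
Hypothesis V2 : 16 * Cl l * V <= c0.
Implicit Types (t s h T M K e : R) (k : int).
Local Notation nc := (@normc R).
Local Notation rc := (real_complex R).

Let lam_neg0 k : complex.Re (lam k) <= 0.
Proof. by apply: le_trans (lam_neg k) _; rewrite oppr_le0 ltW. Qed.

Let w t k := fourier (u t) k - fourier (v t) k.
Let om0' k : 0 <= om l k. Proof. exact: om_ge0. Qed.

Let uH t : 0 <= t -> Hper0 l (u t). Proof. by move=> t0; case: (hu t0). Qed.
Let vH t : 0 <= t -> Hper0 l (v t). Proof. by move=> t0; case: (hv t0). Qed.

Let w_real t : 0 <= t -> is_real (w t).
Proof.
move=> t0 k; have [du _ _] := (iffLR (Hper0P l _) (uH t0)); have [dv _ _] := (iffLR (Hper0P l _) (vH t0)).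
by rewrite /w (fourier_real (proj1 du)) (fourier_real (proj1 dv)) rmorphB.
Qed.

Let w_zero t : 0 <= t -> w t 0 = 0.
Proof.
move=> t0; have [_ _ e1] := (iffLR (Hper0P l _) (uH t0)); have [_ _ e2] := (iffLR (Hper0P l _) (vH t0)).
by rewrite /w e1 e2 subrr.
Qed.

Let w_bound t : 0 <= t -> exists M, norm_le (om l) (w t) M.
Proof.
move=> t0; have [_ [M hM] _] := (iffLR (Hper0P l _) (uH t0)).
by exists (M + V); apply: norm_leB => //; exact: hV.
Qed.

Let Gw t := Gf lam (fourier (v t)) (w t).

(** The forcing [f] cancels, and what remains is bilinear in functions that are Lipschitz in time,
    so [duh_second] applies. The Lipschitz bounds themselves come from [duh_lip], where [f] enters
    only through its size. *)
Lemma difference_steps T : 0 <= T -> exists M Y K, [/\ 0 <= K,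
  forall t, 0 <= t <= T -> norm_le (om l) (w t) M,
  forall t, 0 <= t <= T -> norm_le (om l) (Gw t) Y &
  forall t h, 0 <= t -> 0 <= h -> t + h <= T ->
    norm_le (om l) (fun k => w (t + h) k - (w t k + rc h * Gw t k)) (K * h ^+ 2)].
Proof.
move=> T0.
have [Gu [du eu [Mu hMu]]] := mild_duhamel l0 lam_neg0 lam_le Scoef hf hu T0.
have [Gv [dv ev [Mv hMv]]] := mild_duhamel l0 lam_neg0 lam_le Scoef hf hv T0.
have T00 : (0 : R) <= 0 <= T. by rewrite lexx T0.
have Mu0 : 0 <= Mu by case: (hMu 0 T00).
have Mv0 : 0 <= Mv by case: (hMv 0 T00).
have Lam0 : 0 <= Lam := le_trans (nc_ge0 _) (lam_le 0).
have d0 : 0 <= delta by case: (hf (lexx 0)) => _ [].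
have C0 := Cl_ge0 l.
pose M := Mu + Mv; have M0 : 0 <= M by rewrite addr_ge0.
have bu t : 0 <= t <= T -> norm_le (om l) (fourier (u t)) M.
  by move=> /hMu h; apply: norm_le_W h _; rewrite /M lerDl.
have bv t : 0 <= t <= T -> norm_le (om l) (fourier (v t)) M.
  by move=> /hMv h; apply: norm_le_W h _; rewrite /M lerDr.
have bw t : 0 <= t <= T -> norm_le (om l) (w t) M.
  by move=> tT; apply: norm_leB; [exact: om_ge0|exact: hMu|exact: hMv].
pose K1 := delta + Cl l * (M * M + M * M).
have K10 : 0 <= K1 by rewrite addr_ge0 // mulr_ge0 // addr_ge0 // mulr_ge0.
pose L := 2 * Lam * M + K1.
have L0 : 0 <= L by rewrite addr_ge0 // !mulr_ge0.
have forc (x : R -> dist R) G : (forall t, 0 <= t <= T -> norm_le (om l) (fourier (x t)) M) ->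
    {ae (@lebesgue_measure R), forall s, `[0, T]%classic s -> forall k, forcing f x s k = G k s} ->
    {ae (@lebesgue_measure R), forall s, `[0, T]%classic s -> norm_le (om l) (G^~ s) K1}.
  move=> bx; apply: ae_mono => s e /[dup] sI; rewrite /= in_itv /= => sT.
  rewrite (_ : G^~ s = forcing f x s); last by apply: funext => k; rewrite (e sI).
  by apply: forcing_le (bx s sT) => //; case/andP: sT.
have lu t h : 0 <= t -> 0 <= h -> t + h <= T ->
    norm_le (om l) (fun k => fourier (u (t + h)) k - fourier (u t) k) (L * h).
  by move=> t0 h0 thT; apply: (duh_lip lam_neg0 lam_le du) => //; exact: forc eu.
have lv t h : 0 <= t -> 0 <= h -> t + h <= T ->
    norm_le (om l) (fun k => fourier (v (t + h)) k - fourier (v t) k) (L * h).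
  by move=> t0 h0 thT; apply: (duh_lip lam_neg0 lam_le dv) => //; exact: forc ev.
have lw t h : 0 <= t -> 0 <= h -> t + h <= T ->
    norm_le (om l) (fun k => w (t + h) k - w t k) ((L + L) * h).
  move=> t0 h0 thT; have h1 := norm_leB om0' (lu t h t0 h0 thT) (lv t h t0 h0 thT).
  rewrite mulrDl; move: h1; congr (norm_le _ _ _); apply: funext => k; rewrite /w; ring.
pose B t k := Nl (w t) (w t) k + (Nl (fourier (v t)) (w t) k + Nl (w t) (fourier (v t)) k).
pose KB := Cl l * (M * M + M * M) + (Cl l * (M * M + M * M) + Cl l * (M * M + M * M)).
have KB0 : 0 <= KB by rewrite !addr_ge0 // mulr_ge0 // addr_ge0 // mulr_ge0.
have bB t : 0 <= t <= T -> norm_le (om l) (B t) KB.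
  move=> tT; have h1 := bw t tT; have h2 := bv t tT; rewrite /B.
  by do ![apply: norm_leD => //]; apply: Nl_le => //; exact: (om_one l0).
pose KL := Cl l * (2 * (L + L) * M + 2 * M * (L + L)).
have lB t h : 0 <= t -> 0 <= h -> t + h <= T ->
    norm_le (om l) (fun k => B (t + h) k - B t k) ((KL + (KL + KL)) * h).
  move=> t0 h0 thT.
  have tT : 0 <= t <= T by rewrite t0 (le_trans _ thT) // lerDl.
  have tT' : 0 <= t + h <= T by rewrite addr_ge0.
  have lv' : norm_le (om l) (fun k => fourier (v (t + h)) k - fourier (v t) k) ((L + L) * h).
    by apply: norm_le_W (lv t h t0 h0 thT) _; rewrite (mulrDl L L h) lerDl mulr_ge0.
  have w1 := bw t tT; have w2 := bw _ tT'; have v1 := bv t tT; have v2 := bv _ tT'.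
  have e : (KL + (KL + KL)) * h = KL * h + (KL * h + KL * h) by ring.
  have eK : KL * h = Cl l * (2 * ((L + L) * h) * M + 2 * M * ((L + L) * h)) by rewrite /KL; ring.
  rewrite e eK.
  rewrite (_ : (fun k => _) = fun k => (Nl (w (t + h)) (w (t + h)) k - Nl (w t) (w t) k) +
    ((Nl (fourier (v (t + h))) (w (t + h)) k - Nl (fourier (v t)) (w t) k) +
     (Nl (w (t + h)) (fourier (v (t + h))) k - Nl (w t) (fourier (v t)) k))); last first.
    by apply: funext => k; rewrite /B; ring.
  by do ![apply: norm_leD => //]; apply: Nl_lip => //; exact: lw.
have KL0 : 0 <= KL + (KL + KL).
  have : 0 <= KL by rewrite mulr_ge0 // addr_ge0 // !mulr_ge0 // addr_ge0.
  by move=> ?; rewrite !addr_ge0.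
have eB : {ae (@lebesgue_measure R), forall s, `[0, T]%classic s -> forall k, B s k = Gu k s - Gv k s}.
  apply: ae_mono (ae_and eu ev) => s [e1 e2] /[dup] sI; rewrite /= in_itv /= => sT k.
  rewrite -(e1 sI) -(e2 sI) /forcing /B.
  have h1 := om_one l0 (bw s sT); have h2 := om_one l0 (bv s sT).
  have h3 := norm_leD (fun=> ler01) h2 h1.
  have E : fourier (u s) = fun k => fourier (v s) k + w s k.
    by apply: funext => j; rewrite /w addrC subrK.
  by rewrite [in RHS]E (NlDl k h2 h1 h3) (NlDr k h2 h2 h1) (NlDr k h1 h2 h1); ring.
have dw := duh_sub du dv.
exists M, (Lam * M + KB), (4 * Lam ^+ 2 * M + 2 * Lam * KB + (KL + (KL + KL))); split.
- by apply: addr_ge0 => //; apply: addr_ge0; rewrite !mulr_ge0 ?sqr_ge0.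
- exact: bw.
- move=> t tT; rewrite /Gw /Gf; apply: norm_leD => //; last exact: bB.
  by apply: norm_le_ptw (bw t tT) => // k; rewrite normcM ler_wpM2r ?nc_ge0.
- move=> t h t0 h0 thT.
  exact: (duh_second lam_neg0 lam_le dw om0' KB0 KL0 bw bB lB eB t0 h0 thT).
Qed.

Let C0 : 0 <= Cl l. Proof. exact: Cl_ge0. Qed.
Let V0 : 0 <= V. Proof. by case: (hV (lexx 0)). Qed.

(** [energy_decay] with the weight [te e], which dominates the L^2 weight. The initial energy norm
    is at most [r * M0] with [r = e^-2], and the ceiling is [r * (M0 + 1)]. *)
Lemma l2_decay : exists X, 0 <= X /\ forall t, 0 <= t ->
  norm_le one (w t) (expR (- (c0 * t / 2)) * X).
Proof.
have [M0 hM0] := w_bound (lexx 0); have M00 : 0 <= M0 by case: hM0.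
(* Below the ceiling [e^3 X <= e (M0 + 1) <= c0 / 4]; with [3 V <= c0 / 4] from [V1] the nonlinear
   terms use up at most half of the dissipation. The bound 1 makes the weight at least 1. *)
pose e := Num.min 1 (c0 / (4 * (M0 + 1))).
have M1 : 0 < M0 + 1 by lra.
have e0 : 0 < e by rewrite lt_min ltr01 divr_gt0 // mulr_gt0.
have e1 : e <= 1 by rewrite ge_min lexx.
have e01 : 0 < e <= 1 by rewrite e0.
have eM : e * (4 * (M0 + 1)) <= c0.
  by rewrite -ler_pdivlMr ?mulr_gt0 // ge_min lexx orbT.
pose r := (e ^+ 2)^-1; have r0 : 0 < r by rewrite invr_gt0 exprn_gt0.
have th0 := @te_ge0 R e.
have conv_te (a : int -> R[i]) X : norm_le (om l) a X -> norm_le (te e) a (r * X).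
  move=> /(om_one l0); apply: norm_le_th; first exact: ltW.
  by move=> k; exact: te_le.
exists (r * M0); split; first by rewrite mulr_ge0 // ltW.
move=> T T0; have [M [Y [K [K0 hM hY hK]]]] := difference_steps T0.
have /norm_le_th1 : forall k, one k <= te e k by move=> k; exact: te_ge1.
apply; rewrite -[in X in expR X](subr0 T).
apply: (@energy_decay _ _ w Gw c0 0 T (r * M) (r * Y) (r * K) (r * M0) (r * (M0 + 1))) => //.
- by rewrite mulr_ge0 // ltW.
- by move=> t tT; apply: conv_te; exact: hY.
- by move=> t h t0 h0 thT; rewrite -mulrA; apply: conv_te; exact: hK.
- move=> t X /andP[t0 tT] XX hX eta eta0.
  have lneg k : k != 0 -> complex.Re (lam k) <= - c0 by move=> _; exact: lam_neg.
  have [n0 hn0] := dissip_te lneg e01 (w_real t0) (w_zero t0) hX (om_one l0 (hV t0)) eta0.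
  exists n0 => n /hn0 h; apply: (le_trans h); rewrite lerD2r lerD2l ler_wpM2r ?sqr_ge0 //.
  have : e ^+ 3 * X <= e * (M0 + 1).
    apply: (@le_trans _ _ (e ^+ 3 * (r * (M0 + 1)))).
      by rewrite ler_wpM2l // exprn_ge0 // ltW.
    rewrite mulrA ler_wpM2r ?(ltW M1) // /r (exprSr e 2) mulrAC divff ?mul1r //.
    by rewrite gt_eqF // exprn_gt0.
  have := V1; lra.
- exact: conv_te.
- by rewrite ltr_pM2l //; lra.
Qed.

(** Two phases: after [T1] the L^2 norm stays below [x0], and from then on the H^l energy decays
    from whatever value [XT] it has at [T1]; [T2] is the time this takes to reach [e]. *)
Lemma stability e : 0 < e -> exists2 T, 0 <= T & forall t, T <= t -> norm_le (om l) (w t) e.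
Proof.
move=> e0; have [X [X0 hX]] := l2_decay.
(* Makes [2 * Cl l * x0 <= c0 / 4]; together with [4 * Cl l * V <= c0 / 4] from [V2] half of the
   dissipation is left. *)
pose x0 := c0 / (8 * Cl l + 1).
have D0 : 0 < 8 * Cl l + 1 by rewrite ltr_wpDl // mulr_ge0.
have x00 : 0 < x0 by rewrite divr_gt0.
have [T1 T10 hT1] := expR_decay_small c00 X0 x00.
have small t : T1 <= t -> norm_le one (w t) x0.
  by move=> t1; apply: norm_le_W (hX t (le_trans T10 t1)) _; exact: hT1.
have [XT hXT] := w_bound T10; have XT0 : 0 <= XT by case: hXT.
have [T2 T20 hT2] := expR_decay_small c00 XT0 e0.
exists (T1 + T2); first exact: addr_ge0.
move=> t tT; have t1 : T1 <= t by lra.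
have t0 : 0 <= t by lra.
have [M [Y [K [K0 hM hY hK]]]] := difference_steps t0.
have t2 : T2 <= t - T1 by lra.
apply: norm_le_W (hT2 (t - T1) t2).
apply: (@energy_decay _ _ w Gw c0 T1 t M Y K XT (XT + 1)) => //.
- by move=> s /andP[s1 st]; apply: hY; rewrite (le_trans T10 s1).
- by move=> s h s1 h0 sh; apply: hK => //; exact: le_trans s1.
- move=> s Z /andP[s1 st] ZX hZ eta eta0.
  have s0 : 0 <= s := le_trans T10 s1.
  have lneg k : k != 0 -> complex.Re (lam k) <= - c0 by move=> _; exact: lam_neg.
  (* [dissip_om] wants the L^2 bound to be at most the H^l bound [Z], which may be smaller than
     [x0]. *)
  have hm : norm_le one (w s) (Num.min x0 Z).
    by rewrite minEle; case: ifP => _; [exact: small|exact: om_one hZ].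
  have mZ : Num.min x0 Z <= Z by rewrite ge_min lexx orbT.
  have [n0 hn0] := dissip_om lneg l0 (w_zero s0) mZ hZ hm (hV s0) eta0.
  exists n0 => n /hn0 h; apply: (le_trans h); rewrite lerD2r lerD2l ler_wpM2r ?sqr_ge0 //.
  have h1 : Cl l * Num.min x0 Z <= Cl l * x0 by rewrite ler_wpM2l // ge_min lexx.
  have h2 : 8 * (Cl l * x0) <= c0.
    rewrite /x0; have -> : 8 * (Cl l * (c0 / (8 * Cl l + 1))) = 8 * Cl l * c0 / (8 * Cl l + 1) by ring.
    by rewrite ler_pdivrMr // mulrC ler_wpM2l ?(ltW c00) // lerDl.
  have := V2; lra.
- by rewrite ltrDl.
Qed.

End Stability.

(** * The periodic solution *)

Section TimeTools.
Context {R : realType}.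
Implicit Types (D : set R) (a b c t s h T M K e : R) (k : int) (z : R[i]) (th : int -> R).
Local Notation mu := (@lebesgue_measure R).
Local Notation nc := (@normc R).
Local Notation rc := (real_complex R).

Let mI a b : measurable (`[a, b]%classic : set R). Proof. exact: measurable_itv. Qed.

Lemma cmeas_lim D (c : nat -> R -> R[i]) (F : R -> R[i]) : measurable D ->
  (forall n, cmeas D (c n)) -> (forall x, D x -> ccvg (fun n => c n x) (F x)) -> cmeas D F.
Proof.
move=> mD mc cv.
have [g1 [m1 h1]] := lim_measurable mD (fun n => proj1 (mc n)).
have [g2 [m2 h2]] := lim_measurable mD (fun n => proj2 (mc n)).
split.
  apply: (eq_measurable_fun g1) => // x; rewrite inE => Dx.
  by apply: h1 => //; exact: (ccvg_Re (cv x Dx)).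
apply: (eq_measurable_fun g2) => // x; rewrite inE => Dx.
by apply: h2 => //; exact: (ccvg_Im (cv x Dx)).
Qed.

Lemma cmeas_sum D (r : seq int) (c : int -> R -> R[i]) : (forall k, cmeas D (c k)) ->
  cmeas D (fun x => \sum_(k <- r) c k x).
Proof.
move=> mc; elim: r => [|k r IH].
  by under eq_fun do rewrite big_nil; exact: cmeas_cst.
by under eq_fun do rewrite big_cons; exact: cmeasD.
Qed.

Lemma cmeas_Nl D (a b : R -> int -> R[i]) A B k : measurable D ->
  (forall x, D x -> norm_le one (a x) A) -> (forall x, D x -> norm_le one (b x) B) ->
  (forall j, cmeas D (a^~ j)) -> (forall j, cmeas D (b^~ j)) ->
  cmeas D (fun x => Nl (a x) (b x) k).
Proof.
move=> mD ha hb ma mb'; apply: cmeasM; first exact: cmeas_cst.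
apply: (@cmeas_lim _ (fun m x => \sum_(j <- zr m) a x j * b x (k - j))) => //.
  by move=> n; apply: cmeas_sum => j; exact: cmeasM.
by move=> x Dx; exact: conv_cvg (ha x Dx) (hb x Dx).
Qed.

(** Turns a measurable version whose values are controlled only almost everywhere into a bounded
    one, without changing the controlled values. Real and imaginary part are cut off separately,
    hence the factor 2. *)
Lemma clamp D (g : R -> R[i]) c : cmeas D g ->
  exists g', [/\ cmeas D g', forall x, nc (g' x) <= 2 * `|c| &
    forall x, nc (g x) <= c -> g' x = g x].
Proof.
move=> [m1 m2]; pose cl (y : R) := Num.max (- `|c|) (Num.min `|c| y).
have mcl (f : R -> R) : measurable_fun D f -> measurable_fun D (fun x => cl (f x)).
  move=> mf; apply: measurable_maxr; first exact: measurable_cst.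
  by apply: measurable_minr => //; exact: measurable_cst.
have clb y : `|cl y| <= `|c|.
  rewrite ler_norml /cl le_max lexx /= ge_max ge_min lexx andbT.
  by apply: le_trans (normr_ge0 c); rewrite oppr_le0.
have cle y : `|y| <= c -> cl y = y.
  move=> yc; have := le_trans yc (ler_norm c); rewrite ler_norml => /andP[h1 h2].
  by rewrite /cl (min_r h2) (max_r h1).
exists (fun x => Complex (cl (complex.Re (g x))) (cl (complex.Im (g x)))); split.
- by split; exact: mcl.
- move=> x; apply: (le_trans (nc_le _)); rewrite mulr_natl mulr2n; exact: lerD (clb _) (clb _).
- move=> x gx; rewrite !cle.
  + by case: (g x).
  + exact: le_trans (nc_Im _) gx.
  + exact: le_trans (nc_Re _) gx.
Qed.

(** The image of Lebesgue measure under the translation gives intervals their lengths, so uniqueness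
    of Lebesgue measure applies. *)
Lemma shift_measure c (A : set R) : measurable A ->
  mu ((fun x => x + c) @^-1` A) = mu A.
Proof.
move=> mA; have ms : measurable_fun setT (fun x : R => x + c).
  by apply: measurable_funD; [exact: measurable_id|exact: measurable_cst].
have h := @lebesgue_measure_unique R (pushforward mu (fun x : R => x + c : measurableTypeR R)).
symmetry; apply: h => //= _ [[a b]] _ <-.
transitivity (mu `]a - c, b - c]%classic); last first.
  rewrite /pushforward; congr (mu _); apply/seteqP; split => x /=;
  by rewrite !in_itv /= ltrBlDr lerBrDr.
rewrite !lebesgue_measure_itv /= !lte_fin ltrD2r; case: ifP => // _.
by rewrite -!EFinB; congr EFin; ring.
Qed.

Lemma shift_ae c (P : R -> Prop) : {ae mu, forall x, P x} -> {ae mu, forall x, P (x + c)}.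
Proof.
case=> N [mN N0 hN]; exists ((fun x => x + c) @^-1` N); split.
- have ms : measurable_fun setT (fun x : R => x + c).
    by apply: measurable_funD; [exact: measurable_id|exact: measurable_cst].
  by rewrite -[X in measurable X]setTI; exact: ms.
- by rewrite shift_measure.
- by move=> x /= nP; exact: hN.
Qed.

Lemma Rint_shift a b c (f : R -> R) : integ `[a + c, b + c] f ->
  \int[mu]_(x in `[a + c, b + c]) f x = \int[mu]_(x in `[a, b]) f (x + c).
Proof.
move=> hf; set D := `[a + c, b + c]%classic.
have mD : measurable D by exact: mI.
have ms : measurable_fun setT (fun x : R => x + c : measurableTypeR R).
  by apply: measurable_funD; [exact: measurable_id|exact: measurable_cst].
have eD : (fun x : R => x + c) @^-1` D = `[a, b]%classic.
  by apply/seteqP; split => x /=; rewrite /D /= !in_itv /= !lerD2r.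
have ge0 (g : R -> \bar R) : measurable_fun D g -> (forall x, (0 <= g x)%E) ->
    (\int[mu]_(x in D) g x = \int[mu]_(x in `[a, b]) g (x + c)%R)%E.
  move=> mg g0; rewrite -eD.
  rewrite -(@ge0_integral_pushforward _ _ (measurableTypeR R) (measurableTypeR R) R (fun x : R => x + c) ms mu D g mD mg); last by move=> x _.
  by apply: eq_measure_integral => A mA _; exact: esym (shift_measure c mA).
rewrite /Rintegral; congr fine; rewrite (@integralE _ _ _ mu) [RHS](@integralE _ _ _ mu).
have mf : measurable_fun D (EFin \o f) by exact: measurable_int hf.
congr (_ - _)%E.
  rewrite ge0; [by apply: (@eq_integral _ _ _ mu) => x _; rewrite !funeposE|exact: measurable_funepos|exact: funepos_ge0].
rewrite ge0; [by apply: (@eq_integral _ _ _ mu) => x _; rewrite !funenegE|exact: measurable_funeneg|exact: funeneg_ge0].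
Qed.

Lemma cint_shift a b c (g : R -> R[i]) : cinteg `[a + c, b + c] g ->
  cint `[a + c, b + c] g = cint `[a, b] (fun x => g (x + c)).
Proof. by move=> [g1 g2]; rewrite /cint !Rint_shift. Qed.

(** The primitive is continuous on each [[0, n]], and these intervals cover the half-line. *)
Lemma measurable_primitive (f : R -> R) : (forall T, integ `[0, T] f) ->
  measurable_fun [set t : R | 0 <= t] (fun t => \int[mu]_(s in `[0, t]) f s).
Proof.
move=> hf; have -> : [set t : R | 0 <= t] = \bigcup_n `[0, n%:R]%classic.
  apply/seteqP; split => [t /= t0|t [n _] /=]; last by rewrite in_itv => /andP[].
  exists (Num.bound t) => //=; rewrite in_itv /= t0 /= ltW //.
  exact: archi_boundP.
apply/measurable_fun_bigcup => n; first exact: mI.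
apply: subspace_continuous_measurable_fun; first exact: mI.
exact: (parameterized_integral_continuous (ler0n R n) (hf n%:R)).
Qed.

(** Subtracting [2 C 2^-n] makes the sequence nondecreasing and keeps it bounded. *)
Lemma geometric_cvg (x : nat -> R) C : (forall n, `|x n.+1 - x n| <= C * 2^-1 ^+ n) -> cvgn x.
Proof.
move=> hx; have C0 : 0 <= C.
  by have := hx 0%N; rewrite expr0 mulr1; apply: le_trans.
pose y n := x n - 2 * C * 2^-1 ^+ n.
have half0 n : 0 <= 2^-1 ^+ n :> R by rewrite exprn_ge0.
have ymono n : y n <= y n.+1.
  have := hx n; rewrite ler_norml /y exprS => /andP[h1 h2]; have := half0 n; lra.
have yb n : y n <= x 0%N + 2 * C - 2 * C * 2^-1 ^+ n - 2 * C * 2^-1 ^+ n.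
  elim: n => [|n IH]; first by rewrite /y expr0; lra.
  have := hx n; move: IH; rewrite ler_norml /y exprS => IH /andP[h1 h2]; have := half0 n; lra.
have ycv : cvgn y.
  apply: nondecreasing_is_cvgn.
    by apply/nondecreasing_seqP.
  exists (x 0%N + 2 * C) => _ [n _ <-]; apply: (le_trans (yb n)).
  have := mulr_ge0 (mulr_ge0 (ler0n R 2) C0) (half0 n); lra.
have gcv : (fun n => 2 * C * 2^-1 ^+ n : R) @ \oo --> 2 * C * 0.
  apply: cvgMr; apply: cvg_expr; rewrite ger0_norm //; lra.
have -> : x = fun n => y n + 2 * C * 2^-1 ^+ n by apply: funext => n; rewrite /y subrK.
by apply/cvg_ex; eexists; exact: (cvgD ycv gcv).
Qed.

Lemma geometric_ccvg (x : nat -> R[i]) C : (forall n, nc (x n.+1 - x n) <= C * 2^-1 ^+ n) ->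
  exists z, ccvg x z.
Proof.
move=> hx.
have h1 : cvgn (fun n => complex.Re (x n)).
  by apply: (@geometric_cvg _ C) => n; rewrite -ReB; apply: le_trans (nc_Re _) (hx n).
have h2 : cvgn (fun n => complex.Im (x n)).
  by apply: (@geometric_cvg _ C) => n; rewrite -ImB; apply: le_trans (nc_Im _) (hx n).
exists (Complex (limn (fun n => complex.Re (x n))) (limn (fun n => complex.Im (x n)))).
exact: ccvg_ReIm.
Qed.

End TimeTools.

(** * The linear periodic problem and the contraction *)

Section PeriodicOrbit.
Context {R : realType}.
Variables (l c0 theta : R) (lam : int -> R[i]).
Hypothesis l0 : 0 <= l.
Hypothesis c00 : 0 < c0.
Hypothesis theta0 : 0 < theta.
Hypothesis lam_neg : forall k, complex.Re (lam k) <= - c0.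
Hypothesis lam_real : is_real lam.
Implicit Types (a t s T r K d : R) (k : int) (z : R[i]) (G : int -> R -> R[i]) (b : R -> int -> R[i]).
Local Notation mu := (@lebesgue_measure R).
Local Notation nc := (@normc R).
Local Notation rc := (real_complex R).
Local Notation D0 := [set t : R | 0 <= t].

Let mI (x y : R) : measurable (`[x, y]%classic : set R). Proof. exact: measurable_itv. Qed.

Let mD0 : measurable (D0 : set R).
Proof.
rewrite (_ : D0 = `[0, +oo[%classic); first exact: measurable_itv.
by apply/seteqP; split => x /=; rewrite in_itv /= andbT.
Qed.

Let lam_neg0 k : complex.Re (lam k) <= 0.
Proof. by apply: le_trans (lam_neg k) _; rewrite oppr_le0 ltW. Qed.

Let om0' k : 0 <= om l k. Proof. exact: om_ge0. Qed.

Definition duh_int G t k := cint `[0, t] (fun s => cexp (lam k) (t - s) * G k s).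
(** The lower bound for the modulus of [1 - cexp (lam k) theta], uniform in the mode. *)
Definition gap := 1 - expR (- (c0 * theta)).
(** Bounds the map from the forcing to the periodic solution over one period: [theta / gap] for the
    initial value, [theta] for the Duhamel integral. *)
Definition amp := theta / gap + theta.

(* The value at time 0 is the fixed point of the period map. *)
Definition per_sol G t k :=
  cexp (lam k) t * (duh_int G theta k / (1 - cexp (lam k) theta)) + duh_int G t k.

Lemma gap_gt0 : 0 < gap.
Proof. by rewrite subr_gt0 expR_lt1 oppr_lt0 mulr_gt0. Qed.

Lemma gap_le k : gap <= nc (1 - cexp (lam k) theta).
Proof.
have h : nc (cexp (lam k) theta) <= expR (- (c0 * theta)).
  by rewrite nc_cexp ler_expR -mulNr ler_wpM2r // ltW.
have e : nc (1 : R[i]) <= nc (1 - cexp (lam k) theta) + nc (cexp (lam k) theta).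
  by rewrite -[X in nc X <= _](subrK (cexp (lam k) theta)); exact: ncD.
move: e; rewrite normc1 /gap; lra.
Qed.

Let gap_neq0 k : 1 - cexp (lam k) theta != 0.
Proof. by apply/eqP => e; have := gap_le k; rewrite e nc0; have := gap_gt0; lra. Qed.

Lemma amp_ge0 : 0 <= amp.
Proof. by rewrite addr_ge0 ?divr_ge0 ?(ltW theta0) ?(ltW gap_gt0). Qed.

Section Linear.
Variable G : int -> R -> R[i].
Hypothesis iG : forall k T, cinteg `[0, T] (G k).

Lemma duh_int0 k : duh_int G 0 k = 0.
Proof.
have h := @cint_split R 0 0 0 (fun s => cexp (lam k) (0 - s) * G k s) (lexx 0) (lexx 0)
  (cinteg_cexp (lam k) 0 (iG k 0)).
by move: h; rewrite -[X in X = _]addr0 => /addrI; rewrite /duh_int => <-.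
Qed.

Lemma per_sol_duhamel T : duhamel lam T (per_sol G) G.
Proof.
split=> [k|t k _]; first exact: iG.
by rewrite /per_sol duh_int0 cexp0 mul1r addr0.
Qed.

Lemma duh_int_bound t K : 0 <= t -> 0 <= K ->
  {ae mu, forall s, 0 <= s -> norm_le (om l) (G^~ s) K} -> norm_le (om l) (duh_int G t) (K * t).
Proof.
move=> t0 K0 hK; rewrite -[X in K * X]subr0.
apply: (@norm_le_cint_bound _ _ _ _ (fun k s => cexp (lam k) (t - s) * G k s)) => //.
  by move=> k; apply: cinteg_cexp.
apply: ae_mono hK => s hs; rewrite /= in_itv /= => /andP[s0 st].
apply: norm_le_sub (hs s0) => // k; rewrite normcM ler_piMl ?nc_ge0 //.
by apply: nc_cexp_le1; rewrite ?subr_ge0.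
Qed.

Lemma per_sol_bound t K : 0 <= t <= theta -> 0 <= K ->
  {ae mu, forall s, 0 <= s -> norm_le (om l) (G^~ s) K} -> norm_le (om l) (per_sol G t) (amp * K).
Proof.
move=> /andP[t0 tth] K0 hK.
have -> : amp * K = gap^-1 * (K * theta) + K * theta by rewrite /amp; ring.
apply: norm_leD => //; last first.
  by apply: norm_le_W (duh_int_bound t0 K0 hK) _; rewrite ler_wpM2l.
apply: norm_le_ptw (duh_int_bound (ltW theta0) K0 hK) => //; first by rewrite invr_ge0 ltW // gap_gt0.
move=> k; rewrite !normcM normcV.
have h1 := nc_cexp_le1 (lam_neg0 k) t0.
have h2 : (nc (1 - cexp (lam k) theta))^-1 <= gap^-1.
  rewrite lef_pV2 ?posrE ?gap_gt0 ?gap_le //; exact: lt_le_trans gap_gt0 (gap_le k).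
rewrite [X in _ * X]mulrC mulrA ler_wpM2r ?nc_ge0 //.
apply: le_trans h2; rewrite ler_piMl // invr_ge0 nc_ge0 //.
Qed.

Lemma per_sol_at_period k : per_sol G theta k = duh_int G theta k / (1 - cexp (lam k) theta).
Proof.
rewrite /per_sol; have := gap_neq0 k.
by move: (cexp _ _) (duh_int _ _ _) => x y h; field.
Qed.

(** The value at [theta] equals the value at 0. Restarting Duhamel's formula at [theta] and
    translating the integral by one period then reproduces the solution from 0. *)
Lemma per_sol_periodic t k : 0 <= t ->
  {ae mu, forall s, 0 <= s -> forall k, G k (s + theta) = G k s} ->
  per_sol G (t + theta) k = per_sol G t k.
Proof.
move=> t0 hp; rewrite addrC.
rewrite (duh_step (T := theta + t) k (per_sol_duhamel _)) ?(ltW theta0) //.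
rewrite per_sol_at_period /per_sol; congr (_ + _); rewrite /duh_int.
have i1 : cinteg `[0, theta + t] (G k) by exact: iG.
have i2 : cinteg `[theta, theta + t] (G k).
  by apply: cintegS i1 => //; apply: itvS => //; exact: ltW.
have i3 : cinteg `[0 + theta, t + theta] (fun s => cexp (lam k) (theta + t - s) * G k s).
  by rewrite add0r (addrC t); exact: cinteg_cexp.
have -> : `[theta, theta + t]%classic = `[0 + theta, t + theta]%classic by rewrite add0r addrC.
rewrite cint_shift //.
rewrite (cint_eq (f := fun x => cexp (lam k) (theta + t - (x + theta)) * G k (x + theta))
  (g := fun x => cexp (lam k) (t - x) * G k (x + theta))); last first.
  by move=> x _; congr (cexp _ _ * _); ring.
apply: cint_ae => //.
- apply: cmeasM; first exact: measurable_cexp.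
  have [m1 m2] := cinteg_cmeas i2.
  have ms : measurable_fun `[0, t] (fun x : R => x + theta).
    by apply: measurable_funTS; apply: measurable_funD; [exact: measurable_id|exact: measurable_cst].
  have sub : (fun x : R => x + theta) @` `[0, t]%classic `<=` `[theta, theta + t]%classic.
    move=> _ [x + <-]; rewrite /= !in_itv /= => /andP[? ?]; apply/andP; split; lra.
  by split; [exact: (measurable_comp (mI _ _) sub m1 ms)|exact: (measurable_comp (mI _ _) sub m2 ms)].
- by apply: cmeasM; [exact: measurable_cexp|exact: cinteg_cmeas (iG k t)].
- apply: ae_mono hp => s hs; rewrite /= in_itv /= => /andP[s0 _]; by rewrite hs.
Qed.

(** Separates [t] from the integration variable, so that measurability in [t] reduces to that of a
    primitive. *)
Lemma duh_int_factor t k : duh_int G t k =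
  cexp (lam k) t * cint `[0, t] (fun s => cexp (lam k) (0 - s) * G k s).
Proof.
rewrite -cintZ //; last exact: cinteg_cexp.
by apply: cint_eq => s _; rewrite mulrA -cexpD; congr (cexp _ _ * _); ring.
Qed.

Lemma per_sol_cmeas k : cmeas D0 (fun t => per_sol G t k).
Proof.
have mc : cmeas D0 (fun t => cexp (lam k) t).
  have := measurable_cexp_aff (lam k) 0 1 D0; congr (cmeas _ _).
  by apply: funext => t; rewrite add0r mul1r.
have i0 T : cinteg `[0, T] (fun s => cexp (lam k) (0 - s) * G k s) by apply: cinteg_cexp.
apply: cmeasD; first by apply: cmeasM => //; exact: cmeas_cst.
rewrite (_ : (fun t => duh_int G t k) = fun t => cexp (lam k) t *
    cint `[0, t] (fun s => cexp (lam k) (0 - s) * G k s)); last first.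
  by apply: funext => t; rewrite duh_int_factor.
apply: cmeasM => //.
by split; apply: measurable_primitive => T; case: (i0 T).
Qed.

Lemma duh_int_zero t : 0 <= t -> {ae mu, forall s, 0 <= s -> G 0 s = 0} -> duh_int G t 0 = 0.
Proof.
move=> t0 hz; have i0 := @cinteg_cst R 0 t 0.
have -> : duh_int G t 0 = cint `[0, t] (fun=> 0).
  apply: cint_ae; [exact: mI| |exact: cmeas_cst|].
    by apply: cmeasM; [exact: measurable_cexp|exact: cinteg_cmeas (iG 0 t)].
  by apply: ae_mono hz => s hs; rewrite /= in_itv /= => /andP[s0 _]; rewrite hs // mulr0.
by rewrite cint_cst // mulr0.
Qed.

Lemma per_sol_zero t : 0 <= t -> {ae mu, forall s, 0 <= s -> G 0 s = 0} -> per_sol G t 0 = 0.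
Proof.
by move=> t0 hz; rewrite /per_sol !duh_int_zero ?(ltW theta0) // mul0r mulr0 addr0.
Qed.

Lemma cint_conj (D : set R) (g : R -> R[i]) : measurable D -> cinteg D g ->
  cint D (fun s => conjc (g s)) = conjc (cint D g).
Proof.
move=> mD [g1 g2]; rewrite /cint /=; congr Complex.
  by apply: Rint_eq => x _; case: (g x).
rewrite -[RHS]mulN1r -RintZ //; apply: Rint_eq => x _; rewrite mulN1r; by case: (g x).
Qed.

Lemma duh_int_real t : 0 <= t -> {ae mu, forall s, 0 <= s -> is_real (G^~ s)} ->
  is_real (duh_int G t).
Proof.
move=> t0 hr k; rewrite -cint_conj //; last by apply: cinteg_cexp.
have cm j : cmeas `[0, t] (fun s => cexp (lam j) (t - s) * G j s).
  by apply: cmeasM; [exact: measurable_cexp|exact: cinteg_cmeas (iG j t)].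
apply: cint_ae => //.
  have [m1 m2] := cm k; split.
    by rewrite (_ : (fun x => _) = (fun x => complex.Re (cexp (lam k) (t - x) * G k x))) //;
      apply: funext => x; case: (_ * _).
  rewrite (_ : (fun x => _) = (fun x => - complex.Im (cexp (lam k) (t - x) * G k x))).
    exact: (measurableT_comp (@oppr_measurable R setT)).
  by apply: funext => x; case: (_ * _).
apply: ae_mono hr => s hs; rewrite /= in_itv /= => /andP[s0 _].
by rewrite (hs s0 k) lam_real cexp_conj rmorphM.
Qed.

Lemma per_sol_real t : 0 <= t -> {ae mu, forall s, 0 <= s -> is_real (G^~ s)} ->
  is_real (per_sol G t).
Proof.
move=> t0 hr k; rewrite /per_sol !(duh_int_real _ hr) ?(ltW theta0) // lam_real !cexp_conj.
by rewrite (rmorphD (@conjc R)) !(rmorphM (@conjc R)) (fmorphV (@conjc R)) (rmorphB (@conjc R)) (rmorph1 (@conjc R)).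
Qed.

End Linear.

Lemma per_sol_sub G G' t k : (forall k T, cinteg `[0, T] (G k)) ->
  (forall k T, cinteg `[0, T] (G' k)) ->
  per_sol (fun k s => G k s - G' k s) t k = per_sol G t k - per_sol G' t k.
Proof.
move=> iG iG'.
have e T : duh_int (fun k s => G k s - G' k s) T k = duh_int G T k - duh_int G' T k.
  rewrite /duh_int -cintB //; try exact: cinteg_cexp.
  by apply: cint_eq => s _; rewrite mulrBr.
by rewrite /per_sol !e; ring.
Qed.

(** The linear bounds grow with [t] and are used on one period only; this carries them to all
    times. *)
Lemma periodic_ind b (P : (int -> R[i]) -> Prop) : (forall t, 0 <= t -> b (t + theta) = b t) ->
  (forall t, 0 <= t <= theta -> P (b t)) -> forall t, 0 <= t -> P (b t).
Proof.
move=> hp hP t t0.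
suff h n : forall t, 0 <= t -> t <= n.+1%:R * theta -> P (b t).
  apply: (h (Num.bound (t / theta))) => //; rewrite -ler_pdivrMr //.
  apply: ltW; apply: (@lt_trans _ _ (Num.bound (t / theta))%:R); last by rewrite ltr_nat.
  by rewrite archi_boundP // divr_ge0 // ltW.
elim: n => [|n IH] s s0 sn; first by apply: hP; rewrite s0 -[theta]mul1r.
have [sth|sth] := leP s theta; first by apply: hP; rewrite s0.
rewrite -(subrK theta s) hp; last by rewrite subr_ge0 ltW.
apply: IH; first by rewrite subr_ge0 ltW.
by move: sn; rewrite -natr1 mulrDl mul1r lerBlDr.
Qed.

Variables (rho : int -> R -> R[i]) (delta r : R).
Hypothesis rho_int : forall k T, cinteg `[0, T] (rho k).
Hypothesis rho_le : {ae mu, forall s, 0 <= s -> norm_le (om l) (rho^~ s) delta}.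
Hypothesis rho_real : {ae mu, forall s, 0 <= s -> is_real (rho^~ s)}.
Hypothesis rho_zero : {ae mu, forall s, 0 <= s -> rho 0 s = 0}.
Hypothesis rho_per : {ae mu, forall s, 0 <= s -> forall k, rho k (s + theta) = rho k s}.
Hypothesis delta0 : 0 <= delta.
Hypothesis r0 : 0 <= r.
Hypothesis r_inv : amp * (delta + Cl l * (r * r + r * r)) <= r.
Hypothesis r_contr : 8 * amp * Cl l * r <= 1.

Definition rhs b k s := rho k s + Nl (b s) (b s) k.

(** The class that the fixed-point map preserves. Measurability makes the next right-hand side
    integrable, while conjugate symmetry and the vanishing zeroth mode let the limit be realized in
    the mean-zero space. *)
Definition orbit b := [/\ forall t, 0 <= t -> norm_le (om l) (b t) r,
  forall t, 0 <= t -> is_real (b t), forall t, 0 <= t -> b t 0 = 0,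
  forall t, 0 <= t -> b (t + theta) = b t & forall k, cmeas D0 (b^~ k)].

Lemma rhs_int b k T : orbit b -> cinteg `[0, T] (rhs b k).
Proof.
move=> [hr _ _ _ mb']; apply: cintegD => //.
have sub : `[0, T]%classic `<=` D0 by move=> x; rewrite /= in_itv /= => /andP[].
have hr1 t : 0 <= t -> norm_le one (b t) r by move=> t0; exact: om_one (hr t t0).
have cst_i : integ `[0, T] (fun=> Cl l * (r * r + r * r)) by apply: integ_cst => //; exact: mu_itv_lt.
apply: (nc_cinteg (h := fun=> Cl l * (r * r + r * r))) => //.
  apply: (cmeasS mD0 sub); apply: (cmeas_Nl (A := r) (B := r)) => //.
move=> s /sub s0; apply: norm_le1_coef; apply: (om_one l0).
by apply: Nl_le => //; [exact: hr|exact: hr|exact: hr1|exact: hr1].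
Qed.

Lemma Nl_is_real (a c : int -> R[i]) B C : norm_le one a B -> norm_le one c C -> is_real a -> is_real c ->
  is_real (Nl a c).
Proof.
move=> ha hc ra rc' k; rewrite /Nl (conv_real ha hc ra rc') rmorphM; congr (_ * _).
by rewrite /rk kapN sqrrN /= mulNr mulNr opprK; congr Complex; rewrite opprK.
Qed.

Lemma orbit_step b : orbit b -> orbit (per_sol (rhs b)).
Proof.
move=> ob; have [hr rb zb pb mb'] := ob.
have ib k T := rhs_int k T ob.
have K0 : 0 <= delta + Cl l * (r * r + r * r) by rewrite addr_ge0 // mulr_ge0 ?Cl_ge0 // addr_ge0 // mulr_ge0.
have per t : 0 <= t -> per_sol (rhs b) (t + theta) = per_sol (rhs b) t.
  move=> t0; apply: funext => k; apply: per_sol_periodic => //.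
  by apply: ae_mono rho_per => s hs s0 j; rewrite /rhs hs // pb.
have h1 t : 0 <= t -> norm_le one (b t) r by move=> t0; exact: om_one (hr t t0).
split=> //.
- apply: (periodic_ind (P := fun c => norm_le (om l) c r)) => // t tth.
  apply: norm_le_W r_inv; apply: per_sol_bound => //.
  apply: ae_mono rho_le => s hs s0; apply: norm_leD => //; first exact: hs.
  by apply: Nl_le => //; [exact: hr|exact: hr|exact: h1|exact: h1].
- move=> t t0; apply: per_sol_real => //.
  apply: ae_mono rho_real => s hs s0 k; rewrite /rhs (hs s0).
  by rewrite (Nl_is_real (h1 s s0) (h1 s s0) (rb s s0) (rb s s0)) rmorphD.
- move=> t t0; apply: per_sol_zero => //.
  apply: ae_mono rho_zero => s hs s0; rewrite /rhs (hs s0) add0r.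
  by rewrite /Nl /rk kap0 !mul0r oppr0 mul0r.
- by move=> k; exact: per_sol_cmeas.
Qed.

(** [Nl_lip] and the factor [amp] give [4 * amp * Cl l * r * d], which is at most [d / 2] by
    [r_contr]. *)
Lemma orbit_contract b b' d : orbit b -> orbit b' -> 0 <= d ->
  (forall t, 0 <= t -> norm_le (om l) (fun k => b' t k - b t k) d) ->
  forall t, 0 <= t ->
    norm_le (om l) (fun k => per_sol (rhs b') t k - per_sol (rhs b) t k) (d / 2).
Proof.
move=> ob ob' d0 hd.
have [hr _ _ _ _] := ob; have [hr' _ _ _ _] := ob'.
have [_ _ _ p1 _] := orbit_step ob; have [_ _ _ p2 _] := orbit_step ob'.
have i1 k T := rhs_int k T ob; have i2 k T := rhs_int k T ob'.
apply: (periodic_ind (b := fun t k => per_sol (rhs b') t k - per_sol (rhs b) t k)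
  (P := fun c => norm_le (om l) c (d / 2))).
  by move=> t t0; apply: funext => k; rewrite p1 // p2.
move=> t tth.
rewrite (_ : (fun k => _) = per_sol (fun k s => rhs b' k s - rhs b k s) t); last first.
  by apply: funext => k; rewrite per_sol_sub.
have i3 k T : cinteg `[0, T] (fun s => rhs b' k s - rhs b k s) by exact: cintegB.
have K0 : 0 <= Cl l * (2 * d * r + 2 * r * d).
  by rewrite mulr_ge0 ?Cl_ge0 // addr_ge0 // !mulr_ge0.
apply: (norm_le_W (M := amp * (Cl l * (2 * d * r + 2 * r * d)))); last first.
  have -> : amp * (Cl l * (2 * d * r + 2 * r * d)) = (8 * amp * Cl l * r) * (d / 2) by field.
  by rewrite ler_piMl // divr_ge0.
apply: per_sol_bound => //; apply: aeW => s s0.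
rewrite (_ : (fun k => _) = fun k => Nl (b' s) (b' s) k - Nl (b s) (b s) k); last first.
  by apply: funext => k; rewrite /rhs; ring.
by apply: Nl_lip => //; [exact: hr|exact: hr|exact: hr'|exact: hr'|exact: hd|exact: hd].
Qed.

Definition picard n := iter n (fun b => per_sol (rhs b)) (fun _ _ => 0 : R[i]).

Lemma picard_orbit n : orbit (picard n).
Proof.
elim: n => [|n IH]; last exact: orbit_step.
split=> //.
- by move=> t _; exact: norm_le0.
- by move=> t _ k; rewrite conjc0.
Qed.

Lemma picard_diff n t : 0 <= t ->
  norm_le (om l) (fun k => picard n.+1 t k - picard n t k) (r * 2^-1 ^+ n).
Proof.
elim: n t => [|n IH] t t0.
  have [h _ _ _ _] := picard_orbit 1; rewrite expr0 mulr1; have := h t t0; congr (norm_le _ _ _).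
  by apply: funext => k; rewrite subr0.
have -> : r * 2^-1 ^+ n.+1 = r * 2^-1 ^+ n / 2 by rewrite exprSr mulrA.
apply: (orbit_contract (picard_orbit n) (picard_orbit n.+1)) => //.
by rewrite mulr_ge0 // exprn_ge0.
Qed.

(** The iterates converge in each mode, and every property of the class passes to this limit. Their
    geometric rate is uniform in time, so the contraction estimate identifies the limit as a fixed
    point. *)
Lemma periodic_orbit : exists b, orbit b /\ forall t, 0 <= t -> b t = per_sol (rhs b) t.
Proof.
(* Convergence is claimed for nonnegative times only; at negative times the limit is set to 0. *)
have ex (p : R * int) : exists z, 0 <= p.1 -> ccvg (fun n => picard n p.1 p.2) z.
  case: p => t k /=; have [t0|_] := boolP (0 <= t); last by exists 0.
  have [z hz] : exists z, ccvg (fun n => picard n t k) z.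
    apply: (@geometric_ccvg _ _ r) => n.
    exact: (norm_le1_coef k (om_one l0 (picard_diff n t0))).
  by exists z.
have [bl hbl] := choice ex.
pose b t k := bl (t, k).
have cv t k : 0 <= t -> ccvg (fun n => picard n t k) (b t k) by move=> t0; exact: (hbl (t, k)).
have half0 n : 0 <= 2^-1 ^+ n :> R by rewrite exprn_ge0.
have ob : orbit b.
  split.
  - move=> t t0; apply: (norm_le_lim (s := fun n => picard n t)) => // [k|n]; first exact: cv.
    by have [h _ _ _ _] := picard_orbit n; exact: h.
  - move=> t t0 k; apply: (ccvg_uniq (cv t (- k) t0)).
    have := ccvg_conj (cv t k t0); congr (ccvg _ _); apply: funext => n.
    by have [_ h _ _ _] := picard_orbit n; rewrite h.
  - move=> t t0; apply: (ccvg_uniq (cv t 0 t0)).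
    rewrite (_ : (fun n => _) = fun=> 0); first exact: ccvg_cst.
    by apply: funext => n; have [_ _ h _ _] := picard_orbit n; rewrite h.
  - move=> t t0; apply: funext => k; have t1 : 0 <= t + theta by rewrite addr_ge0 // ltW.
    apply: (ccvg_uniq (cv _ k t1)); have := cv t k t0; congr (ccvg _ _).
    by apply: funext => n; have [_ _ _ h _] := picard_orbit n; rewrite h.
  - move=> k; apply: (@cmeas_lim _ _ (fun n t => picard n t k)) => //.
      by move=> n; have [_ _ _ _ h] := picard_orbit n; exact: h.
    by move=> t t0; exact: cv.
have rate n t : 0 <= t -> norm_le (om l) (fun k => b t k - picard n t k) (2 * r * 2^-1 ^+ n).
  move=> t0; apply: (norm_le_lim (s := fun m k => picard (m + n)%N t k - picard n t k)) => // [k|m].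
    exact: ccvgD (ccvg_shift n (cv t k t0)) (ccvg_cst _).
  (* The exact value of the geometric sum of [m] increments, which is what makes the induction on
     [m] close. *)
  apply: (norm_le_W (M := 2 * r * 2^-1 ^+ n - 2 * r * 2^-1 ^+ (m + n))); last first.
    by rewrite gerBl !mulr_ge0.
  elim: m => [|m IH].
    rewrite add0n subrr; have := @norm_le0 _ (om l) 0 (lexx 0); congr (norm_le _ _ _).
    by apply: funext => k; rewrite subrr.
  have := norm_leD om0' IH (picard_diff (m + n) t0).
  have -> : 2 * r * 2^-1 ^+ n - 2 * r * 2^-1 ^+ (m + n) + r * 2^-1 ^+ (m + n) =
     2 * r * 2^-1 ^+ n - 2 * r * 2^-1 ^+ (m.+1 + n) by rewrite addSn exprS; field.
  by congr (norm_le _ _ _); apply: funext => k; rewrite addSn; ring.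
exists b; split=> // t t0; apply: funext => k.
apply: (ccvg_uniq (ccvg_shift 1 (cv t k t0))).
have gcv : (fun n => r * 2^-1 ^+ n : R) @ \oo --> r * 0.
  apply: cvgMr; apply: cvg_expr; rewrite ger0_norm //; lra.
rewrite mulr0 in gcv.
apply: (squeeze_cvgr _ (cvg_cst 0) gcv); apply: nearW => n; rewrite nc_ge0 /= addn1.
have h : forall t, 0 <= t -> norm_le (om l) (fun k => b t k - picard n t k) (2 * r * 2^-1 ^+ n).
  by move=> s; exact: rate.
have d0 : 0 <= 2 * r * 2^-1 ^+ n by rewrite !mulr_ge0.
have h1 := norm_le1_coef k (om_one l0 (orbit_contract (picard_orbit n) ob d0 h t0)).
have e : 2 * r * 2^-1 ^+ n / 2 = r * 2^-1 ^+ n by move: (2^-1 ^+ n) => x; field.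
by rewrite e in h1; rewrite -ncN opprB.
Qed.

End PeriodicOrbit.

(** * The periodic mild solution *)

Section Existence.
Context {R : realType}.
Variables (l c0 theta : R) (lam : int -> R[i]) (S : R -> dist R -> dist R).
Hypothesis l0 : 0 <= l.
Hypothesis c00 : 0 < c0.
Hypothesis theta0 : 0 < theta.
Hypothesis lam_neg : forall k, complex.Re (lam k) <= - c0.
Hypothesis lam_real : is_real lam.
Hypothesis SH : forall t v, 0 <= t -> Hper0 l v -> Hper0 l (S t v).
Hypothesis Scoef : forall t v k, 0 <= t -> Hper0 l v ->
  fourier (S t v) k = cexp (lam k) t * fourier v k.
Variables (f : R -> dist R) (delta r : R).
Hypothesis hf : forall t, 0 <= t ->
  [/\ is_distribution (f t), norm_le (om (l - 2)) (fourier (f t)) delta & fourier (f t) 0 = 0].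
Hypothesis f_meas : strongly_measurable (l - 2) [set t | 0 <= t] f.
Hypothesis f_per : time_periodic theta f.
Hypothesis r0 : 0 <= r.
Hypothesis r_inv : amp c0 theta * (delta + Cl l * (r * r + r * r)) <= r.
Hypothesis r_contr : 8 * amp c0 theta * Cl l * r <= 1.
Local Notation mu := (@lebesgue_measure R).
Local Notation nc := (@normc R).
Local Notation rc := (real_complex R).
Local Notation D0 := [set t : R | 0 <= t].

Lemma measurable_halfline : measurable (D0 : set R).
Proof.
rewrite (_ : D0 = `[0, +oo[%classic); first exact: measurable_itv.
by apply/seteqP; split => x /=; rewrite in_itv /= andbT.
Qed.

Lemma periodic_mild_solution : exists ut : R -> dist R,
  [/\ mild_solution l S f ut, time_periodic theta ut &
      forall t, 0 <= t -> norm_le (om l) (fourier (ut t)) r].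
Proof.
have delta0 : 0 <= delta by case: (hf (lexx 0)) => _ [].
have rfle s : 0 <= s -> norm_le (om l) (rf f s) delta by exact: rf_le hf s.
have [g [mg hg]] := strongly_version measurable_halfline f_meas.
(* The measurable version of the coefficients of [f] is arbitrary on a null set; clamping makes the
   forcing bounded, hence integrable on every [[0, T]]. *)
have ex k : exists h, [/\ cmeas D0 h, forall x, nc (h x) <= 2 * `|delta| &
    forall x, nc (rc (1 + kap k ^+ 2)^-1 * g k x) <= delta ->
      h x = rc (1 + kap k ^+ 2)^-1 * g k x].
  by apply: clamp; apply: cmeasM => //; exact: cmeas_cst.
have [rho hrho] := choice ex.
have rhoE : {ae mu, forall s, 0 <= s -> forall k, rho k s = rf f s k}.
  apply: ae_mono hg => s hs s0 k; have [_ _ h] := hrho k.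
  rewrite h -(hs s0) //; exact: norm_le1_coef k (om_one l0 (rfle s s0)).
have rho_int k T : cinteg `[0, T] (rho k).
  have [m h _] := hrho k.
  have sub : `[0, T]%classic `<=` D0 by move=> x; rewrite /= in_itv /= => /andP[].
  apply: (nc_cinteg (h := fun=> 2 * `|delta|)) => //.
    exact: cmeasS measurable_halfline sub m.
  by apply: integ_cst; [exact: measurable_itv|exact: mu_itv_lt].
have rho_fun : {ae mu, forall s, 0 <= s -> rho^~ s = rf f s}.
  by apply: ae_mono rhoE => s h s0; apply: funext => k; exact: h.
have [b [ob eb]] : exists b, orbit l theta r b /\
    forall t, 0 <= t -> b t = per_sol theta lam (rhs rho b) t.
  apply: (@periodic_orbit _ l c0 theta lam l0 c00 theta0 lam_neg lam_real rho delta r) => //.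
  - by apply: ae_mono rho_fun => s h s0; rewrite h //; exact: rfle.
  - apply: ae_mono rho_fun => s h s0; rewrite h // => k.
    have [[ls _] _ _] := hf s0.
    by rewrite /rf kapN sqrrN (fourier_real ls) rmorphM; congr (_ * _); rewrite /= oppr0.
  - apply: ae_mono rhoE => s h s0; rewrite h //.
    by have [_ _ e] := hf s0; rewrite /rf e mulr0.
  (* [rho] represents the forcing only almost everywhere, so its periodicity needs the
     representation at [s] and at [s + theta]; translates of null sets are null. *)
  - apply: ae_mono (ae_and rhoE (shift_ae theta rhoE)) => s [h1 h2] s0 k.
    by rewrite h1 // h2 ?addr_ge0 ?(ltW theta0) // /rf f_per.
have [hr rb zb pb mb] := ob.
pose ut t := realize (b t).
have ub t : 0 <= t -> Hper0 l (ut t) /\ fourier (ut t) = b t.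
  by move=> t0; exact: realize_Hper0 (hr t t0) (rb t t0) (zb t t0).
exists ut; split; last by move=> t t0; rewrite (proj2 (ub t t0)); exact: hr.
- have lam_neg0 k : complex.Re (lam k) <= 0.
    by apply: le_trans (lam_neg k) _; rewrite oppr_le0 ltW.
  apply: (mild_intro l0 lam_neg0 SH Scoef hf (u := ut) (G := rhs rho b) (M := r)).
  + by move=> t t0; exact: (proj1 (ub t t0)).
  + by move=> t t0; rewrite (proj2 (ub t t0)); exact: hr.
  + move=> T T0; have iG k T' := rhs_int l0 rho_int k T' ob.
    have [_ hd] := per_sol_duhamel theta lam iG T.
    split=> [k|t k /[dup] tT /andP[t0 _]]; first exact: iG.
    by rewrite (proj2 (ub t t0)) (proj2 (ub 0 (lexx 0))) !eb //; exact: hd.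
  + move=> T T0; apply: ae_mono rhoE => s h; rewrite /= in_itv /= => /andP[s0 _] k.
    by rewrite /forcing /rhs (proj2 (ub s s0)) h.
- by move=> t t0; rewrite /ut pb.
Qed.

End Existence.

(* The zeroth mode is absent on mean-zero spaces, so its symbol may be replaced
   by -c0, which makes all symbols uniformly dissipative. *)
Definition symbol (R : realType) (beta gamma c0 : R) (k : int) : R[i] :=
  if k == 0 then real_complex R (- c0) else lamA beta gamma k.

Theorem theorem1p6 (R : realType) (l beta gamma theta : R)
    (S : R -> dist R -> dist R)
    (hl : 0 <= l)
    (hgamma : Num.max 0 (- (beta / (4 * pi ^+ 2))) < gamma)
    (htheta : 0 < theta)
    (hS : C0_semigroup_generated_by l (opA beta gamma) S) :
  exists2 delta' : R, 0 < delta' &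
    forall f : R -> dist R,
      (forall t, 0 <= t -> Hper (l - 2) (f t)) ->
      strongly_measurable (l - 2) [set t | 0 <= t] f ->
      time_periodic theta f ->
      (forall t, 0 <= t < theta -> mean_zero (f t)) ->
      (ereal_sup [set sobolev_norm (l - 2) (f t) | t in [set t | (0 <= t)%R]]
         <= delta'%:E)%E ->
      exists ut : R -> dist R,
        [/\ mild_solution l S f ut, time_periodic theta ut &
            globally_stable l S f ut].
Proof.
have [c0 c00 lam_neg'] := lamA_neg hgamma.
pose lam := symbol beta gamma c0.
have lam_neg k : complex.Re (lam k) <= - c0.
  by rewrite /lam /symbol; case: eqVneq => [//|k0]; exact: lam_neg'.
have lam_le k : normc (lam k) <= `|beta| + `|gamma| + 1 + c0.
  rewrite /lam /symbol; case: eqVneq => [_|_].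
    by rewrite nc_real normrN gtr0_norm // lerDr !addr_ge0.
  by apply: (le_trans (lamA_le _ _ _)); rewrite lerDl ltW.
have lam_real : is_real lam.
  move=> k; rewrite /lam /symbol oppr_eq0; case: eqVneq => [_|_]; last exact: lamA_real.
  by rewrite /= oppr0.
have SH t v : 0 <= t -> Hper0 l v -> Hper0 l (S t v).
  by move=> t0; case: hS => /(_ t t0)[h _ _] _ _ _ _; exact: h.
have Scoef t v k : 0 <= t -> Hper0 l v -> fourier (S t v) k = cexp (lam k) t * fourier v k.
  move=> t0 hv; rewrite /lam /symbol; case: eqVneq => [->|_].
    case/Hper0P: (hv) => _ _ ->; case/Hper0P: (SH t v t0 hv) => _ _ ->.
    by rewrite mulr0.
  exact: (semigroup_coef hl c00 lam_neg' hS k t0 hv).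
have C0 := Cl_ge0 l; have A0 := amp_ge0 c00 htheta.
set A := amp c0 theta in A0.
(* The radius of the ball for the contraction: the first entry provides the smallness [V1] and [V2]
   of the stability argument with [V = r], the second one the contraction condition. *)
pose r := Num.min (c0 / (16 * Cl l + 12)) (8 * A * Cl l + 1)^-1.
have p1 : 0 < 16 * Cl l + 12 by rewrite ltr_wpDl // mulr_ge0.
have p2 : 0 < 8 * A * Cl l + 1 by rewrite ltr_wpDl // !mulr_ge0.
have r0 : 0 < r by rewrite lt_min divr_gt0 //= invr_gt0.
have r1 : r * (16 * Cl l + 12) <= c0 by rewrite -ler_pdivlMr // ge_min lexx.
have r2 : r * (8 * A * Cl l + 1) <= 1.
  by rewrite -ler_pdivlMr // mul1r ge_min lexx orbT.
have Cr : 0 <= Cl l * r by rewrite mulr_ge0 // ltW.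
have ACr : 0 <= A * (Cl l * r) by rewrite mulr_ge0.
(* Then [A * delta <= r / 2], while the contraction condition bounds the quadratic part by [r / 4],
   so the ball is mapped into itself. *)
pose delta := r / (2 * A + 1).
have p3 : 0 < 2 * A + 1 by rewrite ltr_wpDl // mulr_ge0.
have d0 : 0 < delta by rewrite divr_gt0.
have rd : delta * (2 * A + 1) = r by rewrite /delta divfK // gt_eqF.
have contr : 8 * A * Cl l * r <= 1 by lra.
have inv : A * (delta + Cl l * (r * r + r * r)) <= r.
  have h1 : A * (Cl l * (r * r + r * r)) = (8 * A * Cl l * r) * (r / 4) by field.
  have h2 : (8 * A * Cl l * r) * (r / 4) <= r / 4 by rewrite ler_piMl // divr_ge0 // ltW.
  rewrite mulrDr h1; move: h2; lra.
exists delta => // f fH fm fp fz fsup.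
have hf t : 0 <= t ->
    [/\ is_distribution (f t), norm_le (om (l - 2)) (fourier (f t)) delta & fourier (f t) 0 = 0].
  move=> t0; split; first by case: (fH t t0).
    apply/sob_le; first exact: ltW.
    by apply: le_trans fsup; apply: ereal_sup_ubound; exists t.
  (* The mean is known to vanish on [[0, theta)] only; the end point [theta] is covered by
     [f theta = f 0]. *)
  apply: (periodic_ind htheta (b := fun t => fourier (f t)) (P := fun c => c 0 = 0)) => //.
    by move=> s s0; rewrite fp.
  move=> s /andP[s0]; rewrite le_eqVlt => /orP[/eqP ->|st]; last by apply: fz; rewrite s0.
  by have := fp 0 (lexx 0); rewrite add0r => ->; apply: fz; rewrite lexx.
have [ut [mut put but]] := periodic_mild_solution hl c00 htheta lam_neg lam_real SH Scoef
  hf fm fp (ltW r0) inv contr.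
exists ut; split=> // u mu_; apply/sob_cvg0 => e e0.
have V1 : 12 * r <= c0 by lra.
have V2 : 16 * Cl l * r <= c0 by lra.
have [T _ hT] := stability hl c00 lam_neg lam_le Scoef hf mu_ mut but V1 V2 e0.
exists T; split; first exact: num_real.
move=> t /= Tt; rewrite (_ : fourier _ = fun k => fourier (u t) k - fourier (ut t) k).
  exact: hT t (ltW Tt).
by apply: funext => k; rewrite fourierB.
Qed.
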